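(* Let $f_1(z)=\frac{\eta(2z)^5}{\eta(z)^2\eta(4z)^2}$, $f_2(z)=\frac{\eta(4z)^5}{\eta(2z)^2\eta(8z)^2}$ and $g(z)=\eta(z)^2\eta(2z)\eta(4z)\eta(8z)^2$. Then $$\mathcal{M}_{\mathbb{Z}/2}^{\mathrm{quad}}(\Gamma_0(8))=\mathbb{C}[f_1,f_2]\cong\mathbb{C}[x_1,x_2],$$ where the isomorphism is the isomorphism of graded $\mathbb{C}$-algebras sending $f_1\mapsto x_1$, $f_2\mapsto x_2$, and $\mathbb{C}[x_1,x_2]$ is the polynomial ring with $\deg(x_1)=\deg(x_2)=1$. Moreover $$\mathcal{S}_{\mathbb{Z}/2}^{\mathrm{quad}}(\Gamma_0(8))=g\cdot\mathbb{C}[f_1,f_2],$$ and under this isomorphism $g$ corresponds to $\frac14\left(-2x_1x_2^5+3x_1^3x_2^3-x_1^5x_2\right)$.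
   Context: $\eta(z)=e^{2\pi i z/24}\prod_{n\ge1}(1-q^n)$, $q=e^{2\pi i z}$, $z$ in the upper half plane $\mathcal{H}$. For odd $d$ put $\varepsilon_d=1$ if $d\equiv1\pmod 4$ and $\varepsilon_d=i$ if $d\equiv3\pmod4$; $\left(\frac{c}{d}\right)$ is the Kronecker symbol; square roots have argument in $(-\pi/2,\pi/2]$. For $k\in\frac12\mathbb{Z}$, $N\ge1$ (with $4\mid N$ if $k\in\frac12+\mathbb{Z}$) and a Dirichlet character $\chi$ modulo $N$, $\mathcal{M}_k(\Gamma_0(N),\chi)$ (resp. $\mathcal{S}_k(\Gamma_0(N),\chi)$) is the space of holomorphic $f:\mathcal{H}\to\mathbb{C}$ such that for every $\gamma=\begin{pmatrix}a&b\\c&d\end{pmatrix}\in\Gamma_0(N)$ one has $(cz+d)^{-k}f(\gamma z)=\chi(d)f(z)$ if $k\in\mathbb{Z}$, and $\left(\frac{c}{d}\right)^{-2k}\varepsilon_d^{2k}(cz+d)^{-k}f(\gamma z)=\chi(d)f(z)$ if $k\in\frac12+\mathbb{Z}$, and such that $\lim_{z\to i\infty}(cz+d)^{-k}f(\gamma z)$ exists (resp. is zero) for every $\gamma=\begin{pmatrix}a&b\\c&d\end{pmatrix}\in\mathrm{SL}_2(\mathbb{Z})$. $\mathcal{M}_k^{\mathrm{quad}}(\Gamma_0(N))=\bigoplus_\chi\mathcal{M}_k(\Gamma_0(N),\chi)$ and $\mathcal{S}_k^{\mathrm{quad}}(\Gamma_0(N))=\bigoplus_\chi\mathcal{S}_k(\Gamma_0(N),\chi)$,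 where $\chi$ runs over all Dirichlet characters modulo $N$ taking only the values $\pm1$ on integers prime to $N$ (the trivial character included). $\mathcal{M}_{\mathbb{Z}/2}^{\mathrm{quad}}(\Gamma_0(N))=\bigoplus_{k\in\frac12\mathbb{Z},\,k\ge0}\mathcal{M}_k^{\mathrm{quad}}(\Gamma_0(N))$, a graded $\mathbb{C}$-algebra under multiplication of functions, and $\mathcal{S}_{\mathbb{Z}/2}^{\mathrm{quad}}(\Gamma_0(N))=\bigoplus_{k\in\frac12\mathbb{Z},\,k\ge0}\mathcal{S}_k^{\mathrm{quad}}(\Gamma_0(N))$, a homogeneous ideal of it. The degree of a form of weight $k$ is $2k$. $\mathbb{C}[f_1,f_2]$ denotes the $\mathbb{C}$-subalgebra generated by $f_1,f_2$. *)

(* Defs.v *)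
From HB Require Import structures.
From mathcomp Require Import all_boot all_order all_algebra.
From mathcomp Require Import all_classical all_reals all_analysis.
From mathcomp Require Import complex.
From mathcomp Require mpoly.
(* The notations of mpoly clash with those of mathcomp-analysis. *)
Import -(notations) mpoly.
Import numFieldNormedType.Exports.
Import Order.TTheory GRing.Theory Num.Theory.

Set Implicit Arguments.
Unset Strict Implicit.
Unset Printing Implicit Defensive.

Local Open Scope classical_set_scope.
Local Open Scope ring_scope.
Local Open Scope complex_scope.

(* The topology and norm of the complex numbers R[i], so that [derivable f z 1]
   is complex differentiability. *)
HB.instance Definition _ (R : realType) := NormedModule.copy R[i] (R[i]^o).

Definition uhp (R : realType) : Type := {z : R[i] | 0 < complex.Im z}.
HB.instance Definition _ (R : realType) := SubChoice.on (uhp R).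
HB.instance Definition _ (R : realType) :=
  isPointed.Build (uhp R) (exist _ (0 +i* 1) ltr01).

Lemma fct_scalerAl (T : pointedType) (K : pzRingType) (A : lalgType K) (a : K)
  (u v : T -> A) : a *: (u * v) = (a *: u) * v.
Proof. by rewrite funeqE => x; exact: scalerAl. Qed.
HB.instance Definition _ (T : pointedType) (K : pzRingType) (A : lalgType K) :=
  GRing.Lmodule_isLalgebra.Build K (T -> A) (@fct_scalerAl T K A).

(* The functions [uhp R -> R[i]] form a commutative R[i]-algebra for the
   pointwise operations.  [extend f] is f on the upper half plane and 0 outside;
   it is only used at points of the (open) upper half plane. *)
Definition extend (R : realType) (f : uhp R -> R[i]) (w : R[i]) : R[i] :=
  oapp f 0 (insub w).

Definition holomorphic (R : realType) (f : uhp R -> R[i]) : Prop :=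
  forall z : uhp R, derivable (extend f) (val z) 1.

(* The filter "z --> i oo": the imaginary part tends to +oo, uniformly in the
   real part. *)
Definition i_infty (R : realType) : set_system (uhp R) :=
  filter_from [set: R] (fun Y => [set z : uhp R | Y < complex.Im (val z)]).
Arguments i_infty {R}.

Lemma i_infty_proper (R : realType) : ProperFilter (@i_infty R).
Proof.
apply: filter_from_proper.
  apply: filter_from_filter; first by exists 0.
  by move=> Y1 Y2 _ _; exists (Num.max Y1 Y2) => // z /=; rewrite gt_max => /andP[].
move=> Y _; have y0 : 0 < Num.max Y 0 + 1 by rewrite ltr_wpDl// le_max lexx orbT.
exists (exist _ (0 +i* (Num.max Y 0 + 1)) y0) => /=.
by rewrite ltr_pwDr// le_max lexx.
Qed.
#[global] Existing Instance i_infty_proper.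

Definition cexp (R : realType) (z : R[i]) : R[i] :=
  (expR (complex.Re z))%:C *
  (cos (complex.Im z) +i* sin (complex.Im z)).

Definition eta (R : realType) (z : R[i]) : R[i] :=
  let q : R[i] := cexp (2 * pi%:C * 'i * z) in
  cexp (2 * pi%:C * 'i * z / 24) *
  lim ((\prod_(1 <= n < N.+1) (1 - q ^+ n) : R[i]) @[N --> \oo]).

Definition legendre (a : int) (p : nat) : int :=
  if (p %| a)%Z then 0
  else if [exists x : 'I_p, ((x : nat)%:Z ^+ 2 == a %[mod p])%Z] then 1 else -1.

(* The symbol (a / p) for p prime. *)
Definition kronecker_prime (a : int) (p : nat) : int :=
  if p == 2 then
    if (2 %| a)%Z then 0
    else if (a == 1 %[mod 8])%Z || (a == 7 %[mod 8])%Z then 1 else -1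
  else legendre a p.

Definition kronecker (a n : int) : int :=
  if n == 0 then (if `|a|%N == 1%N then 1 else 0)
  else (if (n < 0) && (a < 0) then -1 else 1) *
       \prod_(p <- primes `|n|%N) kronecker_prime a p ^+ logn p `|n|%N.

Definition eps (R : realType) (d : int) : R[i] :=
  if (d == 1 %[mod 4])%Z then 1 else 'i.

Definition SL2Z : set 'M[int]_2 := [set M : 'M[int]_2 | \det M = 1].

Definition Gamma0 (N : nat) : set 'M[int]_2 :=
  [set M : 'M[int]_2 | \det M = 1 /\ (N%:Z %| M 1%R 0%R)%Z].

Definition moebius (R : realType) (M : 'M[int]_2) (z : R[i]) : R[i] :=
  ((M 0 0)%:~R * z + (M 0 1)%:~R) / ((M 1 0)%:~R * z + (M 1 1)%:~R).

(* Throughout, a half-integral weight k is represented by the integer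
   kk = 2k, and w ^ k stands for (sqrtc w) ^ kk.  The function sqrtc takes
   its values in the arguments ]- pi / 2, pi / 2]; sqrtC would not do, since
   its arguments are in [0, pi[. *)
Definition slash (R : realType) (kk : int) (M : 'M[int]_2)
    (f : uhp R -> R[i]) (z : uhp R) : R[i] :=
  sqrtc ((M 1 0)%:~R * val z + (M 1 1)%:~R) ^ (- kk) *
  extend f (moebius M (val z)).

Definition multiplier (R : realType) (kk c d : int) : R[i] :=
  if odd `|kk|%N then (kronecker c d)%:~R ^ (- kk) * eps R d ^ kk else 1.

Definition dirichlet_character (R : realType) (N : nat) (chi : int -> R[i]) :
    Prop :=
  [/\ chi 1 = 1,
      forall a b, chi (a * b) = chi a * chi b,
      forall a, chi (a + N%:Z) = chi a &
      forall a, (chi a != 0) = coprimez a N].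

Definition quadratic_characters (R : realType) (N : nat) : set (int -> R[i]) :=
  [set chi | dirichlet_character N chi /\
             forall a, coprimez a N -> chi a = 1 \/ chi a = -1].
Arguments quadratic_characters : clear implicits.

Definition weakly_modular (R : realType) (kk : int) (N : nat)
    (chi : int -> R[i]) (f : uhp R -> R[i]) : Prop :=
  forall M : 'M[int]_2, Gamma0 N M -> forall z : uhp R,
    multiplier R kk (M 1 0) (M 1 1) * slash kk M f z = chi (M 1 1) * f z.

(* For odd kk, this is meant for N divisible by 4. *)
Definition modular_forms (R : realType) (kk : int) (N : nat)
    (chi : int -> R[i]) : set (uhp R -> R[i]) :=
  [set f | [/\ holomorphic f,
               weakly_modular kk N chi f &
               forall M, SL2Z M ->
                 exists l : R[i], slash kk M f z @[z --> i_infty] --> l]].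

Definition cusp_forms (R : realType) (kk : int) (N : nat)
    (chi : int -> R[i]) : set (uhp R -> R[i]) :=
  [set f | [/\ holomorphic f,
               weakly_modular kk N chi f &
               forall M, SL2Z M ->
                 slash kk M f z @[z --> i_infty] --> (0 : R[i])]].

Definition fin_supp (R : realType) (I : choiceType) (D : set I)
    (F : I -> uhp R -> R[i]) : Prop :=
  finite_set (D `&` [set i | F i <> 0]).

(* The sum of the subspaces V i, for i in D; it is direct when the V i are
   independent. *)
Definition space_sum (R : realType) (I : choiceType) (D : set I)
    (V : I -> set (uhp R -> R[i])) : set (uhp R -> R[i]) :=
  [set f | exists F : I -> uhp R -> R[i],
    [/\ fin_supp D F,
        forall i, D i -> V i (F i) &
        f = \sum_(i \in D) F i]].

Definition independent (R : realType) (I : choiceType) (D : set I)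
    (V : I -> set (uhp R -> R[i])) : Prop :=
  forall F : I -> uhp R -> R[i],
    fin_supp D F -> (forall i, D i -> V i (F i)) ->
    \sum_(i \in D) F i = 0 -> forall i, D i -> F i = 0.

Definition modular_forms_quad (R : realType) (kk : int) (N : nat) :
    set (uhp R -> R[i]) :=
  space_sum (quadratic_characters R N) (modular_forms kk N).
Arguments modular_forms_quad : clear implicits.

Definition cusp_forms_quad (R : realType) (kk : int) (N : nat) :
    set (uhp R -> R[i]) :=
  space_sum (quadratic_characters R N) (cusp_forms kk N).
Arguments cusp_forms_quad : clear implicits.

Definition all_modular_forms_quad (R : realType) (N : nat) :
    set (uhp R -> R[i]) :=
  space_sum [set: nat] (fun d => modular_forms_quad R d%:Z N).
Arguments all_modular_forms_quad : clear implicits.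

Definition all_cusp_forms_quad (R : realType) (N : nat) :
    set (uhp R -> R[i]) :=
  space_sum [set: nat] (fun d => cusp_forms_quad R d%:Z N).
Arguments all_cusp_forms_quad : clear implicits.

Definition generated_subalgebra (R : realType) (G : set (uhp R -> R[i])) :
    set (uhp R -> R[i]) :=
  smallest (fun A : set (uhp R -> R[i]) =>
    GRing.subalg_closed [pred f : uhp R -> R[i] | f \in A]) G.

Definition f1 (R : realType) (z : uhp R) : R[i] :=
  let z := val z in
  eta (2 * z) ^+ 5 / (eta z ^+ 2 * eta (4 * z) ^+ 2).
Arguments f1 : clear implicits.

Definition f2 (R : realType) (z : uhp R) : R[i] :=
  let z := val z in
  eta (4 * z) ^+ 5 / (eta (2 * z) ^+ 2 * eta (8 * z) ^+ 2).
Arguments f2 : clear implicits.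

Definition g (R : realType) (z : uhp R) : R[i] :=
  let z := val z in
  eta z ^+ 2 * eta (2 * z) * eta (4 * z) * eta (8 * z) ^+ 2.
Arguments g : clear implicits.

Definition x1 (R : realType) : mpoly 2 R[i] := mpolyX R[i] (mnm1 0).
Definition x2 (R : realType) : mpoly 2 R[i] := mpolyX R[i] (mnm1 1).

(* The homogeneous polynomials of total degree d, together with 0. *)
Definition homogeneous (R : realType) (d : nat) : set (mpoly 2 R[i]) :=
  [set p | p \is ishomog1 d mdeg].
Arguments homogeneous : clear implicits.

Definition g_poly (R : realType) : mpoly 2 R[i] :=
  4^-1 *: (- 2 * x1 R * x2 R ^+ 5 + 3 * x1 R ^+ 3 * x2 R ^+ 3
           - x1 R ^+ 5 * x2 R).

(* Main.v *)
(* By the Jacobi triple product, f1 z = th (2 z) and f2 z = th (4 z) for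
   th t = sum_n e^(pi i n^2 t); theta identities turn g into the stated
   polynomial in f1 and f2.  The inversion formula of th comes from the
   functional equations characterising sum_n e^(- pi t (u + n)^2), its
   multiplier on Gamma_0(4) from a Euclidean descent together with quadratic
   reciprocity.

   Dividing a form f of weight d / 2 by f1^d gives a function invariant under
   Gamma_1(8).  Since f1 vanishes only at the cusp 1/2, to first order, and f2
   does not vanish there, f - c f2^d is divisible by f1 for a suitable constant
   c; by induction f is a homogeneous polynomial in f1 and f2 plus a multiple of
   a form of weight -1/2, and there is none because its Fourier coefficients are
   bounded by a positive power of the height at which they are computed.

   At the cusps, the ratio f2 / f1 takes exactly the values 0, oo, 1, -1 and the
   square roots of 1/2, so that a form is cuspidal if and only if its polynomial
   is divisible by the six corresponding linear forms, whose product is that of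
   g.  Algebraic independence follows by letting [1, 0; 8 n, 1] act, which scales
   f1 and f2 by a common factor taking infinitely many values, and from f2 / f1
   being nonconstant. *)
Require Import Defs.
From HB Require Import structures.
From mathcomp Require Import all_boot all_order all_algebra.
From mathcomp Require Import all_classical all_reals all_analysis.
From mathcomp Require Import complex.
From mathcomp Require mpoly.
Import -(notations) mpoly.
From mathcomp Require all_fingroup finfield.
From mathcomp Require Import ring lra zify.
Import numFieldNormedType.Exports.
Import Order.TTheory GRing.Theory Num.Theory.

Set Implicit Arguments.
Unset Strict Implicit.
Unset Printing Implicit Defensive.

Local Open Scope classical_set_scope.
Local Open Scope ring_scope.
Local Open Scope complex_scope.

Import Normc.

(** * Complex differentiation *)

(** Most functions to be integrated are periodic: on a rectangle one period wide the vertical sides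
    cancel, so a horizontal integral over a period does not depend on its height. Fourier
    coefficients are such integrals, and a Cauchy formula with the periodic kernel [ckernel]
    recovers the function; these two facts play the role of Taylor and Laurent expansions in the
    local parameter at a cusp. Zeros are controlled by a product: the triple product shows that f1
    vanishes nowhere in the upper half plane, and its limits at the four cusps are explicit. The
    obstacle of half-integral weight is the branch of [sqrtc]: the product of two square roots is
    off by a sign, which has to match the sign that the Kronecker symbol carries for negative
    arguments. Outside the theta formula this sign is carried along as [sgc], or removed by
    squaring, as in [Hn]. The passage to Gamma_1(8) serves the same end: there quadratic characters
    are trivial and the theta multiplier squares to 1, so that both parities of the weight and all
    characters are treated at once. *)

Section ComplexNorm.
Variable R : realType.
Implicit Types (z w : R[i]) (x y : R).

(** The norm of [R[i]] is [R[i]]-valued; estimates are made with the real-valued [normc], to which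
    [lra] and the order lemmas of [R] apply. *)
Lemma normC_normc z : `|z| = (normc z)%:C.
Proof. by case: z => a b; rewrite normc_def. Qed.

Lemma normc_ge0 z : 0 <= normc z.
Proof. by case: z => a b; rewrite sqrtr_ge0. Qed.

Lemma ler_normcD z w : normc (z + w) <= normc z + normc w.
Proof. exact: le_normcD. Qed.

Lemma normcN' z : normc (- z) = normc z.
Proof. exact: normcN. Qed.

Lemma normcB z w : normc (z - w) = normc (w - z).
Proof. by rewrite -normcN' opprB. Qed.

Lemma ler_normcB z w : normc (z - w) <= normc z + normc w.
Proof. by rewrite (le_trans (ler_normcD _ _))// normcN'. Qed.

Lemma ler_normc_dist z w u : normc (z - w) <= normc (z - u) + normc (u - w).
Proof. by rewrite (le_trans _ (ler_normcD _ _))// addrA subrK. Qed.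

Lemma ler_normcBd z w : normc z - normc w <= normc (z - w).
Proof. by rewrite lerBlDr (le_trans _ (ler_normcD _ _))// subrK. Qed.

Lemma normc_eq0 z : (normc z == 0) = (z == 0).
Proof.
by apply/idP/idP => [/eqP/eq0_normc->//|/eqP->]; rewrite normc0.
Qed.

Lemma normc_gt0 z : (0 < normc z) = (z != 0).
Proof. by rewrite lt_neqAle normc_ge0 andbT eq_sym normc_eq0. Qed.

Lemma normcX z n : normc (z ^+ n) = normc z ^+ n.
Proof.
by elim: n => [|n IH]; rewrite ?expr0 ?normc1// !exprS normcM IH.
Qed.

Lemma normcR x : normc x%:C = `|x|.
Proof. by rewrite /= expr0n addr0 sqrtr_sqr. Qed.

Lemma ler_Re_normc z : `|complex.Re z| <= normc z.
Proof. by case: z => a b /=; rewrite -sqrtr_sqr ler_wsqrtr// lerDl sqr_ge0. Qed.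

Lemma ler_Im_normc z : `|complex.Im z| <= normc z.
Proof. by case: z => a b /=; rewrite -sqrtr_sqr ler_wsqrtr// lerDr sqr_ge0. Qed.

Lemma ler_normc_ReIm z : normc z <= `|complex.Re z| + `|complex.Im z|.
Proof.
have {1}-> : z = (complex.Re z)%:C + 'i * (complex.Im z)%:C by exact: complexE.
rewrite (le_trans (ler_normcD _ _))// normcM !normcR.
by rewrite /= expr0n add0r expr1n sqrtr1 mul1r.
Qed.

Lemma normc_sqr z : normc z ^+ 2 = complex.Re z ^+ 2 + complex.Im z ^+ 2.
Proof. by case: z => a b /=; rewrite sqr_sqrtr// addr_ge0 ?sqr_ge0. Qed.

Lemma normci : normc ('i : R[i]) = 1.
Proof. by rewrite /= expr0n add0r expr1n sqrtr1. Qed.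

Lemma cReD z w : complex.Re (z + w) = complex.Re z + complex.Re w.
Proof. by case: z => a b; case: w. Qed.
Lemma cImD z w : complex.Im (z + w) = complex.Im z + complex.Im w.
Proof. by case: z => a b; case: w. Qed.
Lemma cReN z : complex.Re (- z) = - complex.Re z. Proof. by case: z. Qed.
Lemma cImN z : complex.Im (- z) = - complex.Im z. Proof. by case: z. Qed.
Lemma cReM z w : complex.Re (z * w) =
  complex.Re z * complex.Re w - complex.Im z * complex.Im w.
Proof. by case: z => a b; case: w. Qed.
Lemma cImM z w : complex.Im (z * w) =
  complex.Re z * complex.Im w + complex.Im z * complex.Re w.
Proof. by case: z => a b; case: w. Qed.
Lemma cReR x : complex.Re x%:C = x. Proof. by []. Qed.
Lemma cImR x : complex.Im x%:C = 0. Proof. by []. Qed.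
Lemma cRei : complex.Re ('i : R[i]) = 0. Proof. by []. Qed.
Lemma cImi : complex.Im ('i : R[i]) = 1. Proof. by []. Qed.
Lemma cReRM x z : complex.Re (x%:C * z) = x * complex.Re z.
Proof. by rewrite cReM cReR cImR mul0r subr0. Qed.
Lemma cImRM x z : complex.Im (x%:C * z) = x * complex.Im z.
Proof. by rewrite cImM cReR cImR mul0r addr0. Qed.
Lemma cRe0 : complex.Re (0 : R[i]) = 0. Proof. by []. Qed.
Lemma cIm0 : complex.Im (0 : R[i]) = 0. Proof. by []. Qed.
Lemma cRe1 : complex.Re (1 : R[i]) = 1. Proof. by []. Qed.
Lemma cIm1 : complex.Im (1 : R[i]) = 0. Proof. by []. Qed.
Lemma complex_ext z w : complex.Re z = complex.Re w ->
  complex.Im z = complex.Im w -> z = w.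
Proof. by case: z => a b; case: w => c d /= -> ->. Qed.

End ComplexNorm.

(** * Continuity and complex differentiability in epsilon form *)

Section ComplexDerivative.
Variable R : realType.
Notation C := R[i].
Implicit Types (f g : C -> C) (z d : C).

Definition ccont f z := forall e : R, 0 < e -> exists2 r : R, 0 < r &
  forall h, normc h < r -> normc (f (z + h) - f z) < e.

(** Differentiability multiplied out by [normc h], so that [h = 0] is included; [cderivableP]
    relates it to [derivable]. *)
Definition cderiv f z d := forall e : R, 0 < e -> exists2 r : R, 0 < r &
  forall h, normc h < r -> normc (f (z + h) - f z - d * h) <= e * normc h.

Lemma ccont_ext f g z r : 0 < r -> (forall h, normc h < r -> f (z + h) = g (z + h)) ->
  ccont f z -> ccont g z.
Proof.
move=> r0 fg cf e e0; have [s s0 H] := cf e e0.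
exists (Num.min r s); first by rewrite lt_min r0.
move=> h; rewrite lt_min => /andP[hr hs]; have fz : f z = g z by have := fg 0; rewrite normc0 addr0; apply.
by rewrite -fz -fg//; exact: H.
Qed.

Lemma cderiv_ext f g z d r : 0 < r ->
  (forall h, normc h < r -> f (z + h) = g (z + h)) ->
  cderiv f z d -> cderiv g z d.
Proof.
move=> r0 fg cf e e0; have [s s0 H] := cf e e0.
exists (Num.min r s); first by rewrite lt_min r0.
move=> h; rewrite lt_min => /andP[hr hs].
have fz : f z = g z by have := fg 0; rewrite normc0 addr0; apply.
by rewrite -fz -fg//; exact: H.
Qed.

Lemma cderiv_ccont f z d : cderiv f z d -> ccont f z.
Proof.
move=> df e e0; have [r r0 H] := df 1 ltr01.
have M0 : 0 < 1 + normc d by rewrite ltr_pwDl ?normc_ge0.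
exists (Num.min r (e / (1 + normc d))); first by rewrite lt_min r0 divr_gt0.
move=> h; rewrite lt_min => /andP[hr he].
have -> : f (z + h) - f z = (f (z + h) - f z - d * h) + d * h by rewrite subrK.
apply: le_lt_trans (ler_normcD _ _) _; rewrite normcM.
apply: (@le_lt_trans _ _ ((1 + normc d) * normc h)).
  by rewrite mulrDl lerD2r; exact: H.
by rewrite -ltr_pdivlMl// mulrC.
Qed.

Lemma ccont_bound f z : ccont f z -> exists2 r : R, 0 < r &
  forall h, normc h < r -> normc (f (z + h)) < 1 + normc (f z).
Proof.
move=> /(_ 1 ltr01)[r r0 H]; exists r => // h /H H1.
have -> : f (z + h) = (f (z + h) - f z) + f z by rewrite subrK.
by apply: le_lt_trans (ler_normcD _ _) _; rewrite ltrD2r.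
Qed.

Lemma ccontD f g z : ccont f z -> ccont g z -> ccont (fun x => f x + g x) z.
Proof.
move=> cf cg e e0; have e2 : 0 < e / 2 by rewrite divr_gt0.
have [r r0 Hr] := cf _ e2; have [s s0 Hs] := cg _ e2.
exists (Num.min r s); first by rewrite lt_min r0.
move=> h; rewrite lt_min => /andP[hr hs].
rewrite opprD addrACA [ltRHS]splitr (le_lt_trans (ler_normcD _ _))//.
by rewrite ltrD ?Hr ?Hs.
Qed.

Lemma ccont_cst (c : C) z : ccont (fun=> c) z.
Proof. by move=> e e0; exists 1 => // h _; rewrite subrr normc0. Qed.

Lemma ccont_id z : ccont id z.
Proof. by move=> e e0; exists e => // h; rewrite addrC addKr. Qed.

Lemma ccontM f g z : ccont f z -> ccont g z -> ccont (fun x => f x * g x) z.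
Proof.
move=> cf cg e e0.
have [t t0 Ht] := ccont_bound cg.
have e2 : 0 < e / 2 by rewrite divr_gt0.
have F0 : 0 < 1 + normc (f z) by rewrite ltr_pwDl ?normc_ge0.
have G0 : 0 < 1 + normc (g z) by rewrite ltr_pwDl ?normc_ge0.
have [r r0 Hr] := cf _ (divr_gt0 e2 G0); have [s s0 Hs] := cg _ (divr_gt0 e2 F0).
exists (Num.min t (Num.min r s)); first by rewrite !lt_min r0 s0 t0.
move=> h; rewrite !lt_min => /and3P[ht hr hs].
have -> : f (z + h) * g (z + h) - f z * g z =
  (f (z + h) - f z) * g (z + h) + f z * (g (z + h) - g z) by ring.
rewrite [ltRHS]splitr (le_lt_trans (ler_normcD _ _))// !normcM.
apply: ltr_leD.
  have [->|n0] := eqVneq (normc (f (z + h) - f z)) 0; first by rewrite mul0r.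
  have n1 : 0 < normc (f (z + h) - f z) by rewrite lt_neqAle eq_sym n0 normc_ge0.
  apply: (@lt_trans _ _ (normc (f (z + h) - f z) * (1 + normc (g z)))).
    by rewrite ltr_pM2l// Ht.
  by rewrite -ltr_pdivlMr// Hr.
apply: (@le_trans _ _ ((1 + normc (f z)) * normc (g (z + h) - g z))).
  by rewrite ler_wpM2r ?normc_ge0// lerDr.
by rewrite -ler_pdivlMl// mulrC ltW// Hs.
Qed.

Lemma ccontV f z : f z != 0 -> ccont f z -> ccont (fun x => (f x)^-1) z.
Proof.
move=> fz0 cf e e0; have n0 : 0 < normc (f z) by rewrite normc_gt0.
have n2 : 0 < normc (f z) / 2 by rewrite divr_gt0.
have E0 : 0 < e * (normc (f z) ^+ 2 / 2) by rewrite !(mulr_gt0, invr_gt0, exprn_gt0).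
have [r r0 Hr] := cf _ n2; have [s s0 Hs] := cf _ E0.
exists (Num.min r s); first by rewrite lt_min r0.
move=> h; rewrite lt_min => /andP[hr hs].
have lb : normc (f z) / 2 < normc (f (z + h)).
  have := ler_normcBd (f z) (f (z + h)); rewrite normcB.
  by have := Hr _ hr; set a := normc _; set b := normc (f z); set c := normc _ => *; lra.
have fh0 : f (z + h) != 0 by rewrite -normc_gt0 (lt_trans _ lb).
have -> : (f (z + h))^-1 - (f z)^-1 = - (f (z + h) - f z) / (f (z + h) * f z).
  by field; rewrite fz0 fh0.
rewrite normcM normcV normcN' normcM ltr_pdivrMr ?mulr_gt0 ?normc_gt0//.
apply: lt_trans (Hs _ hs) _; rewrite ltr_pM2l// expr2 mulrAC ltr_pM2r//.
Qed.

Lemma ccont_comp f g z : ccont g z -> ccont f (g z) -> ccont (fun x => f (g x)) z.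
Proof.
move=> cg cf e e0; have [r r0 Hr] := cf e e0; have [s s0 Hs] := cg r r0.
by exists s => // h /Hs/Hr; rewrite [g z + _]addrC subrK.
Qed.

Lemma cderiv_cst (c : C) z : cderiv (fun=> c) z 0.
Proof.
by move=> e e0; exists 1 => // h _; rewrite subrr mul0r subr0 normc0 mulr_ge0 ?normc_ge0 ?ltW.
Qed.

Lemma cderiv_id z : cderiv id z 1.
Proof.
move=> e e0; exists 1 => // h _.
by rewrite [z + h]addrC addrK mul1r subrr normc0 mulr_ge0 ?normc_ge0 ?ltW.
Qed.

Lemma cderivD f g z d d' : cderiv f z d -> cderiv g z d' ->
  cderiv (fun x => f x + g x) z (d + d').
Proof.
move=> cf cg e e0; have e2 : 0 < e / 2 by rewrite divr_gt0.
have [r r0 Hr] := cf _ e2; have [s s0 Hs] := cg _ e2.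
exists (Num.min r s); first by rewrite lt_min r0.
move=> h; rewrite lt_min => /andP[hr hs].
have -> : f (z + h) + g (z + h) - (f z + g z) - (d + d') * h =
  (f (z + h) - f z - d * h) + (g (z + h) - g z - d' * h) by ring.
rewrite (le_trans (ler_normcD _ _))// [leRHS](_ : _ = e / 2 * normc h + e / 2 * normc h).
  by rewrite lerD ?Hr ?Hs.
by field.
Qed.

(* Caratheodory's form: [f] is differentiable when its difference quotient
   extends continuously to [h = 0]; this turns the product and chain rules into
   statements about continuity. *)
Lemma cderiv_slope f z d : cderiv f z d ->
  exists p : C -> C, [/\ p 0 = d, ccont p 0 & forall h, f (z + h) = f z + p h * h].
Proof.
move=> df; exists (fun h => if h == 0 then d else (f (z + h) - f z) / h).
split=> [||h]; first by rewrite eqxx.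
- move=> e e0; have e2 : 0 < e / 2 by rewrite divr_gt0.
  have [r r0 H] := df _ e2; exists r => // h hr; rewrite add0r eqxx.
  case: eqP => [_|/eqP h0]; first by rewrite subrr normc0.
  have -> : (f (z + h) - f z) / h - d = (f (z + h) - f z - d * h) / h by field.
  rewrite normcM normcV ltr_pdivrMr ?normc_gt0// (le_lt_trans (H _ hr))//.
  by rewrite ltr_pM2r ?normc_gt0// ltr_pdivrMr// ltr_pMr// ltr1n.
- case: eqP => [->|/eqP h0]; first by rewrite mulr0 !addr0.
  by rewrite divfK// [f z + _]addrC subrK.
Qed.

Lemma slope_cderiv f z (p : C -> C) : ccont p 0 ->
  (forall h, f (z + h) = f z + p h * h) -> cderiv f z (p 0).
Proof.
move=> cp fp e e0; have [r r0 H] := cp _ e0; exists r => // h hr.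
have -> : f (z + h) - f z - p 0 * h = (p (0 + h) - p 0) * h by rewrite fp add0r; ring.
by rewrite normcM ler_wpM2r ?normc_ge0// ltW// H.
Qed.

Lemma cderivM f g z d d' : cderiv f z d -> cderiv g z d' ->
  cderiv (fun x => f x * g x) z (d * g z + f z * d').
Proof.
move=> df dg; have [p [p0 cp fp]] := cderiv_slope df.
have [q [q0 cq gq]] := cderiv_slope dg.
pose s h := p h * g (z + h) + f z * q h.
have -> : d * g z + f z * d' = s 0 by rewrite /s p0 q0 addr0.
apply: slope_cderiv.
  apply: ccontD; last by apply: ccontM => //; exact: ccont_cst.
  apply: ccontM => //; apply: ccont_comp.
    by apply: ccontD; [exact: ccont_cst|exact: ccont_id].
  by rewrite addr0; exact: cderiv_ccont dg.
by move=> h; rewrite /s fp gq; ring.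
Qed.

Lemma cderivV f z d : f z != 0 -> cderiv f z d ->
  cderiv (fun x => (f x)^-1) z (- d / f z ^+ 2).
Proof.
move=> fz0 df; have [p [p0 cp fp]] := cderiv_slope df.
pose s h := - p h * (f (z + h) * f z)^-1.
have cfz : ccont (fun h => f (z + h)) 0.
  apply: ccont_comp; last by rewrite addr0; exact: cderiv_ccont df.
  by apply: ccontD; [exact: ccont_cst|exact: ccont_id].
have cs : ccont s 0.
  apply: ccontM.
    apply: (@ccont_ext (fun h => -1 * p h) _ _ 1) => // [h _|].
      by rewrite mulN1r.
    by apply: ccontM => //; exact: ccont_cst.
  apply: ccontV; first by rewrite addr0 mulf_neq0.
  by apply: ccontM => //; exact: ccont_cst.
have nf0 : 0 < normc (f z) by rewrite normc_gt0.
have [r r0 Hr] := cfz (normc (f z)) nf0.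
(* The slope identity fails where [f (z + h)] vanishes, so [slope_cderiv] does not apply directly
   and the radius is cut down. *)
have fne h : normc h < r -> f (z + h) != 0.
  move=> /Hr; rewrite add0r addr0; apply: contraTneq => ->.
  by rewrite sub0r normcN' ltxx.
have -> : - d / f z ^+ 2 = s 0 by rewrite /s p0 addr0 expr2.
move=> e e0; have [r' r'0 H'] := cs _ e0.
exists (Num.min r r'); first by rewrite lt_min r'0 r0.
move=> h; rewrite lt_min => /andP[hr hr'].
have -> : (f (z + h))^-1 - (f z)^-1 - s 0 * h = (s (0 + h) - s 0) * h.
  rewrite mulrBl; congr (_ - _); rewrite add0r /s.
  have -> : - p h * (f (z + h) * f z)^-1 * h = - (p h * h) / (f (z + h) * f z) by field; rewrite fne ?fz0.
  have -> : p h * h = f (z + h) - f z by rewrite fp addrC addKr.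
  by field; rewrite fne ?fz0.
by rewrite normcM ler_wpM2r ?normc_ge0// ltW// H'.
Qed.

Lemma cderiv_comp f g z d d' : cderiv g z d -> cderiv f (g z) d' ->
  cderiv (fun x => f (g x)) z (d' * d).
Proof.
move=> dg df; have [p [p0 cp fp]] := cderiv_slope df.
have [q [q0 cq gq]] := cderiv_slope dg.
pose s h := p (q h * h) * q h.
have -> : d' * d = s 0 by rewrite /s mulr0 p0 q0.
apply: slope_cderiv.
  apply: ccontM => //; apply: ccont_comp; last by rewrite mulr0.
  by apply: ccontM => //; exact: ccont_id.
by move=> h; rewrite /s gq fp; ring.
Qed.

Lemma cderivZ (c : C) f z d : cderiv f z d -> cderiv (fun x => c * f x) z (c * d).
Proof.
move=> df; have := cderivM (cderiv_cst c z) df.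
by rewrite mul0r add0r.
Qed.

Lemma cderiv_lin (a b : C) z : cderiv (fun x => a * x + b) z a.
Proof.
have := cderivD (cderivZ a (cderiv_id z)) (cderiv_cst b z).
by rewrite mulr1 addr0.
Qed.

Lemma cderivB f g z d d' : cderiv f z d -> cderiv g z d' ->
  cderiv (fun x => f x - g x) z (d - d').
Proof.
move=> df dg; have := cderivD df (cderivZ (-1) dg).
rewrite mulN1r; apply: (@cderiv_ext _ _ _ _ 1) => // h _.
by rewrite mulN1r.
Qed.

Lemma cderivX f n z d : cderiv f z d -> exists d', cderiv (fun x => f x ^+ n) z d'.
Proof.
move=> df; elim: n => [|n [d' IH]].
  by exists 0; apply: (@cderiv_ext (fun=> 1) _ _ _ 1) => //; exact: cderiv_cst.
exists (d * f z ^+ n + f z * d'); apply: (@cderiv_ext (fun x => f x * f x ^+ n) _ _ _ 1) => //.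
  by move=> h _; rewrite exprS.
exact: cderivM.
Qed.

End ComplexDerivative.

(** * The complex exponential *)

Section ComplexExponential.
Variable R : realType.
Notation C := R[i].
Implicit Types (z w : C) (x y : R).

Lemma is_derive_eps (f : R -> R) x df : is_derive x 1 f df ->
  forall e, 0 < e -> exists2 r, 0 < r &
    forall h, `|h| < r -> `|f (x + h) - f x - df * h| <= e * `|h|.
Proof.
move=> [dfx dfE] e e0; move: dfx; rewrite /derivable.
move=> /(@cvgrPdist_le R R) /(_ _ e0) [r /= r0 H]; exists r => // h hr.
have [->|h0] := eqVneq h 0; first by rewrite addr0 subrr mulr0 subr0 normr0 mulr0.
have := H h; rewrite /= sub0r normrN => /(_ hr h0).
have -> : lim (h^-1 *: ((f \o shift x) (h *: 1) - f x) @[h --> 0^']) = df by exact: dfE.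
rewrite /= /GRing.scale /= mulr1 [h + x]addrC.
have -> : df - h^-1 * (f (x + h) - f x) = - (f (x + h) - f x - df * h) / h by field.
by rewrite normrM normrN normfV ler_pdivrMr ?normr_gt0.
Qed.

Lemma normc_cexp z : normc (cexp z) = expR (complex.Re z).
Proof.
rewrite /cexp normcM normcR ger0_norm ?expR_ge0//.
by rewrite /= cos2Dsin2 sqrtr1 mulr1.
Qed.

Lemma cexp_neq0 z : cexp z != 0.
Proof. by rewrite -normc_gt0 normc_cexp expR_gt0. Qed.

Lemma cexpD z w : cexp (z + w) = cexp z * cexp w.
Proof.
rewrite /cexp cReD cImD expRD cosD sinD rmorphM /= mulrACA; congr (_ * _).
by apply: complex_ext => /=; ring.
Qed.

Lemma cexp0 : cexp (0 : C) = 1.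
Proof. by rewrite /cexp cRe0 cIm0 expR0 cos0 sin0 mul1r. Qed.

Lemma cexpN z : cexp (- z) = (cexp z)^-1.
Proof.
by apply: (mulfI (cexp_neq0 z)); rewrite -cexpD subrr cexp0 mulfV// cexp_neq0.
Qed.

Lemma cexpB z w : cexp (z - w) = cexp z / cexp w.
Proof. by rewrite cexpD cexpN. Qed.

Lemma cexpMn n z : cexp (n%:R * z) = cexp z ^+ n.
Proof.
elim: n => [|n IH]; first by rewrite mul0r cexp0 expr0.
by rewrite -natr1 mulrDl mul1r cexpD IH exprSr.
Qed.

Lemma cexpMz (n : int) z : cexp (n%:~R * z) = cexp z ^ n.
Proof.
case: n => n; first exact: cexpMn.
by rewrite NegzE mulrNz mulNr cexpN cexpMn.
Qed.

Lemma cexpR x : cexp x%:C = (expR x)%:C.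
Proof. by rewrite /cexp cReR cImR cos0 sin0 [X in _ * X]complexr0 mulr1. Qed.

Lemma cexpi y : cexp ('i * y%:C) = cos y +i* sin y.
Proof. by rewrite /cexp cReM cImM cRei cImi cReR cImR !mul0r mulr0 subrr mul1r add0r expR0 mul1r. Qed.

Lemma cexp_pii : cexp ('i * pi%:C) = -1 :> C.
Proof. by rewrite cexpi cospi sinpi; apply: complex_ext; rewrite ?cReN ?cImN/= ?oppr0. Qed.

Lemma cexp_2pii : cexp (2 * pi%:C * 'i) = 1 :> C.
Proof.
have -> : 2 * pi%:C * 'i = 'i * pi%:C + 'i * pi%:C :> C by ring.
by rewrite cexpD cexp_pii mulrNN mulr1.
Qed.

Lemma cexp_2piin (n : int) : cexp (2 * pi%:C * 'i * n%:~R) = 1 :> C.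
Proof. by rewrite mulrC cexpMz cexp_2pii exp1rz. Qed.

(** The modulus forces Re z = 0. For the argument, [cos] is injective on [0, pi], and an angle y in
    [pi, 2 pi[ is reflected to 2 pi - y. *)
Lemma cexp_eq1 z : `|complex.Im z| < pi *+ 2 -> cexp z = 1 -> z = 0.
Proof.
move=> Iz ez.
have R0 : complex.Re z = 0.
  have := normc_cexp z; rewrite ez normc1 => /esym/eqP.
  by rewrite -expR0 => /eqP/expR_inj.
have := ez; rewrite /cexp R0 expR0 mul1r => -[c1 s0].
apply: complex_ext => //; rewrite cIm0; move: (complex.Im z) Iz c1 => y Iy c1.
wlog y0 : y Iy c1 / 0 <= y.
  move=> H; case: (leP 0 y) => [|/ltW yN]; first exact: H.
  by apply/oppr_inj; rewrite oppr0; apply: H; rewrite ?normrN ?cosN// oppr_ge0.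
rewrite ger0_norm// in Iy.
have [ylt|yge] := ltP y pi.
  by apply: (@cos_inj R); rewrite ?cos0 ?c1// in_itv/= ?y0 ?(ltW ylt)// lexx pi_ge0.
have : pi *+ 2 - y = 0.
  apply: (@cos_inj R); rewrite ?cos0 ?in_itv/= ?lexx ?pi_ge0//.
    by rewrite subr_ge0 ltW//= lerBlDl mulr2n lerD2r.
  by rewrite cosB cos2pi sin2pi mul1r mul0r addr0.
by move/eqP; rewrite subr_eq0 => /eqP yE; rewrite yE ltxx in Iy.
Qed.

Lemma cexp_inj z w : `|complex.Im (z - w)| < pi *+ 2 -> cexp z = cexp w -> z = w.
Proof.
move=> zw e; apply/eqP; rewrite -subr_eq0; apply/eqP/cexp_eq1 => //.
by rewrite cexpB e mulfV// cexp_neq0.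
Qed.

Lemma cderiv_cexp0 : cderiv (@cexp R) 0 1.
Proof.
(* The constant 8 is the sum 1 + 2 + 4 + 1 of those in the bounds [B1], ..., [B4] below; e < 1
   enters through |1 + x| <= 2 and |E - 1| <= 2 |x|. *)
suff : forall e : R, 0 < e < 1 -> exists2 r : R, 0 < r &
    forall h, normc h < r -> normc (cexp h - 1 - h) <= (8 * e) * normc h.
  move=> H e e0; pose e' := Num.min (e / 8) (1 / 2).
  have /H[r r0 Hr] : 0 < e' < 1 by rewrite /e' lt_min divr_gt0//= gt_min; apply/andP; split => //; apply/orP; right; lra.
  exists r => // h hr; rewrite add0r cexp0 mul1r.
  apply: le_trans (Hr _ hr) _; rewrite ler_wpM2r ?normc_ge0//.
  by rewrite -ler_pdivlMl// mulrC /e' ge_min lexx.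
move=> e /andP[e0 e1].
have [r1 r10 H1] := is_derive_eps (is_derive_expR 0) e0.
have [r2 r20 H2] := is_derive_eps (is_derive_sin 0) e0.
have [r3 r30 H3] := is_derive_eps (is_derive_cos 0) e0.
exists (Num.min (Num.min r1 r2) (Num.min r3 e)); first by rewrite !lt_min r10 r20 r30 e0.
move=> h; rewrite !lt_min => /andP[/andP[h1 h2] /andP[h3 he]].
have hx := ler_Re_normc h; have hy := ler_Im_normc h.
have := H1 (complex.Re h) (le_lt_trans hx h1).
have := H2 (complex.Im h) (le_lt_trans hy h2).
have := H3 (complex.Im h) (le_lt_trans hy h3).
rewrite !add0r expR0 cos0 sin0 !subr0 oppr0 mul0r subr0 !mul1r => Hc Hs HE.
apply: le_trans (ler_normc_ReIm _) _; move: Hc Hs HE.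
rewrite /cexp !cReD !cImD !cReN !cImN cReRM cImRM cRe1 cIm1 subr0 /=.
have c1 := cos_max (complex.Im h).
move: (complex.Re h) (complex.Im h) (normc h) hx hy he c1 => x y n.
move: (expR x) (cos y) (sin y) => E c s hx hy he c1 Hc Hs HE.
have n0 : 0 <= n by rewrite (le_trans _ hx).
have HE' : `|E - 1| <= 2 * `|x|.
  have -> : E - 1 = (E - 1 - x) + x by ring.
  rewrite (le_trans (ler_normD _ _))// mulr_natl mulr2n lerD2r (le_trans HE)//.
  by rewrite ler_piMl// ltW.
have Hs' : `|s| <= 2 * `|y|.
  have -> : s = (s - y) + y by ring.
  rewrite (le_trans (ler_normD _ _))// mulr_natl mulr2n lerD2r (le_trans Hs)//.
  by rewrite ler_piMl// ltW.
have -> : E * c - 1 - x = (E - 1 - x) * c + (1 + x) * (c - 1) by ring.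
have -> : E * s - y = (E - 1) * s + (s - y) by ring.
have B1 : `|(E - 1 - x) * c| <= e * n.
  rewrite normrM (le_trans (ler_piMr _ _))// (le_trans HE)// ler_pM2l//.
have B2 : `|(1 + x) * (c - 1)| <= 2 * (e * n).
  rewrite normrM ler_pM//.
    by rewrite (le_trans (ler_normD _ _))// normr1 -lerBrDl (le_trans hx)// (le_trans (ltW he))//; lra.
  by rewrite (le_trans Hc)// ler_pM2l.
have B3 : `|(E - 1) * s| <= 4 * (e * n).
  rewrite normrM (_ : 4 * (e * n) = (2 * e) * (2 * n)); last by ring.
  rewrite ler_pM// ?(le_trans HE')// ?(le_trans Hs')// ler_pM2l//.
  by rewrite (le_trans hx)// ltW.
have B4 : `|s - y| <= e * n by rewrite (le_trans Hs)// ler_pM2l.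
rewrite (le_trans (lerD (ler_normD _ _) (ler_normD _ _)))//.
rewrite (le_trans (lerD (lerD B1 B2) (lerD B3 B4)))// -mulrA -subr_ge0.
have -> : 8 * (e * n) - (e * n + 2 * (e * n) + (4 * (e * n) + e * n)) = 0 by ring.
by [].
Qed.

Lemma cderiv_cexp z : cderiv (@cexp R) z (cexp z).
Proof.
move=> e e0; have E0 := expR_gt0 (complex.Re z).
have [r r0 H] := cderiv_cexp0 (divr_gt0 e0 E0).
exists r => // h /H; rewrite add0r cexp0 mul1r => Hh.
have -> : cexp (z + h) - cexp z - cexp z * h = cexp z * (cexp h - 1 - h).
  by rewrite cexpD; ring.
rewrite normcM normc_cexp (le_trans (ler_wpM2l (expR_ge0 _) Hh))//.
by rewrite mulrA mulrCA divff ?mulr1// gt_eqF.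
Qed.

Lemma cderiv_cexp_lin (a b : C) z :
  cderiv (fun x : C => cexp (a * x + b)) z (cexp (a * z + b) * a).
Proof. by apply: (cderiv_comp (cderiv_lin a b z)); exact: cderiv_cexp. Qed.

Lemma cderivableP (f : C -> C) z : derivable f z 1 <-> exists d, cderiv f z d.
Proof.
split.
  move=> /(@cvgrPdist_le R[i]) H; set d := lim _ in H.
  exists d => e e0; have ec0 : 0 < e%:C by rewrite ltcR.
  have [r /= r0 Hr] := H _ ec0.
  have rR : r = (complex.Re r)%:C by rewrite RRe_real// gtr0_real.
  rewrite rR ltcR in r0; exists (complex.Re r) => // h hr.
  have [->|h0] := eqVneq h 0; first by rewrite addr0 subrr mulr0 subr0 normc0 mulr0.
  have := Hr h; rewrite /= sub0r normrN normC_normc rR ltcR => /(_ hr h0).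
  rewrite normC_normc lecR -/d /GRing.scale /= mulr1 [h + z]addrC.
  have -> : d - h^-1 * (f (z + h) - f z) = - (f (z + h) - f z - d * h) / h by field.
  by rewrite normcM normcN' normcV ler_pdivrMr// normc_gt0.
move=> [d df]; rewrite /derivable; apply/(@cvg_ex R[i]); exists d.
apply/(@cvgrPdist_le R[i]) => e e0.
have eR : e = (complex.Re e)%:C by rewrite RRe_real// gtr0_real.
rewrite eR ltcR in e0; have [r r0 H] := df _ e0.
exists r%:C => /=; first by rewrite ltcR.
move=> h /=; rewrite sub0r normrN normC_normc ltcR => hr h0.
rewrite normC_normc eR lecR /GRing.scale /= mulr1 [h + z]addrC.
have -> : d - h^-1 * (f (z + h) - f z) = - (f (z + h) - f z - d * h) / h by field.
by rewrite normcM normcN' normcV ler_pdivrMr ?normc_gt0// H.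
Qed.

End ComplexExponential.

(** * Contour integrals and the theorem of Goursat *)

Section ComplexIntegral.
Variable R : realType.
Notation C := R[i].
Notation mu := (@lebesgue_measure R).
Implicit Types (u v : R -> C) (a b c x y : R).

Definition seg_cont u a b := forall t, a <= t <= b -> forall e : R, 0 < e ->
  exists2 r : R, 0 < r &
    forall s, a <= s <= b -> `|s - t| < r -> normc (u s - u t) < e.

Definition cint u a b : C :=
  Rintegral mu `[a, b] (fun t => complex.Re (u t)) +i*
  Rintegral mu `[a, b] (fun t => complex.Im (u t)).

(** [p] stands for Re or Im, both 1-Lipschitz for [normc], so that one proof serves the two
    components of [cint]. *)
Lemma seg_integrable (p : C -> R) u a b :
  (forall z w, `|p z - p w| <= normc (z - w)) -> seg_cont u a b ->
  mu.-integrable `[a, b] (EFin \o (fun t => p (u t))).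
Proof.
move=> p_lip cu; apply: continuous_compact_integrable.
  exact: segment_compact.
apply/subspace_continuousP => t; rewrite /= in_itv/= => tab.
apply/cvgrPdist_lt => e e0; have [r r0 Hr] := cu t tab e e0.
rewrite near_withinE; apply/nbhs_ballP; exists r => //= s.
rewrite /ball/= distrC => st; rewrite in_itv/= => sab.
by rewrite (le_lt_trans (p_lip _ _))// normcB Hr.
Qed.

Lemma Re_lip z w : `|complex.Re z - complex.Re w| <= @normc R (z - w).
Proof. by rewrite -cReN -cReD ler_Re_normc. Qed.
Lemma Im_lip z w : `|complex.Im z - complex.Im w| <= @normc R (z - w).
Proof. by rewrite -cImN -cImD ler_Im_normc. Qed.

Lemma seg_contD u v a b : seg_cont u a b -> seg_cont v a b ->
  seg_cont (fun t => u t + v t) a b.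
Proof.
move=> cu cv t tab e e0; have e2 : 0 < e / 2 by rewrite divr_gt0.
have [r r0 Hr] := cu t tab _ e2; have [s s0 Hs] := cv t tab _ e2.
exists (Num.min r s); first by rewrite lt_min r0.
move=> h hab; rewrite lt_min => /andP[hr hs].
rewrite opprD addrACA [ltRHS]splitr (le_lt_trans (ler_normcD _ _))//.
by rewrite ltrD// ?Hr ?Hs.
Qed.

Lemma seg_contZ (k : C) u a b : seg_cont u a b -> seg_cont (fun t => k * u t) a b.
Proof.
move=> cu t tab e e0; have K0 : 0 < 1 + normc k by rewrite ltr_pwDl ?normc_ge0.
have [r r0 Hr] := cu t tab _ (divr_gt0 e0 K0).
exists r => // s sab st; rewrite -mulrBr normcM.
apply: (@le_lt_trans _ _ ((1 + normc k) * normc (u s - u t))).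
  by rewrite ler_wpM2r ?normc_ge0// lerDr.
by rewrite -ltr_pdivlMl// mulrC Hr.
Qed.

Lemma seg_cont_cst (k : C) a b : seg_cont (fun=> k) a b.
Proof. by move=> t _ e e0; exists 1 => // s _ _; rewrite subrr normc0. Qed.

Lemma ccont_seg (f : C -> C) (p d : C) a b :
  (forall t, a <= t <= b -> ccont f (p + d * t%:C)) ->
  seg_cont (fun t => f (p + d * t%:C)) a b.
Proof.
move=> cf t tab e e0; have [r r0 Hr] := cf t tab e e0.
have K0 : 0 < 1 + normc d by rewrite ltr_pwDl ?normc_ge0.
exists (r / (1 + normc d)); first by rewrite divr_gt0.
move=> s sab st.
have -> : p + d * s%:C = (p + d * t%:C) + d * (s - t)%:C by rewrite rmorphB /=; ring.
apply: Hr; rewrite normcM normcR.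
apply: (@le_lt_trans _ _ ((1 + normc d) * `|s - t|)).
  by rewrite ler_wpM2r// lerDr.
by rewrite -ltr_pdivlMl// mulrC.
Qed.

Lemma eq_cint u v a b : (forall t, a <= t <= b -> u t = v t) -> cint u a b = cint v a b.
Proof.
move=> uv; rewrite /cint; congr (_ +i* _); apply: eq_Rintegral => t;
  by rewrite inE/= in_itv/= => /uv ->.
Qed.

Lemma Rintegral_itv_split (f : R -> R) a b c : a <= c -> c <= b ->
  mu.-integrable `[a, b] (EFin \o f) ->
  Rintegral mu `[a, b] f = Rintegral mu `[a, c] f + Rintegral mu `[c, b] f.
Proof.
move=> ac cb intf.
have H := @Rintegral_itvB R f (BLeft a) (BRight b) c intf.
rewrite -[LHS](subrK (Rintegral mu `[a, c] f)) H ?bnd_simp// addrC.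
congr (_ + _); apply: Rintegral_itv_obnd_cbnd.
apply: integrableS intf => //; apply: subset_itvr; rewrite bnd_simp.
exact: ac.
Qed.

Lemma cint_split u a b c : a <= c -> c <= b -> seg_cont u a b ->
  cint u a b = cint u a c + cint u c b.
Proof.
move=> ac cb cu; rewrite /cint.
rewrite (Rintegral_itv_split ac cb (seg_integrable Re_lip cu)).
by rewrite (Rintegral_itv_split ac cb (seg_integrable Im_lip cu)).
Qed.

Lemma cintD u v a b : seg_cont u a b -> seg_cont v a b ->
  cint (fun t => u t + v t) a b = cint u a b + cint v a b.
Proof.
move=> cu cv; apply: complex_ext; rewrite ?cReD ?cImD /=.
  rewrite -RintegralD//; [|exact: (seg_integrable Re_lip)..].
  by apply: eq_Rintegral => t _; rewrite cReD.
rewrite -RintegralD//; [|exact: (seg_integrable Im_lip)..].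
by apply: eq_Rintegral => t _; rewrite cImD.
Qed.

Lemma cintZ (k : C) u a b : seg_cont u a b ->
  cint (fun t => k * u t) a b = k * cint u a b.
Proof.
move=> cu; have iR := seg_integrable Re_lip cu; have iI := seg_integrable Im_lip cu.
have iZ (l : R) (w : R -> R) : mu.-integrable `[a, b] (EFin \o w) ->
    mu.-integrable `[a, b] (EFin \o (fun t => l * w t)).
  by move=> iw; exact: (@integrableZl _ _ _ mu `[a, b] _ l (EFin \o w)).
apply: complex_ext; rewrite ?cReM ?cImM /=.
  rewrite -!RintegralZl// -RintegralB//; [|exact: iZ..].
  by apply: eq_Rintegral => t _; rewrite cReM.
rewrite -!RintegralZl// -RintegralD//; [|exact: iZ..].
by apply: eq_Rintegral => t _; rewrite cImM.
Qed.

Lemma cint_cst (k : C) a b : a <= b -> cint (fun=> k) a b = (b - a)%:C * k.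
Proof.
move=> ab; rewrite /cint !Rintegral_cst//= lebesgue_measure_itv/= lte_fin.
have -> : fine (if a < b then (b%:E - a%:E)%E else 0%E) = b - a.
  by move: ab; rewrite le_eqVlt => /orP[/eqP->|->]//; rewrite ltxx subrr.
by apply: complex_ext; rewrite ?cReRM ?cImRM/= mulrC.
Qed.

Lemma ler_norm_Rintegral_cst (f : R -> R) a b (M : R) : a <= b ->
  mu.-integrable `[a, b] (EFin \o f) -> (forall t, a <= t <= b -> `|f t| <= M) ->
  `|Rintegral mu `[a, b] f| <= M * (b - a).
Proof.
move=> ab intf fM; rewrite (le_trans (le_normr_Rintegral _ _))//.
have iabs : mu.-integrable `[a, b] (EFin \o (fun t => `|f t|)).
  exact: (integrable_norm intf).
have -> : M * (b - a) = Rintegral mu `[a, b] (fun=> M).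
  rewrite Rintegral_cst//= lebesgue_measure_itv/= lte_fin.
  by move: ab; rewrite le_eqVlt => /orP[/eqP->|->]//; rewrite ltxx subrr.
apply: le_Rintegral => //.
  apply: continuous_compact_integrable; first exact: segment_compact.
  by apply: continuous_subspaceT => x; exact: cvg_cst.
Qed.

(** The factor 2 comes from estimating the real and imaginary parts separately. *)
Lemma normc_cint u a b (M : R) : a <= b -> seg_cont u a b ->
  (forall t, a <= t <= b -> normc (u t) <= M) -> normc (cint u a b) <= 2 * M * (b - a).
Proof.
move=> ab cu uM; rewrite (le_trans (ler_normc_ReIm _))//=.
rewrite -mulrA mulr_natl mulr2n lerD// ler_norm_Rintegral_cst//.
- exact: (seg_integrable Re_lip).
- by move=> t /uM; apply: le_trans; exact: ler_Re_normc.
- exact: (seg_integrable Im_lip).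
- by move=> t /uM; apply: le_trans; exact: ler_Im_normc.
Qed.

Lemma cint_point u a : cint u a a = 0.
Proof. by rewrite /cint set_itv1 !Rintegral_set1. Qed.

End ComplexIntegral.

(** * Integrals around rectangles and the theorem of Goursat *)

Section Goursat.
Variable R : realType.
Notation C := R[i].
Implicit Types (f g : C -> C) (x y a b c : R).

Definition hcont f y a b := seg_cont (fun t => f (t +i* y)) a b.
Definition vcont f x a b := seg_cont (fun t => f (x +i* t)) a b.
Definition hint f y a b := cint (fun t => f (t +i* y)) a b.
Definition vint f x a b := cint (fun t => f (x +i* t)) a b.

(** The contour integral taken counterclockwise: bottom minus top, then right minus left with dz = i
    dt. *)
Definition rect_int f x1 x2 y1 y2 :=
  hint f y1 x1 x2 - hint f y2 x1 x2 + 'i * (vint f x2 y1 y2 - vint f x1 y1 y2).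

Lemma complexD a b c d : (a +i* b) + (c +i* d) = (a + c) +i* (b + d) :> C.
Proof. by []. Qed.

Lemma hpt x y : x +i* y = (0 +i* y) + 1 * x%:C :> C.
Proof. by apply: complex_ext; rewrite ?(cReD, cImD, mul1r) /= ?add0r ?addr0. Qed.

Lemma vpt x y : x +i* y = x%:C + 'i * y%:C :> C.
Proof. by apply: complex_ext; rewrite ?(cReD, cImD, cReM, cImM) /= ?mul0r ?mul1r ?mulr0 ?subrr ?addr0 ?add0r. Qed.

Lemma ccont_hcont f y a b : (forall t, a <= t <= b -> ccont f (t +i* y)) -> hcont f y a b.
Proof.
move=> cf; rewrite /hcont.
have -> : (fun t => f (t +i* y)) = (fun t : R => f ((0 +i* y) + 1 * t%:C)).
  by apply/funext => t; rewrite hpt.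
by apply: ccont_seg => t tab; rewrite -hpt; exact: cf.
Qed.

Lemma ccont_vcont f x a b : (forall t, a <= t <= b -> ccont f (x +i* t)) -> vcont f x a b.
Proof.
move=> cf; rewrite /vcont.
have -> : (fun t => f (x +i* t)) = (fun t : R => f (x%:C + 'i * t%:C)).
  by apply/funext => t; rewrite vpt.
by apply: ccont_seg => t tab; rewrite -vpt; exact: cf.
Qed.

Lemma rect_int_splitx f x1 x2 y1 y2 c : x1 <= c -> c <= x2 ->
  hcont f y1 x1 x2 -> hcont f y2 x1 x2 ->
  rect_int f x1 x2 y1 y2 = rect_int f x1 c y1 y2 + rect_int f c x2 y1 y2.
Proof.
move=> xc cx c1 c2; rewrite /rect_int /hint (cint_split xc cx c1) (cint_split xc cx c2).
by ring.
Qed.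

Lemma rect_int_splity f x1 x2 y1 y2 c : y1 <= c -> c <= y2 ->
  vcont f x1 y1 y2 -> vcont f x2 y1 y2 ->
  rect_int f x1 x2 y1 y2 = rect_int f x1 x2 y1 c + rect_int f x1 x2 c y2.
Proof.
move=> xc cx c1 c2; rewrite /rect_int /vint (cint_split xc cx c1) (cint_split xc cx c2).
by ring.
Qed.

Lemma rect_intD f g x1 x2 y1 y2 :
  hcont f y1 x1 x2 -> hcont f y2 x1 x2 -> vcont f x1 y1 y2 -> vcont f x2 y1 y2 ->
  hcont g y1 x1 x2 -> hcont g y2 x1 x2 -> vcont g x1 y1 y2 -> vcont g x2 y1 y2 ->
  rect_int (fun z => f z + g z) x1 x2 y1 y2 =
  rect_int f x1 x2 y1 y2 + rect_int g x1 x2 y1 y2.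
Proof.
move=> f1 f2 f3 f4 g1 g2 g3 g4; rewrite /rect_int /hint /vint.
by rewrite !cintD//; ring.
Qed.

(** On opposite sides the values of an affine function differ by a constant, so each pair of sides
    contributes a product of side lengths, and the two contributions cancel. *)
Lemma rect_int_affine (p d : C) x1 x2 y1 y2 : x1 <= x2 -> y1 <= y2 ->
  rect_int (fun z => d * z + p) x1 x2 y1 y2 = 0.
Proof.
move=> x12 y12.
have cL z : ccont (fun z => d * z + p) z by exact: cderiv_ccont (cderiv_lin d p z).
have hL y : hcont (fun z => d * z + p) y x1 x2 by apply: ccont_hcont.
have vL x : vcont (fun z => d * z + p) x y1 y2 by apply: ccont_vcont.
rewrite /rect_int /hint /vint.
have subE (u v : R -> C) (k : C) a b : a <= b -> seg_cont v a b ->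
    (forall t, u t = v t + k) -> cint u a b - cint v a b = (b - a)%:C * k.
  move=> ab cv uv; have -> : u = (fun t => v t + k) by apply/funext.
  by rewrite cintD ?cint_cst//; [rewrite addrC addKr|exact: seg_cont_cst].
rewrite (subE _ _ (d * (0 +i* (y1 - y2))))//; first last.
  move=> t; rewrite addrAC -mulrDr; congr (d * _ + _).
  by rewrite complexD addr0 [y2 + _]addrC subrK.
  exact: (hL y2).
rewrite (subE _ _ (d * (x2 - x1)%:C))//; first last.
  move=> t; rewrite addrAC -mulrDr; congr (d * _ + _).
  by rewrite complexD addr0 [x1 + _]addrC subrK.
  exact: (vL x1).
have -> : 0 +i* (y1 - y2) = - ('i * (y2 - y1)%:C) :> C.
  by apply: complex_ext; rewrite ?(cReN, cImN, cReM, cImM)/=; ring.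
by ring.
Qed.

Lemma normc_rect_int f x1 x2 y1 y2 (M : R) : x1 <= x2 -> y1 <= y2 ->
  hcont f y1 x1 x2 -> hcont f y2 x1 x2 -> vcont f x1 y1 y2 -> vcont f x2 y1 y2 ->
  (forall x, x1 <= x <= x2 -> normc (f (x +i* y1)) <= M /\ normc (f (x +i* y2)) <= M) ->
  (forall y, y1 <= y <= y2 -> normc (f (x1 +i* y)) <= M /\ normc (f (x2 +i* y)) <= M) ->
  normc (rect_int f x1 x2 y1 y2) <= 4 * M * ((x2 - x1) + (y2 - y1)).
Proof.
move=> x12 y12 c1 c2 c3 c4 Mx My; rewrite /rect_int.
have B1 := normc_cint x12 c1 (fun t ht => (Mx t ht).1).
have B2 := normc_cint x12 c2 (fun t ht => (Mx t ht).2).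
have B3 := normc_cint y12 c3 (fun t ht => (My t ht).1).
have B4 := normc_cint y12 c4 (fun t ht => (My t ht).2).
rewrite (le_trans (ler_normcD _ _))// normcM normci mul1r.
rewrite (le_trans (lerD (ler_normcB _ _) (ler_normcB _ _)))//.
rewrite (le_trans (lerD (lerD B1 B2) (lerD B4 B3)))// -subr_ge0.
by rewrite [X in 0 <= X](_ : _ = 0)//; ring.
Qed.

Lemma nested_intervals (a : nat -> R) (w : R) : 0 <= w ->
  (forall n, a n <= a n.+1 /\ a n.+1 + w / 2 ^+ n.+1 <= a n + w / 2 ^+ n) ->
  exists x, forall n, a n <= x <= a n + w / 2 ^+ n.
Proof.
move=> w0 H.
have amon n k : a n <= a (n + k)%N.
  elim: k => [|k IH]; first by rewrite addn0.
  by rewrite addnS (le_trans IH)//; have [] := H (n + k)%N.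
have bmon n k : a (n + k)%N + w / 2 ^+ (n + k) <= a n + w / 2 ^+ n.
  elim: k => [|k IH]; first by rewrite addn0.
  by rewrite addnS (le_trans _ IH)//; have [] := H (n + k)%N.
have ub n m : a m <= a n + w / 2 ^+ n.
  have [nm|/ltnW mn] := leqP n m.
    apply: le_trans (bmon n (m - n)%N); rewrite subnKC// lerDl.
    by rewrite divr_ge0// exprn_ge0.
  apply: le_trans (amon m (n - m)%N) _; rewrite subnKC// lerDl.
  by rewrite divr_ge0// exprn_ge0.
have ne : range a !=set0 by exists (a 0%N), 0%N.
exists (sup (range a)) => n; apply/andP; split.
  apply: ub_le_sup; last by exists n.
  by exists (a 0%N + w / 2 ^+ 0) => _ [m _ <-].
by apply: ge_sup => // _ [m _ <-].
Qed.

(** A property inherited from the four quarters can only fail on a rectangle if it fails on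
    arbitrarily small rectangles around one point. This serves both for Goursat and as a substitute
    for compactness in [hol_rect_bounded]. *)
Lemma bisect_rect (P : R -> R -> R -> R -> Prop) x1 x2 y1 y2 :
  x1 <= x2 -> y1 <= y2 ->
  (forall a b c d, x1 <= a <= b -> b <= x2 -> y1 <= c <= d -> d <= y2 ->
    P a ((a + b) / 2) c ((c + d) / 2) -> P ((a + b) / 2) b c ((c + d) / 2) ->
    P a ((a + b) / 2) ((c + d) / 2) d -> P ((a + b) / 2) b ((c + d) / 2) d -> P a b c d) ->
  ~ P x1 x2 y1 y2 ->
  exists x y, [/\ x1 <= x <= x2, y1 <= y <= y2 &
    forall n, exists a c, [/\ a <= x <= a + (x2 - x1) / 2 ^+ n,
      c <= y <= c + (y2 - y1) / 2 ^+ n,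
      x1 <= a /\ a + (x2 - x1) / 2 ^+ n <= x2,
      y1 <= c /\ c + (y2 - y1) / 2 ^+ n <= y2 &
      ~ P a (a + (x2 - x1) / 2 ^+ n) c (c + (y2 - y1) / 2 ^+ n)]].
Proof.
move=> x12 y12 HP nP; set w := x2 - x1; set h := y2 - y1.
have w0 : 0 <= w by rewrite subr_ge0.
have h0 : 0 <= h by rewrite subr_ge0.
have W n : w / 2 ^+ n = w / 2 ^+ n.+1 + w / 2 ^+ n.+1.
  by rewrite exprS; field; rewrite expf_neq0.
have H n : h / 2 ^+ n = h / 2 ^+ n.+1 + h / 2 ^+ n.+1.
  by rewrite exprS; field; rewrite expf_neq0.
pose inside n (s : R * R) := [/\ x1 <= s.1, s.1 + w / 2 ^+ n <= x2, y1 <= s.2 & s.2 + h / 2 ^+ n <= y2].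
pose bad n (s : R * R) := inside n s /\ ~ P s.1 (s.1 + w / 2 ^+ n) s.2 (s.2 + h / 2 ^+ n).
pose nx n (s : R * R) (ij : bool * bool) : R * R :=
  (s.1 + (if ij.1 then w / 2 ^+ n.+1 else 0), s.2 + (if ij.2 then h / 2 ^+ n.+1 else 0)).
have step n s : bad n s -> exists ij, bad n.+1 (nx n s ij).
  move=> [[i1 i2 i3 i4] nPs]; apply: contrapT => /forallNP nb.
  have wn0 : 0 <= w / 2 ^+ n.+1 by rewrite divr_ge0 ?exprn_ge0.
  have hn0 : 0 <= h / 2 ^+ n.+1 by rewrite divr_ge0 ?exprn_ge0.
  have Pn ij : P (nx n s ij).1 ((nx n s ij).1 + w / 2 ^+ n.+1)
      (nx n s ij).2 ((nx n s ij).2 + h / 2 ^+ n.+1).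
    apply: contrapT => nPn; apply: (nb ij); split => //.
    move: i2 i4; rewrite /nx /inside W H; move: wn0 hn0.
    move: (w / 2 ^+ n.+1) (h / 2 ^+ n.+1) => v u v0 u0 i2 i4.
    by clear - i1 i2 i3 i4 v0 u0; case: ij => [[] []] /=; split; lra.
  apply: nPs; rewrite W H.
  move: wn0 hn0 (Pn (false, false)) (Pn (false, true)) (Pn (true, false)) (Pn (true, true)).
  move: i2 i4; rewrite W H /=.
  move: (w / 2 ^+ n.+1) (h / 2 ^+ n.+1) => v u i2 i4 v0 u0.
  have Ev (a v' : R) : (a + (a + (v' + v'))) / 2 = a + v' by field.
  rewrite !addr0 => P1 P2 P3 P4; apply: HP; rewrite ?Ev ?addrA//; lra.
(* The choice of a bad quarter is made total, with a dummy value at rectangles that are not bad, so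
   that the sequence [S] is a plain fixpoint. *)
have [F HF] : {F : nat -> R * R -> bool * bool & forall n s, bad n s -> bad n.+1 (nx n s (F n s))}.
  have /choice[F HF] : forall ns : nat * (R * R), exists ij, bad ns.1 ns.2 -> bad ns.1.+1 (nx ns.1 ns.2 ij).
    move=> [n s] /=; have [/step[ij ?]|nb] := pselect (bad n s); first by exists ij.
    by exists (true, true) => /nb.
  by exists (fun n s => F (n, s)) => n s; exact: (HF (n, s)).
pose S := fix S n := if n is m.+1 then nx m (S m) (F m (S m)) else (x1, y1).
have Sbad n : bad n (S n).
  elim: n => [|n IH]; last exact: HF.
  have xE : x1 + w / 2 ^+ 0 = x2 by rewrite expr0 divr1 /w [x1 + _]addrC subrK.
  have yE : y1 + h / 2 ^+ 0 = y2 by rewrite expr0 divr1 /h [y1 + _]addrC subrK.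
  by split; [split|]; rewrite /= ?xE ?yE.
have [|x Hx] := @nested_intervals (fun n => (S n).1) w w0.
  move=> n; rewrite /= (W n).
  have wn0 : 0 <= w / 2 ^+ n.+1 by rewrite divr_ge0 ?exprn_ge0.
  by case: (F n (S n)).1; lra.
have [|y Hy] := @nested_intervals (fun n => (S n).2) h h0.
  move=> n; rewrite /= (H n).
  have hn0 : 0 <= h / 2 ^+ n.+1 by rewrite divr_ge0 ?exprn_ge0.
  by case: (F n (S n)).2; lra.
exists x, y; split.
- by have := Hx 0%N; rewrite /= expr0 divr1 /w [x1 + _]addrC subrK.
- by have := Hy 0%N; rewrite /= expr0 divr1 /h [y1 + _]addrC subrK.
- move=> n; exists (S n).1, (S n).2; have [[]] := Sbad n.
  by split.
Qed.

Lemma exists_pow2_gt x : exists n, x < 2 ^+ n.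
Proof.
exists (Num.bound `|x|); rewrite (le_lt_trans (ler_norm x))//.
rewrite (lt_le_trans (archi_boundP _))//.
by rewrite -natrX ler_nat ltnW// ltn_expl.
Qed.

Lemma dist_itv (a w s t : R) : a <= s <= a + w -> a <= t <= a + w -> `|s - t| <= w.
Proof. by move=> /andP[? ?] /andP[? ?]; rewrite ler_norml; lra. Qed.

Lemma goursat f x1 x2 y1 y2 : x1 <= x2 -> y1 <= y2 ->
  (forall x y, x1 <= x <= x2 -> y1 <= y <= y2 -> exists d, cderiv f (x +i* y) d) ->
  rect_int f x1 x2 y1 y2 = 0.
Proof.
rewrite !le_eqVlt => /orP[/eqP <-|x12] /orP[/eqP <-|y12] df.
- by rewrite /rect_int /hint /vint !cint_point !subrr mulr0 addr0.
- by rewrite /rect_int /hint /vint !cint_point !subrr mulr0 addr0.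
- by rewrite /rect_int /hint /vint !cint_point !subrr mulr0 addr0.
have cf x y : x1 <= x <= x2 -> y1 <= y <= y2 -> ccont f (x +i* y).
  by move=> hx hy; have [d] := df x y hx hy; exact: cderiv_ccont.
have hf y a b : x1 <= a -> b <= x2 -> y1 <= y <= y2 -> hcont f y a b.
  move=> ha hb hy; apply: ccont_hcont => t /andP[ta tb]; apply: cf => //.
  by rewrite (le_trans ha)// (le_trans tb).
have vf x a b : y1 <= a -> b <= y2 -> x1 <= x <= x2 -> vcont f x a b.
  move=> ha hb hx; apply: ccont_vcont => t /andP[ta tb]; apply: cf => //.
  by rewrite (le_trans ha)// (le_trans tb).
apply/eqP; rewrite -normc_eq0 eq_le normc_ge0 andbT; apply/ler_addgt0Pl => e e0.
rewrite addr0; pose A := (x2 - x1) * (y2 - y1).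
have w0 : 0 < x2 - x1 by rewrite subr_gt0.
have h0 : 0 < y2 - y1 by rewrite subr_gt0.
have A0 : 0 < A by rewrite mulr_gt0.
(* A bound proportional to the area is additive under subdivision, hence inherited from the
   quarters. *)
pose P a b c d : Prop := normc (rect_int f a b c d) <= e / A * ((b - a) * (d - c)).
suff : P x1 x2 y1 y2 by rewrite /P -/A divfK// gt_eqF.
apply: contrapT => nP; have := bisect_rect (ltW x12) (ltW y12) _ nP; case.
  move=> a b c d /andP[ha ab] hb /andP[hc cd] hd P1 P2 P3 P4; rewrite /P.
  have mab : a <= (a + b) / 2 <= b by lra.
  have mcd : c <= (c + d) / 2 <= d by lra.
  move: mab mcd P1 P2 P3 P4; set m := (a + b) / 2; set k := (c + d) / 2 => /andP[am mb] /andP[ck kd] P1 P2 P3 P4.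
  rewrite /P (@rect_int_splitx _ _ _ _ _ m)//; first last.
    by apply: hf => //; lra.
    by apply: hf => //; lra.
  rewrite (@rect_int_splity _ a m _ _ k)//; first last.
    by apply: vf => //; lra.
    by apply: vf => //; lra.
  rewrite (@rect_int_splity _ m b _ _ k)//; first last.
    by apply: vf => //; lra.
    by apply: vf => //; lra.
  rewrite (le_trans (ler_normcD _ _))//.
  rewrite (le_trans (lerD (ler_normcD _ _) (ler_normcD _ _)))//.
  rewrite (le_trans (lerD (lerD P1 P3) (lerD P2 P4)))// -subr_ge0.
  by rewrite [X in 0 <= X](_ : _ = 0)//; ring.
move=> x [y [hx hy Hn]].
have [d dd] := df x y hx hy.
pose L := (x2 - x1) + (y2 - y1).
have L0 : 0 < L by rewrite addr_gt0.
(* With this constant [normc_rect_int] gives 4/5 of e / 4 ^ n on a rectangle of the n-th generation,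
   while [P] asks for e / 4 ^ n. *)
have e'0 : 0 < e / (5 * L ^+ 2) by rewrite divr_gt0// mulr_gt0// exprn_gt0.
have [r r0 Hr] := dd _ e'0.
have [n hn] := exists_pow2_gt (L / r).
have p0 : 0 < 2 ^+ n :> R by rewrite exprn_gt0.
have Lr : L / 2 ^+ n < r by rewrite ltr_pdivrMr// mulrC -ltr_pdivrMr.
have [a [c [hax hcy [xa ax] [yc cy]]]] := Hn n; apply.
rewrite /P.
set w := (x2 - x1) / 2 ^+ n in hax ax *; set h := (y2 - y1) / 2 ^+ n in hcy cy *.
have wn0 : 0 < w by rewrite divr_gt0.
have hn0 : 0 < h by rewrite divr_gt0.
have wh : w + h < r by rewrite /w /h -mulrDl.
pose z := x +i* y.
(* Subtracting the tangent at z does not change the integral, by [rect_int_affine], and leaves a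
   function that is small of first order near z. *)
pose g u := f u + ((- d) * u + (d * z - f z)).
have cL u : ccont (fun u => (- d) * u + (d * z - f z)) u by exact: cderiv_ccont (cderiv_lin _ _ u).
have hL y' a' b' : hcont (fun u => (- d) * u + (d * z - f z)) y' a' b' by apply: ccont_hcont.
have vL x' a' b' : vcont (fun u => (- d) * u + (d * z - f z)) x' a' b' by apply: ccont_vcont.
have hg y' : c <= y' <= c + h -> hcont f y' a (a + w).
  by move=> /andP[h1 h2]; apply: hf xa ax _; rewrite (le_trans yc h1) (le_trans h2 cy).
have vg x' : a <= x' <= a + w -> vcont f x' c (c + h).
  by move=> /andP[h1 h2]; apply: vf yc cy _; rewrite (le_trans xa h1) (le_trans h2 ax).
have aa : a <= a <= a + w by rewrite lexx lerDl ltW.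
have aa' : a <= a + w <= a + w by rewrite lexx lerDl ltW.
have cc : c <= c <= c + h by rewrite lexx lerDl ltW.
have cc' : c <= c + h <= c + h by rewrite lexx lerDl ltW.
have -> : rect_int f a (a + w) c (c + h) = rect_int g a (a + w) c (c + h).
  rewrite rect_intD//; [|by apply: hg|by apply: hg|by apply: vg|by apply: vg].
  by rewrite rect_int_affine ?addr0// lerDl ltW.
have bnd x' y' : a <= x' <= a + w -> c <= y' <= c + h ->
    normc (g (x' +i* y')) <= e / (5 * L ^+ 2) * (w + h).
  move=> hx' hy'; pose k := x' +i* y' - z.
  have kE : x' +i* y' = z + k by rewrite /k [z + _]addrC subrK.
  have kn : normc k <= w + h.
    rewrite (le_trans (ler_normc_ReIm _))// /k /z cReD cImD cReN cImN /=.
    exact: lerD (dist_itv hx' hax) (dist_itv hy' hcy).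
  have -> : g (x' +i* y') = f (z + k) - f z - d * k by rewrite /g kE; ring.
  rewrite (le_trans (Hr _ (le_lt_trans kn wh)))// ler_pM2l//.
have cg : forall u, ccont f u -> ccont g u by move=> u cfu; apply: ccontD.
apply: (le_trans (normc_rect_int (M := e / (5 * L ^+ 2) * (w + h)) _ _ _ _ _ _ _ _)).
- by rewrite lerDl ltW.
- by rewrite lerDl ltW.
- by apply: seg_contD; [exact: hg cc|exact: hL].
- by apply: seg_contD; [exact: hg cc'|exact: hL].
- by apply: seg_contD; [exact: vg aa|exact: vL].
- by apply: seg_contD; [exact: vg aa'|exact: vL].
- by move=> x' hx'; split; [exact: bnd hx' cc|exact: bnd hx' cc'].
- by move=> y' hy'; split; [exact: bnd aa hy'|exact: bnd aa' hy'].
rewrite ![_ + _ - _]addrAC !subrr !add0r.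
have -> : w + h = L / 2 ^+ n by rewrite /w /h -mulrDl.
have -> : e / A * (w * h) = e / (2 ^+ n) ^+ 2.
  by rewrite /w /h /A; field; rewrite !gt_eqF.
have -> : 4 * (e / (5 * L ^+ 2) * (L / 2 ^+ n)) * (L / 2 ^+ n) = (4 / 5) * (e / (2 ^+ n) ^+ 2).
  by field; rewrite !gt_eqF.
rewrite ger_pMl; last by rewrite divr_gt0// exprn_gt0.
by lra.
Qed.

(** The outer rectangle is cut into the inner one and four pieces to its left, right, bottom and
    top, none of which contains (p, q); [goursat] applies to each of the four. *)
Lemma rect_int_shrink f x1 x2 y1 y2 p q a b c d :
  x1 <= a -> a < p -> p < b -> b <= x2 -> y1 <= c -> c < q -> q < d -> d <= y2 ->
  (forall x y, x1 <= x <= x2 -> y1 <= y <= y2 -> (x, y) != (p, q) ->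
     exists e, cderiv f (x +i* y) e) ->
  rect_int f x1 x2 y1 y2 = rect_int f a b c d.
Proof.
move=> x1a ap pb bx2 y1c cq qd dy2 df.
have x1p : x1 < p := le_lt_trans x1a ap; have px2 : p < x2 := lt_le_trans pb bx2.
have y1q : y1 < q := le_lt_trans y1c cq; have qy2 : q < y2 := lt_le_trans qd dy2.
have x12 : x1 <= x2 := ltW (lt_trans x1p px2); have y12 : y1 <= y2 := ltW (lt_trans y1q qy2).
have ax2 : a <= x2 := ltW (lt_trans ap px2); have x1b : x1 <= b := ltW (lt_trans x1p pb).
have cy2 : c <= y2 := ltW (lt_trans cq qy2); have y1d : y1 <= d := ltW (lt_trans y1q qd).
have ab : a <= b := ltW (lt_trans ap pb); have cd : c <= d := ltW (lt_trans cq qd).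
have cf x y : x1 <= x <= x2 -> y1 <= y <= y2 -> (x != p) || (y != q) -> ccont f (x +i* y).
  move=> hx hy hn; have [|e] := df x y hx hy; last exact: cderiv_ccont.
  by rewrite xpair_eqE negb_and.
have hf y a' b' : x1 <= a' -> b' <= x2 -> y1 <= y -> y <= y2 -> y != q -> hcont f y a' b'.
  move=> ha hb y1y yy2 yq; apply: ccont_hcont => t /andP[ta tb].
  by apply: cf; [rewrite (le_trans ha ta) (le_trans tb hb)|rewrite y1y|rewrite yq orbT].
have vf x a' b' : y1 <= a' -> b' <= y2 -> x1 <= x -> x <= x2 -> x != p -> vcont f x a' b'.
  move=> ha hb x1x xx2 xp; apply: ccont_vcont => t /andP[ta tb].
  by apply: cf; [rewrite x1x|rewrite (le_trans ha ta) (le_trans tb hb)|rewrite xp].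
have G a' b' c' d' : x1 <= a' -> a' <= b' -> b' <= x2 -> y1 <= c' -> c' <= d' -> d' <= y2 ->
    [|| b' < p, p < a', d' < q | q < c'] -> rect_int f a' b' c' d' = 0.
  move=> h1 h2 h3 h4 h5 h6 H; apply: goursat => // x y /andP[hx1 hx2] /andP[hy1 hy2].
  apply: df; first by rewrite (le_trans h1 hx1) (le_trans hx2 h3).
    by rewrite (le_trans h4 hy1) (le_trans hy2 h6).
  rewrite xpair_eqE negb_and; case/or4P: H => H; apply/orP; [left|left|right|right].
  - by rewrite lt_eqF// (le_lt_trans hx2).
  - by rewrite gt_eqF// (lt_le_trans H).
  - by rewrite lt_eqF// (le_lt_trans hy2).
  - by rewrite gt_eqF// (lt_le_trans H).
have n1 : y1 != q by rewrite lt_eqF.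
have n2 : y2 != q by rewrite gt_eqF.
have n3 : a != p by rewrite lt_eqF.
have n4 : b != p by rewrite gt_eqF.
have lx := lexx x1; have rx := lexx x2; have ly := lexx y1; have ry := lexx y2.
rewrite (@rect_int_splitx f x1 x2 y1 y2 a x1a ax2 (hf y1 _ _ lx rx ly y12 n1) (hf y2 _ _ lx rx y12 ry n2)).
rewrite (G x1 a y1 y2 lx x1a ax2 ly y12 ry _) ?ap// add0r.
rewrite (@rect_int_splitx f a x2 y1 y2 b ab bx2 (hf y1 _ _ x1a rx ly y12 n1) (hf y2 _ _ x1a rx y12 ry n2)).
rewrite (G b x2 y1 y2 x1b bx2 rx ly y12 ry _) ?pb ?orbT// addr0.
rewrite (@rect_int_splity f a b y1 y2 c y1c cy2 (vf a _ _ ly ry x1a ax2 n3) (vf b _ _ ly ry x1b bx2 n4)).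
rewrite (G a b y1 c x1a ab bx2 ly y1c cy2 _) ?cq ?orbT// add0r.
rewrite (@rect_int_splity f a b c y2 d cd dy2 (vf a _ _ y1c ry x1a ax2 n3) (vf b _ _ y1c ry x1b bx2 n4)).
by rewrite (G a b d y2 x1a ab bx2 y1d dy2 ry _) ?qd ?orbT// addr0.
Qed.

(* Cutting out a small rectangle around [p]: the integral over the small one
   tends to 0 because [f] is bounded there. *)
Lemma goursat_except f x1 x2 y1 y2 p q (M r0 : R) :
  x1 < p < x2 -> y1 < q < y2 -> 0 < r0 ->
  (forall x y, x1 <= x <= x2 -> y1 <= y <= y2 -> (x, y) != (p, q) ->
     exists d, cderiv f (x +i* y) d) ->
  (forall x y, `|x - p| <= r0 -> `|y - q| <= r0 -> normc (f (x +i* y)) <= M) ->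
  rect_int f x1 x2 y1 y2 = 0.
Proof.
move=> /andP[x1p px2] /andP[y1q qy2] r00 df fM.
apply/eqP; rewrite -normc_eq0 eq_le normc_ge0 andbT; apply/ler_addgt0Pl => e e0.
rewrite addr0.
have M0 : 0 <= M by rewrite (le_trans _ (fM p q _ _)) ?normc_ge0// subrr normr0 ltW.
(* A square of half-side s contributes at most 4 M (2 s + 2 s) = 16 M s; M + 1 keeps the divisor
   positive. *)
have K0 : 0 < 16 * (M + 1) by rewrite mulr_gt0// ltr_wpDl.
pose s := Num.min (Num.min r0 (e / (16 * (M + 1))))
  (Num.min (Num.min (p - x1) (x2 - p)) (Num.min (q - y1) (y2 - q))).
have s0 : 0 < s by rewrite !lt_min r00 !subr_gt0 x1p px2 y1q qy2 divr_gt0.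
have sr0 : s <= r0 by rewrite /s !ge_min lexx.
have se : s <= e / (16 * (M + 1)) by rewrite /s !ge_min lexx orbT.
have s1 : x1 <= p - s by rewrite lerBrDr addrC -lerBrDr /s !ge_min lexx !orbT.
have s2 : p + s <= x2 by rewrite addrC -lerBrDr /s !ge_min lexx !orbT.
have s3 : y1 <= q - s by rewrite lerBrDr addrC -lerBrDr /s !ge_min lexx !orbT.
have s4 : q + s <= y2 by rewrite addrC -lerBrDr /s !ge_min lexx !orbT.
have ap : p - s < p by rewrite gtrDl oppr_lt0.
have pb : p < p + s by rewrite ltrDl.
have cq : q - s < q by rewrite gtrDl oppr_lt0.
have qd : q < q + s by rewrite ltrDl.
have cf x y : p - s <= x <= p + s -> q - s <= y <= q + s -> (x != p) || (y != q) -> ccont f (x +i* y).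
  move=> /andP[h1 h2] /andP[h3 h4] hn.
  have [|||k] := df x y; last exact: cderiv_ccont.
  - by rewrite (le_trans s1 h1) (le_trans h2 s2).
  - by rewrite (le_trans s3 h3) (le_trans h4 s4).
  by rewrite xpair_eqE negb_and.
have ab : p - s <= p + s := ltW (lt_trans ap pb).
have cd : q - s <= q + s := ltW (lt_trans cq qd).
rewrite (rect_int_shrink s1 ap pb s2 s3 cq qd s4 df).
have ball (t u : R) : u - s <= t <= u + s -> `|t - u| <= r0.
  by move=> /andP[h1 h2]; rewrite (le_trans _ sr0)// ler_norml lerBrDr addrC h1 lerBlDr addrC.
have inx : p - s <= p - s <= p + s by rewrite lexx.
have inx' : p - s <= p + s <= p + s by rewrite lexx andbT.
have iny : q - s <= q - s <= q + s by rewrite lexx.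
have iny' : q - s <= q + s <= q + s by rewrite lexx andbT.
apply: (le_trans (normc_rect_int (M := M) _ _ _ _ _ _ _ _)).
- by [].
- by [].
- by apply: ccont_hcont => t ht; apply: cf => //; rewrite (lt_eqF cq) orbT.
- by apply: ccont_hcont => t ht; apply: cf => //; rewrite (gt_eqF qd) orbT.
- by apply: ccont_vcont => t ht; apply: cf => //; rewrite (lt_eqF ap).
- by apply: ccont_vcont => t ht; apply: cf => //; rewrite (gt_eqF pb).
- by move=> x hx; split; apply: fM; exact: ball.
- by move=> x hx; split; apply: fM; exact: ball.
have -> : 4 * M * (p + s - (p - s) + (q + s - (q - s))) = 16 * M * s by ring.
apply: (@le_trans _ _ (16 * (M + 1) * s)).
  by rewrite ler_pM2r// ler_pM2l// lerDl.
by rewrite mulrC -ler_pdivlMr.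
Qed.

End Goursat.

(** * Periodic functions and their Fourier coefficients *)

Section Periodic.
Variable R : realType.
Notation C := R[i].
Implicit Types (f g h F : C -> C) (x y a b c : R) (z : C).

Definition qexp z : C := cexp (2 * pi%:C * 'i * z).

Definition hol_above h (Y0 : R) := forall z, Y0 < complex.Im z -> exists d, cderiv h z d.
Definition per_above h (Y0 : R) := forall z, Y0 < complex.Im z -> h (z + 1) = h z.

Lemma Re_2pii z : complex.Re (2 * pi%:C * 'i * z) = - (2 * pi * complex.Im z).
Proof.
have -> : 2 * pi%:C * 'i * z = (2 * pi)%:C * ('i * z) :> C.
  by rewrite rmorphM /= rmorph_nat mulrA.
by rewrite cReRM cReM cRei cImi mul0r mul1r sub0r mulrN.
Qed.

Lemma Im_2pii z : complex.Im (2 * pi%:C * 'i * z) = 2 * pi * complex.Re z.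
Proof.
have -> : 2 * pi%:C * 'i * z = (2 * pi)%:C * ('i * z) :> C.
  by rewrite rmorphM /= rmorph_nat mulrA.
by rewrite cImRM cImM cRei cImi mul0r mul1r add0r.
Qed.

Lemma normc_qexp z : normc (qexp z) = expR (- (2 * pi * complex.Im z)).
Proof. by rewrite normc_cexp Re_2pii. Qed.

Lemma qexp_neq0 z : qexp z != 0. Proof. exact: cexp_neq0. Qed.
Lemma qexpD z w : qexp (z + w) = qexp z * qexp w.
Proof. by rewrite /qexp mulrDr cexpD. Qed.
Lemma qexpN z : qexp (- z) = (qexp z)^-1.
Proof. by rewrite /qexp mulrN cexpN. Qed.
Lemma qexp0 : qexp 0 = 1. Proof. by rewrite /qexp mulr0 cexp0. Qed.
Lemma qexp1 : qexp 1 = 1. Proof. by rewrite /qexp mulr1 cexp_2pii. Qed.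
Lemma qexpMn n z : qexp (n%:R * z) = qexp z ^+ n.
Proof. by rewrite /qexp mulrCA cexpMn. Qed.
Lemma qexpDz z (n : int) : qexp (z + n%:~R) = qexp z.
Proof. by rewrite qexpD /qexp cexp_2piin mulr1. Qed.
Lemma qexpD1 z : qexp (z + 1) = qexp z.
Proof. by rewrite qexpD qexp1 mulr1. Qed.

Lemma cderiv_qexp z : cderiv qexp z (qexp z * (2 * pi%:C * 'i)).
Proof.
have := cderiv_cexp_lin (2 * pi%:C * 'i) 0 z; rewrite addr0.
by apply: (@cderiv_ext _ _ _ _ _ 1) => // h _; rewrite addr0.
Qed.

Lemma pi2_gt0 : 0 < 2 * pi :> R. Proof. by rewrite mulr_gt0// pi_gt0. Qed.

Lemma normc_qexp_lt z w : complex.Im w < complex.Im z -> normc (qexp z) < normc (qexp w).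
Proof. by move=> zw; rewrite !normc_qexp ltr_expR ltrN2 ltr_pM2l// pi2_gt0. Qed.

Lemma twopii_neq0 : 2 * pi%:C * 'i != 0 :> C.
Proof.
rewrite !mulf_neq0 ?pnatr_eq0//; last by rewrite -normc_gt0 normci.
by rewrite -normc_gt0 normcR normr_gt0 gt_eqF// pi_gt0.
Qed.

Lemma qexp_inj z w : `|complex.Re (z - w)| < 1 -> qexp z = qexp w -> z = w.
Proof.
move=> zw; rewrite /qexp => /cexp_inj H.
apply: (mulfI twopii_neq0); apply: H; rewrite -mulrBr Im_2pii normrM gtr0_norm ?pi2_gt0//.
by rewrite -[ltRHS]mulr_natl -[ltRHS]mulr1 ltr_pM2l// pi2_gt0.
Qed.

Lemma qexp_small (e : R) : 0 < e -> exists Y : R, forall z, Y <= complex.Im z -> normc (qexp z) < e.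
Proof.
move=> e0; exists ((1 - ln e) / (2 * pi)) => z; rewrite ler_pdivrMr ?pi2_gt0// mulrC => h.
rewrite normc_qexp -[ltRHS](lnK e0) ltr_expR.
by move: h; rewrite -/pi; lra.
Qed.

Lemma qexp_large (M : R) : 0 < M -> exists Y : R, forall z, complex.Im z <= Y -> M < normc (qexp z).
Proof.
move=> M0; exists ((-1 - ln M) / (2 * pi)) => z; rewrite ler_pdivlMr ?pi2_gt0// mulrC => h.
rewrite normc_qexp -[ltLHS](lnK M0) ltr_expR.
by move: h; rewrite -/pi; lra.
Qed.

(** The vertical sides are one period apart and cancel, so that the vanishing of the contour
    integral compares the two heights. *)
Lemma hint_const_except F a y1 y2 p q (M r0 : R) :
  a < p < a + 1 -> y1 < q < y2 -> 0 < r0 ->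
  (forall x y, a <= x <= a + 1 -> y1 <= y <= y2 -> (x, y) != (p, q) ->
     exists d, cderiv F (x +i* y) d) ->
  (forall x y, `|x - p| <= r0 -> `|y - q| <= r0 -> normc (F (x +i* y)) <= M) ->
  (forall y, y1 <= y <= y2 -> F ((a + 1) +i* y) = F (a +i* y)) ->
  hint F y1 a (a + 1) = hint F y2 a (a + 1).
Proof.
move=> ap yq r00 dF bF perF; apply/eqP; rewrite -subr_eq0.
have := goursat_except ap yq r00 dF bF; rewrite /rect_int.
have -> : vint F (a + 1) y1 y2 = vint F a y1 y2 by apply: eq_cint => t /perF.
by rewrite subrr mulr0 addr0 => ->.
Qed.

Lemma hint_const F a y1 y2 : y1 <= y2 ->
  (forall x y, a <= x <= a + 1 -> y1 <= y <= y2 -> exists d, cderiv F (x +i* y) d) ->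
  (forall y, y1 <= y <= y2 -> F ((a + 1) +i* y) = F (a +i* y)) ->
  hint F y1 a (a + 1) = hint F y2 a (a + 1).
Proof.
move=> y12 dF perF; apply/eqP; rewrite -subr_eq0.
have a1 : a <= a + 1 by rewrite lerDl.
have := goursat a1 y12 dF; rewrite /rect_int.
have -> : vint F (a + 1) y1 y2 = vint F a y1 y2 by apply: eq_cint => t /perF.
by rewrite subrr mulr0 addr0 => ->.
Qed.

Lemma complexD1 x y : (x +i* y) + 1 = (x + 1) +i* y :> C.
Proof. by apply: complex_ext; rewrite ?(cReD, cImD)/= ?addr0. Qed.

Lemma hint_const_hol F a Y0 y1 y2 : hol_above F Y0 -> per_above F Y0 ->
  Y0 < y1 -> Y0 < y2 -> hint F y1 a (a + 1) = hint F y2 a (a + 1).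
Proof.
move=> hF pF; wlog y12 : y1 y2 / y1 <= y2.
  move=> H Yy1 Yy2; case: (leP y1 y2) => [|/ltW] h; first exact: H.
  by rewrite (H y2 y1).
move=> Yy1 _; apply: hint_const => // [x y _ /andP[h1 h2]|y /andP[h1 h2]].
  by apply: hF; rewrite /= (lt_le_trans Yy1).
by rewrite -complexD1 pF//= (lt_le_trans Yy1).
Qed.

Lemma cderiv_hcont F y a b : (forall x, a <= x <= b -> exists d, cderiv F (x +i* y) d) ->
  hcont F y a b.
Proof. by move=> dF; apply: ccont_hcont => t /dF[d]; exact: cderiv_ccont. Qed.

Lemma normc_hint F y a (M : R) : hcont F y a (a + 1) ->
  (forall x, a <= x <= a + 1 -> normc (F (x +i* y)) <= M) ->
  normc (hint F y a (a + 1)) <= 2 * M.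
Proof.
move=> cF FM; have a1 : a <= a + 1 by rewrite lerDl.
by have := normc_cint a1 cF FM; rewrite [a + 1 - a]addrAC subrr add0r mulr1.
Qed.

(** The periodic Cauchy kernel: near z0 it behaves like 1 / (2 pi i (z - z0)), it tends to 0 for Im
    z -> +oo and to 1 for Im z -> -oo. *)
Definition ckernel z0 z : C := qexp z / (qexp z - qexp z0).

Lemma ckernel_cderiv z0 z : qexp z != qexp z0 -> exists d, cderiv (ckernel z0) z d.
Proof.
move=> zz; have H := cderivB (cderiv_qexp z) (cderiv_cst (qexp z0) z).
have nz : qexp z - qexp z0 != 0 by rewrite subr_eq0.
have H2 := cderivM (cderiv_qexp z) (@cderivV R (fun x : C => qexp x - qexp z0) z _ nz H).
by eexists; exact: H2.
Qed.

Lemma ckernelD1 z0 z : ckernel z0 (z + 1) = ckernel z0 z.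
Proof. by rewrite /ckernel qexpD1. Qed.

Lemma qexp_neq_im z w : complex.Im z != complex.Im w -> qexp z != qexp w.
Proof.
rewrite neq_lt => /orP[] /normc_qexp_lt; apply: contraTneq => ->; by rewrite ltxx.
Qed.

Lemma hint_ckernel_above z0 a y : complex.Im z0 < y -> hint (ckernel z0) y a (a + 1) = 0.
Proof.
move=> z0y; apply/eqP; rewrite -normc_eq0 eq_le normc_ge0 andbT; apply/ler_addgt0Pl => e e0.
rewrite addr0; set q0 := normc (qexp z0).
have q00 : 0 < q0 by rewrite normc_gt0 qexp_neq0.
(* The first bound keeps the denominator above q0 / 2, the second then makes the quotient at most e
   / 2. *)
have s0 : 0 < Num.min (q0 / 2) (q0 * e / 4) by rewrite lt_min !divr_gt0// mulr_gt0.
have [Y HY] := qexp_small s0.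
pose y' := Num.max y Y.
have yy' : y <= y' by rewrite le_max lexx.
have Yy' : Y <= y' by rewrite le_max lexx orbT.
have dK x t : y <= t -> exists d, cderiv (ckernel z0) (x +i* t) d.
  by move=> yt; apply: ckernel_cderiv; apply: qexp_neq_im; rewrite /= gt_eqF// (lt_le_trans z0y).
rewrite (@hint_const (ckernel z0) a y y')//; first last.
  by move=> t _; rewrite -complexD1 ckernelD1.
  by move=> x t _ /andP[yt _]; exact: dK.
have -> : e = 2 * (e / 2) by field.
apply: normc_hint; first by apply: cderiv_hcont => x _; exact: dK.
move=> x _; have := HY (x +i* y') Yy'; rewrite lt_min => /andP[h1 h2].
rewrite /ckernel normcM normcV.
have lb : q0 / 2 <= normc (qexp (x +i* y') - qexp z0).
  by rewrite normcB (le_trans _ (ler_normcBd _ _))// -/q0; lra.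
have p2 : 0 < q0 / 2 by rewrite divr_gt0.
rewrite ler_pdivrMr ?(lt_le_trans p2)//.
apply: le_trans (ltW h2) _; rewrite (@le_trans _ _ (e / 2 * (q0 / 2)))//.
  by rewrite le_eqVlt; apply/orP; left; apply/eqP; field.
by rewrite ler_pM2l// divr_gt0.
Qed.

Lemma ckernelN1 z0 z : qexp z != qexp z0 -> ckernel z0 z - 1 = qexp z0 / (qexp z - qexp z0).
Proof. by move=> zz; rewrite /ckernel; field; rewrite subr_eq0. Qed.

(** The line is pushed down, where the kernel tends to 1; [ckernelN1] bounds the difference. *)
Lemma hint_ckernel_below z0 a y : y < complex.Im z0 -> hint (ckernel z0) y a (a + 1) = 1.
Proof.
move=> z0y; apply/eqP; rewrite -subr_eq0 -normc_eq0 eq_le normc_ge0 andbT; apply/ler_addgt0Pl => e e0.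
rewrite addr0; set q0 := normc (qexp z0).
have q00 : 0 < q0 by rewrite normc_gt0 qexp_neq0.
have s0 : 0 < q0 + 2 * q0 / e by rewrite addr_gt0 ?divr_gt0// mulr_gt0.
have [Y HY] := qexp_large s0.
pose y' := Num.min y Y.
have yy' : y' <= y by rewrite ge_min lexx.
have Yy' : y' <= Y by rewrite ge_min lexx orbT.
have dK x t : t <= y -> exists d, cderiv (ckernel z0) (x +i* t) d.
  by move=> yt; apply: ckernel_cderiv; apply: qexp_neq_im; rewrite /= lt_eqF// (le_lt_trans yt).
rewrite -(@hint_const (ckernel z0) a y' y)//; first last.
  by move=> t _; rewrite -complexD1 ckernelD1.
  by move=> x t _ /andP[_ yt]; exact: dK.
have cK : hcont (ckernel z0) y' a (a + 1) by apply: cderiv_hcont => x _; exact: dK.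
have a1 : a <= a + 1 by rewrite lerDl.
have -> : hint (ckernel z0) y' a (a + 1) - 1 = hint (fun z => ckernel z0 z + (- 1)) y' a (a + 1).
  rewrite /hint cintD//; last exact: seg_cont_cst.
  by rewrite cint_cst// [a + 1]addrC addrK mul1r.
have -> : e = 2 * (e / 2) by field.
apply: normc_hint; first by apply: seg_contD => //; exact: seg_cont_cst.
move=> x _; rewrite ckernelN1; last by apply: qexp_neq_im; rewrite /= lt_eqF// (le_lt_trans yy').
have h1 := HY (x +i* y') Yy'.
rewrite normcM normcV.
have p2 : 0 < 2 * q0 / e by rewrite divr_gt0// mulr_gt0.
have lb : 2 * q0 / e <= normc (qexp (x +i* y') - qexp z0).
  by rewrite (le_trans _ (ler_normcBd _ _))// -/q0 lerBrDl ltW.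
rewrite -/q0 ler_pdivrMr ?(lt_le_trans p2)//.
apply: (@le_trans _ _ (e / 2 * (2 * q0 / e))); last by rewrite ler_pM2l// divr_gt0.
by rewrite le_eqVlt; apply/orP; left; apply/eqP; field; rewrite gt_eqF.
Qed.

(** The simple pole of the kernel is compensated by the zero of h - h z0. *)
Lemma ckernel_bounded h z0 d : cderiv h z0 d -> exists (r0 M : R), 0 < r0 /\
  forall x y, `|x - complex.Re z0| <= r0 -> `|y - complex.Im z0| <= r0 ->
    normc ((h (x +i* y) - h z0) * ckernel z0 (x +i* y)) <= M.
Proof.
move=> dh; have dq := cderiv_qexp z0; set k := _ * _ in dq.
have k0 : 0 < normc k.
  by rewrite normc_gt0 mulf_neq0 ?qexp_neq0// twopii_neq0.
have k2 : 0 < normc k / 2 by rewrite divr_gt0.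
have [r r_gt0 Hr] := dq _ k2.
have [s s_gt0 Hs] := dh _ ltr01.
have [t t_gt0 Ht] := ccont_bound (cderiv_ccont dq).
pose m := Num.min r (Num.min s t).
have m0 : 0 < m by rewrite !lt_min r_gt0 s_gt0 t_gt0.
(* A box of half-side m / 3 lies in the disc of radius m, where the three local estimates hold. *)
exists (m / 3), ((1 + normc d) * ((1 + normc (qexp z0)) / (normc k / 2))).
split=> [|x y hx hy]; first by rewrite divr_gt0.
set u := x +i* y - z0; have -> : x +i* y = z0 + u by rewrite /u [z0 + _]addrC subrK.
have um : normc u < m.
  rewrite (le_lt_trans (ler_normc_ReIm _))// /u cReD cImD cReN cImN/=.
  by rewrite (le_lt_trans (lerD hx hy))//; lra.
move: um; rewrite !lt_min => /and3P[ur us ut].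
have [->|u0] := eqVneq u 0.
  rewrite addr0 subrr mul0r normc0 !mulr_ge0 ?invr_ge0 ?addr_ge0 ?normc_ge0 ?mulr_ge0 ?normc_ge0//.
have nu : 0 < normc u by rewrite normc_gt0.
have lb : normc k / 2 * normc u <= normc (qexp (z0 + u) - qexp z0).
  have := Hr _ ur; set A := qexp (z0 + u) - qexp z0 => HA.
  have : normc (k * u) <= normc A + normc (A - k * u).
    by have := ler_normcB A (A - k * u); rewrite opprB [A + _]addrC subrK.
  by rewrite normcM; lra.
have ub : normc (h (z0 + u) - h z0) <= (1 + normc d) * normc u.
  have := Hs _ us; set A := h (z0 + u) - h z0 => HA.
  have : normc A <= normc (A - d * u) + normc (d * u).
    by have := ler_normcD (A - d * u) (d * u); rewrite subrK.
  by rewrite normcM; lra.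
rewrite /ckernel (normcM (h _ - _)) (normcM (qexp _)) normcV.
have p0 : 0 < normc k / 2 * normc u by rewrite mulr_gt0.
apply: (@le_trans _ _ ((1 + normc d) * normc u * ((1 + normc (qexp z0)) / (normc k / 2 * normc u)))).
  rewrite ler_pM ?mulr_ge0 ?normc_ge0 ?invr_ge0 ?normc_ge0//.
  rewrite ler_pM ?invr_ge0 ?normc_ge0 ?(ltW (Ht _ ut))// lef_pV2 ?posrE//.
  exact: lt_le_trans p0 lb.
rewrite le_eqVlt; apply/orP; left; apply/eqP; field.
by rewrite !gt_eqF.
Qed.

(** The function (h - h z0) times the kernel has a removable singularity, so its integrals at
    heights y1 and y2 agree; the kernel alone integrates to 1 below z0 and to 0 above it. *)
Lemma cauchy_period h Y0 z0 y1 y2 a : hol_above h Y0 -> per_above h Y0 ->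
  Y0 < y1 -> y1 < complex.Im z0 < y2 -> a < complex.Re z0 < a + 1 ->
  h z0 = hint (fun z => h z * ckernel z0 z) y1 a (a + 1) -
         hint (fun z => h z * ckernel z0 z) y2 a (a + 1).
Proof.
move=> hh ph Yy1 /andP[y1q qy2] ap.
have y1q' : y1 < complex.Im z0 < y2 by rewrite y1q.
have Yz0 : Y0 < complex.Im z0 by rewrite (lt_trans Yy1).
have a1 : a <= a + 1 by rewrite lerDl.
have [d0 dh0] := hh _ Yz0.
have [r0 [M [r00 HM]]] := ckernel_bounded dh0.
pose G z := (h z - h z0) * ckernel z0 z.
have per_h x y : y1 <= y -> h ((x + 1) +i* y) = h (x +i* y).
  by move=> yy; rewrite -complexD1 ph//= (lt_le_trans Yy1).
have per_K x y : ckernel z0 ((x + 1) +i* y) = ckernel z0 (x +i* y).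
  by rewrite -complexD1 ckernelD1.
have dK x y : a <= x <= a + 1 -> (x, y) != (complex.Re z0, complex.Im z0) ->
    exists d, cderiv (ckernel z0) (x +i* y) d.
  move=> hx xy; apply: ckernel_cderiv; apply: contra xy => /eqP/qexp_inj H.
  rewrite -H//; last by rewrite cReD cReN /= ltr_norml; move: ap hx => /andP[? ?] /andP[? ?]; lra.
have HG : hint G y1 a (a + 1) = hint G y2 a (a + 1).
  apply: (hint_const_except ap y1q' r00 _ HM).
    move=> x y hx /andP[hy1 hy2] xy.
    have [d dh] := hh (x +i* y) (lt_le_trans Yy1 hy1).
    have [d' dK'] := dK x y hx xy.
    by eexists; apply: cderivM dK'; apply: cderivB dh (cderiv_cst _ _).
  by move=> y /andP[hy _]; rewrite /G per_h// per_K.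
have nq y : y != complex.Im z0 -> forall x, (x, y) != (complex.Re z0, complex.Im z0).
  by move=> yq x; rewrite xpair_eqE negb_and yq orbT.
have key y : y1 <= y -> y != complex.Im z0 ->
    hint G y a (a + 1) = hint (fun z => h z * ckernel z0 z) y a (a + 1) -
      h z0 * hint (ckernel z0) y a (a + 1).
  move=> hy yq.
  have cK : hcont (ckernel z0) y a (a + 1) by apply: cderiv_hcont => x hx; apply: dK => //; exact: nq.
  have chK : hcont (fun z => h z * ckernel z0 z) y a (a + 1).
    apply: cderiv_hcont => x hx; have [d dh] := hh (x +i* y) (lt_le_trans Yy1 hy).
    by have [d' dK'] := dK x y hx (nq _ yq x); eexists; exact: cderivM dh dK'.
  rewrite /hint -mulNr -(cintZ _ cK) -(cintD chK (seg_contZ _ cK)).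
  by apply: eq_cint => t _; rewrite /G mulrBl mulNr.
have n1 : y1 != complex.Im z0 by rewrite lt_eqF.
have n2 : y2 != complex.Im z0 by rewrite gt_eqF.
have := HG; rewrite (key y1 (lexx _) n1) (key y2 (ltW (lt_trans y1q qy2)) n2).
rewrite (hint_ckernel_below _ y1q) (hint_ckernel_above _ qy2) mulr0 mulr1 subr0 => <-.
by rewrite opprB addrCA subrr addr0.
Qed.

End Periodic.

Opaque cexp qexp.

(** * Vanishing of Fourier coefficients and order of vanishing at i oo *)

Section PeriodicConsequences.
Variable R : realType.
Notation C := R[i].
Implicit Types (f g h F : C -> C) (x y a b c Y : R) (z : C).

Definition qpow (m : int) z : C := qexp (m%:~R * z).

Lemma hol_above_M f g Y0 : hol_above f Y0 -> hol_above g Y0 ->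
  hol_above (fun z => f z * g z) Y0.
Proof.
move=> hf hg z Yz; have [d df] := hf z Yz; have [d' dg] := hg z Yz.
by eexists; exact: cderivM df dg.
Qed.

Lemma per_above_M f g Y0 : per_above f Y0 -> per_above g Y0 ->
  per_above (fun z => f z * g z) Y0.
Proof. by move=> hf hg z Yz; rewrite hf// hg. Qed.

Lemma qpow_hol m Y0 z : Y0 < complex.Im z -> exists d, cderiv (qpow m) z d.
Proof.
move=> _; have := cderiv_comp (cderiv_lin m%:~R 0 z) (cderiv_qexp (m%:~R * z + 0)).
move=> H; eexists; apply: (@cderiv_ext _ _ _ _ _ 1 _ _ H) => // k _.
by rewrite addr0.
Qed.

Lemma qpow_per m Y0 : per_above (qpow m) Y0.
Proof. by move=> z _; rewrite /qpow mulrDr mulr1 qexpDz. Qed.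

Lemma qpowD m n z : qpow (m + n) z = qpow m z * qpow n z.
Proof. by rewrite /qpow rmorphD /= mulrDl qexpD. Qed.

Lemma qpow0 z : qpow 0 z = 1. Proof. by rewrite /qpow mul0r qexp0. Qed.

Lemma qpow_nat (n : nat) z : qpow n z = qexp z ^+ n.
Proof. by rewrite /qpow -qexpMn. Qed.

Lemma qpow_natN (n : nat) z : qpow (- n%:Z) z = (qexp z ^+ n)^-1.
Proof. by rewrite /qpow rmorphN /= mulNr qexpN -qexpMn. Qed.

Lemma hol_hcont F Y0 y a b : hol_above F Y0 -> Y0 < y -> hcont F y a b.
Proof. by move=> hF Yy; apply: cderiv_hcont => x _; exact: hF. Qed.

Lemma hol_shift_bounded F Y0 y a b : hol_above F Y0 -> Y0 < y -> a <= b ->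
  exists2 M : R, 0 < M & forall x, a <= x <= b -> normc (F (x +i* y)) <= M.
Proof.
move=> hF Yy ab.
have cN : {within `[a, b], continuous (fun t : R => normc (F (t +i* y)))}.
  apply/subspace_continuousP => t; rewrite /= in_itv/= => tab.
  apply/cvgrPdist_lt => e e0.
  have [r r0 Hr] := @hol_hcont F Y0 y a b hF Yy t tab e e0.
  rewrite near_withinE; apply/nbhs_ballP; exists r => //= s.
  rewrite /ball/= distrC => st; rewrite in_itv/= => sab.
  rewrite (le_lt_trans _ (Hr s sab st))// ler_norml.
  by rewrite lerNl opprB ler_normcBd/= [in leRHS]normcB ler_normcBd.
have [c _ Hc] := EVT_max ab cN.
exists (1 + normc (F (c +i* y))); first by rewrite ltr_pwDl ?normc_ge0.
move=> x xab; rewrite (le_trans (Hc x _)) ?in_itv// lerDr//.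
Qed.

Lemma small_normc_eq0 z : (forall e : R, 0 < e -> normc z <= e) -> z = 0.
Proof.
move=> H; apply/eqP; rewrite -normc_eq0 eq_le normc_ge0 andbT; apply/ler_addgt0Pl => e e0.
by rewrite addr0 H.
Qed.

Lemma geometric_lt1 (r M e : R) : 0 <= r < 1 -> 0 < e -> exists n, M * r ^+ n <= e.
Proof.
move=> /andP[r0 r1] e0.
have : (fun n => M * r ^+ n) @ \oo --> 0.
  rewrite -[X in _ --> X](mulr0 M); apply: cvgM; first exact: cvg_cst.
  by apply: cvg_expr; rewrite ger0_norm.
move=> /cvgrPdist_le/(_ e e0)[n _ /(_ n (leqnn _))]; rewrite sub0r normrN => H.
by exists n; rewrite (le_trans (ler_norm _)).
Qed.

(* A periodic function all of whose Fourier coefficients vanish is zero: in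
   [cauchy_period], replace the kernel by the tail of its geometric expansion. *)
Lemma fourier_eq0 h Y0 : hol_above h Y0 -> per_above h Y0 ->
  (forall m a y, Y0 < y -> hint (fun z => h z * qpow m z) y a (a + 1) = 0) ->
  forall z, Y0 < complex.Im z -> h z = 0.
Proof.
move=> hh ph H0 z Yz; set p := complex.Re z; set q := complex.Im z.
pose a := p - 1 / 2; pose y1 := (Y0 + q) / 2; pose y2 := q + 1.
have Yy1 : Y0 < y1 by rewrite /y1; move: Yz; rewrite -/q; lra.
have yy : y1 < q < y2 by rewrite /y1 /y2; move: Yz; rewrite -/q => ?; apply/andP; split; lra.
have ap : a < p < a + 1 by rewrite /a; apply/andP; split; lra.
have a1 : a <= a + 1 by rewrite lerDl.
rewrite (cauchy_period hh ph Yy1 yy ap).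
case/andP: yy => y1q qy2.
have Yy2 : Y0 < y2 by rewrite (lt_trans Yy1)// (lt_trans y1q).
set qz := qexp z; have qz0 : qz != 0 by exact: qexp_neq0.
have chK y : Y0 < y -> y != q -> hcont (fun z0 => h z0 * ckernel z z0) y a (a + 1).
  move=> Yy yq; apply: cderiv_hcont => x hx; have [d dh] := hh (x +i* y) Yy.
  have [d' dK] : exists d', cderiv (ckernel z) (x +i* y) d'.
    by apply: ckernel_cderiv; exact: qexp_neq_im.
  by eexists; exact: cderivM dh dK.
have chq m y : Y0 < y -> hcont (fun z0 => h z0 * qpow m z0) y a (a + 1).
  by move=> Yy; apply: hol_hcont Yy; apply: hol_above_M => //; exact: qpow_hol.
have cqK m y : Y0 < y -> y != q ->
    hcont (fun z0 => qpow m z0 * (h z0 * ckernel z z0)) y a (a + 1).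
  move=> Yy yq; apply: cderiv_hcont => x hx; have [d dh] := hh (x +i* y) Yy.
  have [d' dK] : exists d', cderiv (ckernel z) (x +i* y) d'.
    by apply: ckernel_cderiv; exact: qexp_neq_im.
  have [d'' dq] := qpow_hol m (z := x +i* y) Yy.
  by eexists; exact: cderivM dq (cderivM dh dK).
have neq y x : y != q -> qexp (x +i* y) - qz != 0.
  by move=> yq; rewrite subr_eq0; exact: qexp_neq_im.
(* Below z one has |[qz]| < |[qexp z0]|. Each step takes one term of the geometric series in qz /
   qexp z0 out of the kernel, and that term integrates to 0 by [H0]. *)
have E1 n : hint (fun z0 => h z0 * ckernel z z0) y1 a (a + 1) =
    hint (fun z0 => qz ^+ n * (qpow (- n%:Z) z0 * (h z0 * ckernel z z0))) y1 a (a + 1).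
  elim: n => [|n ->].
    by apply: eq_cint => t _; rewrite expr0 mul1r oppr0 qpow0 mul1r.
  have -> : hint (fun z0 => qz ^+ n * (qpow (- n%:Z) z0 * (h z0 * ckernel z z0))) y1 a (a + 1) =
     hint (fun z0 => qz ^+ n.+1 * (qpow (- n.+1%:Z) z0 * (h z0 * ckernel z z0))
            + qz ^+ n * (h z0 * qpow (- n%:Z) z0)) y1 a (a + 1).
    apply: eq_cint => t _; rewrite !qpow_natN /ckernel exprSr -/qz.
    have := neq y1 t; rewrite lt_eqF// => /(_ isT); move: (qexp_neq0 (t +i* y1)).
    move: (qexp _) => u u0 uq; rewrite [in RHS]exprSr.
    by field; rewrite expf_neq0// u0 uq.
  have y1n : y1 != q by rewrite lt_eqF.
  rewrite /hint cintD//.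
  - rewrite [X in _ + X](_ : _ = 0) ?addr0//.
    rewrite cintZ; last exact: (chq _ _ Yy1).
    by rewrite -/(hint (fun z0 => h z0 * qpow (- n%:Z) z0) y1 a (a + 1)) H0// mulr0.
  - by apply: seg_contZ; exact: (cqK _ _ Yy1).
  - by apply: seg_contZ; exact: (chq _ _ Yy1).
(* Above z the expansion runs in the inverse quotient. *)
have E2 n : hint (fun z0 => h z0 * ckernel z z0) y2 a (a + 1) =
    hint (fun z0 => (qz ^+ n)^-1 * (qpow n z0 * (h z0 * ckernel z z0))) y2 a (a + 1).
  elim: n => [|n ->].
    by apply: eq_cint => t _; rewrite expr0 invr1 mul1r qpow0 mul1r.
  have -> : hint (fun z0 => (qz ^+ n)^-1 * (qpow n z0 * (h z0 * ckernel z z0))) y2 a (a + 1) =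
     hint (fun z0 => (qz ^+ n.+1)^-1 * (qpow n.+1 z0 * (h z0 * ckernel z z0))
            + - (qz ^+ n.+1)^-1 * (h z0 * qpow n.+1 z0)) y2 a (a + 1).
    apply: eq_cint => t _; rewrite !qpow_nat /ckernel !exprSr -/qz.
    have := neq y2 t; rewrite gt_eqF// => /(_ isT); move: (qexp_neq0 (t +i* y2)).
    move: (qexp _) => u u0 uq.
    by field; rewrite qz0 expf_neq0// uq.
  have y2n : y2 != q by rewrite gt_eqF.
  rewrite /hint cintD//.
  - rewrite [X in _ + X](_ : _ = 0) ?addr0//.
    rewrite cintZ; last exact: (chq _ _ Yy2).
    by rewrite -/(hint (fun z0 => h z0 * qpow n.+1 z0) y2 a (a + 1)) H0// mulr0.
  - by apply: seg_contZ; exact: (cqK _ _ Yy2).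
  - by apply: seg_contZ; exact: (chq _ _ Yy2).
have nq z1 : normc (qexp z1) = expR (- (2 * pi * complex.Im z1)) by exact: normc_qexp.
have bK y : Y0 < y -> y != q -> exists2 M : R, 0 < M & forall x, a <= x <= a + 1 ->
    normc (h (x +i* y) * ckernel z (x +i* y)) <= M.
  move=> Yy yq.
  have [Mh Mh0 HM] := hol_shift_bounded hh Yy a1.
  pose D := `|expR (- (2 * pi * y)) - expR (- (2 * pi * q))|.
  have D0 : 0 < D.
    rewrite normr_gt0 subr_eq0; apply: contra yq => /eqP/expR_inj/oppr_inj/mulfI.
    by move=> ->//; rewrite gt_eqF// pi2_gt0.
  exists (Mh * (expR (- (2 * pi * y)) / D)).
    by rewrite mulr_gt0// divr_gt0// expR_gt0.
  move=> x hx; rewrite (normcM (h _)) ler_pM ?normc_ge0 ?HM//.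
  rewrite /ckernel (normcM (qexp _)) normcV nq/= ler_pM2l ?expR_gt0//.
  rewrite lef_pV2 ?posrE ?normc_gt0 ?neq//.
  rewrite /D -/q ler_norml; have := ler_normcBd (qexp (x +i* y)) qz.
  have := ler_normcBd qz (qexp (x +i* y)); rewrite (normcB qz) /qz !nq/= -/q.
  by move=> ? ?; apply/andP; split; lra.
(* On a fixed horizontal line the factor left after n expansion steps has constant modulus r ^ n, so
   the remainder tends to 0. *)
have small y (u : nat -> C -> C) (r : R) : Y0 < y -> y != q -> 0 <= r < 1 ->
   (forall n x, normc (u n (x +i* y)) = r ^+ n) ->
   (forall n, hcont (fun z0 => u n z0 * (h z0 * ckernel z z0)) y a (a + 1)) ->
   (forall n, hint (fun z0 => h z0 * ckernel z z0) y a (a + 1) =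
     hint (fun z0 => u n z0 * (h z0 * ckernel z z0)) y a (a + 1)) ->
   hint (fun z0 => h z0 * ckernel z z0) y a (a + 1) = 0.
  move=> Yy yq r01 nu cu Eu; apply: small_normc_eq0 => e e0.
  have [M M0 HM] := bK y Yy yq.
  have [n Hn] := geometric_lt1 (2 * M) r01 e0.
  rewrite (Eu n) (le_trans _ Hn)// -mulrA; apply: normc_hint; first exact: cu.
  move=> x hx; rewrite (normcM (u _ _)) nu mulrC ler_wpM2r ?HM// exprn_ge0//.
  by case/andP: r01.
have -> : hint (fun z0 => h z0 * ckernel z z0) y1 a (a + 1) = 0.
  apply: (small y1 (fun n z0 => qz ^+ n * qpow (- n%:Z) z0) (expR (2 * pi * (y1 - q))) Yy1).
  - by rewrite lt_eqF.
  - by rewrite expR_ge0/= expR_lt1 pmulr_rlt0 ?pi2_gt0// subr_lt0.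
  - move=> n x; rewrite (normcM (qz ^+ n)) qpow_natN normcV !normcX !nq /= -/q -exprVn -exprMn.
    by congr (_ ^+ _); rewrite -expRN -expRD; congr expR; ring.
  - move=> n; apply: cderiv_hcont => x hx; have [d dh] := hh (x +i* y1) Yy1.
    have [d' dK] : exists d', cderiv (ckernel z) (x +i* y1) d'.
    apply: ckernel_cderiv.
      by apply: qexp_neq_im; rewrite lt_eqF.
    have [d'' dq] := qpow_hol (- n%:Z) (z := x +i* y1) Yy1.
    by eexists; exact: cderivM (cderivZ (qz ^+ n) dq) (cderivM dh dK).
  - by move=> n; rewrite (E1 n); apply: eq_cint => t _; rewrite mulrA.
rewrite sub0r; apply/eqP; rewrite oppr_eq0; apply/eqP.
apply: (small y2 (fun n z0 => (qz ^+ n)^-1 * qpow n z0) (expR (2 * pi * (q - y2))) Yy2).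
- by rewrite gt_eqF.
- by rewrite expR_ge0/= expR_lt1 pmulr_rlt0 ?pi2_gt0// subr_lt0.
- move=> n x; rewrite (normcM (qz ^+ n)^-1) qpow_nat normcV !normcX !nq /= -/q -exprVn -exprMn.
  by congr (_ ^+ _); rewrite -expRN -expRD; congr expR; ring.
- move=> n; apply: cderiv_hcont => x hx; have [d dh] := hh (x +i* y2) Yy2.
  have [d' dK] : exists d', cderiv (ckernel z) (x +i* y2) d'.
    apply: ckernel_cderiv.
    by apply: qexp_neq_im; rewrite gt_eqF.
  have [d'' dq] := qpow_hol n (z := x +i* y2) Yy2.
  by eexists; exact: cderivM (cderivZ (qz ^+ n)^-1 dq) (cderivM dh dK).
- by move=> n; rewrite (E2 n); apply: eq_cint => t _; rewrite -[RHS]mulrA.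
Qed.

(** The limit along i oo for functions defined on all of [R[i]]; [uhp_limP] translates from the
    filter [i_infty]. *)
Definition ioo_lim h (l : C) := forall e : R, 0 < e -> exists Y : R, forall z,
  Y < complex.Im z -> normc (h z - l) < e.

Lemma hint_cusp_eq0 h Y0 a y : hol_above h Y0 -> per_above h Y0 ->
  ioo_lim h 0 -> Y0 < y -> hint h y a (a + 1) = 0.
Proof.
move=> hh ph h0 Yy; apply: small_normc_eq0 => e e0.
have e2 : 0 < e / 2 by rewrite divr_gt0.
have [Y HY] := h0 _ e2; pose y' := Num.max Y0 Y + 1.
have Yy' : Y0 < y' by rewrite /y' ltr_pwDr// le_max lexx.
rewrite (hint_const_hol a hh ph Yy Yy').
have -> : e = 2 * (e / 2) by field.
apply: normc_hint; first exact: hol_hcont Yy'.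
move=> x _; have := HY (x +i* y'); rewrite subr0 /= => /(_ _)/ltW; apply.
by rewrite /y' ltr_pwDr// le_max lexx orbT.
Qed.

(** A Fourier coefficient may be computed at any height. As the height tends to 0, [qpow m] stays
    bounded while h tends to 0, so every coefficient vanishes. *)
Lemma decay_eq0 h : hol_above h 0 -> per_above h 0 ->
  (forall e : R, 0 < e -> exists2 r : R, 0 < r &
    forall z, 0 < complex.Im z < r -> normc (h z) <= e) ->
  forall z, 0 < complex.Im z -> h z = 0.
Proof.
move=> hh ph H; apply: fourier_eq0 => // m a y y0.
have hhq : hol_above (fun z => h z * qpow m z) 0.
  by apply: hol_above_M => //; exact: qpow_hol.
have phq : per_above (fun z => h z * qpow m z) 0.
  by apply: per_above_M => //; exact: qpow_per.
apply: small_normc_eq0 => e e0.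
pose K : R := expR (2 * pi * `|m%:~R|).
have K0 : 0 < K by exact: expR_gt0.
have E0 : 0 < e / 2 / K by rewrite !divr_gt0.
have [r r0 Hr] := H _ E0; pose y' := Num.min (r / 2) 1.
have y'0 : 0 < y' by rewrite /y' lt_min divr_gt0/=.
rewrite (hint_const_hol a hhq phq y0 y'0).
have -> : e = 2 * (e / 2 / K * K) by field; rewrite gt_eqF.
apply: normc_hint; first exact: hol_hcont y'0.
move=> x _; rewrite (normcM (h _)) ler_pM ?normc_ge0//.
  apply: Hr; rewrite /= y'0 /y' gt_min; apply/orP; left.
  by rewrite ltr_pdivrMr// ltr_pMr// ltr1n.
rewrite /qpow normc_qexp /K ler_expR -mulrN ler_pM2l ?pi2_gt0//.
have -> : complex.Im (m%:~R * (x +i* y')) = m%:~R * y'.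
  have -> : m%:~R = m%:~R%:C :> C by rewrite rmorph_int.
  by rewrite cImRM.
rewrite (le_trans (ler_norm _))// normrN normrM ler_piMr//.
by rewrite gtr0_norm// /y' ge_min lexx orbT.
Qed.

(** In the variable q = [qexp z] this is the removable singularity of h / q at q = 0; the limit is
    the Fourier coefficient of index 1, which is [l]. *)
Lemma cusp_order h Y0 : hol_above h Y0 -> per_above h Y0 -> ioo_lim h 0 ->
  exists l, ioo_lim (fun z => h z / qexp z) l.
Proof.
move=> hh ph h0; pose y1 := Y0 + 1.
have Yy1 : Y0 < y1 by rewrite ltrDl.
pose l a := hint (fun z => h z / qexp z) y1 a (a + 1).
have dhq z : Y0 < complex.Im z -> exists d, cderiv (fun z => h z / qexp z) z d.
  move=> Yz; have [d dh] := hh z Yz.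
  by eexists; exact: cderivM dh (cderivV (qexp_neq0 z) (cderiv_qexp z)).
(* the Cauchy formula with the upper line sent to infinity *)
have rep a z : y1 < complex.Im z -> a < complex.Re z < a + 1 ->
    h z = hint (fun z0 => h z0 * (ckernel z z0 - 1)) y1 a (a + 1).
  move=> yz az.
  have cK y : Y0 < y -> y != complex.Im z -> hcont (fun z0 => h z0 * ckernel z z0) y a (a + 1).
    move=> Yy yq; apply: cderiv_hcont => x hx; have [d dh] := hh (x +i* y) Yy.
    have [d' dK] : exists d', cderiv (ckernel z) (x +i* y) d'.
    by apply: ckernel_cderiv; exact: qexp_neq_im.
    by eexists; exact: cderivM dh dK.
  (* Subtracting 1 from the kernel is free because h has mean 0, and by [ckernelN1] it exhibits the
     factor [qexp z]. *)
  have -> : hint (fun z0 => h z0 * (ckernel z z0 - 1)) y1 a (a + 1) =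
     hint (fun z0 => h z0 * ckernel z z0) y1 a (a + 1).
    rewrite -[RHS]subr0 -[X in _ - X](hint_cusp_eq0 a hh ph h0 Yy1).
    have ch1 := hol_hcont (a := a) (b := a + 1) hh Yy1.
    have -> : - hint h y1 a (a + 1) = cint (fun t => -1 * h (t +i* y1)) a (a + 1).
      by rewrite cintZ// mulN1r.
    rewrite /hint -cintD; [|exact: (cK y1 Yy1 (negbT (lt_eqF yz)))|exact: seg_contZ].
    by apply: eq_cint => t _; rewrite mulrBr mulr1 mulN1r.
  apply/eqP; rewrite -subr_eq0; apply/eqP; apply: small_normc_eq0 => e e0.
  set q0 := normc (qexp z).
  have q00 : 0 < q0 by rewrite normc_gt0 qexp_neq0.
  have [Y HY] := h0 _ ltr01.
  have s0 : 0 < Num.min (q0 / 2) (q0 * e / 4) by rewrite lt_min !divr_gt0// mulr_gt0.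
  have [Y' HY'] := qexp_small s0.
  pose y2 := Num.max (complex.Im z) (Num.max Y Y') + 1.
  have zy2 : complex.Im z < y2 by rewrite /y2 ltr_pwDr// le_max lexx.
  have Yy2 : Y < y2 by rewrite /y2 ltr_pwDr// !le_max lexx orbT.
  have Y'y2 : Y' <= y2 by rewrite ltW// /y2 ltr_pwDr// !le_max lexx !orbT.
  have Y0y2 : Y0 < y2 by rewrite (lt_trans Yy1)// (lt_trans yz).
  have yzy : y1 < complex.Im z < y2 by rewrite yz.
  rewrite {1}(cauchy_period hh ph Yy1 yzy az) addrAC subrr add0r normcN'.
  have -> : e = 2 * (e / 2) by field.
  apply: normc_hint; first by apply: cK => //; rewrite gt_eqF.
  move=> x _; rewrite (normcM (h _)) -[leRHS]mul1r ler_pM ?normc_ge0//.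
    by have := HY (x +i* y2); rewrite subr0 => /(_ Yy2)/ltW.
  have := HY' (x +i* y2) Y'y2; rewrite lt_min => /andP[h1 h2].
  rewrite /ckernel (normcM (qexp _)) normcV.
  have lb : q0 / 2 <= normc (qexp (x +i* y2) - qexp z).
    by rewrite normcB (le_trans _ (ler_normcBd _ _))// -/q0; lra.
  have p2 : 0 < q0 / 2 by rewrite divr_gt0.
  rewrite ler_pdivrMr ?(lt_le_trans p2)//.
  apply: le_trans (ltW h2) _; rewrite (@le_trans _ _ (e / 2 * (q0 / 2)))//.
    by rewrite le_eqVlt; apply/orP; left; apply/eqP; field.
  by rewrite ler_pM2l// divr_gt0.
have est a e : 0 < e -> exists Y : R, forall z, Y < complex.Im z ->
    a < complex.Re z < a + 1 -> normc (h z / qexp z - l a) < e.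
  move=> e0; have a1 : a <= a + 1 by rewrite lerDl.
  have [M M0 HM] := hol_shift_bounded hh Yy1 a1.
  pose Q := expR (- (2 * pi * y1)).
  have Q0 : 0 < Q by exact: expR_gt0.
  have s0 : 0 < Num.min (Q / 2) (e / (5 * (M / (Q * (Q / 2))))).
    by rewrite lt_min !(divr_gt0, mulr_gt0).
  have [Y HY] := qexp_small s0.
  exists (Num.max y1 Y) => z; rewrite gt_max => /andP[y1z Yz] az.
  have := HY z (ltW Yz); rewrite lt_min => /andP[h1 h2].
  have c1 : hcont (fun z => h z / qexp z) y1 a (a + 1).
    by apply: cderiv_hcont => x _; exact: dhq.
  have neq x : qexp (x +i* y1) != qexp z by apply: qexp_neq_im; rewrite lt_eqF.
  have c2 : hcont (fun z0 => qexp z * (h z0 / (qexp z0 * (qexp z0 - qexp z)))) y1 a (a + 1).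
    apply: cderiv_hcont => x _; have [d dh] := hh (x +i* y1) Yy1.
    have dd := cderivM (cderiv_qexp (x +i* y1)) (cderivB (cderiv_qexp (x +i* y1)) (cderiv_cst (qexp z) (x +i* y1))).
    have nz : qexp (x +i* y1) * (qexp (x +i* y1) - qexp z) != 0.
      by rewrite mulf_neq0 ?qexp_neq0// subr_eq0.
    have dV := @cderivV R (fun u : C => qexp u * (qexp u - qexp z)) _ _ nz dd.
    by eexists; exact: (cderivZ (qexp z) (cderivM dh dV)).
  have -> : h z / qexp z - l a =
     hint (fun z0 => qexp z * (h z0 / (qexp z0 * (qexp z0 - qexp z)))) y1 a (a + 1).
    rewrite (rep a z)//.
    have -> : hint (fun z0 => h z0 * (ckernel z z0 - 1)) y1 a (a + 1) =
       qexp z * (hint (fun z0 => h z0 / qexp z0) y1 a (a + 1) +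
       hint (fun z0 => qexp z * (h z0 / (qexp z0 * (qexp z0 - qexp z)))) y1 a (a + 1)).
      rewrite /hint -cintD// -cintZ; last exact: seg_contD.
      apply: eq_cint => t _; rewrite ckernelN1//.
      have := neq t; rewrite -subr_eq0; move: (qexp_neq0 (t +i* y1)).
      move: (qexp (t +i* y1)) => u u0 uz.
      by field; rewrite u0 uz.
    by rewrite mulrAC mulfV ?qexp_neq0// mul1r /l addrAC subrr add0r.
  apply: (@le_lt_trans _ _ (2 * (normc (qexp z) * (M / (Q * (Q / 2)))))).
    apply: normc_hint => // x hx; rewrite (normcM (qexp z)) ler_pM2l ?normc_gt0 ?qexp_neq0//.
    rewrite (normcM (h _)) ler_pM ?normc_ge0 ?HM// normcV lef_pV2 ?posrE ?mulr_gt0 ?divr_gt0//; last first.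
      by rewrite normc_gt0 mulf_neq0 ?qexp_neq0// subr_eq0.
    rewrite (normcM (qexp _)) normc_qexp/= -/Q ler_pM2l//.
    by rewrite (le_trans _ (ler_normcBd _ _))// normc_qexp/= -/Q; lra.
  have W0 : 0 < M / (Q * (Q / 2)) by rewrite !(divr_gt0, mulr_gt0).
  move: h2; move: (M / _) W0 => W W0.
  have W5 : 0 < 5 * W by rewrite mulr_gt0.
  rewrite ltr_pdivlMr//; have := normc_ge0 (qexp z); move: (normc (qexp z)) => u u0 h2.
  have : 0 <= u * W by rewrite mulr_ge0// ltW.
  by lra.
(* [est a] covers the open strip a < Re z < a + 1. Integral real parts need a second strip, and the
   two limits agree because the strips overlap. *)
have lE : l (- (1 / 2)) = l 0.
  apply/eqP; rewrite -subr_eq0; apply/eqP; apply: small_normc_eq0 => e e0.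
  have e2 : 0 < e / 2 by rewrite divr_gt0.
  have [Y1 H1] := est (- (1 / 2)) _ e2; have [Y2 H2] := est 0 _ e2.
  pose z := (1 / 4) +i* (Num.max Y1 Y2 + 1).
  have z1 : Y1 < complex.Im z by rewrite /z/= ltr_pwDr// le_max lexx.
  have z2 : Y2 < complex.Im z by rewrite /z/= ltr_pwDr// le_max lexx orbT.
  have r1 : - (1 / 2) < complex.Re z < - (1 / 2) + 1 by rewrite /z /complex.Re; apply/andP; split; lra.
  have r2 : 0 < complex.Re z < 0 + 1 by rewrite /z /complex.Re; apply/andP; split; lra.
  rewrite (le_trans (ler_normc_dist _ _ (h z / qexp z)))// [e in _ <= e]splitr.
  by rewrite lerD// ?(ltW (H2 z z2 r2))// normcB (ltW (H1 z z1 r1)).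
exists (l 0) => e e0.
have [Y1 H1] := est (- (1 / 2)) _ e0; have [Y2 H2] := est 0 _ e0.
exists (Num.max Y0 (Num.max Y1 Y2)) => z; rewrite !gt_max => /and3P[z0 z1 z2].
pose n := Num.floor (complex.Re z).
have perD w (k : nat) : Y0 < complex.Im w -> h (w + k%:R) = h w.
  move=> Yw; elim: k => [|k IH]; first by rewrite addr0.
  by rewrite -natr1 addrA ph// cImD -(rmorph_nat (real_complex R)) cImR addr0.
have perZ w (k : int) : Y0 < complex.Im w -> h (w + k%:~R) = h w.
  move=> Yw; case: k => k; first exact: perD.
  rewrite NegzE rmorphN /= -[in RHS](subrK (k.+1%:R) w) perD//.
  by rewrite cImD cImN -(rmorph_nat (real_complex R)) cImR oppr0 addr0.
pose w := z - n%:~R.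
have zE : z = w + n%:~R by rewrite subrK.
have Iw : complex.Im w = complex.Im z.
  by rewrite /w cImD cImN -(rmorph_int (real_complex R)) cImR oppr0 addr0.
have Rw : complex.Re w = complex.Re z - n%:~R.
  by rewrite /w cReD cReN -(rmorph_int (real_complex R)) cReR.
have rw : 0 <= complex.Re w < 1.
  by rewrite Rw subr_ge0 ge_floor ltrBlDl -intrD1 floorD1_gt.
rewrite zE perZ ?Iw// qexpDz.
have [w0|w0] := ltP 0 (complex.Re w).
  by apply: H2; rewrite ?Iw// w0 add0r; case/andP: rw.
rewrite -lE; apply: H1; rewrite ?Iw//.
by have -> : complex.Re w = 0; [apply/eqP; rewrite eq_le w0; case/andP: rw => ->|apply/andP; split; lra].
Qed.

End PeriodicConsequences.

Opaque cexp qexp.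
Arguments normc : simpl never.

(** * The identity principle along the imaginary axis *)

Section Identity.
Variable R : realType.
Notation C := R[i].
Implicit Types (f g h k : C -> C) (x y a b c : R) (z : C).

Lemma exists_cos_sin x y : x ^+ 2 + y ^+ 2 = 1 -> exists t, cos t = x /\ sin t = y.
Proof.
move=> xy; have x1 : -1 <= x <= 1.
  by rewrite -ler_norml -(@ler_pXn2r _ 2)// ?nnegrE// real_normK ?num_real// expr1n -xy lerDl sqr_ge0.
have sE : sin (acos x) = `|y|.
  rewrite sin_acos//; have -> : 1 - x ^+ 2 = y ^+ 2 by rewrite -xy addrC addKr.
  by rewrite sqrtr_sqr.
have [y0|y0] := leP 0 y.
  by exists (acos x); rewrite acosK ?in_itv//= sE ger0_norm.
by exists (- acos x); rewrite cosN sinN acosK ?in_itv//= sE ltr0_norm// opprK.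
Qed.

Lemma exists_cexp z : z != 0 -> exists w, cexp w = z.
Proof.
move=> z0; have r0 : 0 < normc z by rewrite normc_gt0.
have [|t [ct st]] := @exists_cos_sin (complex.Re z / normc z) (complex.Im z / normc z).
  by rewrite !expr_div_n -mulrDl -normc_sqr divff// expf_neq0// gt_eqF.
exists ((ln (normc z))%:C + 'i * t%:C); rewrite cexpD cexpR cexpi lnK// ct st.
by apply: complex_ext; rewrite ?cReRM ?cImRM/= mulrC divfK// gt_eqF.
Qed.

Lemma exists_qexp z : z != 0 -> exists w, qexp w = z.
Proof.
move=> /exists_cexp[w wz]; exists (w / (2 * pi%:C * 'i)).
Transparent qexp. rewrite /qexp mulrC divfK ?wz//. Opaque qexp.
exact: twopii_neq0.
Qed.

Lemma normc_qexp_lt1 z : (normc (qexp z) < 1) = (0 < complex.Im z).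
Proof. by rewrite normc_qexp expR_lt1 oppr_lt0 pmulr_rgt0// pi2_gt0. Qed.

Lemma ioo_lim_unique h l l' : ioo_lim h l -> ioo_lim h l' -> l = l'.
Proof.
move=> hl hl'; apply/eqP; rewrite -subr_eq0; apply/eqP; apply: small_normc_eq0 => e e0.
have e2 : 0 < e / 2 by rewrite divr_gt0.
have [Y1 H1] := hl _ e2; have [Y2 H2] := hl' _ e2.
pose z := 0 +i* (Num.max Y1 Y2 + 1).
have z1 : Y1 < complex.Im z by rewrite /z/= ltr_pwDr// le_max lexx.
have z2 : Y2 < complex.Im z by rewrite /z/= ltr_pwDr// le_max lexx orbT.
rewrite (le_trans (ler_normc_dist _ _ (h z)))// [e in _ <= e]splitr.
by rewrite lerD// ?(ltW (H2 z z2))// normcB (ltW (H1 z z1)).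
Qed.

Lemma imaginary_zero_lim h l : ioo_lim h l -> (forall y, 0 < y -> h (0 +i* y) = 0) -> l = 0.
Proof.
move=> hl h0; apply: small_normc_eq0 => e e0.
have [Y H] := hl e e0; pose y := Num.max 0 Y + 1.
have y0 : 0 < y by rewrite ltr_pwDr// le_max lexx.
have := H (0 +i* y); rewrite h0// sub0r normcN' => /(_ _)/ltW; apply.
by rewrite /= /y ltr_pwDr// le_max lexx orbT.
Qed.

(** After division by [qexp] the function still vanishes on the imaginary axis, so its limit, which
    exists by [cusp_order], is 0 again. Iterating, all Fourier coefficients vanish. *)
Lemma periodic_imaginary_eq0 k : hol_above k 0 -> per_above k 0 -> ioo_lim k 0 ->
  (forall y, 0 < y -> k (0 +i* y) = 0) -> forall z, 0 < complex.Im z -> k z = 0.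
Proof.
move=> hk pk k0 ky.
have hq m : hol_above (fun z => k z * qpow m z) 0.
  by apply: hol_above_M => // z; exact: qpow_hol.
have pq m : per_above (fun z => k z * qpow m z) 0.
  by apply: per_above_M => //; exact: qpow_per.
have limN (n : nat) : ioo_lim (fun z => k z * qpow (- n%:Z) z) 0.
  elim: n => [|n IH].
    by move=> e /k0[Y H]; exists Y => z /H; rewrite oppr0 qpow0 mulr1.
  have [l Hl] := cusp_order (hq _) (pq _) IH.
  have E : (fun z => k z * qpow (- n%:Z) z / qexp z) = (fun z => k z * qpow (- n.+1%:Z) z).
    by apply/funext => z; rewrite !qpow_natN -mulrA -invfM exprSr mulrC.
  rewrite E in Hl; rewrite -[X in ioo_lim _ X](imaginary_zero_lim Hl)//.
  by move=> y y0; rewrite ky// mul0r.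
have limP (n : nat) : ioo_lim (fun z => k z * qpow n%:Z z) 0.
  move=> e /k0[Y H]; exists (Num.max 0 Y) => z; rewrite gt_max => /andP[z0 zY].
  have := H z zY; rewrite !subr0 normcM; apply: le_lt_trans.
  rewrite ler_piMr ?normc_ge0// qpow_nat normcX exprn_ile1 ?normc_ge0//.
  by rewrite ltW// normc_qexp_lt1.
apply: fourier_eq0 => // m a y y0; apply: (hint_cusp_eq0 a (hq m) (pq m) _ y0).
by case: m => m; rewrite ?NegzE; [exact: limP|exact: limN].
Qed.

(* The discs centered at [iY] with radius [Y] exhaust the upper half plane;
   [w |-> iY + iY qexp w] maps it onto the punctured disc. *)
Lemma imaginary_eq0 h : hol_above h 0 -> (forall y, 0 < y -> h (0 +i* y) = 0) ->
  forall z, 0 < complex.Im z -> h z = 0.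
Proof.
move=> hh hy z z0; set x := complex.Re z; set y := complex.Im z.
(* This Y gives |z - iY| ^ 2 = Y ^ 2 - (x ^ 2 + y ^ 2) < Y ^ 2, so z lies in the disc. *)
pose Y := (x ^+ 2 + y ^+ 2) / y; pose c : C := 0 +i* Y.
have Y0 : 0 < Y by rewrite divr_gt0// ltr_wpDl ?sqr_ge0// exprn_gt0.
have c0 : c != 0 by rewrite eq_complex /= negb_and (gt_eqF Y0) orbT.
have nc : normc c = Y by rewrite /normc /c expr0n/= add0r sqrtr_sqr gtr0_norm.
have [zc|zc] := eqVneq z c; first by rewrite zc hy.
have u0 : (z - c) / c != 0 by rewrite mulf_neq0 ?invr_eq0// subr_eq0.
have [w Hw] := exists_qexp u0.
have w0 : 0 < complex.Im w.
  rewrite -normc_qexp_lt1 Hw normcM normcV nc ltr_pdivrMr// mul1r.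
  rewrite -(@ltr_pXn2r _ 2)// ?nnegrE ?normc_ge0 ?(ltW Y0)// normc_sqr.
  rewrite cReD cReN cImD cImN /c/= -/x -/y oppr0 addr0 sqrrB.
  have yY : y * Y = x ^+ 2 + y ^+ 2 by rewrite mulrC /Y divfK// gt_eqF.
  rewrite yY; have : 0 < x ^+ 2 + y ^+ 2 by rewrite ltr_wpDl ?sqr_ge0// exprn_gt0.
  by lra.
have zE : z = c + c * qexp w by rewrite Hw mulrCA mulfV// mulr1 [c + _]addrC subrK.
pose k v := h (c + c * qexp v).
suff : k w = 0 by rewrite /k -zE.
have Im_in v : 0 < complex.Im v -> 0 < complex.Im (c + c * qexp v).
  rewrite -normc_qexp_lt1 => vq; rewrite cImD cImM /c/= mul0r add0r.
  have := ler_Re_normc (qexp v); rewrite ler_norml => /andP[h1 _].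
  have : - Y < Y * complex.Re (qexp v) by rewrite -ltr_pdivrMl// mulrN mulVf ?gt_eqF//; lra.
  by lra.
apply: periodic_imaginary_eq0 => //.
- move=> v v0; have [d dh] := hh _ (Im_in v v0).
  have dl := cderiv_comp (cderiv_qexp v) (cderiv_lin c c (qexp v)).
  rewrite addrC in dh.
  have := cderiv_comp (g := fun v => c * qexp v + c) dl dh => H.
  eexists; apply: (@cderiv_ext _ _ _ _ _ 1 _ _ H) => // u _.
  by rewrite /k addrC.
- by move=> v _; rewrite /k qexpD1.
- move=> e e0; have [|d dh] := hh c; first by rewrite /c.
  have [r r0 Hr] := cderiv_ccont dh e0.
  have [Y1 HY] := qexp_small (divr_gt0 r0 Y0).
  exists Y1 => v /ltW/HY vr; rewrite /k -[0](hy Y Y0); apply: Hr.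
  by rewrite normcM nc mulrC -ltr_pdivlMr.
(* On the imaginary axis [qexp] is real and positive, so the parametrisation maps this axis into
   itself. *)
- move=> s s0; rewrite /k.
  have -> : qexp (0 +i* s) = (expR (- (2 * pi * s)))%:C.
    Transparent qexp. rewrite /qexp -cexpR; congr cexp. Opaque qexp.
    by apply: complex_ext; rewrite ?Re_2pii ?Im_2pii//= mulr0.
  rewrite (_ : c + _ = 0 +i* (Y + Y * expR (- (2 * pi * s)))).
    by apply: hy; rewrite addr_gt0// mulr_gt0// expR_gt0.
  apply: complex_ext; rewrite ?cReD ?cImD ?cReM ?cImM/= ?mul0r ?mulr0 ?subrr ?addr0 ?add0r//.
Qed.

End Identity.

(** * Complex series *)

Section ComplexSeries.
Variable R : realType.
Notation C := R[i].
Implicit Types (a b : nat -> C) (l : C) (m n : nat).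

Definition seq_lim (s : nat -> C) l := forall e : R, 0 < e ->
  exists N, forall n, (N <= n)%N -> normc (s n - l) <= e.

Lemma seq_lim_unique (s : nat -> C) l l' : seq_lim s l -> seq_lim s l' -> l = l'.
Proof.
move=> sl sl'; apply/eqP; rewrite -subr_eq0 -normc_eq0 eq_le normc_ge0 andbT.
apply/ler_addgt0Pl => e e0; rewrite addr0.
have e2 : 0 < e / 2 by rewrite divr_gt0.
have [N1 H1] := sl _ e2; have [N2 H2] := sl' _ e2.
rewrite (le_trans (ler_normc_dist _ _ (s (maxn N1 N2))))// [e in _ <= e]splitr.
by rewrite lerD// ?H2 ?leq_maxr// normcB H1// leq_maxl.
Qed.

Lemma seq_lim_cst l : seq_lim (fun=> l) l.
Proof. by move=> e e0; exists 0%N => n _; rewrite subrr normc0 ltW. Qed.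

Lemma eq_seq_lim (s t : nat -> C) l N : (forall n, (N <= n)%N -> s n = t n) ->
  seq_lim s l -> seq_lim t l.
Proof.
move=> st sl e /sl[M H]; exists (maxn N M) => n; rewrite geq_max => /andP[Nn Mn].
by rewrite -st// H.
Qed.

Lemma seq_limD (s t : nat -> C) l l' : seq_lim s l -> seq_lim t l' ->
  seq_lim (fun n => s n + t n) (l + l').
Proof.
move=> sl tl e e0; have e2 : 0 < e / 2 by rewrite divr_gt0.
have [N1 H1] := sl _ e2; have [N2 H2] := tl _ e2; exists (maxn N1 N2) => n.
rewrite geq_max => /andP[n1 n2]; rewrite opprD addrACA [leRHS]splitr.
by rewrite (le_trans (ler_normcD _ _))// lerD ?H1 ?H2.
Qed.

Lemma seq_lim_bounded (s : nat -> C) l : seq_lim s l -> exists2 M : R, 0 < M &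
  exists N, forall n, (N <= n)%N -> normc (s n) <= M.
Proof.
move=> /(_ 1 ltr01)[N H]; exists (1 + normc l); first by rewrite ltr_pwDl ?normc_ge0.
exists N => n /H sn; have -> : s n = (s n - l) + l by rewrite subrK.
by rewrite (le_trans (ler_normcD _ _))// lerD2r.
Qed.

Lemma seq_limM (s t : nat -> C) l l' : seq_lim s l -> seq_lim t l' ->
  seq_lim (fun n => s n * t n) (l * l').
Proof.
move=> sl tl e e0; have [M M0 [N HM]] := seq_lim_bounded sl.
have L0 : 0 < 1 + normc l' by rewrite ltr_pwDl ?normc_ge0.
have e2 : 0 < e / 2 by rewrite divr_gt0.
have [N1 H1] := sl _ (divr_gt0 e2 L0); have [N2 H2] := tl _ (divr_gt0 e2 M0).
exists (maxn N (maxn N1 N2)) => n; rewrite !geq_max => /and3P[n0 n1 n2].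
have -> : s n * t n - l * l' = s n * (t n - l') + (s n - l) * l' by ring.
rewrite (le_trans (ler_normcD _ _))// !normcM [leRHS]splitr lerD//.
  have -> : e / 2 = M * (e / 2 / M) by field; rewrite gt_eqF.
  by rewrite ler_pM ?normc_ge0 ?HM ?H2.
have -> : e / 2 = (e / 2 / (1 + normc l')) * (1 + normc l') by field; rewrite gt_eqF.
by rewrite ler_pM ?normc_ge0 ?H1// lerDr.
Qed.

Lemma seq_limZ (c : C) (s : nat -> C) l : seq_lim s l -> seq_lim (fun n => c * s n) (c * l).
Proof. by apply: seq_limM; exact: seq_lim_cst. Qed.

Lemma seq_limV (s : nat -> C) l : l != 0 -> seq_lim s l -> seq_lim (fun n => (s n)^-1) l^-1.
Proof.
move=> l0 sl e e0; have n0 : 0 < normc l by rewrite normc_gt0.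
have n2 : 0 < normc l / 2 by rewrite divr_gt0.
have E0 : 0 < e * (normc l / 2 * normc l) by rewrite !mulr_gt0 ?invr_gt0.
have [N1 H1] := sl _ n2; have [N2 H2] := sl _ E0.
exists (maxn N1 N2) => n; rewrite geq_max => /andP[n1 n2'].
have lb : normc l / 2 <= normc (s n).
  by have := ler_normcBd l (s n); rewrite normcB; have := H1 _ n1; lra.
have sn0 : s n != 0 by rewrite -normc_gt0 (lt_le_trans n2).
have -> : (s n)^-1 - l^-1 = - (s n - l) / (s n * l) by field; rewrite sn0 l0.
rewrite normcM normcV normcN' normcM ler_pdivrMr ?mulr_gt0 ?normc_gt0//.
by rewrite (le_trans (H2 _ n2'))// ler_pM2l// ler_pM2r.
Qed.

Lemma seq_lim_sub (s : nat -> C) l (k : nat -> nat) : (forall n, (n <= k n)%N) ->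
  seq_lim s l -> seq_lim (fun n => s (k n)) l.
Proof.
move=> kn sl e /sl[N H]; exists N => n Nn; apply: H.
exact: leq_trans Nn (kn n).
Qed.

Lemma seq_lim_ge (s : nat -> C) l (c : R) N : (forall n, (N <= n)%N -> c <= normc (s n)) ->
  seq_lim s l -> c <= normc l.
Proof.
move=> cs sl; apply/ler_addgt0Pl => e /sl[M H].
have := ler_normcBd (s (maxn N M)) l; have := H _ (leq_maxr N M).
by have := cs _ (leq_maxl N M); lra.
Qed.

Lemma seq_lim_le (s : nat -> C) l (c : R) N : (forall n, (N <= n)%N -> normc (s n) <= c) ->
  seq_lim s l -> normc l <= c.
Proof.
move=> cs sl; apply/ler_addgt0Pl => e /sl[M H].
have := ler_normcBd l (s (maxn N M)); rewrite normcB; have := H _ (leq_maxr N M).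
by have := cs _ (leq_maxl N M); lra.
Qed.

Lemma seq_limP (s : nat -> C) l : seq_lim s l <-> s @ \oo --> l.
Proof.
split=> [sl|/(@cvgrPdist_le R[i]) H].
  apply/(@cvgrPdist_le R[i]) => e e0.
  have eR : e = (complex.Re e)%:C by rewrite RRe_real// gtr0_real.
  rewrite eR ltcR in e0; have [N H] := sl _ e0.
  by exists N => // n /= Nn; rewrite normC_normc eR lecR normcB H.
move=> e e0; have ec0 : 0 < e%:C by rewrite ltcR.
have [N _ HN] := H _ ec0; exists N => n Nn.
by have := HN n Nn; rewrite normC_normc lecR normcB.
Qed.

Lemma seq_lim_lim (s : nat -> C) l : seq_lim s l -> lim (s n @[n --> \oo]) = l.
Proof. by move=> /seq_limP; exact: (@cvg_lim R[i]). Qed.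

Definition psum a n := \sum_(k < n) a k.

Lemma psumS a n : psum a n.+1 = psum a n + a n.
Proof. by rewrite /psum big_ord_recr. Qed.

Lemma psumSl a n : psum a n.+1 = a 0%N + psum (fun k => a k.+1) n.
Proof. by rewrite /psum big_ord_recl. Qed.

Lemma psum0 a : psum a 0 = 0. Proof. by rewrite /psum big_ord0. Qed.

Lemma normc_psum_sub a (b : nat -> R) m n : (forall k, normc (a k) <= b k) -> (m <= n)%N ->
  normc (psum a n - psum a m) <= \sum_(m <= k < n) b k.
Proof.
move=> ab /subnKC <-; elim: (n - m)%N => [|k IH].
  by rewrite addn0 subrr normc0 big_geq.
rewrite addnS psumS big_nat_recr ?leq_addr//= addrAC.
by rewrite (le_trans (ler_normcD _ _))// lerD.
Qed.

Lemma exists_seq_lim (s : nat -> C) :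
  (forall e : R, 0 < e -> exists N, forall n m, (N <= m)%N -> (m <= n)%N -> normc (s n - s m) <= e) ->
  exists l, seq_lim s l.
Proof.
move=> H.
have cv (p : C -> R) : (forall z w, `|p z - p w| <= normc (z - w)) ->
    exists x : R, forall e, 0 < e -> exists N, forall n, (N <= n)%N -> `|p (s n) - x| <= e.
  move=> plip; have : cvg ((fun n => p (s n)) @ \oo).
    apply: cauchy_cvg; apply: cauchy_exP => e e0.
    have e2 : 0 < e / 2 by rewrite divr_gt0.
    have [N HN] := H _ e2; exists (p (s N)); exists N => // n /= Nn.
    rewrite /ball/= distrC (le_lt_trans (plip _ _))// (le_lt_trans (HN n N (leqnn _) Nn))//.
    by rewrite ltr_pdivrMr// ltr_pMr// ltr1n.
  move=> /cvg_ex[x /cvgrPdist_le Hx]; exists x => e e0.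
  have [N _ HN] := Hx e e0.
  by exists N => n Nn; rewrite distrC; exact: HN.
have [|x Hx] := cv (fun z => complex.Re z).
  by move=> z w; rewrite -cReN -cReD ler_Re_normc.
have [|y Hy] := cv (fun z => complex.Im z).
  by move=> z w; rewrite -cImN -cImD ler_Im_normc.
exists (x +i* y) => e e0; have e2 : 0 < e / 2 by rewrite divr_gt0.
have [N1 H1] := Hx _ e2; have [N2 H2] := Hy _ e2; exists (maxn N1 N2) => n.
rewrite geq_max => /andP[n1 n2]; rewrite (le_trans (ler_normc_ReIm _))//.
by rewrite cReD cReN cImD cImN /= [leRHS]splitr lerD ?H1 ?H2.
Qed.

(** All series used are dominated by a geometric one; the explicit [K] and [r] make tail estimates
    uniform in further parameters. *)
Definition dominated a (K r : R) := forall n, normc (a n) <= K * r ^+ n.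

Lemma geometric_tail (r : R) m n : 0 <= r < 1 -> (m <= n)%N ->
  \sum_(m <= k < n) r ^+ k <= r ^+ m / (1 - r).
Proof.
move=> /andP[r0 r1] /subnKC <-; have p : 0 < 1 - r by rewrite subr_gt0.
rewrite ler_pdivlMr//; suff -> : (\sum_(m <= k < m + (n - m)) r ^+ k) * (1 - r) = r ^+ m - r ^+ (m + (n - m)).
  by rewrite gerBl exprn_ge0.
elim: (n - m)%N => [|k IH]; first by rewrite addn0 big_geq// subrr mul0r.
by rewrite addnS big_nat_recr ?leq_addr//= mulrDl IH exprS; ring.
Qed.

Lemma dominated_tail a (K r : R) m n : 0 <= K -> 0 <= r < 1 -> dominated a K r -> (m <= n)%N ->
  normc (psum a n - psum a m) <= K * r ^+ m / (1 - r).
Proof.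
move=> K0 r01 da mn; rewrite (le_trans (normc_psum_sub da mn))//.
by rewrite -mulr_sumr -mulrA ler_wpM2l// geometric_tail.
Qed.

(** The default 0 is taken for a divergent series; [csum_lim] gives convergence under domination. *)
Definition csum a : C := xget 0 [set l | seq_lim (psum a) l].

Lemma csumE a l : seq_lim (psum a) l -> csum a = l.
Proof.
move=> al; apply: (seq_lim_unique _ al).
by rewrite /csum; apply: (xgetPex 0 (P := [set l | seq_lim (psum a) l])); exists l.
Qed.

Lemma pow_small (r e : R) : 0 <= r < 1 -> 0 < e -> exists N, forall n, (N <= n)%N -> r ^+ n <= e.
Proof.
move=> /andP[r0 r1] e0.
have : (fun n => r ^+ n) @ \oo --> 0 by apply: cvg_expr; rewrite ger0_norm.
move=> /cvgrPdist_le/(_ e e0)[N _ HN]; exists N => n /HN /=.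
by rewrite sub0r normrN; apply: le_trans; exact: ler_norm.
Qed.

Lemma csum_lim a (K r : R) : 0 <= K -> 0 <= r < 1 -> dominated a K r -> seq_lim (psum a) (csum a).
Proof.
move=> K0 r01 da; have [l al] : exists l, seq_lim (psum a) l.
  apply: exists_seq_lim => e e0; have p : 0 < 1 - r by case/andP: r01; rewrite subr_gt0.
  have K1 : 0 < K + 1 by rewrite ltr_wpDl.
  have [N HN] := pow_small r01 (mulr_gt0 (divr_gt0 e0 K1) p).
  exists N => n m Nm mn; rewrite (le_trans (dominated_tail K0 r01 da mn))//.
  rewrite ler_pdivrMr// (le_trans (ler_wpM2l K0 (HN m Nm)))//.
  rewrite mulrA ler_pM2r// mulrCA ler_piMr ?(ltW e0)//.
  by rewrite ler_pdivrMr// mul1r lerDl.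
by rewrite (csumE al).
Qed.

Lemma csum_bound a (K r : R) n : 0 <= K -> 0 <= r < 1 -> dominated a K r ->
  normc (csum a - psum a n) <= K * r ^+ n / (1 - r).
Proof.
move=> K0 r01 da; have al := csum_lim K0 r01 da.
apply: (@seq_lim_le (fun m => psum a m - psum a n) _ _ n).
  by move=> m nm; exact: dominated_tail.
by apply: seq_limD => //; exact: seq_lim_cst.
Qed.

Lemma normc_csum a (K r : R) : 0 <= K -> 0 <= r < 1 -> dominated a K r ->
  normc (csum a) <= K / (1 - r).
Proof.
by move=> K0 r01 /(csum_bound 0 K0 r01); rewrite psum0 subr0 expr0 mulr1.
Qed.

Lemma csumSl a (K r : R) : 0 <= K -> 0 <= r < 1 -> dominated a K r ->
  csum a = a 0%N + csum (fun k => a k.+1).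
Proof.
move=> K0 r01 da; have da' : dominated (fun k => a k.+1) (K * r) r.
  by move=> n; rewrite -mulrA -exprS.
have K'0 : 0 <= K * r by case/andP: r01 => r0 _; rewrite mulr_ge0.
apply: csumE; have H := csum_lim K'0 r01 da'.
have H2 := seq_limD (seq_lim_cst (a 0%N)) H.
move=> e /H2[N HN]; exists N.+1 => -[//|n] Nn; rewrite psumSl; exact: HN.
Qed.

Lemma psumD a b n : psum (fun k => a k + b k) n = psum a n + psum b n.
Proof. by rewrite /psum big_split. Qed.

Lemma psumZ (c : C) a n : psum (fun k => c * a k) n = c * psum a n.
Proof. by rewrite /psum mulr_sumr. Qed.

Lemma csumD a b (K r K' r' : R) : 0 <= K -> 0 <= r < 1 -> dominated a K r ->
  0 <= K' -> 0 <= r' < 1 -> dominated b K' r' ->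
  csum (fun k => a k + b k) = csum a + csum b.
Proof.
move=> K0 r01 da K'0 r'01 db; apply: csumE.
apply: eq_seq_lim (seq_limD (csum_lim K0 r01 da) (csum_lim K'0 r'01 db)).
by move=> n _; rewrite psumD.
Unshelve. exact: 0%N.
Qed.

Lemma csumZ (c : C) a (K r : R) : 0 <= K -> 0 <= r < 1 -> dominated a K r ->
  csum (fun k => c * a k) = c * csum a.
Proof.
move=> K0 r01 da; apply: csumE.
apply: eq_seq_lim (seq_limZ c (csum_lim K0 r01 da)).
by move=> n _; rewrite psumZ.
Unshelve. exact: 0%N.
Qed.

Lemma eq_csum a b : a =1 b -> csum a = csum b.
Proof. by move=> ab; congr csum; apply/funext. Qed.

(** Termwise differentiation: the first-order remainders are quadratic in h with dominated
    constants, so their sum is at most K / (1 - r) |h| ^ 2. *)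
Lemma cderiv_csum (a : nat -> C -> C) (d : nat -> C) (z : C) (rho K r : R) :
  0 < rho -> 0 <= K -> 0 <= r < 1 ->
  (forall h, normc h < rho -> dominated (fun n => a n (z + h)) K r) ->
  dominated d K r ->
  (forall n h, normc h < rho ->
     normc (a n (z + h) - a n z - d n * h) <= K * r ^+ n * normc h ^+ 2) ->
  cderiv (fun w => csum (fun n => a n w)) z (csum d).
Proof.
move=> rho0 K0 r01 da dd Ha e e0.
have p : 0 < 1 - r by case/andP: r01; rewrite subr_gt0.
pose M := K / (1 - r); have M0 : 0 <= M by rewrite divr_ge0// ltW.
have M1 : 0 < M + 1 by rewrite ltr_wpDl.
exists (Num.min rho (e / (M + 1))); first by rewrite lt_min rho0 divr_gt0.
move=> h; rewrite lt_min => /andP[hrho he].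
have az : dominated (fun n => a n z) K r.
  by have := da 0; rewrite normc0 addr0; apply.
have -> : csum (fun n => a n (z + h)) - csum (fun n => a n z) - csum d * h =
    csum (fun n => (a n (z + h) + (-1) * a n z) + (- h) * d n).
  have d1 : dominated (fun n => -1 * a n z) K r.
    by move=> n; rewrite mulN1r normcN'; exact: az.
  have d2 : dominated (fun n => - h * d n) (normc h * K) r.
    by move=> n; rewrite normcM normcN' -mulrA ler_wpM2l ?normc_ge0.
  have d3 : dominated (fun n => a n (z + h) + -1 * a n z) (K + K) r.
    by move=> n; rewrite mulrDl (le_trans (ler_normcD _ _))// lerD ?d1//; exact: da.
  rewrite (csumD (addr_ge0 K0 K0) r01 d3 (mulr_ge0 (normc_ge0 _) K0) r01 d2).
  rewrite (csumD K0 r01 (da h hrho) K0 r01 d1) (csumZ _ K0 r01 az) (csumZ _ K0 r01 dd).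
  by ring.
have d4 : dominated (fun n => (a n (z + h) + (-1) * a n z) + (- h) * d n) (K * normc h ^+ 2) r.
  move=> n; rewrite mulrAC; have := Ha n h hrho.
  by rewrite mulN1r mulNr [h * _]mulrC.
rewrite (le_trans (normc_csum _ r01 d4))//; first by rewrite mulr_ge0// exprn_ge0 ?normc_ge0.
have -> : K * normc h ^+ 2 / (1 - r) = M * normc h * normc h by rewrite /M expr2; field; rewrite gt_eqF.
rewrite ler_wpM2r ?normc_ge0//.
rewrite (@le_trans _ _ ((M + 1) * normc h))//; first by rewrite ler_wpM2r ?normc_ge0// lerDl.
by rewrite mulrC -ler_pdivlMr// ltW.
Qed.

(** Induction on n, using the bound [diff] on (z + h) ^ n - z ^ n. The polynomial factor n ^ 2 is
    absorbed later by [nat_pow_bounded]. *)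
Lemma expr_remainder (z h : C) (r : R) n : normc z <= r -> normc (z + h) <= r -> 0 < r ->
  normc ((z + h) ^+ n - z ^+ n - n%:R * z ^+ n.-1 * h) <= n%:R ^+ 2 * r ^+ n / r ^+ 2 * normc h ^+ 2.
Proof.
move=> zr hr r0.
have diff m : normc ((z + h) ^+ m - z ^+ m) <= m%:R * r ^+ m / r * normc h.
  elim: m => [|m IH]; first by rewrite !expr0 subrr normc0 !mul0r.
  have -> : (z + h) ^+ m.+1 - z ^+ m.+1 = (z + h) * ((z + h) ^+ m - z ^+ m) + h * z ^+ m.
    by rewrite !exprS; ring.
  rewrite (le_trans (ler_normcD _ _))// !normcM.
  have -> : m.+1%:R * r ^+ m.+1 / r * normc h = r * (m%:R * r ^+ m / r * normc h) + normc h * r ^+ m.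
    by rewrite -natr1 exprS; field; rewrite gt_eqF.
  rewrite lerD//; first by rewrite ler_pM ?normc_ge0.
  by rewrite ler_wpM2l ?normc_ge0// normcX lerXn2r// ?nnegrE ?normc_ge0// ltW.
elim: n => [|n IH]; first by rewrite !expr0 subrr !mul0r subrr normc0 expr0n /= !mul0r.
have -> : (z + h) ^+ n.+1 - z ^+ n.+1 - n.+1%:R * z ^+ n.+1.-1 * h =
  z * ((z + h) ^+ n - z ^+ n - n%:R * z ^+ n.-1 * h) + h * ((z + h) ^+ n - z ^+ n).
  rewrite !exprS /= -natr1; case: n {IH} => [|n]; first by rewrite !expr0 /=; ring.
  by rewrite /= !exprS; ring.
rewrite (le_trans (ler_normcD _ _))// !normcM.
have rn : 0 <= r ^+ n / r ^+ 2 by rewrite divr_ge0 ?exprn_ge0 // ltW.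
apply: (@le_trans _ _ (r * (n%:R ^+ 2 * r ^+ n / r ^+ 2 * normc h ^+ 2) +
    normc h * (n%:R * r ^+ n / r * normc h))).
  by rewrite lerD// ler_pM ?normc_ge0.
have -> : r * (n%:R ^+ 2 * r ^+ n / r ^+ 2 * normc h ^+ 2) + normc h * (n%:R * r ^+ n / r * normc h) =
  (n%:R ^+ 2 + n%:R) * (r ^+ n.+1 / r ^+ 2 * normc h ^+ 2).
  by rewrite (exprS r n); field; rewrite gt_eqF.
rewrite [leRHS](_ : _ = n.+1%:R ^+ 2 * (r ^+ n.+1 / r ^+ 2 * normc h ^+ 2)); last by rewrite !mulrA.
rewrite ler_wpM2r//.
  by rewrite mulr_ge0 ?exprn_ge0 ?normc_ge0// divr_ge0 ?exprn_ge0// ltW.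
have n0 : 0 <= n%:R :> R by [].
by rewrite -natr1 sqrrD1 -mulr_natl; lra.
Qed.

(** For s = sqrt r one has n s ^ n <= 1 + s + ... + s ^ (n - 1) <= 1 / (1 - s); then square. *)
Lemma nat_pow_bounded (r : R) : 0 <= r < 1 -> exists2 K, 0 < K & forall n, n%:R ^+ 2 * r ^+ n <= K.
Proof.
move=> /andP[r0 r1]; pose s := Num.sqrt r.
have s0 : 0 <= s by rewrite sqrtr_ge0.
have s1 : s < 1 by rewrite -sqrtr1 ltr_sqrt.
have p : 0 < 1 - s by rewrite subr_gt0.
exists ((1 / (1 - s)) ^+ 2); first by rewrite exprn_gt0// divr_gt0.
move=> n; have -> : r = s ^+ 2 by rewrite sqr_sqrtr.
rewrite -exprM mulnC exprM -exprMn.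
rewrite lerXn2r ?nnegrE ?mulr_ge0 ?exprn_ge0 ?divr_ge0 ?invr_ge0 ?(ltW p)//.
rewrite ler_pdivlMr//.
have H : n%:R * s ^+ n <= \sum_(0 <= k < n) s ^+ k.
  rewrite big_mkord -[n in n%:R]card_ord mulr_natl -sumr_const.
  by apply: ler_sum => i _; rewrite ler_wiXn2l ?(ltW s1) ?(ltnW (ltn_ord i)).
have := @geometric_tail s 0 n; rewrite s0 s1 => /(_ isT (leq0n _)); rewrite expr0 ler_pdivlMr//.
by apply: le_trans; rewrite ler_wpM2r// ltW.
Qed.

End ComplexSeries.

(** * The Jacobi triple product *)

Section JacobiTheta.
Variable R : realType.
Notation C := R[i].
Implicit Types (q w z : C) (m n N : nat).

(* [Jth q w] is the sum of [q ^ (n ^ 2) * w ^ n] over all integers n; it is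
   split at [n = 0], which both halves count. *)
Definition sterm q w n : C := q ^+ (n * n) * w ^+ n.
Definition Sth q w : C := csum (sterm q w).
Definition Jth q w : C := Sth q w + Sth q w^-1 - 1.
Definition phi q : C := Jth q 1.

Lemma half01 : 0 <= (1 / 2 : R) < 1. Proof. by apply/andP; split; lra. Qed.
Lemma quarter01 : 0 <= (1 / 4 : R) < 1. Proof. by apply/andP; split; lra. Qed.

(** Once rho ^ n <= 1 / (4 r), the term (rho ^ n r) ^ n is at most 4 ^ - n; the finitely many
    earlier terms are absorbed in K = (4 r) ^ N. *)
Lemma square_exp_dominated (rho r : R) : 0 <= rho < 1 -> 1 <= r ->
  exists2 K : R, 0 < K & forall n, rho ^+ (n * n) * r ^+ n <= K * (1 / 4) ^+ n.
Proof.
move=> /[dup] rho01 /andP[rho0 rho1] r1; have r0 : 0 < r by rewrite (lt_le_trans ltr01).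
have r4 : 0 < 1 / (4 * r) by rewrite divr_gt0// mulr_gt0.
have [N HN] := pow_small rho01 r4.
have r41 : 1 <= 4 * r by lra.
exists ((4 * r) ^+ N); first by rewrite exprn_gt0// mulr_gt0.
move=> n; have [Nn|/ltnW nN] := leqP N n.
  rewrite exprM -exprMn -[leLHS]mul1r ler_pM ?exprn_ge0 ?mulr_ge0 ?exprn_ge0 ?(ltW r0)//.
    by rewrite exprn_ege1.
  rewrite lerXn2r ?nnegrE ?mulr_ge0 ?exprn_ge0 ?(ltW r0)//.
  by rewrite -ler_pdivlMr// (le_trans (HN n Nn))// le_eqVlt; apply/orP; left; apply/eqP; field; rewrite gt_eqF.
apply: (@le_trans _ _ (1 * r ^+ n)).
  by rewrite ler_wpM2r ?exprn_ge0 ?(ltW r0)// exprn_ile1 ?(ltW rho1).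
rewrite mul1r (le_trans (ler_weXn2l r1 nN))//.
rewrite exprMn mulrAC ler_peMl ?exprn_ge0 ?(ltW r0)//.
rewrite -[leLHS](_ : 4 ^+ n * (1 / 4) ^+ n = 1); last by rewrite -exprMn mulrC divfK ?expr1n.
by rewrite ler_wpM2r ?exprn_ge0// ler_weXn2l// ler1n.
Qed.

Lemma sterm_dominated q w : normc q < 1 -> exists2 K : R, 0 <= K & dominated (sterm q w) K (1 / 4).
Proof.
move=> q1; have [||K K0 HK] := @square_exp_dominated (normc q) (1 + normc w).
- by rewrite normc_ge0.
- by rewrite lerDl normc_ge0.
exists K; first exact: ltW.
move=> n; apply: le_trans (HK n); rewrite /sterm normcM !normcX.
by rewrite ler_wpM2l ?exprn_ge0 ?normc_ge0// lerXn2r ?nnegrE ?normc_ge0 ?addr_ge0 ?normc_ge0// lerDr.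
Qed.

Lemma Sth_lim q w : normc q < 1 -> seq_lim (psum (sterm q w)) (Sth q w).
Proof. by move=> q1; have [K K0 HK] := sterm_dominated w q1; exact: csum_lim K0 quarter01 HK. Qed.

Lemma phiE q : phi q = 2 * Sth q 1 - 1.
Proof. by rewrite /phi /Jth invr1 mulr_natl. Qed.

Lemma cderiv_Sth_w q w : normc q < 1 -> exists d, cderiv (Sth q) w d.
Proof.
(* [r] bounds w + h for |h| < 1. The factor n ^ 2 of [expr_remainder] is paid for by passing from
   the ratio 1 / 4 to 1 / 2. *)
move=> q1; pose r := 1 + (1 + normc w).
have r1 : 1 <= r by rewrite lerDl addr_ge0// normc_ge0.
have r0 : 0 < r by rewrite (lt_le_trans ltr01).
have q01 : 0 <= normc q < 1 by rewrite normc_ge0.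
have [K K0 HK] := square_exp_dominated q01 r1.
have [K2 K20 HK2] := nat_pow_bounded half01.
have K2n n : n%:R ^+ 2 * (1 / 4) ^+ n <= K2 * (1 / 2) ^+ n :> R.
  have -> : 1 / 4 = 1 / 2 * (1 / 2) :> R by field.
  by rewrite exprMn mulrA ler_wpM2r ?exprn_ge0.
have KK n : normc q ^+ (n * n) * (n%:R ^+ 2 * r ^+ n) <= K * K2 * (1 / 2) ^+ n.
  rewrite mulrCA (le_trans (ler_wpM2l _ (HK n)))//.
  by rewrite mulrCA -mulrA ler_wpM2l// ltW.
pose M := K + K * K2.
have M0 : 0 <= M by rewrite addr_ge0 ?mulr_ge0 ?ltW.
have KKM n : K * K2 * (1 / 2) ^+ n <= M * (1 / 2) ^+ n.
  by rewrite ler_wpM2r ?exprn_ge0// lerDr ltW.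
exists (csum (fun n => q ^+ (n * n) * (n%:R * w ^+ n.-1))).
apply: (@cderiv_csum _ (fun n w => sterm q w n) _ _ 1 M (1 / 2)) => //.
- exact: half01.
- move=> h h1 n; rewrite /sterm normcM !normcX.
  apply: (@le_trans _ _ (normc q ^+ (n * n) * r ^+ n)).
    rewrite ler_wpM2l ?exprn_ge0 ?normc_ge0// lerXn2r ?nnegrE ?normc_ge0 ?(ltW r0)//.
    by rewrite (le_trans (ler_normcD _ _))// /r addrC lerD ?(ltW h1)// lerDr.
  rewrite (le_trans (HK n))// ler_pM ?exprn_ge0 ?(ltW K0)//.
    by rewrite lerDl mulr_ge0 ?ltW.
  by rewrite lerXn2r ?nnegrE//; lra.
- move=> n; rewrite /= !normcM !normcX (le_trans _ (KKM n))// (le_trans _ (KK n))//.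
  rewrite ler_wpM2l ?exprn_ge0 ?normc_ge0//.
  rewrite -(rmorph_nat (real_complex R)) normcR ger0_norm//.
  case: n => [|n]; first by rewrite mul0r mulr_ge0// exprn_ge0.
  rewrite ler_pM ?exprn_ge0 ?normc_ge0//.
    by rewrite expr2 ler_peMl// ler1n.
  rewrite /= exprS (@le_trans _ _ (1 * r ^+ n))// ?mul1r.
    rewrite lerXn2r ?nnegrE ?normc_ge0 ?(ltW r0)//.
    by rewrite /r addrA lerDr.
  by rewrite ler_peMl// exprn_ge0// ltW.
- move=> n h h1; rewrite /sterm.
  have -> : q ^+ (n * n) * (w + h) ^+ n - q ^+ (n * n) * w ^+ n - q ^+ (n * n) * (n%:R * w ^+ n.-1) * h =
    q ^+ (n * n) * ((w + h) ^+ n - w ^+ n - n%:R * w ^+ n.-1 * h) by ring.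
  rewrite normcM normcX.
  have wr : normc w <= r by rewrite /r addrA lerDr.
  have whr : normc (w + h) <= r.
    by rewrite (le_trans (ler_normcD _ _))// /r addrC lerD ?(ltW h1)// lerDr.
  apply: le_trans (ler_wpM2l (exprn_ge0 _ (normc_ge0 q)) (expr_remainder n wr whr r0)) _.
  rewrite mulrA ler_wpM2r ?exprn_ge0 ?normc_ge0// (le_trans _ (KKM n))// (le_trans _ (KK n))//.
  rewrite ler_wpM2l ?exprn_ge0 ?normc_ge0//.
  by rewrite ler_piMr ?mulr_ge0 ?exprn_ge0 ?(ltW r0)// invf_le1 ?exprn_gt0// exprn_ege1.
Qed.

Lemma cderiv_Sth1 q : normc q < 1 -> exists d, cderiv (fun q => Sth q 1) q d.
Proof.
move=> q1; pose rho := (1 + normc q) / 2.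
have rho0 : 0 < rho by rewrite divr_gt0// ltr_pwDl ?normc_ge0.
have rho1 : rho < 1 by rewrite /rho; lra.
have qrho : normc q < rho by rewrite /rho; lra.
(* rho = s * s: one factor absorbs the polynomial in the exponent, the other keeps the series
   geometric. *)
pose s := Num.sqrt rho.
have s0 : 0 < s by rewrite sqrtr_gt0.
have s1 : s < 1 by rewrite -sqrtr1 ltr_sqrt.
have s01 : 0 <= s < 1 by rewrite (ltW s0).
have rs : rho = s * s by rewrite -expr2 sqr_sqrtr// ltW.
have [K2 K20 HK2] := nat_pow_bounded s01.
have B1 m : rho ^+ m <= s ^+ m.
  by rewrite lerXn2r ?nnegrE ?(ltW s0) ?(ltW rho0)// rs ler_piMl ?ltW.
have B2 m : m%:R ^+ 2 * rho ^+ m <= K2 * s ^+ m.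
  by rewrite rs exprMn mulrA ler_wpM2r ?exprn_ge0 ?(ltW s0).
have sq n : s ^+ (n * n) <= s ^+ n.
  by case: n => // n; rewrite ler_wiXn2l ?(ltW s0) ?(ltW s1)// leq_pmulr.
pose K := 1 + K2 / rho ^+ 2.
have K0 : 0 <= K by rewrite addr_ge0// divr_ge0 ?exprn_ge0 ?ltW.
have K1 : 1 <= K by rewrite lerDl divr_ge0 ?exprn_ge0 ?ltW.
have KK : K2 / rho ^+ 2 <= K by rewrite lerDr.
have B3 n : (n * n)%:R ^+ 2 * rho ^+ (n * n) / rho ^+ 2 <= K * s ^+ n.
  rewrite (@le_trans _ _ (K2 / rho ^+ 2 * s ^+ n))//; last by rewrite ler_wpM2r ?exprn_ge0// ltW.
  rewrite [leRHS]mulrAC ler_wpM2r ?invr_ge0 ?exprn_ge0 ?(ltW rho0)//.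
  by rewrite (le_trans (B2 _))// ler_wpM2l ?(ltW K20)// sq.
exists (csum (fun n => (n * n)%:R * q ^+ (n * n).-1)).
apply: (@cderiv_csum _ (fun n q => sterm q 1 n) _ _ (rho - normc q) K s) => //.
- by rewrite subr_gt0.
- move=> h h1 n; rewrite /sterm expr1n mulr1 normcX.
  apply: (@le_trans _ _ (rho ^+ (n * n))).
    rewrite lerXn2r ?nnegrE ?normc_ge0 ?(ltW rho0)//.
    by rewrite (le_trans (ler_normcD _ _))// -lerBrDl ltW.
  by rewrite (le_trans (B1 _))// (le_trans (sq n))// ler_peMl// exprn_ge0// ltW.
- move=> n; rewrite normcM normcX -(rmorph_nat (real_complex R)) normcR ger0_norm//.
  rewrite (le_trans _ (B3 n))//; case: n => [|n]; first by rewrite mul0r !mulr_ge0 ?invr_ge0 ?exprn_ge0 ?(ltW rho0).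
  set m := (n.+1 * n.+1)%N; have m1 : (1 <= m)%N by rewrite /m.
  have -> : m%:R ^+ 2 * rho ^+ m / rho ^+ 2 = m%:R * (m%:R * (rho ^+ m.-1 / rho)).
    by rewrite -[in rho ^+ m](prednK m1) (exprS rho m.-1); field; rewrite gt_eqF.
  rewrite ler_wpM2l// (@le_trans _ _ (1 * (rho ^+ m.-1 / rho)))//; last first.
    by rewrite ler_wpM2r ?ler1n// mulr_ge0 ?invr_ge0 ?exprn_ge0 ?(ltW rho0).
  rewrite mul1r ler_pdivlMr// (@le_trans _ _ (normc q ^+ m.-1 * 1))//.
    by rewrite ler_wpM2l ?exprn_ge0 ?normc_ge0// ltW.
  by rewrite mulr1 lerXn2r ?nnegrE ?normc_ge0 ?(ltW rho0)// ltW.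
- move=> n h h1; rewrite /sterm !expr1n !mulr1.
  have hr : normc (q + h) <= rho by rewrite (le_trans (ler_normcD _ _))// -lerBrDl ltW.
  apply: le_trans (expr_remainder (n * n) (ltW qrho) hr rho0) _.
  by rewrite ler_wpM2r ?exprn_ge0 ?normc_ge0.
Qed.

Lemma cderiv_phi q : normc q < 1 -> exists d, cderiv phi q d.
Proof.
move=> q1; have [d dS] := cderiv_Sth1 q1; exists (2 * d - 0).
apply: (@cderiv_ext _ (fun q => 2 * Sth q 1 - 1) _ _ _ 1) => // [h _|].
  by rewrite phiE.
exact: cderivB (cderivZ 2 dS) (cderiv_cst 1 q).
Qed.

(** Completing the square: q ^ (n ^ 2) (q ^ 2 w) ^ n times q w is the term of index n + 1, so the
    term of index 0 drops out. *)
Lemma Sth_shift q w : normc q < 1 -> q != 0 -> w != 0 ->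
  Sth q (q ^+ 2 * w) = (Sth q w - 1) / (q * w).
Proof.
move=> q1 q0 w0; have [K K0 HK] := sterm_dominated w q1.
rewrite [in RHS]/Sth (csumSl K0 quarter01 HK) {1}/sterm !expr0 mulr1 addrAC subrr add0r.
have d1 : dominated (fun k => sterm q w k.+1) (K / 4) (1 / 4).
  by move=> n; have := HK n.+1; rewrite exprS mul1r !mulrA.
have K40 : 0 <= K / 4 by rewrite divr_ge0.
rewrite [RHS]mulrC -(csumZ _ K40 quarter01 d1); apply: eq_csum => n.
rewrite /sterm (_ : n.+1 * n.+1 = n * n + n * 2 + 1)%N; last by lia.
by rewrite !exprD !exprM !exprS !expr0 !mulr1 !exprMn; field; rewrite q0 w0.
Qed.

Lemma Sth_unshift q w : normc q < 1 -> q != 0 -> w != 0 ->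
  Sth q (w / q ^+ 2) = 1 + w / q * Sth q w.
Proof.
move=> q1 q0 w0; have w'0 : w / q ^+ 2 != 0 by rewrite mulf_neq0 ?invr_eq0// expf_neq0.
have := Sth_shift q1 q0 w'0.
have -> : q ^+ 2 * (w / q ^+ 2) = w by rewrite mulrC divfK// expf_neq0.
by move=> ->; field; rewrite q0 w0.
Qed.

Lemma Jth_shift q w : normc q < 1 -> q != 0 -> w != 0 -> Jth q (q ^+ 2 * w) = Jth q w / (q * w).
Proof.
move=> q1 q0 w0; rewrite /Jth Sth_shift//.
have -> : (q ^+ 2 * w)^-1 = w^-1 / q ^+ 2 by rewrite invfM mulrC.
rewrite Sth_unshift ?invr_eq0//.
move: (Sth q w) (Sth q w^-1) => s s'; field; by rewrite q0 w0.
Qed.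

(* For [z ^ 8 = 1] the factor [z ^ (n ^ 2)] is [z] for odd [n]. *)
Lemma phi_root8 z q : z ^+ 8 = 1 -> normc q < 1 ->
  phi (z * q) = phi ((z * q) ^+ 4) + z * (phi q - phi (q ^+ 4)).
Proof.
move=> z8 q1.
have nz : normc z = 1.
  by apply/eqP; rewrite -(@pexpr_eq1 _ (normc z) 8)// ?normc_ge0// -normcX z8 normc1.
have zq1 : normc (z * q) < 1 by rewrite normcM nz mul1r.
have p4 (u : C) : normc u < 1 -> normc (u ^+ 4) < 1.
  by move=> u1; rewrite normcX exprn_ilt1// ?normc_ge0.
have z1 n : z ^+ ((2 * n).+1 * (2 * n).+1) = z.
  have -> : ((2 * n).+1 * (2 * n).+1 = 8 * 'C(n.+1, 2) + 1)%N.
    have := bin2_sum n.+1; rewrite big_mkord => <-.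
    elim: n => [|n IH]; first by rewrite big_ord_recl big_ord0.
    by rewrite big_ord_recr /= mulnDr addnAC -IH; lia.
  by rewrite exprD exprM z8 expr1n mul1r expr1.
have E N : psum (sterm (z * q) 1) (2 * N) = psum (sterm ((z * q) ^+ 4) 1) N +
   z * (psum (sterm q 1) (2 * N) - psum (sterm (q ^+ 4) 1) N).
  elim: N => [|N IH]; first by rewrite muln0 !psum0; ring.
  rewrite mulnS !addSn add0n !psumS IH /sterm !expr1n !mulr1 -!exprM.
  have -> : (4 * (N * N) = 2 * N * (2 * N))%N by lia.
  by rewrite [(z * q) ^+ ((2 * N).+1 * _)]exprMn z1; ring.
have k2 n : (n <= 2 * n)%N by lia.
have L1 := seq_lim_sub k2 (Sth_lim 1 zq1).
have L2 := seq_limD (Sth_lim 1 (p4 _ zq1)) (seq_limZ z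
  (seq_limD (seq_lim_sub k2 (Sth_lim 1 q1)) (seq_limZ (-1) (Sth_lim 1 (p4 _ q1))))).
have L1' : seq_lim (fun n => psum (sterm (z * q) 1) (2 * n))
    (Sth ((z * q) ^+ 4) 1 + z * (Sth q 1 + -1 * Sth (q ^+ 4) 1)).
  by apply: (@eq_seq_lim _ _ _ _ 0%N _ L2) => n _; rewrite E mulN1r.
rewrite (phiE (z * q)) (phiE ((z * q) ^+ 4)) (phiE q) (phiE (q ^+ 4)) (seq_lim_unique L1 L1').
move: (Sth ((z * q) ^+ 4) 1) (Sth q 1) (Sth (q ^+ 4) 1) => A B D; ring.
Qed.

(** The even squares sum to [phi (q ^+ 4)]; for the odd ones (2 n + 1) ^ 2 = 1 + 4 (n ^ 2 + n). *)
Lemma phi_odd_part q : normc q < 1 -> q != 0 -> phi q - phi (q ^+ 4) = q * Jth (q ^+ 4) (q ^+ 4).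
Proof.
move=> q1 q0.
have q41 : normc (q ^+ 4) < 1 by rewrite normcX exprn_ilt1// ?normc_ge0.
have q40 : q ^+ 4 != 0 by rewrite expf_neq0.
have -> : Jth (q ^+ 4) (q ^+ 4) = 2 * Sth (q ^+ 4) (q ^+ 4).
  rewrite /Jth; have -> : (q ^+ 4)^-1 = q ^+ 4 / (q ^+ 4) ^+ 2 by field.
  by rewrite Sth_unshift// divff// mul1r; ring.
have E N : psum (sterm q 1) (2 * N) = psum (sterm (q ^+ 4) 1) N + q * psum (sterm (q ^+ 4) (q ^+ 4)) N.
  elim: N => [|N IH]; first by rewrite muln0 !psum0; ring.
  rewrite mulnS !addSn add0n !psumS IH /sterm !expr1n !mulr1 -!exprM -exprD.
  have -> : (4 * (N * N) = 2 * N * (2 * N))%N by lia.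
  have -> : ((2 * N).+1 * (2 * N).+1 = 1 + (2 * N * (2 * N) + 4 * N))%N by lia.
  by rewrite [q ^+ (1 + _)]exprD expr1; ring.
have k2 n : (n <= 2 * n)%N by lia.
have L1 := seq_lim_sub k2 (Sth_lim 1 q1).
have L2 := seq_limD (Sth_lim 1 q41) (seq_limZ q (Sth_lim (q ^+ 4) q41)).
have L1' := @eq_seq_lim _ _ (fun n => psum (sterm q 1) (2 * n)) _ 0%N (fun n _ => esym (E n)) L2.
rewrite (phiE q) (phiE (q ^+ 4)) (seq_lim_unique L1 L1').
move: (Sth (q ^+ 4) 1) (Sth (q ^+ 4) (q ^+ 4)) => A B; ring.
Qed.

Lemma phi_bound : exists2 K : R, 0 < K & forall q, normc q <= 1 / 2 -> normc (phi q - 1) <= K * normc q.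
Proof.
have [||K K0 HK] := @square_exp_dominated (1 / 2) 1 => //.
  by apply/andP; split; lra.
exists (8 * K); first by rewrite mulr_gt0.
move=> q qh; have q1 : normc q < 1 by rewrite (le_lt_trans qh)//; lra.
have [K' K'0 HK'] := sterm_dominated 1 q1.
rewrite phiE /Sth (csumSl K'0 quarter01 HK') {1}/sterm !expr0 mulr1.
have -> : 2 * (1 + csum (fun k => sterm q 1 k.+1)) - 1 - 1 = 2 * csum (fun k => sterm q 1 k.+1) by ring.
have d : dominated (fun k => sterm q 1 k.+1) (2 * K * normc q) (1 / 4).
  move=> n; rewrite /sterm expr1n mulr1 normcX.
  have -> : (n.+1 * n.+1 = (n * n + 2 * n).+1)%N by lia.
  rewrite exprS mulrC mulrAC ler_wpM2r ?normc_ge0//.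
  apply: (@le_trans _ _ (normc q ^+ (n * n))).
    by rewrite exprD ler_piMr ?exprn_ge0 ?normc_ge0// exprn_ile1 ?normc_ge0 ?ltW.
  apply: (@le_trans _ _ ((1 / 2) ^+ (n * n))).
    by rewrite lerXn2r ?nnegrE ?normc_ge0.
  have := HK n; rewrite expr1n mulr1 => /le_trans; apply.
  by rewrite ler_wpM2r ?exprn_ge0// ler_peMl ?ler1n// ltW.
rewrite normcM; have -> : normc (2 : C) = 2 by rewrite -(rmorph_nat (real_complex R)) normcR ger0_norm.
rewrite (le_trans (ler_wpM2l _ (normc_csum _ quarter01 d)))//.
  by rewrite !mulr_ge0 ?normc_ge0 ?ltW.
have : 0 <= K * normc q by rewrite mulr_ge0 ?normc_ge0 ?ltW.
set x := K * normc q => x0.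
have -> : 2 * (2 * K * normc q / (1 - 1 / 4)) = 16 / 3 * x by rewrite /x; field.
by rewrite [leRHS](_ : _ = 8 * x); [lra|rewrite /x mulrA].
Qed.

End JacobiTheta.

(** * Gaussian binomial coefficients and the triple product *)

Section TripleProduct.
Variable R : realType.
Notation C := R[i].
Implicit Types (q w z Q x : C) (m n N k : nat).

(** The q-Pochhammer symbol (Q; Q)_n. *)
Definition qpoch Q n : C := \prod_(j < n) (1 - Q ^+ j.+1).

Lemma qpoch0 Q : qpoch Q 0 = 1. Proof. by rewrite /qpoch big_ord0. Qed.
Lemma qpochS Q n : qpoch Q n.+1 = qpoch Q n * (1 - Q ^+ n.+1).
Proof. by rewrite /qpoch big_ord_recr. Qed.

Lemma one_sub_expr_lb Q n : normc Q < 1 -> 1 - normc Q ^+ n.+1 <= normc (1 - Q ^+ n.+1).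
Proof. by move=> _; have := ler_normcBd 1 (Q ^+ n.+1); rewrite normc1 normcX. Qed.

Lemma expr_lt1 (r : R) n : 0 <= r -> r < 1 -> r ^+ n.+1 < 1.
Proof. by move=> r0 r1; rewrite exprn_ilt1. Qed.

Lemma qpoch_neq0 Q n : normc Q < 1 -> qpoch Q n != 0.
Proof.
move=> Q1; elim: n => [|n IH]; first by rewrite qpoch0 oner_eq0.
rewrite qpochS mulf_neq0// -normc_gt0 (lt_le_trans _ (one_sub_expr_lb n Q1))//.
by rewrite subr_gt0 expr_lt1// normc_ge0.
Qed.

(* Weierstrass: [prod (1 - r^j) >= (1 - r)^m (1 - sum_(j > m) r^j)]. *)
Lemma qpoch_bounds Q : normc Q < 1 -> exists c B : R, [/\ 0 < c, 0 < B &
  forall n, c <= normc (qpoch Q n) <= B].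
Proof.
move=> Q1; set r := normc Q; have r0 : 0 <= r by exact: normc_ge0.
have r01 : 0 <= r < 1 by rewrite r0.
have p : 0 < 1 - r by rewrite subr_gt0.
have [N HN] := pow_small r01 (divr_gt0 p (ltr0n _ 2)).
have f0 j : 0 < 1 - r ^+ j.+1 by rewrite subr_gt0 expr_lt1.
have low n : (1 - r) ^+ N * (1 / 2) <= \prod_(j < n) (1 - r ^+ j.+1).
  have H1 k : (1 - r) ^+ k <= \prod_(j < k) (1 - r ^+ j.+1).
    elim: k => [|k IH]; first by rewrite expr0 big_ord0.
    rewrite exprSr big_ord_recr /= ler_pM ?exprn_ge0 ?(ltW p)//.
    by rewrite lerD2l lerN2 exprS ler_piMr// exprn_ile1// ltW.
  have H2 k : \prod_(j < N) (1 - r ^+ j.+1) * (1 - \sum_(N <= j < N + k) r ^+ j.+1) <=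
      \prod_(j < N + k) (1 - r ^+ j.+1).
    elim: k => [|k IH]; first by rewrite addn0 big_geq// subr0 mulr1.
    rewrite addnS big_ord_recr big_nat_recr ?leq_addr//=.
    apply: le_trans (ler_wpM2r (ltW (f0 _)) IH); rewrite -mulrA ler_wpM2l//.
      by apply: prodr_ge0 => i _; rewrite ltW.
    rewrite mulrBr mulr1 mulrBl mul1r.
    have : 0 <= (\sum_(N <= j < N + k) r ^+ j.+1) * r ^+ (N + k).+1.
      by rewrite mulr_ge0 ?exprn_ge0// sumr_ge0// => j _; rewrite exprn_ge0.
    by lra.
  have H3 k : \sum_(N <= j < N + k) r ^+ j.+1 <= 1 / 2.
    have -> : \sum_(N <= j < N + k) r ^+ j.+1 = r * \sum_(N <= j < N + k) r ^+ j.
      by rewrite mulr_sumr; apply: eq_bigr => j _; rewrite exprS.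
    apply: (@le_trans _ _ (1 * (r ^+ N / (1 - r)))).
      apply: ler_pM => //; first by rewrite sumr_ge0// => j _; rewrite exprn_ge0.
        exact: ltW.
      by apply: geometric_tail; rewrite ?leq_addr.
    rewrite mul1r ler_pdivrMr// (le_trans (HN N (leqnn _)))//.
    by rewrite mulrC mul1r.
  have [Nn|nN] := leqP N n.
    rewrite -(subnKC Nn); apply: le_trans (H2 (n - N)%N).
    apply: ler_pM; rewrite ?exprn_ge0 ?(ltW p)//.
    by have := H3 (n - N)%N; lra.
  apply: le_trans (H1 n); rewrite (@le_trans _ _ ((1 - r) ^+ N))//.
    by rewrite ler_piMr ?exprn_ge0 ?(ltW p)//; lra.
  have r1 : 1 - r <= 1 by rewrite gerBl.
  exact: (ler_wiXn2l (ltW p) r1 (ltnW nN)).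
have c0 : 0 < (1 - r) ^+ N * (1 / 2) by rewrite mulr_gt0// exprn_gt0.
exists ((1 - r) ^+ N * (1 / 2)), ((1 - r) ^+ N * (1 / 2))^-1.
split; rewrite ?invr_gt0// => n; apply/andP; split.
  apply: le_trans (low n) _; elim: n => [|n IH]; first by rewrite big_ord0 qpoch0 normc1.
  rewrite big_ord_recr qpochS normcM /= ler_pM ?(ltW (f0 _))//; last exact: one_sub_expr_lb.
  by apply: prodr_ge0 => i _; rewrite ltW.
have P0 k : 0 < \prod_(j < k) (1 - r ^+ j.+1) by apply: prodr_gt0.
(* Since (1 + x) (1 - x) <= 1, the upper bound is the inverse of the lower one. *)
apply: (@le_trans _ _ (\prod_(j < n) (1 - r ^+ j.+1))^-1); last first.
  by rewrite lef_pV2 ?posrE.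
elim: n => [|n IH]; first by rewrite big_ord0 qpoch0 normc1 invr1.
rewrite big_ord_recr qpochS normcM /= invfM ler_pM ?normc_ge0//.
have := ler_normcB 1 (Q ^+ n.+1); rewrite normc1 normcX -/r => /le_trans; apply.
by rewrite -[leRHS]mul1r ler_pdivlMr// mulrC -subr_sqr expr1n gerBl !exprn_ge0.
Qed.

(* [qprod Q] is the infinite product of the [1 - Q ^+ n], n > 0. *)
Definition qprod Q : C := xget 0 [set l | seq_lim (qpoch Q) l].

(** The partial products are partial sums of their increments - (Q; Q)_n Q ^ (n + 1), which are
    dominated because the partial products are bounded. *)
Lemma qprod_lim Q : normc Q < 1 -> seq_lim (qpoch Q) (qprod Q).
Proof.
move=> Q1; have [c [B [c0 B0 HB]]] := qpoch_bounds Q1.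
have r01 : 0 <= normc Q < 1 by rewrite normc_ge0.
have dd : dominated (fun n => - (qpoch Q n * Q ^+ n.+1)) B (normc Q).
  move=> n; rewrite normcN' normcM normcX; have /andP[_ h] := HB n.
  rewrite ler_pM ?normc_ge0 ?exprn_ge0 ?normc_ge0//.
  by rewrite exprS ler_piMl ?exprn_ge0 ?normc_ge0 ?ltW.
have E n : qpoch Q n = 1 + psum (fun n => - (qpoch Q n * Q ^+ n.+1)) n.
  elim: n => [|n IH]; first by rewrite qpoch0 psum0 addr0.
  by rewrite qpochS psumS addrA -IH mulrBr mulr1.
have H := seq_limD (seq_lim_cst 1) (csum_lim (ltW B0) r01 dd).
apply: (xgetPex 0 (P := [set l | seq_lim (qpoch Q) l])).
by eexists; apply: (@eq_seq_lim _ _ _ _ 0%N _ H) => n _; rewrite -E.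
Qed.

Lemma qprod_neq0 Q : normc Q < 1 -> qprod Q != 0.
Proof.
move=> Q1; have [c [B [c0 B0 HB]]] := qpoch_bounds Q1.
rewrite -normc_gt0 (lt_le_trans c0)//; apply: (@seq_lim_ge _ _ _ _ 0%N _ (qprod_lim Q1)) => n _.
by have /andP[] := HB n.
Qed.

(** The Gaussian binomial coefficient; the value 0 beyond n makes Pascal's rule hold at m = n. *)
Definition gcoef Q n m : C :=
  if (m <= n)%N then qpoch Q n / (qpoch Q m * qpoch Q (n - m)) else 0.

Lemma gcoef_pascal Q n m : normc Q < 1 -> (m <= n)%N ->
  Q ^+ 'C(m.+1, 2) * gcoef Q n.+1 m.+1 =
  Q ^+ 'C(m.+1, 2) * gcoef Q n m.+1 + Q ^+ n * (Q ^+ 'C(m, 2) * gcoef Q n m).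
Proof.
move=> Q1 mn; rewrite /gcoef ltnS mn subSS.
have nz k := qpoch_neq0 k Q1.
have C2 : ('C(m.+1, 2) = 'C(m, 2) + m)%N by rewrite binS bin1.
move: mn; rewrite leq_eqVlt => /orP[/eqP ->|mn].
  rewrite ltnn mulr0 add0r subnn qpoch0 !mulr1 (divff (nz n.+1)) (divff (nz n)) !mulr1.
  by rewrite binS bin1 exprD mulrC.
rewrite mn C2 exprD.
have nmE : (n - m = (n - m.+1).+1)%N by rewrite -subSn.
have Qn : Q ^+ n = Q ^+ m * Q ^+ (n - m) by rewrite -exprD subnKC// ltnW.
have h1 := nz m; have h2 := nz m.+1; have h3 := nz (n - m)%N; have h4 := nz (n - m.+1)%N.
move: h2 h3; rewrite !qpochS nmE !qpochS -nmE !mulf_eq0 !negb_or => /andP[_ h2] /andP[_ h3].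
have -> : Q ^+ n.+1 = Q ^+ m.+1 * Q ^+ (n - m) by rewrite -exprD addSn subnKC// ltnW.
rewrite Qn !exprS; move: h1 h2 h3 h4; rewrite exprS.
set a := qpoch Q m; set b := qpoch Q _; set c := qpoch Q n.
set u := Q ^+ (n - m); set v := Q ^+ m.
by move=> h1 h2 h3 h4; field; rewrite h1 h2 h3 h4.
Qed.

Lemma gauss_binomial Q n x : normc Q < 1 ->
  \prod_(j < n) (1 + Q ^+ j * x) = \sum_(m < n.+1) Q ^+ 'C(m, 2) * gcoef Q n m * x ^+ m.
Proof.
move=> Q1; have g0 k : gcoef Q k 0 = 1.
  by rewrite /gcoef /= qpoch0 mul1r subn0 divff// qpoch_neq0.
elim: n => [|n IH]; first by rewrite big_ord0 big_ord_recl big_ord0 g0 expr0 !mulr1 addr0.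
rewrite big_ord_recr /= IH [RHS]big_ord_recl /= g0 !mulr1.
have E (i : 'I_n.+1) : Q ^+ 'C(bump 0 i, 2) * gcoef Q n.+1 (bump 0 i) * x ^+ bump 0 i =
    Q ^+ 'C(i.+1, 2) * gcoef Q n i.+1 * x ^+ i.+1 +
    Q ^+ n * (Q ^+ 'C(i, 2) * gcoef Q n i) * x ^+ i.+1.
  by rewrite /bump /= add1n -mulrDl -gcoef_pascal// -ltnS.
rewrite [X in _ = _ + X](eq_bigr _ (fun i _ => E i)).
rewrite big_split /= addrA mulrDr mulr1; congr (_ + _).
  rewrite [in LHS]big_ord_recl /= g0 !mulr1; congr (_ + _).
  rewrite big_ord_recr /= [X in _ + X](_ : _ = 0) ?addr0//.
  by rewrite /gcoef ltnn mulr0 mul0r.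
rewrite mulr_suml; apply: eq_bigr => i _.
by rewrite exprS; ring.
Qed.

Lemma prod_odd_powers q N : \prod_(j < N) q ^+ (2 * j).+1 = q ^+ (N * N).
Proof.
elim: N => [|N IH]; first by rewrite big_ord0 muln0 expr0.
by rewrite big_ord_recr /= IH -exprD; congr (_ ^+ _); lia.
Qed.

(** The q-binomial theorem with 2 N factors at x = q w / Q ^ N, reindexed from the middle index N,
    where the exponents become squares. The index k = 0 occurs in both sums and is subtracted
    once. *)
Lemma finite_triple_product q w N : normc q < 1 -> q != 0 -> w != 0 ->
  \prod_(j < N) ((1 + q ^+ (2 * j).+1 * w) * (1 + q ^+ (2 * j).+1 * w^-1)) =
  \sum_(k < N.+1) gcoef (q ^+ 2) (2 * N) (N + k) * sterm q w k +
  \sum_(k < N.+1) gcoef (q ^+ 2) (2 * N) (N - k) * sterm q w^-1 k -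
  gcoef (q ^+ 2) (2 * N) N.
Proof.
move=> q1 q0 w0; set Q := q ^+ 2.
have Q1 : normc Q < 1 by rewrite normcX exprn_ilt1// normc_ge0.
pose x := q * w / Q ^+ N.
have Q0 : Q != 0 by rewrite expf_neq0.
have QN0 : Q ^+ N != 0 by rewrite expf_neq0.
have qp0 n : q ^+ n != 0 by rewrite expf_neq0.
have P1 : \prod_(j < 2 * N) (1 + Q ^+ j * x) =
   w ^+ N / q ^+ (N * N) * \prod_(j < N) ((1 + q ^+ (2 * j).+1 * w) * (1 + q ^+ (2 * j).+1 * w^-1)).
  rewrite mul2n -addnn big_split_ord /= big_split /= [LHS]mulrC [RHS]mulrCA; congr (_ * _).
    apply: eq_bigr => j _; congr (1 + _).
    by rewrite /x exprD exprS exprM -/Q; field.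
  rewrite (reindex_inj rev_ord_inj) /=.
  rewrite -(prod_odd_powers q N) -[N in w ^+ N]card_ord -prodr_const -prodf_div -big_split /=.
  apply: eq_bigr => j _.
  have NE : (N = (N - j.+1) + j.+1)%N by rewrite subnK.
  have -> : x = q * w / (Q ^+ (N - j.+1) * Q ^+ j.+1) by rewrite /x -exprD -NE.
  have -> : Q ^+ j.+1 = q ^+ (2 * j).+1 * q by rewrite -exprSr /Q -exprM; congr (_ ^+ _); lia.
  by field; rewrite w0 q0 qp0 expf_neq0.
have := gauss_binomial (2 * N) x Q1; rewrite P1.
set PP := \prod_(j < N) _ => HP.
have -> : PP = q ^+ (N * N) / w ^+ N * (w ^+ N / q ^+ (N * N) * PP).
  by field; rewrite qp0 expf_neq0.
rewrite HP mulr_sumr.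
pose t m := q ^+ (N * N) / w ^+ N * (Q ^+ 'C(m, 2) * gcoef Q (2 * N) m * x ^+ m).
have wn n : w ^+ n != 0 by rewrite expf_neq0.
have Qx m : Q ^+ 'C(m, 2) * x ^+ m = q ^+ (m * m) * w ^+ m / q ^+ (2 * N * m).
  have -> : q ^+ (m * m) = Q ^+ 'C(m, 2) * q ^+ m.
    rewrite /Q -exprM -exprD; congr (_ ^+ _).
    have := bin2_sum m; rewrite big_mkord => <-.
    elim: m {HP} => [|m IH]; first by rewrite big_ord0.
    by rewrite big_ord_recr /= mulnDr addnS addnAC -IH; lia.
  have -> : q ^+ (2 * N * m) = (Q ^+ N) ^+ m by rewrite /Q -!exprM mulnA.
  by rewrite /x !exprMn exprVn !mulrA ?exprMn.
have key m k : (N * N + m * m = k * k + 2 * N * m)%N ->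
    q ^+ (N * N) * q ^+ (m * m) = q ^+ (k * k) * q ^+ (2 * N * m).
  by move=> e; rewrite -!exprD e.
have tE m k : (N * N + m * m = k * k + 2 * N * m)%N ->
    t m = gcoef Q (2 * N) m * (q ^+ (k * k) * (w ^+ m / w ^+ N)).
  move=> e; rewrite /t; have -> : q ^+ (N * N) / w ^+ N * (Q ^+ 'C(m, 2) * gcoef Q (2 * N) m * x ^+ m) =
    gcoef Q (2 * N) m * (q ^+ (N * N) / w ^+ N * (Q ^+ 'C(m, 2) * x ^+ m)) by ring.
  rewrite Qx; congr (_ * _).
  have -> : q ^+ (k * k) = q ^+ (N * N) * q ^+ (m * m) / q ^+ (2 * N * m).
    by rewrite (key _ _ e) mulfK.
  by field; rewrite qp0 wn.
have tp k : t (N + k)%N = gcoef Q (2 * N) (N + k) * sterm q w k.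
  rewrite (@tE _ k); last by lia.
  by rewrite /sterm exprD [w ^+ N * _]mulrC mulfK.
have tm k : (k <= N)%N -> t (N - k)%N = gcoef Q (2 * N) (N - k) * sterm q w^-1 k.
  move=> kN; rewrite (@tE _ k); last by nia.
  have -> : w ^+ N = w ^+ (N - k) * w ^+ k by rewrite -exprD subnK.
  by congr (_ * _); rewrite /sterm exprVn; congr (_ * _); rewrite invfM mulrA divff// mul1r.
have -> : \sum_(m < (2 * N).+1) q ^+ (N * N) / w ^+ N * (Q ^+ 'C(m, 2) * gcoef Q (2 * N) m * x ^+ m) =
  \sum_(m < N.+1 + N) t m.
  by rewrite addSn addnn -mul2n.
rewrite big_split_ord /= [in RHS]big_ord_recl /= addn0.
have -> : gcoef Q (2 * N) N * sterm q w 0 = gcoef Q (2 * N) N by rewrite /sterm muln0 !expr0 !mulr1.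
rewrite (reindex_inj rev_ord_inj) /= addrC -!addrA [in RHS]addrCA.
congr (_ + _).
  by apply: eq_bigr => k _; rewrite /bump /= add1n addSnnS tp.
rewrite addrCA subrr addr0; apply: eq_bigr => k _.
by rewrite subSS tm// -ltnS.
Qed.

(** Dominated convergence for series: up to a fixed [n0] the coefficients converge, and beyond it
    domination makes both the sum and the limit small, uniformly in N. *)
Lemma tannery (a : nat -> nat -> C) (t : nat -> C) (A : C) (M K r : R) :
  0 <= K -> 0 <= r < 1 -> dominated t K r -> 0 <= M -> (forall N n, normc (a N n) <= M) ->
  (forall n, seq_lim (fun N => a N n) A) ->
  seq_lim (fun N => \sum_(n < N.+1) a N n * t n) (A * csum t).
Proof.
move=> K0 r01 dt M0 aM aA e e0.
have p : 0 < 1 - r by case/andP: r01; rewrite subr_gt0.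
have AM : normc A <= M by apply: (@seq_lim_le _ _ _ _ 0%N _ (aA 0%N)) => n _.
have e3 : 0 < e / 3 by rewrite divr_gt0.
pose T := K / (1 - r); have T0 : 0 <= T by rewrite divr_ge0// ltW.
have [n0 Hn0] : exists n0, 2 * M * (K * r ^+ n0 / (1 - r)) <= e / 3.
  have M1 : 0 < 2 * M * T + 1 by rewrite ltr_wpDl// mulr_ge0// mulr_ge0.
  have [n0 H] := pow_small r01 (divr_gt0 e3 M1).
  exists n0; have -> : 2 * M * (K * r ^+ n0 / (1 - r)) = 2 * M * T * r ^+ n0.
    by rewrite /T; field; rewrite gt_eqF.
  rewrite (le_trans (ler_wpM2l _ (H n0 (leqnn _))))//.
    by rewrite mulr_ge0// mulr_ge0.
  by rewrite mulrA ler_pdivrMr// mulrC ler_pM2l// lerDl.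
have [N1 HN1] : exists N1, forall N, (N1 <= N)%N -> forall n, (n < n0)%N ->
    normc (a N n - A) <= e / 3 / (n0%:R * K + 1).
  have E0 : 0 < e / 3 / (n0%:R * K + 1) by rewrite divr_gt0// ltr_wpDl// mulr_ge0.
  move: (e / 3 / _) E0 => d E0; elim: (n0) => [|m [N1 IH]]; first by exists 0%N.
  have [N2 H2] := aA m _ E0; exists (maxn N1 N2) => N; rewrite geq_max => /andP[h1 h2] n.
  by rewrite ltnS leq_eqVlt => /orP[/eqP ->|]; [exact: H2|exact: IH].
exists (maxn n0 N1) => N; rewrite geq_max => /andP[nN N1N].
have cb := csum_bound N.+1 K0 r01 dt.
have -> : \sum_(n < N.+1) a N n * t n - A * csum t =
    \sum_(n < N.+1) (a N n - A) * t n + A * (psum t N.+1 - csum t).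
  rewrite mulrBr /psum mulr_sumr addrA -big_split /=; congr (_ - _).
  by apply: eq_bigr => n _; rewrite mulrBl subrK.
rewrite (le_trans (ler_normcD _ _))//.
have B3 : normc (A * (psum t N.+1 - csum t)) <= e / 3.
  rewrite normcM normcB (le_trans _ Hn0)// -mulrA.
  have H : normc A * normc (csum t - psum t N.+1) <= M * (K * r ^+ n0 / (1 - r)).
    rewrite ler_pM ?normc_ge0// (le_trans cb)//.
    rewrite ler_wpM2r ?invr_ge0 ?(ltW p)// ler_wpM2l//.
    by case/andP: r01 => r0 r1; rewrite ler_wiXn2l// ?ltW// (leq_trans nN).
  have H0 : 0 <= M * (K * r ^+ n0 / (1 - r)).
    by case/andP: r01 => r0 _; rewrite !mulr_ge0 ?invr_ge0 ?exprn_ge0 ?(ltW p).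
  by apply: le_trans H _; rewrite ler_peMl// ler1n.
have -> : \sum_(n < N.+1) (a N n - A) * t n =
   psum (fun n => (a N n - A) * t n) N.+1 by [].
have dd : dominated (fun n => (a N n - A) * t n) (2 * M * K) r.
  move=> n; rewrite normcM -mulrA ler_pM ?normc_ge0//.
  by rewrite (le_trans (ler_normcB _ _))// mulr_natl mulr2n lerD.
have MK0 : 0 <= 2 * M * K by rewrite !mulr_ge0.
have B2 := dominated_tail MK0 r01 dd (leqW nN).
have B1 : normc (psum (fun n => (a N n - A) * t n) n0) <= e / 3.
  have := normc_psum_sub (b := fun k => if (k < n0)%N then e / 3 / (n0%:R * K + 1) * K else 2 * M * K) (a := fun n => (a N n - A) * t n) (m := 0) (n := n0).
  have rk n : r ^+ n <= 1 by case/andP: r01 => r0 r1; rewrite exprn_ile1// ltW.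
  have tK n : normc (t n) <= K by rewrite (le_trans (dt n))// ler_piMr.
  rewrite psum0 subr0 => /(_ _ (leq0n _)) H; apply: le_trans (H _) _.
    move=> k; case: ifP => kn; rewrite normcM.
      by rewrite ler_pM ?normc_ge0// HN1.
    by rewrite ler_pM ?normc_ge0// (le_trans (ler_normcB _ _))// mulr_natl mulr2n lerD.
  rewrite big_mkord (eq_bigr (fun=> e / 3 / (n0%:R * K + 1) * K)); last by move=> i _; rewrite ltn_ord.
  rewrite sumr_const card_ord.
  have D0 : 0 < n0%:R * K + 1 by rewrite ltr_wpDl// mulr_ge0.
  rewrite [leLHS](_ : _ = e / 3 * (n0%:R * K / (n0%:R * K + 1))); last first.
    by rewrite -[LHS]mulr_natl; field; rewrite gt_eqF.
  by rewrite ler_piMr ?(ltW e3)// ler_pdivrMr// mul1r lerDl.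
have B12 : normc (psum (fun n => (a N n - A) * t n) N.+1) <= e / 3 + e / 3.
  rewrite -[psum _ N.+1](subrK (psum (fun n => (a N n - A) * t n) n0)).
  rewrite (le_trans (ler_normcD _ _))// lerD// (le_trans B2)// (le_trans _ Hn0)//.
  by rewrite le_eqVlt !mulrA eqxx.
by rewrite (le_trans (lerD B12 B3))//; lra.
Qed.

Lemma triple_product q w : normc q < 1 -> q != 0 -> w != 0 ->
  seq_lim (fun N => \prod_(j < N) ((1 + q ^+ (2 * j).+1 * w) * (1 + q ^+ (2 * j).+1 * w^-1)))
    (Jth q w / qprod (q ^+ 2)).
Proof.
move=> q1 q0 w0; set Q := q ^+ 2.
have Q1 : normc Q < 1 by rewrite normcX exprn_ilt1// normc_ge0.
have [c [B [c0 B0 HB]]] := qpoch_bounds Q1.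
have gb n m : normc (gcoef Q n m) <= B / c ^+ 2.
  have BC0 : 0 <= B / c ^+ 2 by rewrite divr_ge0 ?exprn_ge0 ?ltW.
  rewrite /gcoef; case: ifP => _; last by rewrite normc0.
  rewrite normcM normcV normcM expr2 ler_pM ?normc_ge0 ?invr_ge0 ?mulr_ge0 ?normc_ge0//.
    by case/andP: (HB n).
  rewrite lef_pV2 ?posrE ?mulr_gt0 ?normc_gt0 ?qpoch_neq0// ler_pM ?(ltW c0)//.
    by case/andP: (HB m).
  by case/andP: (HB (n - m)%N).
have P0 := qprod_neq0 Q1; have PL := qprod_lim Q1.
(* The three indices 2 N, u N and 2 N - u N all tend to infinity, so the coefficient tends to qprod
   Q / qprod Q ^ 2. *)
have glim (u v : nat -> nat) N0 : (forall N, (N0 <= N)%N -> [/\ (u N <= 2 * N)%N, (N <= u N + N0)%N & (N <= v N + N0)%N]) ->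
   (forall N, (N0 <= N)%N -> v N = (2 * N - u N)%N) ->
   seq_lim (fun N => gcoef Q (2 * N) (u N)) (qprod Q)^-1.
  move=> huv hv.
  have sl (k : nat -> nat) : (forall N, (N0 <= N)%N -> (N <= k N + N0)%N) -> seq_lim (fun N => qpoch Q (k N)) (qprod Q).
    move=> hk e /PL[M HM]; exists (M + N0)%N => N MN; apply: HM.
    have : (N0 <= N)%N by rewrite (leq_trans _ MN)// leq_addl.
    by move=> /hk; lia.
  have H := seq_limM (sl (fun N => (2 * N)%N) _) (seq_limV (mulf_neq0 P0 P0) (seq_limM (sl u _) (sl v _))).
  have -> : (qprod Q)^-1 = qprod Q / (qprod Q * qprod Q) by field.
  apply: (@eq_seq_lim _ _ _ _ N0 _ (H _ _ _)).
  - by move=> N hN; rewrite /gcoef; have [-> _ _] := huv N hN; rewrite hv.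
  - by move=> N _; lia.
  - by move=> N /huv[].
  - by move=> N /huv[].
have [K K0 HK] := sterm_dominated w q1; have [K' K'0 HK'] := sterm_dominated w^-1 q1.
have BC0 : 0 <= B / c ^+ 2 by rewrite divr_ge0 ?exprn_ge0 ?ltW.
have L1 : seq_lim (fun N => \sum_(k < N.+1) gcoef Q (2 * N) (N + k) * sterm q w k) ((qprod Q)^-1 * Sth q w).
  apply: (@tannery (fun N k => gcoef Q (2 * N) (N + k)) _ _ _ K (1 / 4) K0 (quarter01 R) HK BC0) => // k.
  apply: (@glim (fun N => N + k)%N (fun N => N - k)%N k) => N kN.
    by rewrite subnK// -addnA leq_addr mul2n -addnn leq_add2l.
  by rewrite mul2n -addnn subnDl.
have L2 : seq_lim (fun N => \sum_(k < N.+1) gcoef Q (2 * N) (N - k) * sterm q w^-1 k) ((qprod Q)^-1 * Sth q w^-1).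
  apply: (@tannery (fun N k => gcoef Q (2 * N) (N - k)) _ _ _ K' (1 / 4) K'0 (quarter01 R) HK' BC0) => // k.
  apply: (@glim (fun N => N - k)%N (fun N => N + k)%N k) => N kN.
    by rewrite subnK// -addnA leq_addr (leq_trans (leq_subr _ _)) ?leq_pmull.
  by rewrite mul2n -addnn -addnBA ?leq_subr// subKn.
have L3 : seq_lim (fun N => gcoef Q (2 * N) N) (qprod Q)^-1.
  apply: (@glim (fun N => N) (fun N => N) 0%N) => N _.
    by rewrite addn0 leqnn leq_pmull.
  by rewrite mul2n -addnn addnK.
have H := seq_limD (seq_limD L1 L2) (seq_limZ (-1) L3).
have -> : Jth q w / qprod Q = (qprod Q)^-1 * Sth q w + (qprod Q)^-1 * Sth q w^-1 + -1 * (qprod Q)^-1.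
  by rewrite /Jth; move: (Sth q w) (Sth q w^-1) (qprod Q)^-1 => s s' u; ring.
apply: (@eq_seq_lim _ _ _ _ 0%N _ H) => N _.
by rewrite finite_triple_product// mulN1r.
Qed.

End TripleProduct.

(** * Eta quotients as theta functions *)

Section EtaQuotients.
Variable R : realType.
Notation C := R[i].
Implicit Types (q w z : C) (m n N k : nat).

Lemma phiJ q : phi q = Jth q 1. Proof. by []. Qed.
Lemma qpochE q n : qpoch q n = \prod_(j < n) (1 - q ^+ j.+1). Proof. by []. Qed.
Opaque qprod phi Jth qpoch cexp.

Lemma normc_expr_lt1 q n : normc q < 1 -> (0 < n)%N -> normc (q ^+ n) < 1.
Proof. by move=> q1 n0; rewrite normcX exprn_ilt1 ?normc_ge0// -lt0n. Qed.

(** At w = 1 the triple product is the square of the product [A] of the 1 + q ^ (2 j + 1), and [E]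
    writes [A] as a quotient of finite products for q, q ^ 2 and q ^ 4. *)
Lemma phi_qprod q : normc q < 1 -> q != 0 ->
  phi q = qprod (q ^+ 2) ^+ 5 / (qprod q ^+ 2 * qprod (q ^+ 4) ^+ 2).
Proof.
move=> q1 q0.
have q21 := normc_expr_lt1 q1 (ltn0Sn 1); have q41 := normc_expr_lt1 q1 (ltn0Sn 3).
pose A N := \prod_(j < N) (1 + q ^+ (2 * j).+1).
have E N : A N * (qpoch q (2 * N) * qpoch (q ^+ 4) N) = qpoch (q ^+ 2) (2 * N) * qpoch (q ^+ 2) N.
  elim: N => [|N IH]; first by rewrite /A big_ord0 muln0 !qpoch0 !mulr1.
  rewrite /A big_ord_recr /= -/(A N) mulnS !addSn add0n !qpochS.
  transitivity (A N * (qpoch q (2 * N) * qpoch (q ^+ 4) N) *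
     ((1 + q ^+ (2 * N).+1) * (1 - q ^+ (2 * N).+1) * (1 - q ^+ (2 * N).+2) * (1 - q ^+ 4 ^+ N.+1))).
    by ring.
  rewrite IH -!exprM.
  have -> : (4 * N.+1 = 2 * (2 * N).+2)%N by lia.
  have -> : (2 * N.+1 = (2 * N).+2)%N by lia.
  have -> : (2 * (2 * N).+1 = (2 * N).+1 * 2)%N by lia.
  have -> : (1 + q ^+ (2 * N).+1) * (1 - q ^+ (2 * N).+1) = 1 - q ^+ ((2 * N).+1 * 2).
    by rewrite exprM; ring.
  by ring.
have k2 n : (n <= 2 * n)%N by lia.
pose L := qprod (q ^+ 2) * qprod (q ^+ 2) / (qprod q * qprod (q ^+ 4)).
have LA : seq_lim A L.
  have H := seq_limM (seq_limM (seq_lim_sub k2 (qprod_lim q21)) (qprod_lim q21))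
    (seq_limV (mulf_neq0 (qprod_neq0 q1) (qprod_neq0 q41))
      (seq_limM (seq_lim_sub k2 (qprod_lim q1)) (qprod_lim q41))).
  apply: (@eq_seq_lim _ _ _ _ 0%N _ H) => N _; rewrite -E mulfK//.
  by rewrite mulf_neq0// qpoch_neq0.
have LJ := triple_product q1 q0 (oner_neq0 C).
have LAA : seq_lim (fun N => \prod_(j < N) ((1 + q ^+ (2 * j).+1 * 1) * (1 + q ^+ (2 * j).+1 * 1^-1))) (L * L).
  apply: (@eq_seq_lim _ _ _ _ 0%N _ (seq_limM LA LA)) => N _.
  by rewrite /A -big_split /=; apply: eq_bigr => j _; rewrite invr1 mulr1.
have := seq_lim_unique LJ LAA.
move=> /(canRL (divfK (qprod_neq0 q21))); rewrite -phiJ => ->.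
rewrite /L; move: (qprod_neq0 q1) (qprod_neq0 q21) (qprod_neq0 q41).
move: (qprod q) (qprod (q ^+ 2)) (qprod (q ^+ 4)) => a b c a0 b0 c0.
by field; rewrite ?a0 ?b0 ?c0.
Qed.

Lemma phi_opp_qprod q : normc q < 1 -> q != 0 ->
  phi (- q) = qprod q ^+ 2 / qprod (q ^+ 2).
Proof.
move=> q1 q0; have q21 := normc_expr_lt1 q1 (ltn0Sn 1).
pose A N := \prod_(j < N) (1 - q ^+ (2 * j).+1).
have E N : A N * qpoch (q ^+ 2) N = qpoch q (2 * N).
  elim: N => [|N IH]; first by rewrite /A big_ord0 muln0 !qpoch0 !mulr1.
  rewrite /A big_ord_recr /= -/(A N) mulnS !addSn add0n !qpochS -IH -!exprM.
  have -> : (2 * N.+1 = (2 * N).+2)%N by lia.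
  by ring.
have k2 n : (n <= 2 * n)%N by lia.
have LA : seq_lim A (qprod q / qprod (q ^+ 2)).
  have H := seq_limM (seq_lim_sub k2 (qprod_lim q1)) (seq_limV (qprod_neq0 q21) (qprod_lim q21)).
  by apply: (@eq_seq_lim _ _ _ _ 0%N _ H) => N _; rewrite -E mulfK// qpoch_neq0.
have nq1 : normc (- q) < 1 by rewrite normcN'.
have nq0 : - q != 0 by rewrite oppr_eq0.
have LJ := triple_product nq1 nq0 (oner_neq0 C).
have LAA : seq_lim (fun N => \prod_(j < N) ((1 + (- q) ^+ (2 * j).+1 * 1) * (1 + (- q) ^+ (2 * j).+1 * 1^-1)))
   (qprod q / qprod (q ^+ 2) * (qprod q / qprod (q ^+ 2))).
  apply: (@eq_seq_lim _ _ _ _ 0%N _ (seq_limM LA LA)) => N _.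
  rewrite /A -big_split /=; apply: eq_bigr => j _; rewrite invr1 mulr1.
  by rewrite exprNn -signr_odd /= oddM /= expr1 mulN1r.
have := seq_lim_unique LJ LAA; rewrite sqrrN.
move=> /(canRL (divfK (qprod_neq0 q21))); rewrite -phiJ => ->.
move: (qprod_neq0 q1) (qprod_neq0 q21); move: (qprod q) (qprod (q ^+ 2)) => a b a0 b0.
by field.
Qed.

(** At w = q the factors are 1 + q ^ (2 j + 2) and 1 + q ^ (2 j); the one with exponent 0
    contributes the 2, the others give the product [A] twice. *)
Lemma Jth_diag q : normc q < 1 -> q != 0 ->
  Jth q q = 2 * qprod (q ^+ 4) ^+ 2 / qprod (q ^+ 2).
Proof.
move=> q1 q0.
have q21 := normc_expr_lt1 q1 (ltn0Sn 1); have q41 := normc_expr_lt1 q1 (ltn0Sn 3).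
pose A N := \prod_(j < N) (1 + q ^+ 2 ^+ j.+1).
have E N : A N * qpoch (q ^+ 2) N = qpoch (q ^+ 4) N.
  elim: N => [|N IH]; first by rewrite /A big_ord0 !qpoch0 !mulr1.
  rewrite /A big_ord_recr /= -/(A N) !qpochS -IH.
  have -> : q ^+ 4 ^+ N.+1 = q ^+ 2 ^+ N.+1 ^+ 2 by rewrite -!exprM; congr (_ ^+ _); lia.
  by ring.
have LA : seq_lim A (qprod (q ^+ 4) / qprod (q ^+ 2)).
  have H := seq_limM (qprod_lim q41) (seq_limV (qprod_neq0 q21) (qprod_lim q21)).
  by apply: (@eq_seq_lim _ _ _ _ 0%N _ H) => N _; rewrite -E mulfK// qpoch_neq0.
have LJ := triple_product q1 q0 q0.
have LJ' := seq_lim_sub (k := fun n => n.+1) (fun n => leqnSn n) LJ.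
have LA' := seq_lim_sub (k := fun n => n.+1) (fun n => leqnSn n) LA.
have LAA : seq_lim (fun N => \prod_(j < N.+1) ((1 + q ^+ (2 * j).+1 * q) * (1 + q ^+ (2 * j).+1 * q^-1)))
   (qprod (q ^+ 4) / qprod (q ^+ 2) * (2 * (qprod (q ^+ 4) / qprod (q ^+ 2)))).
  apply: (@eq_seq_lim _ _ _ _ 0%N _ (seq_limM LA' (seq_limZ 2 LA))) => N _.
  rewrite big_split /=; congr (_ * _).
    by apply: eq_bigr => j _; rewrite -exprSr -exprM; congr (1 + q ^+ _); lia.
  rewrite big_ord_recl /= muln0 expr1 divff//; congr (_ * _).
  by apply: eq_bigr => j _; rewrite /bump /= add1n [q ^+ (2 * _).+1]exprSr mulfK// -exprM.
have := seq_lim_unique LJ' LAA.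
move=> /(canRL (divfK (qprod_neq0 q21))) ->.
move: (qprod_neq0 q21); move: (qprod (q ^+ 2)) (qprod (q ^+ 4)) => b c b0.
by field.
Qed.

(** Read off the product expansion; this is the reason why f1 has no zero in the upper half plane
    and may be divided by. *)
Lemma phi_neq0 q : normc q < 1 -> phi q != 0.
Proof.
move=> q1; have [->|q0] := eqVneq q 0.
  rewrite phiE; have H : seq_lim (psum (sterm (0 : C) 1)) 1.
    apply: (@eq_seq_lim _ (fun=> 1) _ _ 1%N); last exact: seq_lim_cst.
    case=> // n _; rewrite psumSl /sterm !expr0 mulr1 /psum big1 ?addr0// => i _.
    by rewrite expr0n mul0r.
  by rewrite /Sth (csumE H) mulr1 mulr2n addrK oner_eq0.
rewrite phi_qprod// !mulf_neq0 ?invr_eq0 ?mulf_neq0 ?expf_neq0 ?qprod_neq0//;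
  exact: normc_expr_lt1.
Qed.

Lemma phi_mul_opp q : normc q < 1 -> q != 0 -> phi q * phi (- q) = phi (- q ^+ 2) ^+ 2.
Proof.
move=> q1 q0; have q21 := normc_expr_lt1 q1 (ltn0Sn 1); have q41 := normc_expr_lt1 q1 (ltn0Sn 3).
have q20 : q ^+ 2 != 0 by rewrite expf_neq0.
rewrite (phi_qprod q1 q0) (phi_opp_qprod q1 q0) (phi_opp_qprod q21 q20) -exprM.
move: (qprod_neq0 q1) (qprod_neq0 q21) (qprod_neq0 q41).
move: (qprod q) (qprod (q ^+ 2)) (qprod (q ^+ 4)) => a b c a0 b0 c0.
by field; rewrite ?a0 ?b0 ?c0.
Qed.

Lemma phi_add_opp q : normc q < 1 -> phi q + phi (- q) = 2 * phi (q ^+ 4).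
Proof.
move=> q1; have := @phi_root8 _ (-1) q; rewrite mulN1r => ->//; last by rewrite -signr_odd.
have -> : (- q) ^+ 4 = q ^+ 4 by ring.
by move: (phi q) (phi (q ^+ 4)) => a b; ring.
Qed.

(* [D q := phi q ^ 2 + phi (-q) ^ 2 - 2 phi (q ^ 2) ^ 2] satisfies
   [D q = -2 D (q ^ 2)] and is O(q), hence vanishes. *)
Lemma phi_sqr_add_opp q : normc q < 1 -> q != 0 ->
  phi q ^+ 2 + phi (- q) ^+ 2 = 2 * phi (q ^+ 2) ^+ 2.
Proof.
pose D q := phi q ^+ 2 + phi (- q) ^+ 2 - 2 * phi (q ^+ 2) ^+ 2.
move=> q1 q0; suff : D q = 0 by move/eqP; rewrite subr_eq0 => /eqP.
have DE u : normc u < 1 -> u != 0 -> D u = - 2 * D (u ^+ 2).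
  move=> u1 u0; rewrite /D -exprM.
  have := phi_mul_opp u1 u0; have := phi_add_opp u1.
  move: (phi u) (phi (- u)) (phi (u ^+ 4)) (phi (- u ^+ 2)) (phi (u ^+ 2)) => a b c d e ab cd.
  have -> : a ^+ 2 + b ^+ 2 = (a + b) ^+ 2 - 2 * (a * b) by ring.
  by rewrite ab cd; ring.
(* The growth of 2 ^ n is overwhelmed by |u| ^ (2 ^ n), which bounds the last factor up to a
   constant. *)
have DN n u : normc u < 1 -> u != 0 -> D u = (- 2) ^+ n * D (u ^+ (2 ^ n)).
  move: D DE => E DE u1 u0; elim: n => [|n IH]; first by rewrite expr0 expn0 expr1 mul1r.
  have un1 : normc (u ^+ (2 ^ n)) < 1 by apply: normc_expr_lt1 => //; rewrite expn_gt0.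
  by rewrite IH (DE _ un1 (expf_neq0 _ u0)) -exprM -expnSr [in RHS]exprSr mulrA.
have [K K0 HK] := @phi_bound R.
pose M := 4 * (2 * K + K ^+ 2).
have M0 : 0 < M by rewrite mulr_gt0// addr_gt0 ?mulr_gt0 ?exprn_gt0.
have n2 : normc (2 : C) = 2 by rewrite -(rmorph_nat (real_complex R)) normcR ger0_norm.
have DB u : normc u <= 1 / 2 -> normc (D u) <= M * normc u.
  move=> uh; have u0 : 0 <= normc u := normc_ge0 u.
  have u1 : normc u <= 1 by lra.
  have sq (v : C) : normc v <= 1 / 2 -> normc v <= normc u -> normc (phi v ^+ 2 - 1) <= (2 * K + K ^+ 2) * normc u.
    move=> vh vu; have Hv := HK v vh.
    have -> : phi v ^+ 2 - 1 = (phi v - 1) * 2 + (phi v - 1) ^+ 2.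
      by move: (phi v) => a; ring.
    rewrite (le_trans (ler_normcD _ _))// normcM n2 normcX mulrDl lerD//.
      by rewrite mulrC -mulrA ler_pM2l// (le_trans Hv)// ler_pM2l.
    rewrite (@le_trans _ _ ((K * normc u) ^+ 2))//.
      rewrite lerXn2r ?nnegrE ?mulr_ge0 ?normc_ge0 ?(ltW K0)//.
      by rewrite (le_trans Hv)// ler_pM2l.
    by rewrite exprMn ler_pM2l ?exprn_gt0// expr2 ler_piMl.
  have h1 := sq u uh (lexx _).
  have h2 := sq (- u) _ _; rewrite normcN' in h2; have {}h2 := h2 uh (lexx _).
  have u2u : normc (u ^+ 2) <= normc u by rewrite normcX expr2 ler_piMl.
  have h3 := sq (u ^+ 2) (le_trans u2u uh) u2u.
  have -> : D u = (phi u ^+ 2 - 1) + (phi (- u) ^+ 2 - 1) - 2 * (phi (u ^+ 2) ^+ 2 - 1).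
    by rewrite /D; move: (phi u) (phi (- u)) (phi (u ^+ 2)) => a b c; ring.
  rewrite (le_trans (ler_normcB _ _))// normcM n2.
  have := ler_normcD (phi u ^+ 2 - 1) (phi (- u) ^+ 2 - 1).
  have -> : M * normc u = 4 * ((2 * K + K ^+ 2) * normc u) by rewrite /M; ring.
  have LR (a b c d f : R) : a <= f -> b <= f -> c <= f -> d <= a + b -> d + 2 * c <= 4 * f by clear; move=> *; lra.
  exact: LR h1 h2 h3.
apply: small_normc_eq0 => e e0.
have q01 : 0 <= normc q < 1 by rewrite normc_ge0.
have [K2 K20 HK2] := nat_pow_bounded q01.
have [N1 HN1] := pow_small q01 (divr_gt0 ltr01 (ltr0n R 2)).
have [N2 HN2] := exists_pow2_gt (M * K2 / e).
pose n := maxn N1 N2.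
rewrite (DN n)// normcM normcX normcN' n2.
have nN : (N1 <= 2 ^ n)%N by rewrite (leq_trans (leq_maxl N1 N2))// ltnW// ltn_expl.
have qs : normc (q ^+ (2 ^ n)) <= 1 / 2 by rewrite normcX HN1.
have p0 : 0 < 2 ^+ n :> R by rewrite exprn_gt0.
apply: (le_trans (ler_wpM2l (ltW p0) (DB _ qs))).
rewrite -(ler_pM2l p0).
rewrite [leLHS](_ : _ = M * ((2 ^ n)%:R ^+ 2 * normc q ^+ (2 ^ n))); last first.
  rewrite natrX normcX; move: (2 ^+ n) (normc q ^+ _) => p a; clear; ring.
rewrite (le_trans (ler_wpM2l (ltW M0) (HK2 _)))// -ler_pdivrMr//.
by rewrite (le_trans (ltW HN2))// ler_weXn2l ?leq_maxr// ler1n.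
Qed.

Definition th z : C := phi (cexp (pi%:C * 'i * z)).

Lemma normc_cexp_pii z : normc (cexp (pi%:C * 'i * z)) = expR (- (pi * complex.Im z)).
Proof.
rewrite normc_cexp -mulrA cReRM cReM cRei cImi mul0r mul1r sub0r mulrN//.
Qed.

Lemma normc_nome z : 0 < complex.Im z -> normc (cexp (pi%:C * 'i * z)) < 1.
Proof. by move=> z0; rewrite normc_cexp_pii expR_lt1 oppr_lt0 mulr_gt0// pi_gt0. Qed.

Lemma nomeMn n z : cexp (pi%:C * 'i * (n%:R * z)) = cexp (pi%:C * 'i * z) ^+ n :> C.
Proof. by rewrite -cexpMn; congr cexp; ring. Qed.

Lemma nomeD z w : cexp (pi%:C * 'i * (z + w)) = cexp (pi%:C * 'i * z) * cexp (pi%:C * 'i * w) :> C.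
Proof. by rewrite mulrDr cexpD. Qed.

Lemma Im_natM n z : complex.Im (n%:R * z) = n%:R * complex.Im z.
Proof. by rewrite -(rmorph_nat (real_complex R)) cImRM. Qed.

Lemma etaE z : 0 < complex.Im z ->
  Defs.eta z = cexp (2 * pi%:C * 'i * z / 24) * qprod (cexp (2 * pi%:C * 'i * z)).
Proof.
move=> z0; have q1 : normc (cexp (2 * pi%:C * 'i * z)) < 1.
  have -> : 2 * pi%:C * 'i * z = pi%:C * 'i * (2%:R * z) by ring.
  by apply: normc_nome; rewrite Im_natM mulr_gt0.
rewrite /Defs.eta; cbv zeta; congr (_ * _); apply: seq_lim_lim.
apply: (@eq_seq_lim _ _ _ _ 0%N _ (qprod_lim q1)) => N _.
by rewrite qpochE big_add1 /= big_mkord.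
Qed.

Lemma th_neq0 z : 0 < complex.Im z -> th z != 0.
Proof. by move=> z0; apply: phi_neq0; exact: normc_nome. Qed.

Lemma cderiv_th z : 0 < complex.Im z -> exists d, cderiv th z d.
Proof.
move=> z0; have [d dphi] := cderiv_phi (normc_nome z0).
have dc := cderiv_cexp_lin (pi%:C * 'i) 0 z.
have dc' : cderiv (fun z => cexp (pi%:C * 'i * z)) z (cexp (pi%:C * 'i * z + 0) * (pi%:C * 'i)).
  by apply: (@cderiv_ext _ _ _ _ _ 1 _ _ dc) => // h _; rewrite addr0.
by eexists; exact: cderiv_comp dc' dphi.
Qed.

Lemma f1E (z : uhp R) : f1 R z = th (2 * val z).
Proof.
have z0 : 0 < complex.Im (val z) by case: z.
have Im n : (0 < n)%N -> 0 < complex.Im (n%:R * val z) by move=> n0; rewrite Im_natM mulr_gt0// ltr0n.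
have q1 : normc (cexp (2 * pi%:C * 'i * val z)) < 1.
  have -> : 2 * pi%:C * 'i * val z = pi%:C * 'i * (2%:R * val z) by ring.
  exact: normc_nome (Im 2%N isT).
rewrite /f1; cbv zeta; rewrite !etaE// ?(Im 2%N)// ?(Im 4%N)//.
set q := cexp (2 * pi%:C * 'i * val z) in q1 *.
have -> : cexp (2 * pi%:C * 'i * (2 * val z)) = q ^+ 2 by rewrite -cexpMn; congr cexp; ring.
have -> : cexp (2 * pi%:C * 'i * (4 * val z)) = q ^+ 4 by rewrite -cexpMn; congr cexp; ring.
set r := cexp (2 * pi%:C * 'i * val z / 24).
have -> : cexp (2 * pi%:C * 'i * (2 * val z) / 24) = r ^+ 2 by rewrite -cexpMn; congr cexp; ring.
have -> : cexp (2 * pi%:C * 'i * (4 * val z) / 24) = r ^+ 4 by rewrite -cexpMn; congr cexp; ring.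
have r0 : r != 0 by exact: cexp_neq0.
rewrite /th; have -> : cexp (pi%:C * 'i * (2 * val z)) = q by rewrite /q; congr cexp; ring.
have q21 := normc_expr_lt1 q1 (ltn0Sn 1); have q41 := normc_expr_lt1 q1 (ltn0Sn 3).
have q0 : q != 0 by exact: cexp_neq0.
rewrite (phi_qprod q1 q0).
move: (qprod_neq0 q1) (qprod_neq0 q21) (qprod_neq0 q41).
move: (qprod q) (qprod (q ^+ 2)) (qprod (q ^+ 4)) => a b c a0 b0 c0.
by field; rewrite ?a0 ?c0 ?r0.
Qed.

Lemma Im_val_gt0 (z : uhp R) : 0 < complex.Im (val z). Proof. by case: z. Qed.

Lemma f2E (z : uhp R) : f2 R z = th (4 * val z).
Proof.
have z0 := Im_val_gt0 z.
have z20 : 0 < complex.Im (2 * val z) by rewrite (Im_natM 2) mulr_gt0.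
have -> : 4 * val z = 2 * (2 * val z) by ring.
rewrite -(f1E (exist _ (2 * val z) z20)) /f1 /f2; cbv zeta; rewrite /=.
have -> : 2 * (2 * val z) = 4 * val z by ring.
by have -> : 4 * (2 * val z) = 8 * val z by ring.
Qed.

Lemma th_add1 z : th (z + 1) = phi (- cexp (pi%:C * 'i * z)).
Proof. by rewrite /th nomeD mulr1 [pi%:C * 'i]mulrC cexp_pii mulrN1. Qed.

Lemma th_opp_sqr z : 0 < complex.Im z ->
  th (z + 1) ^+ 2 = 2 * th (2 * z) ^+ 2 - th z ^+ 2.
Proof.
move=> z0; have q1 := normc_nome z0; have := phi_sqr_add_opp q1 (cexp_neq0 _).
by rewrite -th_add1 /th -nomeMn => <-; rewrite addrAC subrr add0r.
Qed.

(** With a = phi q, b = phi (-q) and c = phi (q ^ 4), a + b = 2 c turns 2 (a - c) into a - b, whose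
    square is known from the formulas for a ^ 2 + b ^ 2 and a b. *)
Lemma th_diff_sqr z : 0 < complex.Im z ->
  (th z - th (4 * z)) ^+ 2 = th (2 * z) ^+ 2 - th (4 * z) ^+ 2.
Proof.
move=> z0; have q1 := normc_nome z0; have q0 := cexp_neq0 (pi%:C * 'i * z).
have q21 := normc_expr_lt1 q1 (ltn0Sn 1).
have H1 := phi_add_opp q1; have H2 := phi_mul_opp q1 q0; have H3 := phi_sqr_add_opp q1 q0.
have H4 := phi_sqr_add_opp q21 (expf_neq0 2 q0); rewrite -exprM in H4.
rewrite /th !nomeMn.
move: H1 H2 H3 H4; move: (phi _) (phi (- _)) (phi (_ ^+ 4)) (phi (- _ ^+ 2)) (phi (_ ^+ 2)).
move=> a b c d e H1 H2 H3 H4.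
have E : 4 * (a - c) ^+ 2 = 4 * (e ^+ 2 - c ^+ 2).
  have -> : 4 * (a - c) ^+ 2 = (2 * a - 2 * c) ^+ 2 by ring.
  rewrite -H1; have -> : (2 * a - (a + b)) ^+ 2 = a ^+ 2 + b ^+ 2 - 2 * (a * b) by ring.
  rewrite H2 H3; have -> : d ^+ 2 = 2 * c ^+ 2 - e ^+ 2 by rewrite -H4; ring.
  by ring.
have n4 : 4 != 0 :> C by rewrite pnatr_eq0.
exact: (mulfI n4 E).
Qed.

(** Both quadratic factors are squares of eta quotients: 2 f2 ^ 2 - f1 ^ 2 = th (2 z + 1) ^ 2 and f1
    ^ 2 - f2 ^ 2 = (th z - th (4 z)) ^ 2. It then remains to compare powers of [r], which is e ^ (2
    pi i z / 24), and of infinite products. *)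
Lemma gE (z : uhp R) : g R z =
  f1 R z * f2 R z * (2 * f2 R z ^+ 2 - f1 R z ^+ 2) * (f1 R z ^+ 2 - f2 R z ^+ 2) / 4.
Proof.
have z0 := Im_val_gt0 z.
have Im n : (0 < n)%N -> 0 < complex.Im (n%:R * val z) by move=> n0; rewrite Im_natM mulr_gt0// ltr0n.
have q1 : normc (cexp (2 * pi%:C * 'i * val z)) < 1.
  have -> : 2 * pi%:C * 'i * val z = pi%:C * 'i * (2%:R * val z) by ring.
  exact: normc_nome (Im 2%N isT).
rewrite f1E f2E.
have -> : 4 * val z = 2 * (2 * val z) by ring.
rewrite -(th_opp_sqr (Im 2%N isT)).
have -> : 2 * (2 * val z) = 4 * val z by ring.
rewrite -(th_diff_sqr z0) th_add1 /th.
set Q := cexp (pi%:C * 'i * val z).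
have Q0 : Q != 0 by exact: cexp_neq0.
have Q1 : normc Q < 1 by exact: normc_nome.
rewrite !nomeMn -/Q (phi_odd_part Q1 Q0) /g; cbv zeta; rewrite !etaE// ?(Im 2%N)// ?(Im 4%N)// ?(Im 8%N)//.
have QE : cexp (2 * pi%:C * 'i * val z) = Q ^+ 2 by rewrite -cexpMn; congr cexp; ring.
rewrite QE in q1 *.
have -> : cexp (2 * pi%:C * 'i * (2 * val z)) = Q ^+ 2 ^+ 2 by rewrite -!cexpMn; congr cexp; ring.
have -> : cexp (2 * pi%:C * 'i * (4 * val z)) = Q ^+ 2 ^+ 4 by rewrite -!cexpMn; congr cexp; ring.
have -> : cexp (2 * pi%:C * 'i * (8 * val z)) = Q ^+ 2 ^+ 8 by rewrite -!cexpMn; congr cexp; ring.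
set r := cexp (2 * pi%:C * 'i * val z / 24).
have -> : cexp (2 * pi%:C * 'i * (2 * val z) / 24) = r ^+ 2 by rewrite -cexpMn; congr cexp; ring.
have -> : cexp (2 * pi%:C * 'i * (4 * val z) / 24) = r ^+ 4 by rewrite -cexpMn; congr cexp; ring.
have -> : cexp (2 * pi%:C * 'i * (8 * val z) / 24) = r ^+ 8 by rewrite -cexpMn; congr cexp; ring.
have r0 : r != 0 by exact: cexp_neq0.
have Qr : Q = r ^+ 12 by rewrite -cexpMn; congr cexp; field.
have Q20 : Q ^+ 2 != 0 by rewrite expf_neq0.
have Q40 : Q ^+ 4 != 0 by rewrite expf_neq0.
have Q41 : normc (Q ^+ 4) < 1 by exact: normc_expr_lt1.
have Q81 : normc (Q ^+ 4 ^+ 2) < 1 by exact: normc_expr_lt1.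
have Q161 : normc (Q ^+ 4 ^+ 4) < 1 by exact: normc_expr_lt1.
rewrite (Jth_diag Q41 Q40) (phi_opp_qprod q1 Q20) (phi_qprod q1 Q20).
have -> : phi (Q ^+ 4) = phi (Q ^+ 2 ^+ 2) by rewrite -exprM.
rewrite (phi_qprod (normc_expr_lt1 q1 (ltn0Sn 1)) (expf_neq0 2 Q20)).
rewrite -![Q ^+ _ ^+ _]exprM /=.
have E2 := qprod_neq0 q1; have E4 := qprod_neq0 Q41.
have E8 := qprod_neq0 Q81; have E16 := qprod_neq0 Q161.
rewrite -!exprM /= in E8 E16.
move: E2 E4 E8 E16.
move: (qprod (Q ^+ 2)) (qprod (Q ^+ 4)) (qprod (Q ^+ 8)) (qprod (Q ^+ 16)) => a b c d a0 b0 c0 d0.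
rewrite Qr; clear - a0 b0 c0 d0 r0.
have n4 : 4 != 0 :> C by rewrite pnatr_eq0.
by field; rewrite ?a0 ?b0 ?c0 ?d0 ?r0.
Qed.

End EtaQuotients.

(** * Inversion of the theta function *)

Section ThetaIntegrals.
Variable R : realType.
Notation C := R[i].
Notation mu := (@lebesgue_measure R).
Implicit Types (q w z u k l : C) (m n N : nat) (a b c x y t : R) (h : C -> C).
Opaque qprod phi Jth qpoch cexp qexp.

Definition entire h := forall z, exists d, cderiv h z d.

Lemma entire_hol h a : entire h -> hol_above h a.
Proof. by move=> eh z _; exact: eh. Qed.

Lemma entire_hcont h y a b : entire h -> hcont h y a b.
Proof. by move=> eh; apply: ccont_hcont => x _; have [d /cderiv_ccont] := eh (x +i* y). Qed.

Lemma entireM f h : entire f -> entire h -> entire (fun u => f u * h u).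
Proof. by move=> ef eh z; have [d df] := ef z; have [d' dh] := eh z; eexists; exact: cderivM df dh. Qed.

Lemma entireD f h : entire f -> entire h -> entire (fun u => f u + h u).
Proof. by move=> ef eh z; have [d df] := ef z; have [d' dh] := eh z; eexists; exact: cderivD df dh. Qed.

Lemma entireZ k h : entire h -> entire (fun u => (k : C) * h u).
Proof. by move=> eh z; have [d dh] := eh z; eexists; exact: cderivZ dh. Qed.

Lemma entire_cst k : entire (fun=> k : C).
Proof. by move=> z; eexists; exact: cderiv_cst. Qed.

Lemma entire_comp f h : entire f -> entire h -> entire (fun u => f (h u)).
Proof. by move=> ef eh z; have [d dh] := eh z; have [d' df] := ef (h z); eexists; exact: cderiv_comp dh df. Qed.

Lemma entire_id : entire id.
Proof. by move=> z; eexists; exact: cderiv_id. Qed.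

Lemma entire_cexp : entire (@cexp R).
Proof. by move=> z; eexists; exact: cderiv_cexp. Qed.

Lemma eq_entire f h : f =1 h -> entire f -> entire h.
Proof. by move=> /funext ->. Qed.

Lemma entire_Jth q k : normc q < 1 -> entire (fun u => Jth q (cexp (k * u))).
Proof.
move=> q1; have eS l : entire (fun u => Sth q (cexp (l * u))).
  apply: (entire_comp (f := Sth q)); first by move=> z; exact: cderiv_Sth_w.
  by apply: (entire_comp entire_cexp); apply: entireZ; exact: entire_id.
apply: (@eq_entire (fun u => Sth q (cexp (k * u)) + Sth q (cexp (- k * u)) + -1)).
  by move=> u; rewrite mulNr cexpN.
by apply: entireD; [exact: entireD|exact: entire_cst].
Qed.

Lemma seg_continuous (p : C -> R) (u : R -> C) a b :
  (forall z w, `|p z - p w| <= normc (z - w)) -> seg_cont u a b ->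
  {within `[a, b], continuous (fun t => p (u t))}.
Proof.
move=> p_lip cu; apply/subspace_continuousP => t; rewrite /= in_itv/= => tab.
apply/cvgrPdist_lt => e e0; have [r r0 Hr] := cu t tab e e0.
rewrite near_withinE; apply/nbhs_ballP; exists r => //= s.
rewrite /ball/= distrC => st; rewrite in_itv/= => sab.
by rewrite (le_lt_trans (p_lip _ _))// normcB Hr.
Qed.

Lemma Rintegral_shift (f : R -> R) a b c : a <= b ->
  {within `[a + c, b + c], continuous f} ->
  Rintegral mu `[a, b] (fun x => f (x + c)) = Rintegral mu `[a + c, b + c] f.
Proof.
move=> ab cf; rewrite /Rintegral; congr fine.
have D : derive1 (fun x : R => x + c : R) = cst 1.
  by apply/funext => z; rewrite derive1E deriveD// derive_id derive_cst addr0.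
rewrite (@integration_by_substitution_increasing _ (fun x => x + c) f a b ab)//.
- by apply: eq_integral => x _; rewrite D /= mulr1.
- by move=> x y _ _; rewrite ltrD2r.
- by rewrite D => ? _; exact: cst_continuous.
- by rewrite D; exact: is_cvg_cst.
- by rewrite D; exact: is_cvg_cst.
- split => //.
  + by apply: cvg_at_right_filter; apply: cvgD; [exact: cvg_id|exact: cvg_cst].
  + by apply: cvg_at_left_filter; apply: cvgD; [exact: cvg_id|exact: cvg_cst].
Qed.

Lemma hint_shift h y a b c : a <= b -> entire h ->
  hint (fun u => h (u + c%:C)) y a b = hint h y (a + c) (b + c).
Proof.
move=> ab eh; rewrite /hint /cint.
have E x : (x +i* y) + c%:C = (x + c) +i* y by rewrite complexD addr0.
have ch := @entire_hcont h y (a + c) (b + c) eh.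
rewrite -(Rintegral_shift ab (seg_continuous (@Re_lip R) ch)).
rewrite -(Rintegral_shift ab (seg_continuous (@Im_lip R) ch)).
by congr (_ +i* _); apply: eq_Rintegral => x _; rewrite E.
Qed.

Lemma hint_unif_lim (s : nat -> C -> C) h y a :
  (forall n, hcont (s n) y a (a + 1)) -> hcont h y a (a + 1) ->
  (forall e, 0 < e -> exists N, forall n x, (N <= n)%N -> a <= x <= a + 1 ->
    normc (s n (x +i* y) - h (x +i* y)) <= e) ->
  seq_lim (fun n => hint (s n) y a (a + 1)) (hint h y a (a + 1)).
Proof.
move=> cs ch H e e0; have [N HN] := H _ (divr_gt0 e0 (ltr0n R 2)).
exists N => n Nn.
have cN : hcont (fun z => -1 * h z) y a (a + 1) by exact: seg_contZ.
have -> : hint (s n) y a (a + 1) - hint h y a (a + 1) = hint (fun z => s n z + -1 * h z) y a (a + 1).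
  by rewrite /hint cintD//; [rewrite cintZ// mulN1r|exact: cs].
rewrite (le_trans (@normc_hint _ _ _ _ (e / 2) _ _))//.
- by apply: seg_contD => //; exact: cs.
- by move=> x xa; rewrite mulN1r; exact: HN.
- by lra.
Qed.

Lemma hintD f h y a b : hcont f y a b -> hcont h y a b ->
  hint (fun z => f z + h z) y a b = hint f y a b + hint h y a b.
Proof. exact: cintD. Qed.

Lemma hintZ k h y a b : hcont h y a b -> hint (fun z => (k : C) * h z) y a b = k * hint h y a b.
Proof. exact: cintZ. Qed.

Lemma hint_cst k y a b : a <= b -> hint (fun=> k) y a b = (b - a)%:C * k.
Proof. exact: cint_cst. Qed.

Lemma hcontD f h y a b : hcont f y a b -> hcont h y a b -> hcont (fun z => f z + h z) y a b.
Proof. exact: (@seg_contD R (fun t => f (t +i* y)) (fun t => h (t +i* y))). Qed.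

Lemma hcontZ k h y a b : hcont h y a b -> hcont (fun z => k * h z) y a b.
Proof. exact: (@seg_contZ R k (fun t => h (t +i* y))). Qed.

Lemma hint_psum (s : nat -> C -> C) y a b N : a <= b -> (forall n, hcont (s n) y a b) ->
  hcont (fun z => psum (s^~ z) N) y a b /\
  hint (fun z => psum (s^~ z) N) y a b = \sum_(n < N) hint (s n) y a b.
Proof.
move=> ab cs; elim: N => [|N [IHc IH]].
  have -> : (fun z => psum (s^~ z) 0) = (fun=> 0) by apply/funext => z; exact: psum0.
  by split; [exact: seg_cont_cst|rewrite /hint cint_cst// mulr0 big_ord0].
have -> : (fun z => psum (s^~ z) N.+1) = (fun z => psum (s^~ z) N + s N z).
  by apply/funext => z; rewrite psumS.
split; first exact: hcontD.
by rewrite hintD// IH big_ord_recr.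
Qed.

(** The line is moved up for m > 0 and down for m < 0, where the integrand becomes arbitrarily
    small. *)
Lemma hint_qpow_eq0 (m : int) y a : m != 0 -> hint (qpow m) y a (a + 1) = 0.
Proof.
move=> m0; apply: small_normc_eq0 => e e0.
have e2 : 0 < e / 2 by rewrite divr_gt0.
have [Y HY] : exists Y, forall x, normc (qpow m (x +i* Y)) <= e / 2.
  case: m m0 => n n0.
    have n0' : (0 < n)%N by rewrite lt0n.
    have [Y HY] := qexp_small e2; exists (Num.max Y 0) => x.
    rewrite qpow_nat normcX.
    have h1 : normc (qexp (x +i* Num.max Y 0)) < e / 2 by apply: HY; rewrite /= le_max lexx.
    have h2 : normc (qexp (x +i* Num.max Y 0)) <= 1.
      by rewrite normc_qexp expR_le1 oppr_le0 mulr_ge0// ?(ltW (pi2_gt0 R))//= le_max lexx orbT.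
    by rewrite (le_trans _ (ltW h1))// -[leRHS]expr1 ler_wiXn2l// normc_ge0.
  have M0 : 0 < 1 + (e / 2)^-1 by rewrite addr_gt0// invr_gt0.
  have [Y HY] := qexp_large M0.
  exists Y => x; rewrite NegzE qpow_natN normcV normcX.
  have h1 := HY (x +i* Y) (lexx _).
  have h2 : 1 <= normc (qexp (x +i* Y)).
    by rewrite (le_trans _ (ltW h1))// lerDl ltW// invr_gt0.
  have h3 : (e / 2)^-1 <= normc (qexp (x +i* Y)) ^+ n.+1.
    rewrite (@le_trans _ _ (normc (qexp (x +i* Y))))//.
      by rewrite (le_trans _ (ltW h1))// lerDr.
    by rewrite -[leLHS]expr1 ler_weXn2l.
  rewrite -[leRHS]invrK lef_pV2// posrE ?invr_gt0//.
  by rewrite (lt_le_trans _ h3)// invr_gt0.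
rewrite (@hint_const_hol _ (qpow m) a (Num.min y Y - 1) y Y).
- rewrite (le_trans (@normc_hint _ _ _ _ (e / 2) _ _))//; last by lra.
  apply: (@hol_hcont _ _ (Y - 1)); last by rewrite ltrBlDr ltrDl.
  by move=> z; exact: qpow_hol.
- by move=> z; exact: qpow_hol.
- exact: qpow_per.
- by rewrite ltrBlDr ltr_pwDr// ge_min lexx.
- by rewrite ltrBlDr ltr_pwDr// ge_min lexx orbT.
Qed.

Definition Jsum q w N := psum (sterm q w) N + psum (sterm q w^-1) N - 1.

Lemma Jth_tail q (r : R) : normc q < 1 -> 1 <= r -> exists2 K, 0 < K &
  forall w N, normc w <= r -> normc w^-1 <= r -> normc (Jsum q w N - Jth q w) <= K * (1 / 4) ^+ N.
Proof.
move=> q1 r1; have [||K K0 HK] := @square_exp_dominated _ (normc q) r.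
- by rewrite normc_ge0.
- by [].
exists (K / (1 - 1 / 4) + K / (1 - 1 / 4)).
  by rewrite addr_gt0// divr_gt0//; lra.
have D w : normc w <= r -> dominated (sterm q w) K (1 / 4).
  move=> wr n; rewrite /sterm normcM !normcX (le_trans _ (HK n))//.
  by rewrite ler_wpM2l ?exprn_ge0 ?normc_ge0// lerXn2r ?nnegrE ?normc_ge0// (le_trans _ r1).
move=> w N wr wr'.
have -> : Jsum q w N - Jth q w = - ((Sth q w - psum (sterm q w) N) + (Sth q w^-1 - psum (sterm q w^-1) N)).
  Transparent Jth. rewrite /Jth /Jsum. Opaque Jth.
  move: (Sth _ _) (Sth _ _) (psum _ _) (psum _ _) => a b c d; ring.
rewrite normcN' (le_trans (ler_normcD _ _))// mulrDl lerD//.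
  by rewrite mulrAC; apply: csum_bound; [exact: ltW|exact: quarter01|exact: D].
by rewrite mulrAC; apply: csum_bound; [exact: ltW|exact: quarter01|exact: D].
Qed.

Lemma hint_Jth_qexp q a : normc q < 1 -> hint (fun u => Jth q (qexp u)) 0 a (a + 1) = 1.
Proof.
move=> q1; have a1 : a <= a + 1 by rewrite lerDl.
have eJ := entire_Jth (2 * pi%:C * 'i) q1.
have [K K0 HK] := Jth_tail q1 (lexx 1).
have nq x : normc (qexp (x +i* 0)) = 1 by rewrite normc_qexp /= mulr0 oppr0 expR0.
have cq (m : int) : hcont (qpow m) 0 a (a + 1).
  by apply: (@hol_hcont _ _ (-1)); [move=> z; exact: qpow_hol|rewrite ltrN10].
have st (k : C) (m : int) : hcont (fun u => k * qpow m u) 0 a (a + 1) by exact: hcontZ.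
have stE n : (fun u => sterm q (qexp u) n) = (fun u => q ^+ (n * n) * qpow n%:Z u).
  by apply/funext => u; rewrite qpow_nat.
have stEN n : (fun u => sterm q (qexp u)^-1 n) = (fun u => q ^+ (n * n) * qpow (- n%:Z) u).
  by apply/funext => u; rewrite qpow_natN /sterm exprVn.
have c1 n : hcont (fun u => sterm q (qexp u) n) 0 a (a + 1) by rewrite stE.
have c2 n : hcont (fun u => sterm q (qexp u)^-1 n) 0 a (a + 1) by rewrite stEN.
have q0 y : hint (qpow 0) y a (a + 1) = 1.
  have -> : qpow 0 = (fun=> 1 : C) by apply/funext => z; rewrite qpow_nat expr0.
  by rewrite /hint cint_cst// addrAC subrr add0r mulr1.
have S1 N : \sum_(n < N.+1) hint (fun u => sterm q (qexp u) n) 0 a (a + 1) = 1.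
  rewrite big_ord_recl /= stE hintZ// q0 mulr1 expr0 big1 ?addr0// => i _.
  by rewrite stE hintZ// hint_qpow_eq0// mulr0.
have S2 N : \sum_(n < N.+1) hint (fun u => sterm q (qexp u)^-1 n) 0 a (a + 1) = 1.
  rewrite big_ord_recl /= stEN hintZ// oppr0 q0 mulr1 expr0 big1 ?addr0// => i _.
  by rewrite stEN hintZ// hint_qpow_eq0 ?mulr0// oppr_eq0.
have H1 N := hint_psum N a1 c1.
have H2 N := hint_psum N a1 c2.
have cJ N : hcont (fun u => Jsum q (qexp u) N) 0 a (a + 1).
  by apply: hcontD; [apply: hcontD; [exact: (H1 N).1|exact: (H2 N).1]|exact: seg_cont_cst].
have hJ : hcont (fun u => Jth q (qexp u)) 0 a (a + 1) by exact: entire_hcont.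
apply: (@seq_lim_unique _ (fun N => hint (fun u => Jsum q (qexp u) N) 0 a (a + 1))).
  apply: hint_unif_lim => // e e0.
  have [N HN] := pow_small (quarter01 R) (divr_gt0 e0 K0).
  exists N => n x Nn _; have n1 : normc (qexp (x +i* 0))^-1 <= 1 by rewrite normcV nq invr1.
  have n2 : normc (qexp (x +i* 0)) <= 1 by rewrite nq.
  by apply: (le_trans (HK _ n n2 n1)); rewrite mulrC -ler_pdivlMr// HN.
apply: (@eq_seq_lim _ (fun=> 1) _ _ 1%N); last exact: seq_lim_cst.
case=> // N _; rewrite /Jsum hintD; last 2 first.
- by apply: hcontD; [exact: (H1 N.+1).1|exact: (H2 N.+1).1].
- exact: seg_cont_cst.
rewrite hintD; [|exact: (H1 N.+1).1|exact: (H2 N.+1).1].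
transitivity (1 + 1 + (-1 : C)); first by rewrite addrK.
congr (_ + _ + _); apply: esym; first exact: etrans (H1 N.+1).2 (S1 N).
  exact: etrans (H2 N.+1).2 (S2 N).
apply: etrans (hint_cst _ _ a1) _.
have -> : a + 1 - a = 1 by ring.
by rewrite rmorph1 mul1r.
Qed.

Definition gauss t u : C := cexp (- (pi * t)%:C * u ^+ 2).

Lemma entire_gauss t : entire (gauss t).
Proof.
apply: (entire_comp entire_cexp); apply: entireZ.
by apply: (@eq_entire (fun u => u * u)) => [u|]; [rewrite expr2|apply: entireM; exact: entire_id].
Qed.

Lemma gauss_shift t n u : gauss t (u + n%:R) =
  gauss t u * sterm (cexp (- (pi * t)%:C)) (cexp (- (2 * (pi * t)%:C) * u)) n.
Proof.
rewrite /gauss /sterm -!cexpMn -!cexpD natrM; congr cexp.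
by move: ((pi * t)%:C) => A; ring.
Qed.

Lemma gauss_shiftN t n u : gauss t (u - n%:R) =
  gauss t u * sterm (cexp (- (pi * t)%:C)) (cexp (- (2 * (pi * t)%:C) * u))^-1 n.
Proof.
rewrite /gauss /sterm -cexpN -!cexpMn -!cexpD natrM; congr cexp.
by move: ((pi * t)%:C) => A; ring.
Qed.

Lemma gauss_real t x : gauss t (x +i* 0) = (expR (- (pi * t * x ^+ 2)))%:C.
Proof. by rewrite -cexpR /gauss; congr cexp; rewrite !expr2 !rmorphN !rmorphM /= mulNr. Qed.

(** Normalisation of the normal density of variance 1 / (2 pi t). The interval is the one covered by
    the translates of [a, a + 1] by -(N - 1), ..., N - 1. *)
Lemma gauss_integral t a : 0 < t ->
  seq_lim (fun N => hint (gauss t) 0 (a + 1 - N%:R) (a + N%:R)) (Num.sqrt t)^-1%:C.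
Proof.
move=> t0; pose s := (Num.sqrt (2 * pi * t))^-1.
have p0 : 0 < 2 * pi * t by rewrite mulr_gt0// pi2_gt0.
have s0 : s != 0 by rewrite invr_eq0 sqrtr_eq0 -ltNge.
have s2 : s ^+ 2 = (2 * pi * t)^-1 by rewrite exprVn sqr_sqrtr// ltW.
have pt : 0 < Num.sqrt t by rewrite sqrtr_gt0.
have tn0 : t != 0 by rewrite gt_eqF.
have pi0 : pi != 0 :> R by rewrite gt_eqF// pi_gt0.
have HE1 (P T : R) : P != 0 -> T != 0 -> (2 * P * T)^-1 * P *+ 2 = T^-1.
  by move=> P0 T0; rewrite -mulr_natr; field; rewrite ?P0 ?T0.
have HE2 (P T X : R) : P != 0 -> T != 0 -> - (P * T * X ^+ 2) = - X ^+ 2 / ((2 * P * T)^-1 *+ 2).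
  by move=> P0 T0; rewrite -mulr_natr; field; rewrite ?P0 ?T0.
have nE x : expR (- (pi * t * x ^+ 2)) = (Num.sqrt t)^-1 * normal_pdf 0 s x.
  rewrite normal_pdfE// /normal_peak /normal_fun subr0 s2.
  have -> : (2 * pi * t)^-1 * pi *+ 2 = t^-1.
    by rewrite (HE1 _ _ pi0 tn0).
  rewrite sqrtrV ?ltW// invrK mulrA mulVf ?gt_eqF// mul1r; congr expR.
  by rewrite (HE2 _ _ _ pi0 tn0).
pose F N := `[a + 1 - N%:R, a + N%:R]%classic : set R.
have LF : (fun N => \int[mu]_(x in F N) (normal_pdf 0 s x)%:E)%E @ \oo --> (1%:E : \bar R).
  rewrite -(integral_normal_pdf 0 s).
  have -> : [set: R] = \bigcup_N F N.
    apply/seteqP; split=> // x _.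
    exists (Num.bound `|x - a|).+1 => //; rewrite /F /= in_itv /=.
    have := archi_boundP (normr_ge0 (x - a)).
    rewrite ltr_norml -[(Num.bound _).+1]addn1 natrD => /andP[]; lra.
  apply: ge0_nondecreasing_set_cvg_integral.
  - move=> m n mn; rewrite subsetEset => x; rewrite /F /= !in_itv /= => /andP[h1 h2].
    by rewrite (le_trans _ h1) ?(le_trans h2)// ?lerD2l ?lerN2 ler_nat.
  - by move=> N; exact: measurable_itv.
  - move=> N; apply/measurable_realfun.measurable_EFinP; apply: measurable_funTS; exact: measurable_normal_pdf.
  - by move=> N x _; rewrite lee_fin normal_pdf_ge0.
have E N : hint (gauss t) 0 (a + 1 - N%:R) (a + N%:R) =
    ((Num.sqrt t)^-1 * fine (\int[mu]_(x in F N) (normal_pdf 0 s x)%:E)%E)%:C.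
  rewrite /hint /cint; apply: complex_ext => /=.
    rewrite -[fine _]/(Rintegral mu (F N) (normal_pdf 0 s)) -RintegralZl//.
      by apply: eq_Rintegral => x _; rewrite gauss_real /= nE.
      exact: measurable_itv.
    apply: (@integrableS _ _ _ mu setT (F N)) => //; first exact: measurable_itv.
    exact: integrable_normal_pdf.
  rewrite (_ : (fun x => complex.Im (gauss t (x +i* 0))) = cst 0); last first.
    by apply/funext => x; rewrite gauss_real.
  by rewrite Rintegral_cst// mul0r.
move=> e e0.
have ce : 0 < e * Num.sqrt t by rewrite mulr_gt0.
have /fine_cvgP[_] := LF.
move/cvgrPdist_le => /(_ _ ce)[N _ HN].
exists N => n Nn; rewrite E -rmorphB /= -[X in _ - X]mulr1 -mulrBr normcR normrM.
rewrite ger0_norm ?invr_ge0 ?sqrtr_ge0// mulrC ler_pdivrMr// distrC.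
exact: HN.
Qed.

Lemma hint_gauss_split t a b c : a <= c -> c <= b ->
  hint (gauss t) 0 a b = hint (gauss t) 0 a c + hint (gauss t) 0 c b.
Proof. by move=> ac cb; apply: cint_split => //; apply: entire_hcont; exact: entire_gauss. Qed.

Lemma hint_gauss_up t a N :
  \sum_(n < N) hint (gauss t) 0 (a + n%:R) (a + 1 + n%:R) = hint (gauss t) 0 a (a + N%:R).
Proof.
elim: N => [|N IH]; first by rewrite big_ord0 addr0 /hint cint_point.
rewrite big_ord_recr /= IH -hint_gauss_split ?lerDl//; first by rewrite -addrA -natr1 [1 + _]addrC.
by rewrite lerD2r lerDl.
Qed.

Lemma hint_gauss_down t a N :
  \sum_(n < N) hint (gauss t) 0 (a - n%:R) (a + 1 - n%:R) = hint (gauss t) 0 (a + 1 - N%:R) (a + 1).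
Proof.
elim: N => [|N IH]; first by rewrite big_ord0 subr0 /hint cint_point.
have e1 : a - N%:R = a + 1 - N.+1%:R by rewrite -natr1; ring.
rewrite big_ord_recr /= IH e1 addrC -hint_gauss_split//.
  by rewrite -e1 lerD2r lerDl.
by rewrite lerBlDr lerDl.
Qed.

(* The sum over all integers n of [gauss t (u + n)], after expanding the square. *)
Definition gtheta t u : C :=
  gauss t u * Jth (cexp (- (pi * t)%:C)) (cexp (- (2 * (pi * t)%:C) * u)).

Lemma normc_cexpNR (x : R) : normc (cexp (- x%:C)) = expR (- x).
Proof. by rewrite -rmorphN cexpR normcR ger0_norm// expR_ge0. Qed.

Lemma normc_nomeR t : 0 < t -> normc (cexp (- (pi * t)%:C) : C) < 1.
Proof. by move=> t0; rewrite normc_cexpNR expR_lt1 oppr_lt0 mulr_gt0// pi_gt0. Qed.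

Lemma entire_gtheta t : 0 < t -> entire (gtheta t).
Proof. by move=> t0; apply: entireM; [exact: entire_gauss|apply: entire_Jth; exact: normc_nomeR]. Qed.

Lemma gtheta_per t u : 0 < t -> gtheta t (u + 1) = gtheta t u.
Proof.
move=> t0; rewrite /gtheta (gauss_shift t 1).
set q := cexp _; have q1 : normc q < 1 by exact: normc_nomeR.
set w := cexp _.
have -> : cexp (- (2 * (pi * t)%:C) * (u + 1)) = q ^+ 2 * w.
  by rewrite -cexpMn -cexpD; congr cexp; move: ((pi * t)%:C) => A; ring.
have q0 : q != 0 by exact: cexp_neq0.
have w0 : w != 0 by exact: cexp_neq0.
rewrite (Jth_shift q1 q0 w0) /sterm !expr1.
by move: (gauss t u) (Jth q w) => A B; field; rewrite q0 w0.
Qed.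

(** Unfolding: the translates of the Gaussian over one period make up the Gaussian over the whole
    line. Both half sums contain the index 0, hence the subtracted copy. *)
Lemma hint_gtheta t a : 0 < t -> hint (gtheta t) 0 a (a + 1) = (Num.sqrt t)^-1%:C.
Proof.
move=> t0; have a1 : a <= a + 1 by rewrite lerDl.
have q1 := normc_nomeR t0; set q := cexp _ in q1.
pose w u : C := cexp (- (2 * (pi * t)%:C) * u).
have ew : entire w by apply: (entire_comp entire_cexp); apply: entireZ; exact: entire_id.
pose r := expR (2 * pi * t * (`|a| + 1)).
have r1 : 1 <= r.
  by rewrite -expR0 ler_expR mulr_ge0 ?addr_ge0// mulr_ge0 ?(ltW t0)// ltW ?pi2_gt0.
have [K K0 HK] := Jth_tail q1 r1.
have nw x : a <= x <= a + 1 -> normc (w (x +i* 0)) <= r /\ normc (w (x +i* 0))^-1 <= r.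
  move=> /andP[ax xa]; rewrite normcV normc_cexp -expRN.
  have -> : complex.Re (- (2 * (pi * t)%:C) * (x +i* 0)) = - (2 * pi * t * x).
    rewrite mulNr cReN; have -> : 2 * (pi * t)%:C = (2 * pi * t)%:C :> C.
      by rewrite !rmorphM /= rmorph_nat mulrA.
    by rewrite cReRM.
  have c0 : 0 <= 2 * pi * t by rewrite mulr_ge0 ?(ltW t0)// ltW ?pi2_gt0.
  have : `|x| <= `|a| + 1 by rewrite ler_norml; move: (ler_norm a) (ler_norm (- a)); rewrite normrN; lra.
  rewrite ler_norml => /andP[h1 h2].
  rewrite !ler_expR opprK; split; last exact: ler_wpM2l.
  by rewrite -mulrN; apply: ler_wpM2l => //; rewrite lerNl.
have cg (c : C) : hcont (fun u => gauss t (u + c)) 0 a (a + 1).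
  apply: entire_hcont; apply: (entire_comp (entire_gauss t)).
  by apply: entireD; [exact: entire_id|exact: entire_cst].
have H1 N := hint_psum N a1 (fun n => cg n%:R).
have H2 N := hint_psum N a1 (fun n => cg (- n%:R)).
have PE N : (fun u => gauss t u * Jsum q (w u) N) =
    (fun u => psum (fun n => gauss t (u + n%:R)) N + psum (fun n => gauss t (u - n%:R)) N + -1 * gauss t u).
  apply/funext => u; rewrite /Jsum.
  have -> : (fun n => gauss t (u + n%:R)) = (fun n => gauss t u * sterm q (w u) n).
    by apply/funext => n; rewrite gauss_shift.
  have -> : (fun n => gauss t (u - n%:R)) = (fun n => gauss t u * sterm q (w u)^-1 n).
    by apply/funext => n; rewrite gauss_shiftN.
  apply: esym; apply: etrans (congr2 (fun A B : C => A + B + -1 * gauss t u)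
    (psumZ (gauss t u) (sterm q (w u)) N) (psumZ (gauss t u) (sterm q (w u)^-1) N)) _.
  move: (psum (sterm q (w u)) N) (psum (sterm q (w u)^-1) N) (gauss t u) => A B D; ring.
have cg0 : hcont (gauss t) 0 a (a + 1) by apply: entire_hcont; exact: entire_gauss.
have c12 N := hcontD (H1 N).1 (H2 N).1.
have cP N : hcont (fun u => gauss t u * Jsum q (w u) N) 0 a (a + 1).
  by rewrite PE; apply: hcontD; [exact: c12|exact: hcontZ].
apply: (@seq_lim_unique _ (fun N => hint (fun u => gauss t u * Jsum q (w u) N) 0 a (a + 1))).
  apply: hint_unif_lim; [exact: cP|by apply: entire_hcont; exact: entire_gtheta|].
  move=> e e0; have [N HN] := pow_small (quarter01 R) (divr_gt0 e0 K0).
  exists N => n x Nn xa; have [w1 w2] := nw x xa.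
  rewrite /gtheta -mulrBr normcM gauss_real normcR ger0_norm ?expR_ge0//.
  have h := HK _ n w1 w2.
  have g1 : expR (- (pi * t * x ^+ 2)) <= 1.
    by rewrite expR_le1 oppr_le0 mulr_ge0 ?sqr_ge0// mulr_ge0 ?(ltW t0)// pi_ge0.
  rewrite (le_trans (ler_piMl (normc_ge0 _) g1))// (le_trans h)//.
  by rewrite mulrC -ler_pdivlMr// HN.
apply: (@eq_seq_lim _ _ _ _ 1%N _ (gauss_integral a t0)) => N N1.
rewrite PE.
have E1 : \sum_(n < N) hint (fun u => gauss t (u + n%:R)) 0 a (a + 1) = hint (gauss t) 0 a (a + N%:R).
  rewrite -hint_gauss_up; apply: eq_bigr => n _.
  by rewrite -(hint_shift _ n%:R a1 (entire_gauss t)) rmorph_nat.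
have E2 : \sum_(n < N) hint (fun u => gauss t (u - n%:R)) 0 a (a + 1) = hint (gauss t) 0 (a + 1 - N%:R) (a + 1).
  rewrite -hint_gauss_down; apply: eq_bigr => n _.
  by rewrite -(hint_shift _ (- n%:R) a1 (entire_gauss t)) rmorphN /= rmorph_nat.
apply: esym; apply: etrans (hintD (c12 N) (hcontZ (-1) cg0)) _.
rewrite (hintZ (-1) cg0).
apply: etrans (congr1 (fun X => X + -1 * hint (gauss t) 0 a (a + 1)) (hintD (H1 N).1 (H2 N).1)) _.
apply: etrans (congr1 (fun X => X + _ + -1 * hint (gauss t) 0 a (a + 1)) (etrans (H1 N).2 E1)) _.
apply: etrans (congr1 (fun X => _ + X + -1 * hint (gauss t) 0 a (a + 1)) (etrans (H2 N).2 E2)) _.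
have N1' : 1 <= N%:R :> R by rewrite ler1n.
rewrite (@hint_gauss_split t a (a + N%:R) (a + 1))//; last by rewrite lerD2l.
rewrite (@hint_gauss_split t (a + 1 - N%:R) (a + N%:R) (a + 1))//; last 2 first.
- by rewrite lerBlDr lerDl.
- by rewrite lerD2l.
move: (hint _ _ _ _) (hint _ _ _ _) (hint _ _ _ _) => A B D; ring.
Qed.

End ThetaIntegrals.

(** * The inversion formula *)

Section ThetaInversion.
Variable R : realType.
Notation C := R[i].
Implicit Types (q w z u k l : C) (m n N : nat) (a b c x y t : R) (h : C -> C).
Opaque qprod phi Jth qpoch cexp qexp.

Lemma Re_sqrtc_ge0 z : 0 <= complex.Re (sqrtc z).
Proof. by case: z => a b; rewrite /sqrtc /= sqrtr_ge0. Qed.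

Lemma Re_sqrtc_gt0 z : 0 < complex.Re z -> 0 < complex.Re (sqrtc z).
Proof.
case: z => a b /= a0; rewrite sqrtr_gt0 divr_gt0// ltr_wpDl ?sqrtr_ge0//.
Qed.

Lemma sqrtcR x : 0 <= x -> sqrtc x%:C = (Num.sqrt x)%:C.
Proof. by move=> x0; rewrite sqrtc_sqrtr// lecR. Qed.

(** With s = sqrtc z and S = sqrtc (z + h) one has h = (S - s) (S + s), and |S + s| >= Re s because
    Re S >= 0; so continuity of S is not assumed but comes out of the estimate. *)
Lemma cderiv_sqrtc z : 0 < complex.Re z -> exists d, cderiv (@sqrtc R) z d.
Proof.
move=> z0; have s0 := Re_sqrtc_gt0 z0; set s := sqrtc z in s0.
set p := complex.Re s in s0.
have sn0 : s != 0 by apply: contraTneq s0 => s0; rewrite /p s0 ltxx.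
have ps : p <= normc s by rewrite (le_trans (ler_norm _))// ler_Re_normc.
exists (2 * s)^-1 => e e0; exists (e * (2 * p ^+ 3)) => [|h he].
  by rewrite !mulr_gt0// exprn_gt0.
set S := sqrtc (z + h).
have pS : p <= normc (S + s).
  rewrite (le_trans _ (le_trans (ler_norm _) (ler_Re_normc _)))// cReD lerDr.
  exact: Re_sqrtc_ge0.
have S0 : S + s != 0 by rewrite -normc_gt0 (lt_le_trans s0).
have hE : h = (S - s) * (S + s) by rewrite -subr_sqr !sqr_sqrtc addrAC subrr add0r.
have n2 : normc (2 : C) = 2 by rewrite -(rmorph_nat (real_complex R)) normcR ger0_norm.
have -> : S - s - (2 * s)^-1 * h = - (h * h) / (2 * s * (S + s) ^+ 2).
  have t0 : 2 != 0 :> C by rewrite pnatr_eq0.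
  by rewrite hE; field; rewrite ?S0 ?sn0.
rewrite normcM normcN' normcV [normc (h * h)]normcM [normc (2 * s * _)]normcM [normc (2 * s)]normcM n2 normcX mulrAC.
have P0 : 0 < 2 * p ^+ 3 by rewrite mulr_gt0// exprn_gt0.
rewrite ler_wpM2r ?normc_ge0//.
have P1 : 2 * p ^+ 3 <= 2 * normc s * normc (S + s) ^+ 2.
  rewrite exprS mulrA ler_pM ?mulr_ge0 ?(ltW s0)// ?exprn_ge0 ?(ltW s0)// ?ler_pM2l//.
  by rewrite lerXn2r ?nnegrE ?normc_ge0// ltW.
rewrite ler_pdivrMr; last exact: lt_le_trans P1.
by rewrite (le_trans (ltW he))// ler_wpM2l// ltW.
Qed.

(** The second functional equation besides period 1: the theta factor is unchanged, since its
    exponent moves by 2 pi i, and the Gaussian acquires an exponential. [Jth_qexp_shift] is the same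
    equation for the other side of [gtheta_eq]. *)
Lemma gtheta_shift t u : 0 < t ->
  gtheta t (u - 'i * (t^-1)%:C) = qexp u / cexp (- (pi / t)%:C) * gtheta t u.
Proof.
move=> t0; have tn0 : t%:C != 0 :> C by rewrite -normc_gt0 normcR normr_gt0 gt_eqF.
have i2 : 'i ^+ 2 = -1 :> C by rewrite sqr_i.
rewrite /gtheta.
have -> : cexp (- (2 * (pi * t)%:C) * (u - 'i * (t^-1)%:C)) = cexp (- (2 * (pi * t)%:C) * u) :> C.
  have -> : - (2 * (pi * t)%:C) * (u - 'i * (t^-1)%:C) = - (2 * (pi * t)%:C) * u + 2 * pi%:C * 'i :> C.
    by rewrite rmorphM fmorphV /=; field; rewrite tn0.
  by rewrite cexpD cexp_2pii mulr1.
rewrite [RHS]mulrA; congr (_ * _).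
Transparent qexp. rewrite /gauss /qexp. Opaque qexp.
rewrite -cexpN -!cexpD; congr cexp.
rewrite !rmorphM fmorphV /=.
have -> : (u - 'i / t%:C) ^+ 2 = u ^+ 2 - 2 * u * 'i / t%:C + 'i ^+ 2 / t%:C ^+ 2 by field; rewrite tn0.
by rewrite i2; field; rewrite tn0.
Qed.

Lemma Jth_qexp_shift t u : 0 < t ->
  Jth (cexp (- (pi / t)%:C)) (qexp (u - 'i * (t^-1)%:C)) =
  qexp u / cexp (- (pi / t)%:C) * Jth (cexp (- (pi / t)%:C)) (qexp u).
Proof.
move=> t0; have t'0 : 0 < t^-1 by rewrite invr_gt0.
set q := cexp _; have q1 : normc q < 1 by exact: normc_nomeR.
have q0 : q != 0 by exact: cexp_neq0.
set w := qexp (u - _).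
have w0 : w != 0 by exact: qexp_neq0.
have E : qexp u = q ^+ 2 * w.
  Transparent qexp. rewrite /w /q /qexp. Opaque qexp.
  rewrite -cexpMn -cexpD; congr cexp.
  have i2 : 'i * 'i = -1 :> C by rewrite -expr2 sqr_i.
  rewrite rmorphM /=; have -> : 2 * pi%:C * 'i * (u - 'i * (t^-1)%:C) = 2 * pi%:C * 'i * u - 2 * pi%:C * ('i * 'i) * (t^-1)%:C by ring.
  by rewrite i2; ring.
rewrite E Jth_shift//; move: (Jth q w) => A; field; by rewrite q0 w0.
Qed.

Opaque gtheta.
(** The two functional equations give a two-term recursion for the Fourier coefficients [K m] of the
    difference E of both sides, and the choice of the constant k makes [K 0] vanish. *)
Lemma gtheta_eq t u : 0 < t ->
  gtheta t u = (Num.sqrt t)^-1%:C * Jth (cexp (- (pi / t)%:C)) (qexp u).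
Proof.
move=> t0; set k := (Num.sqrt t)^-1%:C; set q := cexp _.
have t'0 : 0 < t^-1 by rewrite invr_gt0.
have q1 : normc q < 1 by exact: normc_nomeR.
have q0 : q != 0 by exact: cexp_neq0.
pose G u := Jth q (qexp u).
have eG : entire G.
  have := entire_Jth (2 * pi%:C * 'i) q1.
  Transparent qexp. exact. Opaque qexp.
pose E u := gtheta t u + - k * G u.
have eE : entire E by apply: entireD; [exact: entire_gtheta|exact: entireZ].
have pE u' : E (u' + 1) = E u' by rewrite /E /G qexpD1 (gtheta_per _ t0).
have sE u' : E (u' - 'i * (t^-1)%:C) = qexp u' / q * E u'.
  rewrite /E gtheta_shift// /G Jth_qexp_shift// -/q.
  by move: (gtheta t u') (Jth q (qexp u')) => A B; ring.
pose K (m : int) a y := hint (fun z => E z * qpow m z) y a (a + 1).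
have hK (m : int) Y : hol_above (fun z => E z * qpow m z) Y.
  by apply: hol_above_M; [exact: entire_hol|move=> z; exact: qpow_hol].
have pK (m : int) Y : per_above (fun z => E z * qpow m z) Y.
  by apply: per_above_M; [move=> z _; exact: pE|exact: qpow_per].
have Ky (m : int) a y y' : K m a y = K m a y'.
  apply: (@hint_const_hol _ _ a (Num.min y y' - 1)); [exact: hK|exact: pK|..].
    by rewrite ltrBlDr ltr_pwDr// ge_min lexx.
  by rewrite ltrBlDr ltr_pwDr// ge_min lexx orbT.
(* Moving the line of integration down by 1 / t relates the coefficients of index m and m + 1. *)
have Ks (m : int) a y : K m a y = qpow m (- ('i * (t^-1)%:C)) / q * K (m + 1) a y.
  rewrite [LHS](Ky m a y (y - t^-1)) /K -hintZ; last first.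
    by apply: entire_hcont => w; apply: (hK _ (complex.Im w - 1)); rewrite ltrBlDr ltrDl.
  apply: eq_cint => x _.
  have -> : x +i* (y - t^-1) = (x +i* y) - 'i * (t^-1)%:C.
    by apply: complex_ext => /=; ring.
  have qD z w : qpow m (z + w) = qpow m z * qpow m w by rewrite /qpow mulrDr qexpD.
  rewrite sE qD qpowD (qpow_nat 1) expr1.
  by move: (E _) (qexp _) (qpow m _) (qpow m _) => A B D F; ring.
have K0 a y : K 0 a y = 0.
  rewrite (Ky 0 a y 0) /K.
  have -> : (fun z => E z * qpow 0 z) = (fun z => gtheta t z + - k * G z).
    by apply/funext => z; rewrite qpow_nat expr0 mulr1.
  rewrite hintD; [|apply: entire_hcont; exact: entire_gtheta|by apply: hcontZ; exact: entire_hcont].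
  rewrite hintZ; last exact: entire_hcont.
  by rewrite hint_gtheta// /G hint_Jth_qexp// mulr1 subrr.
have Kn0 (m : int) : qpow m (- ('i * (t^-1)%:C)) / q != 0.
  by rewrite mulf_neq0 ?invr_eq0//; exact: qexp_neq0.
have KP m a y : K m%:Z a y = 0.
  elim: m => [|m IH]; first exact: K0.
  move/eqP: IH; rewrite Ks mulf_eq0 (negPf (Kn0 _)) /= => /eqP.
  by rewrite intS addrC.
have KN m a y : K (- m%:Z) a y = 0.
  elim: m => [|m IH]; first exact: K0.
  have e : - m.+1%:Z + 1 = - m%:Z by lia.
  by rewrite Ks e IH mulr0.
have : E u = 0.
  apply: (@fourier_eq0 _ E (complex.Im u - 1)).
  - exact: entire_hol.
  - by move=> z _; exact: pE.
  - by move=> m a y _; case: m => m; [exact: KP|rewrite NegzE; exact: KN].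
  - by rewrite ltrBlDr ltrDl.
by rewrite /E mulNr => /eqP; rewrite subr_eq0 => /eqP.
Qed.

Transparent gtheta.
Lemma th_inv_imaginary y : 0 < y -> th (0 +i* y^-1) = (Num.sqrt y)%:C * th (0 +i* y).
Proof.
move=> y0; have := gtheta_eq 0 y0.
rewrite /gtheta /gauss expr2 !mulr0 cexp0 mul1r qexp0.
have E x : pi%:C * 'i * (0 +i* x) = - (pi * x)%:C.
  by rewrite rmorphM /=; apply: complex_ext => /=; ring.
rewrite /th !E -!phiJ => ->; rewrite mulrA -rmorphM /= divff ?rmorph1 ?mul1r//.
by rewrite gt_eqF// sqrtr_gt0.
Qed.

Lemma Im_inv z : complex.Im (- z^-1) = complex.Im z / normc z ^+ 2.
Proof. by rewrite normc_sqr; case: z => a b /=; rewrite opprK. Qed.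

Lemma Im_neq0 z : 0 < complex.Im z -> z != 0.
Proof. by apply: contraTneq => ->; rewrite ltxx. Qed.

Lemma Im_inv_gt0 z : 0 < complex.Im z -> 0 < complex.Im (- z^-1).
Proof. by move=> z0; rewrite Im_inv divr_gt0// exprn_gt0// normc_gt0 Im_neq0. Qed.

Opaque th.
(** Both sides are holomorphic and agree on the imaginary axis, where the formula is [gtheta_eq] at
    u = 0. *)
Lemma th_inv z : 0 < complex.Im z -> th (- z^-1) = sqrtc (- 'i * z) * th z.
Proof.
pose h z := th (- z^-1) + -1 * (sqrtc (- 'i * z) * th z).
move=> z0; suff : h z = 0 by rewrite /h mulN1r => /eqP; rewrite subr_eq0 => /eqP.
apply: imaginary_eq0 => // [w w0|y y0].
  have [d1 D1] := cderiv_th (Im_inv_gt0 w0).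
  have D2 := cderiv_comp (cderivZ (-1) (cderivV (Im_neq0 w0) (cderiv_id w))).
  rewrite -[- w^-1]mulN1r in D1; have {}D2 := D2 _ _ D1.
  have rw : 0 < complex.Re (- 'i * w) by rewrite mulNr cReN cReM cRei cImi mul0r mul1r sub0r opprK.
  have [d3 D3] := cderiv_sqrtc rw.
  have D4 := cderiv_comp (cderivZ (- 'i) (cderiv_id w)) D3.
  have [d5 D5] := cderiv_th w0.
  have D6 := cderivD D2 (cderivZ (-1) (cderivM D4 D5)).
  eexists; apply: (cderiv_ext ltr01 _ D6) => k _.
  by rewrite /h [in LHS](mulN1r (w + k)^-1).
have e1 : - (0 +i* y)^-1 = 0 +i* y^-1 :> C.
  by apply: complex_ext => /=; rewrite ?mul0r ?oppr0// expr0n add0r opprK expr2 invfM mulrA divff ?mul1r// gt_eqF.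
have e2 : sqrtc (- 'i * (0 +i* y)) = (Num.sqrt y)%:C :> C.
  by rewrite -sqrtcR ?ltW//; congr sqrtc; apply: complex_ext => /=; ring.
rewrite /h e1 e2 (th_inv_imaginary y0).
by rewrite (mulN1r ((Num.sqrt y)%:C * th (0 +i* y))) subrr.
Qed.

End ThetaInversion.

(** * Quadratic reciprocity and the Kronecker symbol *)

Module QuadraticReciprocity.
Import all_fingroup finfield.

Section Legendre.
Variable p : nat.
Hypotheses (p_pr : prime p) (p_odd : odd p).
Notation F := 'F_p.
Implicit Types (a b : int) (m n : nat).

Lemma pcharFp : p \in [pchar F]. Proof. exact: pchar_Fp. Qed.

Lemma Fp_nat_eq0 n : ((n%:R : F) == 0) = (p %| n)%N.
Proof. by rewrite (dvdn_pcharf pcharFp). Qed.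

Lemma Fp_int_eq0 a : ((a%:~R : F) == 0) = (p %| a)%Z.
Proof.
case: a => n; first exact: Fp_nat_eq0.
by rewrite NegzE rmorphN oppr_eq0 dvdzE abszN; exact: Fp_nat_eq0.
Qed.

Lemma Fp_int_eq a b : ((a%:~R : F) == b%:~R) = (a == b %[mod p])%Z.
Proof. by rewrite -subr_eq0 -rmorphB /= Fp_int_eq0 eqz_mod_dvd. Qed.

Lemma p_gt2 : (2 < p)%N.
Proof. by case: p p_pr p_odd => [|[|[|[|n]]]]. Qed.

Lemma half_p : p = (p./2).*2.+1.
Proof. by rewrite -{1}(odd_double_half p) p_odd. Qed.

Lemma Fp_two_neq0 : (2 : F) != 0.
Proof. by rewrite (Fp_nat_eq0 2); apply/negP => /dvdn_leq; move: p_gt2; lia. Qed.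

Lemma Fp_one_neqN1 : (1 : F) != -1.
Proof. by rewrite -subr_eq0 opprK; exact: Fp_two_neq0. Qed.

Lemma Fp_fermat (x : F) : x ^+ p = x.
Proof. by rewrite -[in RHS](expf_card x) card_Fp. Qed.

Lemma Fp_expf_half (x : F) : x != 0 -> x ^+ p./2 = 1 \/ x ^+ p./2 = -1.
Proof.
move=> x0; suff : (x ^+ p./2 == 1) || (x ^+ p./2 == -1) by case/orP => /eqP; [left|right].
rewrite -eqf_sqr expr1n -exprM muln2.
have xp := Fp_fermat x.
apply/eqP; apply: (mulfI x0); rewrite mulr1 -exprS -half_p; exact: xp.
Qed.

Lemma half_squares_uniq : uniq [seq (k.+1%:R : F) ^+ 2 | k <- iota 0 p./2].
Proof.
rewrite map_inj_in_uniq ?iota_uniq// => k l; rewrite !mem_iota => kp lp /eqP.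
rewrite eqf_sqr => /orP[].
  rewrite -subr_eq0; wlog kl : k l kp lp / (k <= l)%N.
    move=> H; case: (leqP k l) => [|/ltnW] kl e; first exact: H.
    by apply/esym/H => //; rewrite -oppr_eq0 opprB.
  rewrite -oppr_eq0 opprB -natrB// Fp_nat_eq0 => /dvdnP[[|j] e]; move: e half_p; nia.
rewrite -addr_eq0 -natrD Fp_nat_eq0 => /dvdn_leq; move: half_p; lia.
Qed.

(** The squares of 1, ..., (p - 1) / 2 are already (p - 1) / 2 distinct roots of X ^ ((p - 1) / 2) -
    1; another root would be one too many. *)
Lemma euler_square (x : F) : x != 0 -> x ^+ p./2 = 1 -> exists y : 'I_p, x = (y : nat)%:R ^+ 2.
Proof.
move=> x0 x1; case: (boolP (x \in [seq (k.+1%:R : F) ^+ 2 | k <- iota 0 p./2])).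
  case/mapP=> k; rewrite mem_iota => kp ->.
  have kp' : (k.+1 < p)%N by move: half_p; lia.
  by exists (Ordinal kp').
move=> xn; pose s := x :: [seq (k.+1%:R : F) ^+ 2 | k <- iota 0 p./2].
have P0 : 'X^(p./2) - 1%:P != 0 :> {poly F}.
  by rewrite -size_poly_eq0 size_XnsubC//; move: p_gt2; lia.
have := max_poly_roots (rs := s) P0.
have us : uniq s by rewrite /= xn half_squares_uniq.
have rs : all (root ('X^(p./2) - 1%:P)) s.
  apply/allP => y; rewrite rootE !hornerE subr_eq0 inE => /orP[/eqP->|]; first by rewrite x1.
  case/mapP => k; rewrite mem_iota => kp ->; rewrite -exprM mul2n.
  have k0 : (k.+1%:R : F) != 0.
    by rewrite Fp_nat_eq0; apply/negP => /dvdn_leq; move: half_p; lia.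
  apply/eqP/(mulfI k0); rewrite mulr1 -exprS -half_p.
  exact: Fp_fermat.
move=> /(_ rs us); rewrite size_XnsubC /= ?size_map ?size_iota ?ltnn//.
by move: p_gt2; lia.
Qed.

(** Euler's criterion. *)
Lemma legendreP a : ((legendre a p)%:~R : F) = a%:~R ^+ p./2.
Proof.
rewrite /legendre -Fp_int_eq0; case: eqVneq => [->|a0].
  by rewrite expr0n; move: p_gt2; case: p./2 (half_p) => //; lia.
case: existsP => [[x]|nx].
  rewrite -Fp_int_eq rmorphXn /= => /eqP ax.
  have x0 : ((x : nat)%:R : F) != 0 by apply: contraNneq a0 => x0; rewrite -ax -[_%:~R]/((x : nat)%:R) x0 expr0n.
  rewrite -ax -exprM mul2n; apply: (mulfI x0); rewrite mulr1 -exprS -half_p.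
  by rewrite Fp_fermat.
have [e|->//] := Fp_expf_half a0.
have [y ay] := euler_square a0 e; exfalso; apply: nx; exists y.
by rewrite -Fp_int_eq rmorphXn /= ay.
Qed.

Lemma legendre_cases a : [|| legendre a p == 0, legendre a p == 1 | legendre a p == -1].
Proof. by rewrite /legendre; case: ifP => // _; case: ifP. Qed.

(** As p > 2, the integers -1, 0 and 1 stay distinct in ['F_p], so identities between Legendre
    symbols can be checked there. *)
Lemma sign_Fp_inj a b : [|| a == 0, a == 1 | a == -1] -> [|| b == 0, b == 1 | b == -1] ->
  (a%:~R : F) = b%:~R -> a = b.
Proof.
have n1 := Fp_one_neqN1; have n0 := oner_neq0 F.
have n2 : (-1 : F) != 0 by rewrite oppr_eq0.
case/or3P => /eqP ->; case/or3P => /eqP -> //; rewrite ?rmorphN ?rmorph1 ?rmorph0 => /eqP;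
  by rewrite ?(negPf n1) ?(negPf n0) ?(negPf n2) // eq_sym ?(negPf n1) ?(negPf n0) ?(negPf n2).
Qed.

Lemma legendreM a b : legendre (a * b) p = legendre a p * legendre b p.
Proof.
apply: sign_Fp_inj; first exact: legendre_cases.
  by case/or3P: (legendre_cases a) => /eqP->; case/or3P: (legendre_cases b) => /eqP->.
by rewrite rmorphM /= !legendreP rmorphM exprMn.
Qed.

Lemma legendre_mod a b : (a = b %[mod p])%Z -> legendre a p = legendre b p.
Proof.
move=> ab; apply: sign_Fp_inj; rewrite ?legendre_cases// !legendreP; congr (_ ^+ _).
by apply/eqP; rewrite Fp_int_eq; apply/eqP.
Qed.

Lemma legendreN1 : legendre (-1) p = (-1) ^+ p./2.
Proof.
apply: sign_Fp_inj; rewrite ?legendre_cases//.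
  by rewrite -signr_odd; case: odd.
by rewrite legendreP rmorphXn /= rmorphN.
Qed.

Section Gauss.
Variable a : nat.
Hypothesis pa : ~~ (p %| a)%N.

(** [s k] is the absolute value of the least absolute residue of a (k + 1), and [neg k] says that
    this residue is negative. *)
Let r (k : 'I_p./2) := ((a * k.+1) %% p)%N.
Let neg k := (p./2 < r k)%N.
Let s k := if neg k then (p - r k)%N else r k.

Lemma gauss_r_gt0 k : (0 < r k)%N.
Proof.
rewrite lt0n; have : ~~ (p %| a * k.+1)%N.
  rewrite Euclid_dvdM// negb_or pa /=; apply/negP => /dvdn_leq.
  by move: (ltn_ord k) half_p; lia.
by [].
Qed.

Lemma gauss_s_lt k : ((s k).-1 < p./2)%N.
Proof.
have r0 := gauss_r_gt0 k; have rp : (r k < p)%N by rewrite ltn_pmod// prime_gt0.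
by rewrite /s /neg; case: (ltnP p./2 (r k)) => h; move: half_p; lia.
Qed.

Let sg k : 'I_p./2 := Ordinal (gauss_s_lt k).

Lemma gauss_sE k : (sg k).+1 = s k.
Proof.
have r0 := gauss_r_gt0 k; have rp : (r k < p)%N by rewrite ltn_pmod// prime_gt0.
by rewrite /= /s /neg; case: (ltnP p./2 (r k)) => h; move: half_p; lia.
Qed.

Lemma gauss_sF (k : 'I_p./2) : (a%:R * k.+1%:R : F) = (-1) ^+ neg k * (sg k).+1%:R.
Proof.
have rp : (r k < p)%N by rewrite ltn_pmod// prime_gt0.
have rF : ((r k)%:R : F) = a%:R * k.+1%:R.
  rewrite -natrM [in RHS](divn_eq (a * k.+1) p) natrD natrM.
  by rewrite (_ : (p%:R : F) = 0) ?mulr0 ?add0r//; apply/eqP; rewrite Fp_nat_eq0.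
rewrite gauss_sE /s; case: (neg k); rewrite -?rF ?mul1r ?expr0//.
rewrite expr1 natrB 1?ltnW// (_ : (p%:R : F) = 0); last by apply/eqP; rewrite Fp_nat_eq0.
by rewrite sub0r mulN1r opprK.
Qed.

Lemma gauss_sg_inj : injective sg.
Proof.
have a0 : (a%:R : F) != 0 by rewrite Fp_nat_eq0.
move=> k l /(congr1 (fun i : 'I__ => (i.+1%:R : F))) e.
have : (a%:R * k.+1%:R : F) ^+ 2 = (a%:R * l.+1%:R) ^+ 2.
  by rewrite !gauss_sF e ![(_ * (_ : F)) ^+ 2]exprMn !sqrr_sign.
move=> /eqP; rewrite !exprMn (inj_eq (mulfI (expf_neq0 2 a0))) eqf_sqr => /orP[].
  rewrite -subr_eq0; wlog kl : k l {e} / (k <= l)%N.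
    move=> H; case: (leqP k l) => [|/ltnW] kl kl0; first exact: H.
    by apply/esym/H => //; rewrite -oppr_eq0 opprB.
  rewrite -oppr_eq0 opprB -natrB// Fp_nat_eq0 => /dvdnP[j ej]; apply: val_inj => /=.
  by case: j ej => [|j] ej; move: ej (ltn_ord l) half_p; nia.
rewrite -addr_eq0 -natrD Fp_nat_eq0 => /dvdn_leq; move: (ltn_ord k) (ltn_ord l) half_p; lia.
Qed.

Lemma gauss_sum_s : (\sum_k s k = \sum_(k < p./2) k.+1)%N.
Proof.
rewrite [RHS](reindex_inj gauss_sg_inj); apply: eq_bigr => k _; exact/esym/gauss_sE.
Qed.

(** The product of all a (k + 1) is computed in two ways; [sg] permutes the indices, so the factor
    ((p - 1) / 2)! cancels. *)
Lemma gauss_lemma : legendre a p = (-1) ^+ (\sum_(k < p./2) (p./2 < (a * k.+1) %% p))%N.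
Proof.
apply: sign_Fp_inj; first exact: legendre_cases.
  by rewrite -signr_odd; case: odd.
rewrite legendreP rmorphXn rmorphN /=.
pose W : F := \prod_(k < p./2) k.+1%:R.
have W0 : W != 0.
  apply/prodf_neq0 => k _; rewrite Fp_nat_eq0; apply/negP => /dvdn_leq.
  by move: (ltn_ord k) half_p; lia.
apply: (mulIf W0).
have -> : (a%:~R : F) ^+ p./2 * W = \prod_(k < p./2) (a%:R * k.+1%:R).
  by rewrite big_split /= prodr_const card_ord.
rewrite (eq_bigr _ (fun k _ => gauss_sF k)) big_split /=; congr (_ * _).
  by rewrite prodrXr.
by rewrite /W [RHS](reindex_inj gauss_sg_inj).
Qed.

(** Sum a (k + 1) = p floor(a (k + 1) / p) + r k modulo 2. As a and p are odd, r k has the parity of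
    s k, shifted by one when [neg k] holds, and the s k are a permutation of 1, ..., (p - 1) / 2. *)
Lemma eisenstein_lemma : odd a ->
  legendre a p = (-1) ^+ (\sum_(k < p./2) (a * k.+1) %/ p)%N.
Proof.
move=> a_odd; rewrite gauss_lemma -[RHS]signr_odd -signr_odd; congr (_ ^+ nat_of_bool _).
have E : odd (\sum_(k < p./2) (a * k.+1)) = odd (\sum_(k < p./2) (p * ((a * k.+1) %/ p) + r k)).
  by congr odd; apply: eq_bigr => k _; rewrite [(p * _)%N]mulnC -divn_eq.
move: E; rewrite -big_distrr /= oddM a_odd /= big_split /= -big_distrr /= oddD oddM p_odd /=.
have -> : odd (\sum_k r k) = odd (\sum_k s k) (+) odd (\sum_k neg k).
  rewrite -oddD -big_split /=; move: (index_enum _) => e.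
  elim: e => [|k e IH]; first by rewrite !big_nil.
  rewrite !big_cons !oddD IH; congr addb; rewrite /s; case: ifP => _.
    rewrite oddB ?p_odd /=; last by rewrite ltnW// ltn_pmod// prime_gt0.
    by case: odd.
  by rewrite addbF.
rewrite gauss_sum_s; by case: odd; case: odd; case: odd.
Qed.

End Gauss.

Lemma sum_half_lt h m : (m./2 <= h)%N -> (\sum_(k < h) (m < k.+1.*2) = h - m./2)%N.
Proof.
move=> mh; rewrite -(subnKC mh); move: (h - m./2)%N => d; rewrite addKn.
rewrite big_split_ord /= big1 ?add0n => [|k _]; last by case: ltnP => //; move: (ltn_ord k); lia.
rewrite (eq_bigr (fun=> 1%N)) ?sum1_card ?card_ord// => k _.
by case: ltnP => //; lia.
Qed.

Lemma legendre2 : legendre 2 p = if (p %% 8 == 1)%N || (p %% 8 == 7)%N then 1 else -1.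
Proof.
have p2 : ~~ (p %| 2)%N by apply/negP => /dvdn_leq; move: p_gt2; lia.
rewrite (gauss_lemma p2) (eq_bigr (fun k : 'I_p./2 => (p./2 < k.+1.*2)%N : nat)); last first.
  by move=> k _; rewrite mul2n modn_small//; move: (ltn_ord k) half_p; lia.
rewrite sum_half_lt; last by lia.
rewrite -signr_odd.
have -> : odd (p./2 - p./2./2) = ~~ ((p %% 8 == 1)%N || (p %% 8 == 7)%N).
  by move: p_odd; lia.
by case: orb.
Qed.

End Legendre.

Lemma sum_leq_minn n x : (\sum_(l < n) (l.+1 <= x) = minn n x)%N.
Proof.
elim: n => [|n IH]; first by rewrite big_ord0 min0n.
by rewrite big_ord_recr /= IH; lia.
Qed.

(** The floors count the lattice points below the diagonal in a rectangle of sides (p - 1) / 2 and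
    (q - 1) / 2. *)
Lemma lattice_half (p q : nat) : prime p -> odd p -> prime q -> odd q ->
  (\sum_(k < p./2) (q * k.+1) %/ p = \sum_(k < p./2) \sum_(l < q./2) (l.+1 * p <= q * k.+1))%N.
Proof.
move=> pp po qp qo; apply: eq_bigr => k _.
rewrite (eq_bigr (fun l : 'I_q./2 => (l.+1 <= (q * k.+1) %/ p)%N : nat)); last first.
  by move=> l _; rewrite leq_divRL// prime_gt0.
rewrite sum_leq_minn; apply/esym/minn_idPr.
rewrite -ltnS ltn_divLR ?prime_gt0//.
by move: (ltn_ord k) (half_p po) (half_p qo); nia.
Qed.

(** No lattice point lies on the diagonal, so the points on its two sides together exhaust the
    rectangle. *)
Lemma quadratic_reciprocity (p q : nat) : prime p -> odd p -> prime q -> odd q -> p != q ->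
  legendre q p * legendre p q = (-1) ^+ (p./2 * q./2).
Proof.
move=> pp po qp qo pq.
have npq : ~~ (p %| q)%N by rewrite dvdn_prime2.
have nqp : ~~ (q %| p)%N by rewrite dvdn_prime2// eq_sym.
rewrite (eisenstein_lemma pp po npq qo) (eisenstein_lemma qp qo nqp po) -exprD.
rewrite (lattice_half pp po qp qo) (lattice_half qp qo pp po); congr (_ ^+ _).
rewrite [X in (_ + X)%N]exchange_big /= -big_split /=.
rewrite (eq_bigr (fun=> q./2)) ?sum_nat_const ?card_ord// => k _.
rewrite -big_split /= (eq_bigr (fun=> 1%N)) ?sum1_card ?card_ord// => l _.
have : (q * k.+1 != p * l.+1)%N.
  apply/negP => /eqP e; have : (p %| q * k.+1)%N by rewrite e dvdn_mulr.
  rewrite Euclid_dvdM// (negPf npq) /= => /dvdn_leq.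
  by move: (ltn_ord k) (half_p po); lia.
by rewrite [(l.+1 * p)%N]mulnC [(k.+1 * q)%N]mulnC; case: ltngtP.
Qed.

(** * Jacobi and Kronecker symbols *)

Definition oddz (d : int) : bool := odd `|d|%N.

(** At odd arguments [chi4] and [chi8] are the symbols (-1 / d) and (2 / d); at even arguments both
    take the junk value -1. *)
Definition chi4 (d : int) : int := if (d %% 4)%Z == 1 then 1 else -1.
Definition chi8 (d : int) : int := if ((d %% 8)%Z == 1) || ((d %% 8)%Z == 7) then 1 else -1.

Lemma modz4_odd (d : int) : oddz d -> (d %% 4)%Z = 1 \/ (d %% 4)%Z = 3.
Proof. by rewrite /oddz; lia. Qed.

Lemma modz8_odd (d : int) : oddz d ->
  [\/ (d %% 8)%Z = 1, (d %% 8)%Z = 3, (d %% 8)%Z = 5 | (d %% 8)%Z = 7].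
Proof.
rewrite /oddz => od; have : [|| (d %% 8)%Z == 1, (d %% 8)%Z == 3, (d %% 8)%Z == 5 | (d %% 8)%Z == 7] by lia.
by case/or4P => /eqP; [constructor 1|constructor 2|constructor 3|constructor 4].
Qed.

Lemma chi4M (a b : int) : oddz a -> oddz b -> chi4 (a * b) = chi4 a * chi4 b.
Proof.
by rewrite /chi4 -modzMm => /modz4_odd[]-> /modz4_odd[]->.
Qed.

Lemma chi8M (a b : int) : oddz a -> oddz b -> chi8 (a * b) = chi8 a * chi8 b.
Proof.
by rewrite /chi8 -modzMm => /modz8_odd[]-> /modz8_odd[]->.
Qed.

Lemma chi8_sqr d : chi8 d * chi8 d = 1. Proof. by rewrite /chi8; case: ifP. Qed.

Lemma chi4N d : oddz d -> chi4 (- d) = - chi4 d.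
Proof. by move=> od; rewrite -mulN1r chi4M// mulN1r. Qed.

Lemma chi8N d : oddz d -> chi8 (- d) = chi8 d.
Proof. by move=> od; rewrite -mulN1r chi8M// mul1r. Qed.

Lemma chi4_nat (n : nat) : odd n -> chi4 n = (-1) ^+ n./2.
Proof.
move=> on; rewrite -signr_odd /chi4.
have -> : odd n./2 = ~~ ((n %% 4)%Z == 1) by lia.
by case: eqP.
Qed.

Definition jacobi (a : int) (n : nat) : int :=
  \prod_(p <- primes n) kronecker_prime a p ^+ logn p n.

Lemma jacobi_seq a n s : (0 < n)%N -> uniq s -> {subset primes n <= s} ->
  jacobi a n = \prod_(p <- s) kronecker_prime a p ^+ logn p n.
Proof.
move=> n0 us sub; rewrite (bigID (mem (primes n))) /=.
rewrite [X in _ * X]big1_seq ?mulr1; last first.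
  move=> p /andP[pn _]; have -> : logn p n = 0%N; last by rewrite expr0.
  by apply/eqP; rewrite -leqn0 leqNgt logn_gt0.
rewrite -big_filter; apply: perm_big; apply: uniq_perm; rewrite ?primes_uniq ?filter_uniq//.
by move=> p; rewrite mem_filter andb_idr//; exact: sub.
Qed.

Lemma jacobi1 a : jacobi a 1 = 1.
Proof. by rewrite /jacobi big_nil. Qed.

Lemma jacobiM a m n : (0 < m)%N -> (0 < n)%N -> jacobi a (m * n) = jacobi a m * jacobi a n.
Proof.
move=> m0 n0; have mn0 : (0 < m * n)%N by rewrite muln_gt0 m0.
have us := primes_uniq (m * n).
rewrite (jacobi_seq a m0 us) ?(jacobi_seq a n0 us); last 2 first.
- by move=> p pn; rewrite primesM// pn orbT.
- by move=> p pm; rewrite primesM// pm.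
by rewrite -big_split /=; apply: eq_bigr => p _; rewrite lognM// exprD.
Qed.

Lemma jacobi_prime a p : prime p -> jacobi a p = kronecker_prime a p.
Proof. by move=> pp; rewrite /jacobi primes_prime// big_seq1 logn_prime// eqxx expr1. Qed.

Lemma odd_prime_ind (P : nat -> Prop) : P 1%N ->
  (forall p n, prime p -> odd p -> odd n -> P n -> P (p * n)%N) -> forall n, odd n -> P n.
Proof.
move=> P1 IH n; elim/ltn_ind: n => n IHn on.
case: (leqP n 1) => [n1|n1]; first by case: n n1 on {IHn} => [|[|]].
have pp := pdiv_prime n1; have e := divnK (pdiv_dvd n).
have op : odd (pdiv n) && odd (n %/ pdiv n) by rewrite andbC -oddM e.
case/andP: op => op oq; rewrite -e mulnC; apply: IH => //.
by apply: IHn => //; rewrite ltn_Pdiv ?prime_gt1// ltnW.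
Qed.

Lemma kronecker_prime_odd a p : odd p -> kronecker_prime a p = legendre a p.
Proof. by rewrite /kronecker_prime; case: eqP => // ->. Qed.

Lemma odd_gt0' n : odd n -> (0 < n)%N. Proof. by case: n. Qed.

Lemma jacobi_step a p n : prime p -> odd p -> odd n ->
  jacobi a (p * n) = legendre a p * jacobi a n.
Proof.
by move=> pp op on; rewrite jacobiM ?odd_gt0'// jacobi_prime// kronecker_prime_odd.
Qed.

Lemma jacobiMl a b n : odd n -> jacobi (a * b) n = jacobi a n * jacobi b n.
Proof.
move: n; apply: odd_prime_ind => [|p n pp op on IH]; first by rewrite !jacobi1.
by rewrite !jacobi_step// IH legendreM//; ring.
Qed.

Lemma jacobi_mod a b n : odd n -> (a = b %[mod n])%Z -> jacobi a n = jacobi b n.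
Proof.
move: n; apply: odd_prime_ind => [_|p n pp op on IH ab]; first by rewrite !jacobi1.
have /dvdzP[k e] : ((p * n)%N %| a - b)%Z by rewrite -eqz_mod_dvd; apply/eqP.
rewrite !jacobi_step// IH ?(@legendre_mod p pp op a b)//; apply/eqP; rewrite eqz_mod_dvd e PoszM.
  by rewrite mulrCA dvdz_mulr.
by rewrite mulrA dvdz_mull.
Qed.

Lemma jacobiN1 n : odd n -> jacobi (-1) n = chi4 n.
Proof.
move: n; apply: odd_prime_ind => [|p n pp op on IH]; first by rewrite jacobi1.
by rewrite jacobi_step// IH (legendreN1 pp op) PoszM (@chi4M p n op on) (chi4_nat op).
Qed.

Lemma jacobi2 n : odd n -> jacobi 2 n = chi8 n.
Proof.
move: n; apply: odd_prime_ind => [|p n pp op on IH]; first by rewrite jacobi1.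
rewrite jacobi_step// IH legendre2// PoszM chi8M//; congr (_ * _).
by rewrite /chi8; congr (if _ then _ else _); lia.
Qed.

Lemma legendre1 p : prime p -> odd p -> legendre 1 p = 1.
Proof.
by move=> pp op; apply: (sign_Fp_inj pp op); rewrite ?(legendre_cases)// (legendreP pp op) expr1n.
Qed.

Lemma jacobi1l n : odd n -> jacobi 1 n = 1.
Proof.
move: n; apply: odd_prime_ind => [|p n pp op on IH]; first by rewrite jacobi1.
by rewrite jacobi_step// IH legendre1.
Qed.

(** Induction over the prime factors of n with p fixed. The sign is written [chi4 n ^+ p./2] because
    this form is visibly multiplicative in n. *)
Lemma jacobi_reciprocity p n : prime p -> odd p -> odd n ->
  jacobi p n = legendre n p * chi4 n ^+ p./2.
Proof.
move=> pp op; move: n; apply: odd_prime_ind => [|q n qp oq on IH].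
  by rewrite jacobi1 legendre1// expr1n.
rewrite jacobi_step// IH PoszM chi4M// exprMn (legendreM pp op).
suff -> : legendre p q = legendre q p * chi4 q ^+ p./2 by ring.
have [<-|pq] := eqVneq p q.
  by rewrite /legendre dvdzz mul0r.
have := quadratic_reciprocity pp op qp oq pq.
rewrite chi4_nat// -exprM [(q./2 * _)%N]mulnC => <-.
have : legendre q p * legendre q p = 1.
  have : legendre q p != 0.
    rewrite /legendre; case: ifP; last by case: ifP.
    by rewrite dvdzE /= dvdn_prime2// (negPf pq).
  by have /or3P[] := legendre_cases p q => /eqP ->.
move: (legendre q p) (legendre p q) => x y xx; by rewrite mulrA xx mul1r.
Qed.

(** The Hilbert symbol of a and d at the real place, by which the Kronecker symbol differs from the
    Jacobi symbol at |d|. *)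
Definition sgnz2 (a d : int) : int := if (d < 0) && (a < 0) then -1 else 1.

Lemma kroneckerE c d : d != 0 -> kronecker c d = sgnz2 c d * jacobi c `|d|%N.
Proof. by rewrite /kronecker => /negPf->. Qed.

Lemma oddz_neq0 d : oddz d -> d != 0. Proof. by apply: contraTneq => ->. Qed.

Lemma kroneckerM a b d : a != 0 -> b != 0 -> oddz d ->
  kronecker (a * b) d = kronecker a d * kronecker b d.
Proof.
move=> a0 b0 od; rewrite !kroneckerE ?oddz_neq0// jacobiMl//.
suff -> : sgnz2 (a * b) d = sgnz2 a d * sgnz2 b d by ring.
by rewrite /sgnz2 mulr_lt0 a0 b0 /=; do 3 case: (_ < 0).
Qed.

Lemma oddz_abs d : d < 0 -> d = - (`|d|%N%:Z). Proof. lia. Qed.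

Lemma kroneckerN1 d : oddz d -> kronecker (-1) d = chi4 d.
Proof.
move=> od; rewrite kroneckerE ?oddz_neq0// jacobiN1// /sgnz2 ltrN10 andbT.
case: ltP => [d0|d0]; last by rewrite mul1r; congr chi4; lia.
by rewrite mulN1r -chi4N// -oddz_abs.
Qed.

Lemma kronecker2 d : oddz d -> kronecker 2 d = chi8 d.
Proof.
move=> od; rewrite kroneckerE ?oddz_neq0// jacobi2// /sgnz2 andbF mul1r.
case: (ltP d 0) => [d0|d0]; last by congr chi8; lia.
by rewrite {2}(oddz_abs d0) chi8N.
Qed.

Lemma kronecker_p (p : nat) d : prime p -> odd p -> oddz d ->
  kronecker p d = legendre d p * chi4 d ^+ p./2.
Proof.
move=> pp op od; rewrite kroneckerE ?oddz_neq0// jacobi_reciprocity// /sgnz2 andbF mul1r.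
case: (ltP d 0) => [d0|d0]; last by have -> : `|d|%N%:Z = d by lia.
rewrite [in RHS](oddz_abs d0) chi4N// -mulN1r (legendreM pp op) (legendreN1 pp op).
rewrite [(- chi4 _) ^+ _]exprNn [RHS]mulrACA -expr2 sqrr_sign mul1r.
by [].
Qed.

Lemma chi4_mod a b : (a = b %[mod 4])%Z -> chi4 a = chi4 b. Proof. by rewrite /chi4 => ->. Qed.
Lemma chi8_mod a b : (a = b %[mod 8])%Z -> chi8 a = chi8 b. Proof. by rewrite /chi8 => ->. Qed.

Lemma eqz_mod_mull (m n a b : int) : (a = b %[mod m * n])%Z -> (a = b %[mod n])%Z.
Proof.
by move/eqP; rewrite eqz_mod_dvd => /dvdzP[k e]; apply/eqP; rewrite eqz_mod_dvd e mulrA dvdz_mull.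
Qed.

(** One prime factor of c is split off at a time: an odd p contributes a symbol modulo p and a power
    of [chi4], the prime 2 contributes [chi8], and the moduli involved divide 4 c. *)
Lemma kronecker_period_pos (c : nat) a b : (0 < c)%N -> oddz a -> oddz b ->
  (a = b %[mod 4 * c%:Z])%Z -> kronecker c a = kronecker c b.
Proof.
move=> c0 oa ob; elim/ltn_ind: c c0 => c IH c0 ab.
case: (leqP c 1) => [c1|c1].
  have -> : c = 1%N by lia.
  by rewrite !kroneckerE ?oddz_neq0// !jacobi1l// /sgnz2 !andbF.
have pp := pdiv_prime c1; set p := pdiv c in pp.
have e : c = (p * (c %/ p))%N by rewrite mulnC divnK// pdiv_dvd.
set c' := (c %/ p)%N in e.
have c'0 : (0 < c')%N by rewrite lt0n; apply: contraTneq c0 => c'0; rewrite e c'0 muln0.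
have c'c : (c' < c)%N by rewrite /c' ltn_Pdiv// prime_gt1.
have pz : (p%:Z : int) != 0 by move: (prime_gt0 pp); lia.
have cz : (c'%:Z : int) != 0 by lia.
rewrite e PoszM !kroneckerM//.
rewrite (IH c' c'c c'0); last first.
  by apply: (@eqz_mod_mull p); rewrite mulrCA -PoszM -e.
congr (_ * _).
case: (boolP (odd p)) => op.
  rewrite !kronecker_p// (@legendre_mod p pp op a b); last first.
    by apply: (@eqz_mod_mull (4 * c'%:Z)); rewrite -mulrA -PoszM mulnC -e.
  by rewrite (@chi4_mod a b)//; apply: (@eqz_mod_mull c); rewrite mulrC.
have -> : p = 2%N by move: (even_prime pp) op; case=> ->.
rewrite !kronecker2//; apply: chi8_mod; apply: (@eqz_mod_mull c').
have p2 : p = 2%N by move: (even_prime pp) op; case=> ->.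
by move: ab; rewrite e p2; have -> : 4 * (2 * c')%N%:Z = c' * 8 by lia.
Qed.

Lemma kronecker_4 d : oddz d -> kronecker 4 d = 1.
Proof.
by move=> od; rewrite (@kroneckerM 2 2)// kronecker2// chi8_sqr.
Qed.

(** For c = 4 k with k > 0 the factor 4 has symbol 1, so the period 4 k of the symbol of k is c
    itself; for k < 0 there is in addition (-1 / d), of period 4. *)
Lemma kronecker_addr (c d : int) : (4 %| c)%Z -> oddz d -> kronecker c (d + c) = kronecker c d.
Proof.
have [->|c0] := eqVneq c 0; first by rewrite addr0.
move=> /dvdzP[k e] od; have k0 : k != 0 by apply: contraNneq c0 => k0; rewrite e k0.
have odc : oddz (d + c) by move: od; rewrite /oddz e; lia.
have pos (n : nat) u v : (0 < n)%N -> oddz u -> oddz v -> (u = v %[mod 4 * n%:Z])%Z ->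
    kronecker (n%:Z * 4) u = kronecker (n%:Z * 4) v.
  move=> n0 ou ov uv; have nz : n%:Z != 0 by lia.
  by rewrite !kroneckerM// !kronecker_4// !mulr1; exact: kronecker_period_pos.
rewrite e; case: (ltP k 0) => h.
  have -> : k * 4 = -1 * (`|k|%N%:Z * 4) by lia.
  have kz : `|k|%N%:Z * 4 != 0 by lia.
  have -> : d + -1 * (`|k|%N%:Z * 4) = d + k * 4 by lia.
  rewrite -e !(@kroneckerM (-1))// !kroneckerN1//; congr (_ * _).
    by apply: chi4_mod; apply/eqP; rewrite eqz_mod_dvd e; apply/dvdzP; exists k; ring.
  apply: pos => //; first by lia.
  by apply/eqP; rewrite eqz_mod_dvd; apply/dvdzP; exists (-1); rewrite e; lia.
have -> : k * 4 = `|k|%N%:Z * 4 by lia.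
apply: pos => //; first by lia.
  by move: odc; rewrite e; have -> : `|k|%N%:Z * 4 = k * 4 by lia.
by apply/eqP; rewrite eqz_mod_dvd; apply/dvdzP; exists 1; lia.
Qed.

(** The Jacobi symbol depends on c modulo d only; what may change is the sign at the real place. *)
Lemma kronecker_add4l (c d s : int) : oddz d ->
  kronecker (c + 4 * s * d) d = sgnz2 (c + 4 * s * d) d * sgnz2 c d * kronecker c d.
Proof.
move=> od; rewrite !kroneckerE ?oddz_neq0//.
rewrite (@jacobi_mod (c + 4 * s * d) c)//; last first.
  apply/eqP; rewrite eqz_mod_dvd [_ - c]addrC addKr.
  by apply/dvdzP; case: (ltP d 0) => h; [exists (- (4 * s))|exists (4 * s)]; lia.
have : sgnz2 c d * sgnz2 c d = 1 by rewrite /sgnz2; case: ifP.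
by move: (sgnz2 c d) (sgnz2 (c + 4 * s * d) d) (jacobi _ _) => x y z xx; rewrite -[LHS]mul1r -xx; ring.
Qed.

Lemma kronecker_half (c d : int) : c != 0 -> oddz d ->
  kronecker (2 * c) d = chi8 d * kronecker c d.
Proof. by move=> c0 od; rewrite kroneckerM// kronecker2. Qed.

Lemma kronecker0 (d : int) : `|d|%N = 1%N -> kronecker 0 d = 1.
Proof.
move=> d1; have od : oddz d by rewrite /oddz d1.
by rewrite kroneckerE ?oddz_neq0// d1 jacobi1 mulr1 /sgnz2 ltxx andbF.
Qed.

Lemma kronecker_cases (c d : int) : d != 0 ->
  [|| kronecker c d == 0, kronecker c d == 1 | kronecker c d == -1].
Proof.
move=> d0; rewrite kroneckerE//.
have J : [|| jacobi c `|d|%N == 0, jacobi c `|d|%N == 1 | jacobi c `|d|%N == -1].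
  rewrite /jacobi; elim: (primes _) => [|p s IH]; first by rewrite big_nil.
  rewrite big_cons.
  have k : [|| kronecker_prime c p == 0, kronecker_prime c p == 1 | kronecker_prime c p == -1].
    rewrite /kronecker_prime; case: ifP => _; last exact: legendre_cases.
    by case: ifP => //; case: ifP.
  have k' n : [|| kronecker_prime c p ^+ n == 0, kronecker_prime c p ^+ n == 1 | kronecker_prime c p ^+ n == -1].
    elim: n => [|n]; first by rewrite expr0.
    by rewrite exprS => /or3P[] /eqP->; case/or3P: k => /eqP->.
  by case/or3P: IH => /eqP->; case/or3P: (k' (logn p `|d|%N)) => /eqP->.
by rewrite /sgnz2; case: ifP => _; case/or3P: J => /eqP->.
Qed.

End QuadraticReciprocity.
Import QuadraticReciprocity.

(** * The theta multiplier *)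

Section ThetaMultiplier.
Variable R : realType.
Notation C := R[i].
Implicit Types (z w u : C) (a b c d s : int) (x y t : R).
Opaque qprod phi Jth qpoch cexp qexp th.

(* The half plane of arguments in ]0, pi]: in terms of it, [sqrtc] fails to be
   multiplicative exactly as described by [sgsqrt]. *)
Definition hcls w : bool := (0 < complex.Im w) || ((complex.Im w == 0) && (complex.Re w < 0)).

Lemma sqrtc_hcls w : hcls w -> 0 <= complex.Re (sqrtc w) /\ 0 < complex.Im (sqrtc w).
Proof.
case: w => x y; rewrite /hcls /= => H; split; first exact: sqrtr_ge0.
have r0 : 0 <= Num.sqrt (x ^+ 2 + y ^+ 2) by exact: sqrtr_ge0.
have r2 : Num.sqrt (x ^+ 2 + y ^+ 2) ^+ 2 = x ^+ 2 + y ^+ 2 by rewrite sqr_sqrtr// addr_ge0 ?sqr_ge0.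
move: (Num.sqrt _) r0 r2 => r r0 r2.
case/orP: H => [y0|/andP[/eqP y0 x0]].
  rewrite gt_eqF// gtr0_sg// mul1r sqrtr_gt0 divr_gt0//; nra.
rewrite y0 eqxx mul1r sqrtr_gt0 divr_gt0//; nra.
Qed.

Lemma sqrtc_nhcls w : w != 0 -> ~~ hcls w -> 0 < complex.Re (sqrtc w) /\ complex.Im (sqrtc w) <= 0.
Proof.
case: w => x y; rewrite /hcls eq_complex /= negb_and negb_or negb_and -leNgt => n0 /andP[y0 xy].
have r0 : 0 <= Num.sqrt (x ^+ 2 + y ^+ 2) by exact: sqrtr_ge0.
have r2 : Num.sqrt (x ^+ 2 + y ^+ 2) ^+ 2 = x ^+ 2 + y ^+ 2 by rewrite sqr_sqrtr// addr_ge0 ?sqr_ge0.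
move: (Num.sqrt _) r0 r2 => r r0 r2.
have [e|yn] := eqVneq y 0.
  move: xy n0; rewrite e eqxx orbF /= -leNgt => x0 xn0; have {xn0}x0 : 0 < x by rewrite lt_def xn0.
  have rx : r = x by rewrite e expr0n addr0 in r2; nra.
  by rewrite mul1r rx subrr mul0r sqrtr0 sqrtr_gt0; split => //; lra.
have {}y0 : y < 0 by rewrite lt_neqAle yn.
rewrite sqrtr_gt0 ltr0_sg// mulN1r oppr_le0 sqrtr_ge0; split => //.
by rewrite divr_gt0//; nra.
Qed.

Definition sgsqrt (p q r : bool) : C := if (p == q) && (p != r) then -1 else 1.

(** Both sides have the square w u, so they agree up to sign. The sign follows from the quadrant of
    each root, whose imaginary part is positive exactly when [hcls] holds. *)
Lemma sqrtcM w u : w != 0 -> u != 0 ->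
  sqrtc w * sqrtc u = sgsqrt (hcls w) (hcls u) (hcls (w * u)) * sqrtc (w * u).
Proof.
move=> w0 u0; have wu0 : w * u != 0 by rewrite mulf_neq0.
have /eqP : (sqrtc w * sqrtc u) ^+ 2 = sqrtc (w * u) ^+ 2 by rewrite exprMn !sqr_sqrtc.
rewrite eqf_sqr.
have H v : v != 0 -> if hcls v then 0 <= complex.Re (sqrtc v) /\ 0 < complex.Im (sqrtc v)
    else 0 < complex.Re (sqrtc v) /\ complex.Im (sqrtc v) <= 0.
  by move=> v0; case: ifPn => [/sqrtc_hcls|/(sqrtc_nhcls v0)].
move: (H _ w0) (H _ u0) (H _ wu0) => {H}.
move: (hcls w) (hcls u) (hcls (w * u)) => p q r.
move: (sqrtc w) (sqrtc u) (sqrtc (w * u)) => [a b] [c d] [e f] Hp Hq Hr.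
case/orP => /eqP E; rewrite E /sgsqrt.
  case: ifP => [/andP[/eqP pq pr]|]; last by rewrite mul1r.
  exfalso; case: E => e1 e2; rewrite -{}pq in Hq; case: p pr Hp Hq; case: r Hr => //= -[h1 h2] _ [h3 h4] [h5 h6].
    by nra.
  by nra.
case: ifP => [_|pq]; first by rewrite mulN1r.
exfalso; case: E => e1 e2; move: pq Hp Hq Hr; case: p; case: q; case: r => //= _ [h1 h2] [h3 h4] [h5 h6]; nra.
Qed.

(** The two roots have arguments in ]- pi / 4, pi / 4[, so their product has positive real part. *)
Lemma sqrtcM_Re w u : 0 < complex.Re w -> 0 < complex.Re u -> sqrtc w * sqrtc u = sqrtc (w * u).
Proof.
move=> w0 u0.
have h (v : C) : 0 < complex.Re v -> `|complex.Im (sqrtc v)| < complex.Re (sqrtc v).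
  move=> v0; have s0 := Re_sqrtc_gt0 v0; have := congr1 (@complex.Re R) (sqr_sqrtc v).
  rewrite expr2 cReM => e; rewrite ltr_norml; apply/andP; split; nra.
have /eqP : (sqrtc w * sqrtc u) ^+ 2 = sqrtc (w * u) ^+ 2 by rewrite exprMn !sqr_sqrtc.
rewrite eqf_sqr => /orP[/eqP//|/eqP E].
have := Re_sqrtc_ge0 (w * u); have := congr1 (@complex.Re R) E.
rewrite cReN cReM; move: (h _ w0) (h _ u0); rewrite !ltr_norml => /andP[a1 a2] /andP[b1 b2] e1 e2.
exfalso; nra.
Qed.

(* The value of [hcls] at [c * z + d], for z in the upper half plane. *)
Definition jcls c d : bool := (0 < c) || ((c == 0) && (d < 0)).

Lemma Re_int c : complex.Re (c%:~R : C) = c%:~R.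
Proof. by rewrite -(rmorph_int (real_complex R)). Qed.
Lemma Im_int c : complex.Im (c%:~R : C) = 0.
Proof. by rewrite -(rmorph_int (real_complex R)). Qed.
Lemma Im_intM c z : complex.Im (c%:~R * z) = c%:~R * complex.Im z.
Proof. by rewrite cImM Re_int Im_int mul0r addr0. Qed.

Lemma hcls_jfac c d z : 0 < complex.Im z -> hcls (c%:~R * z + d%:~R) = jcls c d.
Proof.
move=> z0; rewrite /hcls /jcls cImD cReD Im_intM Im_int Re_int addr0 pmulr_lgt0// ltr0z.
congr orb; rewrite mulf_eq0 (gt_eqF z0) orbF intr_eq0; case: eqP => //= ->.
by rewrite mul0r cRe0 add0r ltrz0.
Qed.

Lemma jfac_neq0 c d z : 0 < complex.Im z -> (c != 0) || (d != 0) -> c%:~R * z + d%:~R != 0 :> C.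
Proof.
move=> z0; apply: contraTneq => e; have := congr1 (@complex.Im R) e.
rewrite cImD Im_intM Im_int addr0 /= => /eqP; rewrite mulf_eq0 (gt_eqF z0) orbF intr_eq0 => /eqP c0.
move: e; rewrite c0 mul0r add0r eqxx /= => /eqP; by rewrite intr_eq0 => ->.
Qed.

Lemma th_add2z (n : int) z : th (z + 2 * n%:~R) = th z :> C.
Proof.
Transparent th. rewrite /th. Opaque th.
rewrite nomeD; have -> : pi%:C * 'i * (2 * n%:~R) = 2 * pi%:C * 'i * n%:~R :> C by ring.
by rewrite cexp_2piin mulr1.
Qed.

(* [2z/(4sz+1) = -1/v] with [v = -2s - 1/(2z)]. *)
Lemma th_U s z : 0 < complex.Im z ->
  th (2 * (z / (4 * s%:~R * z + 1))) = sqrtc (4 * s%:~R * z + 1) * th (2 * z).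
Proof.
move=> z0; have zn0 := Im_neq0 z0.
have z20 : 0 < complex.Im (2 * z) by rewrite (Im_natM 2) mulr_gt0.
pose v : C := - (2 * z)^-1 + 2 * (- s)%:~R.
have v0 : 0 < complex.Im v.
  rewrite /v cImD.
  have -> : complex.Im (2 * (- s)%:~R : C) = 0 by rewrite (Im_natM 2) Im_int mulr0.
  by rewrite addr0; exact: Im_inv_gt0.
have vn0 := Im_neq0 v0.
have E : - 'i * v * (- 'i * (2 * z)) = 4 * s%:~R * z + 1.
  have i2 : 'i * 'i = -1 :> C by rewrite -expr2 sqr_i.
  have -> : - 'i * v * (- 'i * (2 * z)) = 'i * 'i * (2 * z * v) by ring.
  rewrite i2 /v rmorphN /=; field; by rewrite ?zn0.
have U0 : 4 * s%:~R * z + 1 != 0.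
  by rewrite -E !mulf_neq0 ?oppr_eq0 -?normc_gt0 ?normci// normc_gt0 ?pnatr_eq0.
have -> : 2 * (z / (4 * s%:~R * z + 1)) = - v^-1.
  have n2 : 2 != 0 :> C by rewrite pnatr_eq0.
  rewrite -{1}E; have i2 : 'i * 'i = -1 :> C by rewrite -expr2 sqr_i.
  have -> : - 'i * v * (- 'i * (2 * z)) = 'i * 'i * (2 * z * v) by ring.
  by rewrite i2; field; rewrite ?zn0 ?vn0.
rewrite (th_inv v0) {2}/v th_add2z (th_inv z20) mulrA sqrtcM_Re ?E//.
  by rewrite mulNr cReN cReM cRei cImi mul0r mul1r sub0r opprK.
by rewrite mulNr cReN cReM cRei cImi mul0r mul1r sub0r opprK.
Qed.

Lemma epsE d : eps R d = if (d %% 4)%Z == 1 then 1 else 'i. Proof. by []. Qed.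

Lemma eps_mod c d : (4 %| c)%Z -> eps R (d + c) = eps R d.
Proof.
move=> c4; rewrite !epsE; suff -> : ((d + c) %% 4)%Z = (d %% 4)%Z by [].
by move/dvdzP: c4 => [k ->]; lia.
Qed.

(** The sign lost in multiplying square roots equals the change of the real-place sign in the
    Kronecker symbols: both depend only on the signs of c, d and c - 4 s d. *)
Lemma jcls_sgn c d s : oddz d -> (s == 1) || (s == -1) ->
  sgsqrt (jcls (c - 4 * s * d) d) (jcls (4 * s) 1) (jcls c d) =
  (sgnz2 c d * sgnz2 (c - 4 * s * d) d)%:~R.
Proof.
rewrite /oddz /sgsqrt /jcls /sgnz2 => od.
case/orP => /eqP ->.
  case: (ltP d 0) => d0; case: (ltP c 0) => h1; case: (ltP (c - 4 * 1 * d) 0) => h2 /=;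
  case: (ltP 0 c) => h3; case: (ltP 0 (c - 4 * 1 * d)) => h4 /=; rewrite ?orbT ?andbF ?andbT ?orbF;
  try (exfalso; lia); try (by rewrite ?rmorphN ?rmorph1);
  case: eqP => h5 //=; try (exfalso; lia); try (by rewrite ?rmorphN ?rmorph1);
  case: eqP => h6 //=; try (exfalso; lia); try (by rewrite ?rmorphN ?rmorph1).
case: (ltP d 0) => d0; case: (ltP c 0) => h1; case: (ltP (c - 4 * -1 * d) 0) => h2 /=;
  case: (ltP 0 c) => h3; case: (ltP 0 (c - 4 * -1 * d)) => h4 /=; rewrite ?orbT ?andbF ?andbT ?orbF;
  try (exfalso; lia); try (by rewrite ?rmorphN ?rmorph1);
  case: eqP => h5 //=; try (exfalso; lia); try (by rewrite ?rmorphN ?rmorph1);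
  case: eqP => h6 //=; try (exfalso; lia); try (by rewrite ?rmorphN ?rmorph1).
Qed.

Lemma oddz_det a b c d : a * d - b * c = 1 -> (2 %| c)%Z -> oddz d.
Proof.
move=> det /dvdzP[k ck]; rewrite /oddz; apply/negPn/negP => od.
have [e de] : exists e, d = 2 * e by exists (d %/ 2)%Z; lia.
have : 2 * (a * e - b * k) = a * d - b * c by rewrite ck de; ring.
by rewrite det; move: (a * e - b * k) => x; lia.
Qed.

Lemma Im_div w u : complex.Im (w / u) =
  (complex.Im w * complex.Re u - complex.Re w * complex.Im u) / normc u ^+ 2.
Proof. by rewrite normc_sqr; case: w => x y; case: u => p q /=; ring. Qed.

Lemma Im_frac a b c d z : a * d - b * c = 1 ->
  complex.Im ((a%:~R * z + b%:~R) / (c%:~R * z + d%:~R)) =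
  complex.Im z / normc (c%:~R * z + d%:~R) ^+ 2.
Proof.
move=> det; rewrite Im_div; congr (_ / _).
rewrite !cImD !cReD !Im_intM !Im_int !Re_int !cReM !Re_int !Im_int !mul0r !subr0 !addr0.
rewrite -[RHS]mul1r -[1 in RHS]/(1%:~R) -det rmorphB !rmorphM /=; ring.
Qed.

Lemma Im_frac_gt0 a b c d z : a * d - b * c = 1 -> 0 < complex.Im z ->
  0 < complex.Im ((a%:~R * z + b%:~R) / (c%:~R * z + d%:~R)).
Proof.
move=> det z0; rewrite Im_frac// divr_gt0// exprn_gt0// normc_gt0 jfac_neq0//.
have [c0|//] := eqVneq c 0; have [d0|//] := eqVneq d 0.
by move: det; rewrite c0 d0 !mulr0 subr0.
Qed.

(** Induction on |c| + |d|. If |c| < 2 |d|, a translation replaces d by d - s c; if |c| > 2 |d|,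
    [th_U] replaces c by c - 4 s d. Equality is excluded because 4 divides c and d is odd, and the
    descent ends at c = 0. *)
Lemma theta_Gamma0_4 a b c d z : a * d - b * c = 1 -> (4 %| c)%Z -> 0 < complex.Im z ->
  th (2 * ((a%:~R * z + b%:~R) / (c%:~R * z + d%:~R))) =
  (kronecker c d)%:~R / eps R d * sqrtc (c%:~R * z + d%:~R) * th (2 * z).
Proof.
have [n] := ubnP (`|c| + `|d|)%N; elim: n => // n IH in a b c d z *.
rewrite ltnS => cdn det c4 z0.
have od : oddz d by apply: oddz_det det (dvdz_trans _ c4).
have cd0 : (c != 0) || (d != 0) by rewrite (oddz_neq0 od) orbT.
have jn0 := jfac_neq0 z0 cd0.
have [c0|c0] := eqVneq c 0.
  have d1 : (d == 1) || (d == -1).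
    have : (`|a| * `|d| == 1)%N by rewrite -abszM; move: det; rewrite c0 mulr0 subr0 => ->.
    by rewrite muln_eq1; lia.
  rewrite c0 mul0r add0r kronecker0; last by lia.
  case/orP: d1 => /eqP d1; rewrite d1 in det *.
    have -> : a = 1 by lia.
    by rewrite sqrtc1 !mul1r divr1 invr1 mulr1 mul1r mulrDr th_add2z.
  have -> : a = -1 by lia.
  have -> : (-1%:~R * z + b%:~R) / (-1)%:~R = z + (- b)%:~R :> C.
    by rewrite !rmorphN /= rmorph1; field.
  by rewrite mulrDr th_add2z rmorphN rmorph1 sqrtN1 epsE /= div1r mulVf ?mul1r// -normc_gt0 normci.
have [s sP [sT sU]] : exists2 s : int, (s == 1) || (s == -1) &
   ((`|c| < 2 * `|d|)%N -> (`|c| + `|(d - s * c)%R| < `|c| + `|d|)%N) /\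
   ((2 * `|d| < `|c|)%N -> (`|(c - 4 * s * d)%R| + `|d| < `|c| + `|d|)%N).
  exists (if (0 < c) == (0 < d) then 1 else -1); first by case: ifP.
  by move: c0; rewrite /oddz in od; case: ifP; split; lia.
have [h|h|h] := ltngtP `|c|%N (2 * `|d|)%N; last first.
- by exfalso; move/dvdzP: c4 od h => [k ->]; rewrite /oddz; lia.
- have c'4 : (4 %| c - 4 * s * d)%Z by rewrite rpredB// -mulrA dvdz_mulr.
  pose z' : C := z / (4 * s%:~R * z + 1).
  have jU : 4 * s%:~R * z + 1 = (4 * s)%:~R * z + 1%:~R :> C by rewrite rmorphM /= rmorph1.
  have U0 : 4 * s%:~R * z + 1 != 0 by rewrite jU jfac_neq0// oner_eq0 orbT.
  have z'0 : 0 < complex.Im z'.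
    have -> : z' = (1%:~R * z + 0%:~R) / ((4 * s)%:~R * z + 1%:~R) by rewrite -jU mul1r addr0.
    by apply: Im_frac_gt0 => //; ring.
  have c'd0 : (c - 4 * s * d != 0) || (d != 0) by rewrite (oddz_neq0 od) orbT.
  have j'0 := jfac_neq0 z'0 c'd0.
  have det' : (a - 4 * s * b) * d - b * (c - 4 * s * d) = 1 by apply: etrans det; ring.
  have := IH (a - 4 * s * b) b (c - 4 * s * d) d z' (leq_trans (sU h) cdn) det' c'4 z'0.
  have jE : ((c - 4 * s * d)%:~R * z' + d%:~R) * (4 * s%:~R * z + 1) = c%:~R * z + d%:~R.
    by rewrite /z' rmorphB !rmorphM /=; field; rewrite U0.
  have aE : ((a - 4 * s * b)%:~R * z' + b%:~R) * (4 * s%:~R * z + 1) = a%:~R * z + b%:~R.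
    by rewrite /z' rmorphB !rmorphM /=; field; rewrite U0.
  have -> : ((a - 4 * s * b)%:~R * z' + b%:~R) / ((c - 4 * s * d)%:~R * z' + d%:~R) =
            (a%:~R * z + b%:~R) / (c%:~R * z + d%:~R).
    by rewrite -jE -aE invfM mulrACA divff// mulr1.
  move=> ->; rewrite {2}/z' th_U// mulrA; congr (_ * _).
  rewrite -mulrA sqrtcM// jE (hcls_jfac _ _ z'0) jU (hcls_jfac _ _ z0) (hcls_jfac _ _ z0).
  rewrite jcls_sgn// mulrA; congr (_ * _).
  have cE : c = (c - 4 * s * d) + 4 * s * d by ring.
  rewrite [in RHS]cE kronecker_add4l// -cE 2!rmorphM /=; ring.
have c's : (4 %| s * c)%Z by rewrite dvdz_mull.
have zs : 0 < complex.Im (z + s%:~R) by rewrite cImD Im_int addr0.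
have det' : a * (d - s * c) - (b - s * a) * c = 1 by apply: etrans det; ring.
have := IH a (b - s * a) c (d - s * c) (z + s%:~R) (leq_trans (sT h) cdn) det' c4 zs.
have jE e f : e%:~R * (z + s%:~R) + (f - s * e)%:~R = e%:~R * z + f%:~R :> C.
  by rewrite rmorphB rmorphM /=; ring.
rewrite !jE [2 * (z + s%:~R)]mulrDr th_add2z => ->; congr (_ / _ * _ * _).
  by case/orP: sP => /eqP ->; rewrite ?mul1r ?mulN1r ?opprK ?kronecker_addr// -{2}[d](subrK c) kronecker_addr// /oddz; move/dvdzP: c4 od => [k ->]; rewrite /oddz; lia.
by rewrite -mulNr eps_mod// dvdz_mull.
Qed.

End ThetaMultiplier.

(** * The slash operator and the cusps *)

Section Slash.
Variable R : realType.
Notation C := R[i].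
Implicit Types (z w u : C) (a b c d s : int) (x y t : R) (M N : 'M[int]_2) (f : uhp R -> C).
Opaque qprod phi Jth qpoch cexp qexp th.

Lemma sum_ord2 (V : nmodType) (F : 'I_2 -> V) : \sum_(i < 2) F i = F 0 + F 1.
Proof. by rewrite !big_ord_recl big_ord0 addr0; congr (_ + F _); exact: val_inj. Qed.

Lemma ord2_cases (P : 'I_2 -> Prop) : P 0 -> P 1 -> forall i, P i.
Proof.
move=> P0 P1 [[|[|//]] i2].
  by have -> : Ordinal i2 = 0 by exact: val_inj.
by have -> : Ordinal i2 = 1 by exact: val_inj.
Qed.

Lemma mulmx2 M N i j : (M *m N) i j = M i 0 * N 0 j + M i 1 * N 1 j.
Proof. by rewrite mxE sum_ord2. Qed.

Definition mk2 a b c d : 'M[int]_2 :=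
  \matrix_(i, j) if i == 0 then (if j == 0 then a else b) else (if j == 0 then c else d).

Lemma mk2E a b c d : [/\ mk2 a b c d 0 0 = a, mk2 a b c d 0 1 = b,
  mk2 a b c d 1 0 = c & mk2 a b c d 1 1 = d].
Proof. by rewrite !mxE. Qed.

Lemma mk2_00 a b c d : mk2 a b c d 0 0 = a. Proof. by case: (mk2E a b c d). Qed.
Lemma mk2_01 a b c d : mk2 a b c d 0 1 = b. Proof. by case: (mk2E a b c d). Qed.
Lemma mk2_10 a b c d : mk2 a b c d 1 0 = c. Proof. by case: (mk2E a b c d). Qed.
Lemma mk2_11 a b c d : mk2 a b c d 1 1 = d. Proof. by case: (mk2E a b c d). Qed.
Definition mk2s := (mk2_00, mk2_01, mk2_10, mk2_11).

Lemma mx2_ext M N : M 0 0 = N 0 0 -> M 0 1 = N 0 1 -> M 1 0 = N 1 0 -> M 1 1 = N 1 1 -> M = N.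
Proof.
by move=> h1 h2 h3 h4; apply/matrixP => i j; move: i j; apply: ord2_cases; apply: ord2_cases.
Qed.

Lemma det2 M : \det M = M 0 0 * M 1 1 - M 0 1 * M 1 0.
Proof.
rewrite (expand_det_row _ 0) sum_ord2 /cofactor !det_mx11 !mxE /=.
have e1 : lift 0 0 = 1 :> 'I_2 by exact: val_inj.
have e2 : lift 1 0 = 0 :> 'I_2 by exact: val_inj.
by rewrite e1 e2 /= expr0 expr1; ring.
Qed.

Lemma SL2ZE M : SL2Z M <-> M 0 0 * M 1 1 - M 0 1 * M 1 0 = 1.
Proof. by rewrite /SL2Z /= det2. Qed.

Lemma SL2Z_mul M N : SL2Z M -> SL2Z N -> SL2Z (M *m N).
Proof. by rewrite /SL2Z /= det_mulmx => -> ->. Qed.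

Lemma SL2Z_mk2 a b c d : a * d - b * c = 1 -> SL2Z (mk2 a b c d).
Proof. by move=> h; apply/SL2ZE; rewrite !mk2s. Qed.

Lemma Gamma0_SL2Z n M : Gamma0 n M -> SL2Z M. Proof. by case. Qed.

Definition inv2 M := mk2 (M 1 1) (- M 0 1) (- M 1 0) (M 0 0).

Lemma SL2Z_inv2 M : SL2Z M -> SL2Z (inv2 M).
Proof. by move=> /SL2ZE h; apply: SL2Z_mk2; rewrite -h; ring. Qed.

Lemma inv2_mul M : SL2Z M -> inv2 M *m M = 1%:M.
Proof.
by move=> /SL2ZE h; apply: mx2_ext; rewrite mulmx2 !mk2s !mxE ?eqxx /= -?h /=; ring.
Qed.

Definition jf M z : C := (M 1 0)%:~R * z + (M 1 1)%:~R.

Lemma jf_neq0 M z : SL2Z M -> 0 < complex.Im z -> jf M z != 0.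
Proof.
move=> /SL2ZE h z0; apply: jfac_neq0 => //.
have [c0|//] := eqVneq (M 1 0) 0; have [d0|//] := eqVneq (M 1 1) 0.
by move: h; rewrite c0 d0 !mulr0 subr0.
Qed.

Lemma Im_moebius M z : SL2Z M -> complex.Im (moebius M z) = complex.Im z / normc (jf M z) ^+ 2.
Proof. by move=> /SL2ZE h; rewrite /moebius Im_frac. Qed.

Lemma moebius_gt0 M z : SL2Z M -> 0 < complex.Im z -> 0 < complex.Im (moebius M z).
Proof. by move=> h z0; rewrite Im_moebius// divr_gt0// exprn_gt0// normc_gt0 jf_neq0. Qed.

Lemma jf_mul M N z : SL2Z N -> 0 < complex.Im z ->
  jf (M *m N) z = jf M (moebius N z) * jf N z.
Proof.
move=> hN z0; have := jf_neq0 hN z0; rewrite /jf /moebius !mulmx2 => n0.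
by rewrite !rmorphD !rmorphM /=; field; rewrite n0.
Qed.

Lemma moebius_mul M N z : SL2Z M -> SL2Z N -> 0 < complex.Im z ->
  moebius (M *m N) z = moebius M (moebius N z).
Proof.
move=> hM hN z0; have n0 := jf_neq0 hN z0.
have E : ((M *m N) 0 0)%:~R * z + ((M *m N) 0 1)%:~R =
    ((M 0 0)%:~R * moebius N z + (M 0 1)%:~R) * jf N z.
  move: n0; rewrite /jf /moebius !mulmx2 => n0.
  by rewrite !rmorphD !rmorphM /=; field; rewrite n0.
by rewrite [LHS]/moebius E -/(jf _ _) (jf_mul M hN z0) invfM mulrACA divff// mulr1.
Qed.

Lemma moebius1 z : moebius 1%:M z = z.
Proof. by rewrite /moebius !mxE /= mul0r mul1r addr0 add0r divr1. Qed.

Lemma moebiusK M z : SL2Z M -> 0 < complex.Im z -> moebius (inv2 M) (moebius M z) = z.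
Proof. by move=> hM z0; rewrite -(moebius_mul (SL2Z_inv2 hM) hM z0) (inv2_mul hM) moebius1. Qed.

Lemma extend_in f w (w0 : 0 < complex.Im w) : extend f w = f (exist _ w w0).
Proof. by rewrite /extend (insubT (fun z : C => 0 < complex.Im z) w0). Qed.

Lemma extend_val f (z : uhp R) : extend f (val z) = f z.
Proof. by rewrite (extend_in f (valP z)); congr f; exact: val_inj. Qed.

Lemma extend_f1 w : 0 < complex.Im w -> extend (f1 R) w = th (2 * w).
Proof. by move=> w0; rewrite (extend_in _ w0) f1E. Qed.

Lemma extend_f2 w : 0 < complex.Im w -> extend (f2 R) w = th (4 * w).
Proof. by move=> w0; rewrite (extend_in _ w0) f2E. Qed.

(** [slash] at a point of [R[i]], the form required by [ioo_lim]. *)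
Definition slashC (kk : int) M f w : C := sqrtc (jf M w) ^ (- kk) * extend f (moebius M w).

Lemma slashCE kk M f (z : uhp R) : slash kk M f z = slashC kk M f (val z).
Proof. by []. Qed.

Lemma slashC1E M f w : slashC 1 M f w = (sqrtc (jf M w))^-1 * extend f (moebius M w).
Proof. by []. Qed.

(* The multiplier of the weight 1/2 theta function. *)
Definition vm M : C := (kronecker (M 1 0) (M 1 1))%:~R / eps R (M 1 1).

Lemma Gamma0_8 M : Gamma0 8 M -> [/\ M 0 0 * M 1 1 - M 0 1 * M 1 0 = 1,
  (8 %| M 1%R 0%R)%Z, (4 %| M 1%R 0%R)%Z & oddz (M 1 1)].
Proof.
move=> [/SL2ZE h h8]; have h4 : (4 %| M 1%R 0%R)%Z by apply: dvdz_trans h8.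
by split=> //; apply: oddz_det h (dvdz_trans _ h4).
Qed.

Lemma f1_Gamma0 M z : Gamma0 8 M -> 0 < complex.Im z ->
  extend (f1 R) (moebius M z) = vm M * sqrtc (jf M z) * extend (f1 R) z.
Proof.
move=> hM z0; have [h _ h4 _] := Gamma0_8 hM.
by rewrite (extend_f1 (moebius_gt0 (Gamma0_SL2Z hM) z0)) (extend_f1 z0) theta_Gamma0_4.
Qed.

Lemma chi8C_f2 M : Gamma0 8 M -> forall c', M 1 0 = 2 * c' ->
  kronecker c' (M 1 1) = chi8 (M 1 1) * kronecker (M 1 0) (M 1 1).
Proof.
move=> hM c' cE; have [h h8 h4 od] := Gamma0_8 hM.
have [c0|c0] := eqVneq c' 0; last by rewrite cE kronecker_half// mulrA chi8_sqr mul1r.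
have d1 : `|M 1%R 1%R|%N = 1%N.
  have : (`|M 0%R 0%R| * `|M 1%R 1%R| == 1)%N by rewrite -abszM; move: h; rewrite cE c0 !mulr0 subr0 => ->.
  by rewrite muln_eq1 => /andP[_ /eqP].
rewrite cE c0 mulr0 kronecker0// mulr1 /chi8.
by have [->|->] : M 1 1 = 1 \/ M 1 1 = -1 by lia.
Qed.

(** As f2 z = th (2 (2 z)), this is [theta_Gamma0_4] at 2 z for the matrix [a, 2 b; c / 2, d], where
    8 | c makes c / 2 divisible by 4. Passing from the symbol of c / 2 to that of c costs
    [chi8 d]. *)
Lemma f2_Gamma0 M z : Gamma0 8 M -> 0 < complex.Im z ->
  extend (f2 R) (moebius M z) = (chi8 (M 1 1))%:~R * vm M * sqrtc (jf M z) * extend (f2 R) z.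
Proof.
move=> hM z0; have [h h8 h4 od] := Gamma0_8 hM.
rewrite (extend_f2 (moebius_gt0 (Gamma0_SL2Z hM) z0)) (extend_f2 z0).
have [c' cE] : exists c', M 1 0 = 2 * c' by move/dvdzP: h8 => [k ->]; exists (k * 4); ring.
have c'4 : (4 %| c')%Z.
  move/dvdzP: h8 => [k kE]; apply/dvdzP; exists k.
  by move: kE; rewrite cE; lia.
have h' : M 0 0 * M 1 1 - (2 * M 0 1) * c' = 1 by apply: etrans h; rewrite cE; ring.
have z20 : 0 < complex.Im (2 * z) by rewrite (Im_natM 2) mulr_gt0.
have := theta_Gamma0_4 h' c'4 z20.
have -> : c'%:~R * (2 * z) + (M 1 1)%:~R = jf M z by rewrite /jf cE rmorphM /=; ring.
have -> : (M 0 0)%:~R * (2 * z) + (2 * M 0 1)%:~R = 2 * ((M 0 0)%:~R * z + (M 0 1)%:~R) :> C.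
  by rewrite rmorphM /=; ring.
have -> : 2 * (2 * ((M 0 0)%:~R * z + (M 0 1)%:~R) / jf M z) = 4 * moebius M z.
  by rewrite /moebius -/(jf M z); ring.
have -> : 2 * (2 * z) = 4 * z by ring.
by rewrite (chi8C_f2 hM cE) rmorphM /= /vm => ->; rewrite !mulrA.
Qed.

(** The sign cocycle by which [sqrtc (jf _ _)] fails to be an automorphy factor of weight 1/2. *)
Definition sgc M N : C := sgsqrt R (jcls (M 1 0) (M 1 1)) (jcls (N 1 0) (N 1 1))
  (jcls ((M *m N) 1 0) ((M *m N) 1 1)).

Lemma sgc_sqr M N : sgc M N ^+ 2 = 1.
Proof. by rewrite /sgc /sgsqrt; case: ifP => _; rewrite ?sqrrN expr1n. Qed.

Lemma sgc_neq0 M N : sgc M N != 0.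
Proof. by apply: contra_eq_neq (sgc_sqr M N) => ->; rewrite expr0n eq_sym oner_eq0. Qed.

Lemma sqrtc_jf M N z : SL2Z M -> SL2Z N -> 0 < complex.Im z ->
  sqrtc (jf M (moebius N z)) * sqrtc (jf N z) = sgc M N * sqrtc (jf (M *m N) z).
Proof.
move=> hM hN z0; have z'0 := moebius_gt0 hN z0.
rewrite sqrtcM ?jf_neq0// -jf_mul//; congr (_ * _); rewrite /sgc.
by rewrite !hcls_jfac.
Qed.

Lemma sqrtc_jf_neq0 M z : SL2Z M -> 0 < complex.Im z -> sqrtc (jf M z) != 0.
Proof. by move=> hM z0; rewrite sqrtc_eq0 jf_neq0. Qed.

Lemma slashC1_cocycle (k : C) M N f w : SL2Z M -> SL2Z N -> 0 < complex.Im w ->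
  (forall z, 0 < complex.Im z -> extend f (moebius M z) = k * sqrtc (jf M z) * extend f z) ->
  slashC 1 (M *m N) f w = k * sgc M N * slashC 1 N f w.
Proof.
move=> hM hN w0 H; rewrite !slashC1E moebius_mul// H ?moebius_gt0//.
have n1 := sqrtc_jf_neq0 hN w0; have n2 := sqrtc_jf_neq0 (SL2Z_mul hM hN) w0.
have := sqrtc_jf hM hN w0; move: (extend f _) (sqrtc _) (sqrtc _) (sqrtc _) (sgc M N) n1 n2.
move=> e A B D s B0 D0 h.
have -> : A = s * B / D by rewrite -h mulfK.
by field; rewrite D0 B0.
Qed.

Lemma slashC1_f1 M N w : Gamma0 8 M -> SL2Z N -> 0 < complex.Im w ->
  slashC 1 (M *m N) (f1 R) w = vm M * sgc M N * slashC 1 N (f1 R) w.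
Proof.
move=> hM hN w0; apply: slashC1_cocycle => //; first exact: Gamma0_SL2Z hM.
by move=> z z0; exact: f1_Gamma0.
Qed.

Lemma slashC1_f2 M N w : Gamma0 8 M -> SL2Z N -> 0 < complex.Im w ->
  slashC 1 (M *m N) (f2 R) w = (chi8 (M 1 1))%:~R * vm M * sgc M N * slashC 1 N (f2 R) w.
Proof.
move=> hM hN w0; apply: slashC1_cocycle => //; first exact: Gamma0_SL2Z hM.
by move=> z z0; exact: f2_Gamma0.
Qed.

Definition T2 s := mk2 1 s 0 1.

Lemma SL2Z_T2 s : SL2Z (T2 s).
Proof. by apply: SL2Z_mk2; ring. Qed.

Lemma moebius_T2 s z : moebius (T2 s) z = z + s%:~R.
Proof. by rewrite /moebius !mk2s mul0r mul1r add0r divr1. Qed.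

Lemma jf_T2 M s z : jf (M *m T2 s) z = jf M (z + s%:~R).
Proof. by rewrite /jf !mulmx2 !mk2s mulr0 mulr1 addr0 mulr1 rmorphD rmorphM /=; ring. Qed.

Lemma slashC_T2 kk M f s w : SL2Z M -> 0 < complex.Im w ->
  slashC kk (M *m T2 s) f w = slashC kk M f (w + s%:~R).
Proof.
by move=> hM w0; rewrite /slashC jf_T2 (moebius_mul hM (SL2Z_T2 s) w0) moebius_T2.
Qed.

Lemma Im_add_int w s : complex.Im (w + s%:~R) = complex.Im w.
Proof. by rewrite cImD Im_int addr0. Qed.

(** [f1_Gamma0] at z = i equates a product containing this factor with a value of [th], which is
    nonzero. *)
Lemma vm_neq0 M : Gamma0 8 M -> vm M != 0.
Proof.
move=> hM; have i0 : 0 < complex.Im ('i : C) by rewrite cImi.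
have := f1_Gamma0 hM i0; apply: contra_eq_neq => ->; rewrite !mul0r.
by rewrite extend_f1 ?moebius_gt0//; [apply: th_neq0; rewrite (Im_natM 2) mulr_gt0// moebius_gt0//|]; exact: Gamma0_SL2Z hM.
Qed.

Lemma kronecker_Gamma0 M : Gamma0 8 M ->
  kronecker (M 1 0) (M 1 1) = 1 \/ kronecker (M 1 0) (M 1 1) = -1.
Proof.
move=> hM; have := vm_neq0 hM; have [_ _ _ /oddz_neq0 d0] := Gamma0_8 hM.
rewrite /vm; case/or3P: (kronecker_cases (M 1 0) d0) => /eqP -> ; [|by left|by right].
by rewrite mul0r eqxx.
Qed.

Lemma eps_sqr d : oddz d -> eps R d ^+ 2 = (chi4 d)%:~R.
Proof. by move=> /modz4_odd[] e; rewrite epsE /chi4 e /= ?expr1n ?sqr_i ?rmorph1 ?rmorphN. Qed.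

Lemma eps_neq0 d : eps R d != 0.
Proof. by rewrite epsE; case: ifP => _; rewrite ?oner_eq0// -normc_gt0 normci. Qed.

End Slash.

(** * Limits at i oo and the function vanishing at the cusp 1/2 *)

Section CuspLimits.
Variable R : realType.
Notation C := R[i].
Implicit Types (z w u v k l q : C) (a b c d s : int) (x y t : R) (M N : 'M[int]_2) (f : uhp R -> C) (h : C -> C).

(** The coefficient 2 counts n = 1 and n = -1; it gives the exact order of vanishing of [kappa]. *)
Lemma phi_bound2 : exists2 K : R, 0 < K &
  forall q, normc q <= 1 / 2 -> normc (phi q - 1 - 2 * q) <= K * normc q ^+ 2.
Proof.
have [||K K0 HK] := @square_exp_dominated R (1 / 2) 1 => //.
  by apply/andP; split; lra.
exists (8 * K); first by rewrite mulr_gt0.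
move=> q qh; have q1 : normc q < 1 by rewrite (le_lt_trans qh)//; lra.
have q1' := ltW q1; have q0 := normc_ge0 q.
have [K' K'0 HK'] := sterm_dominated 1 q1.
have r0 : 0 <= 1 / 4 :> R by lra.
have HK'' : dominated (fun m : nat => sterm q 1 m.+1) (K' * (1 / 4)) (1 / 4).
  by move=> n; rewrite -mulrA -exprS.
have s0 : sterm q 1 0 = 1 by rewrite /sterm !expr0 mulr1.
have s1 : sterm q 1 1 = q by rewrite /sterm muln1 !expr1 mulr1.
rewrite phiE /Sth (csumSl K'0 (quarter01 R) HK') s0 (csumSl (mulr_ge0 K'0 r0) (quarter01 R) HK'') s1.
have -> : 2 * (1 + (q + csum (fun m : nat => sterm q 1 m.+2))) - 1 - 1 - 2 * q = 2 * csum (fun m : nat => sterm q 1 m.+2) by ring.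
have d : dominated (fun m : nat => sterm q 1 m.+2) (2 * K * normc q ^+ 2) (1 / 4).
  move=> n; rewrite /sterm expr1n mulr1 normcX.
  have -> : (n.+2 * n.+2 = 2 + (n * n + (4 * n + 2)))%N by lia.
  rewrite exprD mulrC mulrAC ler_wpM2r ?exprn_ge0//.
  apply: (@le_trans _ _ (normc q ^+ (n * n))).
    by rewrite exprD ler_piMr ?exprn_ge0// exprn_ile1.
  apply: (@le_trans _ _ ((1 / 2) ^+ (n * n))).
    by rewrite lerXn2r ?nnegrE.
  have := HK n; rewrite expr1n mulr1 => /le_trans; apply.
  by rewrite ler_wpM2r ?exprn_ge0// ler_peMl ?ler1n// ltW.
rewrite normcM; have -> : normc (2 : C) = 2 by rewrite -(rmorph_nat (real_complex R)) normcR ger0_norm.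
rewrite (le_trans (ler_wpM2l _ (normc_csum _ (quarter01 R) d)))//.
  by rewrite !mulr_ge0 ?exprn_ge0 ?(ltW K0).
have : 0 <= K * normc q ^+ 2 by rewrite mulr_ge0 ?exprn_ge0 ?(ltW K0).
set x := K * normc q ^+ 2 => x0.
have -> : 2 * (2 * K * normc q ^+ 2 / (1 - 1 / 4)) = 16 / 3 * x by rewrite /x; field.
by rewrite [leRHS](_ : _ = 8 * x); [lra|rewrite /x mulrA].
Qed.

Opaque qprod phi Jth qpoch cexp qexp th.

Lemma eq_ioo_lim h h' l : (forall w, 0 < complex.Im w -> h w = h' w) -> ioo_lim h l -> ioo_lim h' l.
Proof.
move=> hh' hl e /hl[Y H]; exists (Num.max Y 0) => z; rewrite gt_max => /andP[Yz z0].
by rewrite -hh'//; exact: H.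
Qed.

Lemma ioo_lim_cst k : ioo_lim (fun=> k) k.
Proof. by move=> e e0; exists 0 => z _; rewrite subrr normc0. Qed.

Lemma ioo_limD h h' l l' : ioo_lim h l -> ioo_lim h' l' -> ioo_lim (fun w => h w + h' w) (l + l').
Proof.
move=> hl hl' e e0; have e2 : 0 < e / 2 by rewrite divr_gt0.
have [Y H] := hl _ e2; have [Y' H'] := hl' _ e2.
exists (Num.max Y Y') => z; rewrite gt_max => /andP[Yz Yz'].
have -> : h z + h' z - (l + l') = (h z - l) + (h' z - l') by ring.
by rewrite (le_lt_trans (ler_normcD _ _))// [e]splitr ltrD// ?H ?H'.
Qed.

Lemma ioo_limM h h' l l' : ioo_lim h l -> ioo_lim h' l' -> ioo_lim (fun w => h w * h' w) (l * l').
Proof.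
move=> hl hl' e e0.
pose A := 1 + normc l + normc l'; have A0 : 0 < A by rewrite ltr_wpDr ?normc_ge0// ltr_wpDr ?normc_ge0.
pose e' := Num.min 1 (e / (2 * A)).
have e'0 : 0 < e' by rewrite lt_min ltr01 divr_gt0// mulr_gt0.
have [Y H] := hl _ e'0; have [Y' H'] := hl' _ e'0.
exists (Num.max Y Y') => z; rewrite gt_max => /andP[/H hz /H' hz'].
have -> : h z * h' z - l * l' = (h z - l) * (h' z - l') + (l * (h' z - l') + (h z - l) * l') by ring.
rewrite (le_lt_trans (ler_normcD _ _))// (le_lt_trans (lerD (lexx _) (ler_normcD _ _)))// !normcM.
have e'1 : e' <= 1 by rewrite ge_min lexx.
have e'A : e' * A <= e / 2.
  have : e' <= e / (2 * A) by rewrite ge_min lexx orbT.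
  by rewrite ler_pdivlMr ?mulr_gt0// => h1; lra.
move: (normc_ge0 (h z - l)) (normc_ge0 (h' z - l')) (normc_ge0 l) (normc_ge0 l') hz hz' e'A.
rewrite /A; move: (normc (h z - l)) (normc (h' z - l')) (normc l) (normc l') => p p' m m' p0 p'0 m0 m'0 pe p'e eA.
have h1 : p * p' <= e' by rewrite -[leRHS]mulr1 ler_pM ?(ltW pe)//; lra.
have h2 : m * p' <= m * e' by rewrite ler_wpM2l// ltW.
have h3 : p * m' <= e' * m' by rewrite ler_wpM2r// ltW.
lra.
Qed.

Lemma ioo_limZ k h l : ioo_lim h l -> ioo_lim (fun w => k * h w) (k * l).
Proof. exact: ioo_limM (ioo_lim_cst k). Qed.

Lemma ioo_limX h l n : ioo_lim h l -> ioo_lim (fun w => h w ^+ n) (l ^+ n).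
Proof.
move=> hl; elim: n => [|n IH]; first exact: ioo_lim_cst.
rewrite exprS; apply: eq_ioo_lim (ioo_limM hl IH) => w _; by rewrite exprS.
Qed.

Lemma ioo_limV h l : l != 0 -> ioo_lim h l -> ioo_lim (fun w => (h w)^-1) l^-1.
Proof.
move=> l0 hl e e0; have n0 : 0 < normc l by rewrite normc_gt0.
have n2 : 0 < normc l / 2 by rewrite divr_gt0.
have e'0 : 0 < Num.min (normc l / 2) (e * (normc l / 2 * normc l)).
  by rewrite lt_min n2 !mulr_gt0.
have [Y H] := hl _ e'0; exists Y => z /H; rewrite lt_min => /andP[h1 h2].
have hz : normc l / 2 <= normc (h z).
  have e1 : l - (l - h z) = h z by ring.
  by have := ler_normcBd l (l - h z); rewrite e1 normcB; lra.
have hz0 : h z != 0 by rewrite -normc_gt0 (lt_le_trans n2).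
have -> : (h z)^-1 - l^-1 = - (h z - l) / (h z * l) by field; rewrite hz0 l0.
rewrite normcM normcN' normcV normcM ltr_pdivrMr ?mulr_gt0 ?(lt_le_trans n2 hz)//.
by rewrite (lt_le_trans h2)// ler_pM2l// ler_pM2r.
Qed.

Lemma ioo_lim_affine h l (t : R) k : 0 < t -> ioo_lim h l -> ioo_lim (fun w => h (t%:C * w + k)) l.
Proof.
move=> t0 hl e /hl[Y H]; exists ((Y - complex.Im k) / t) => z.
by rewrite ltr_pdivrMr// ltrBlDr => zY; apply: H; rewrite cImD cImRM mulrC.
Qed.

Lemma ioo_lim_qexp : ioo_lim (@qexp R) 0.
Proof. by move=> e /qexp_small[Y H]; exists Y => z Yz; rewrite subr0 H// ltW. Qed.

Lemma nome_qexp z : cexp (pi%:C * 'i * z) = qexp ((2^-1)%:C * z + 0) :> C.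
Proof.
Transparent qexp. rewrite /qexp. Opaque qexp.
by congr cexp; rewrite fmorphV rmorph_nat addr0; field.
Qed.

Lemma ioo_lim_nome : ioo_lim (fun z => cexp (pi%:C * 'i * z)) 0.
Proof.
apply: (@eq_ioo_lim (fun z => qexp ((2^-1)%:C * z + 0))) => [w _|]; first by rewrite nome_qexp.
by apply: ioo_lim_affine; [rewrite invr_gt0|exact: ioo_lim_qexp].
Qed.

Lemma ioo_lim_phi h (l : C) : ioo_lim h 0 -> ioo_lim (fun z => phi (h z)) 1.
Proof.
move=> h0 e e0; have [K K0 HK] := @phi_bound R.
have e'0 : 0 < Num.min (1 / 2) (e / K) by rewrite lt_min !divr_gt0.
have [Y H] := h0 _ e'0; exists Y => z /H; rewrite subr0 lt_min => /andP[h1 h2].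
by rewrite (le_lt_trans (HK _ (ltW h1)))// mulrC -ltr_pdivlMr.
Qed.

Lemma ioo_lim_th : ioo_lim (@th R) 1.
Proof.
Transparent th. rewrite /th. Opaque th.
exact: ioo_lim_phi 0 ioo_lim_nome.
Qed.

(* [kappa] vanishes to first order at the cusp; up to a translation it is the
   expansion of f1 at the cusp 1/2. *)
Definition kappa v : C := th (v / 4) - th v.

Lemma ioo_lim_kappa0 : ioo_lim kappa 0.
Proof.
rewrite -(subrr 1); apply: ioo_limD; last first.
  rewrite -mulN1r; apply: eq_ioo_lim (ioo_limZ (-1) ioo_lim_th) => w _; by rewrite mulN1r.
apply: (@eq_ioo_lim (fun w => th ((4^-1)%:C * w + 0))) => [w _|].
  by rewrite addr0 mulrC fmorphV rmorph_nat.
by apply: ioo_lim_affine ioo_lim_th; rewrite invr_gt0.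
Qed.

(* [kappa v = phi q - phi (q ^ 4) = 2 q + O (q ^ 2)] with [q = e^(pi i v / 4)]. *)
Lemma ioo_lim_kappa : ioo_lim (fun v => kappa v / cexp (pi%:C * 'i * (v / 4))) 2.
Proof.
have [K K0 HK] := phi_bound2; have [K' K'0 HK'] := @phi_bound R.
move=> e e0.
have A0 : 0 < K + K' by rewrite addr_gt0.
have hq : ioo_lim (fun v => cexp (pi%:C * 'i * (v / 4))) 0.
  apply: (@eq_ioo_lim (fun w => cexp (pi%:C * 'i * ((4^-1)%:C * w + 0)))) => [w _|].
    by rewrite addr0 [_ * w]mulrC fmorphV rmorph_nat.
  by apply: (ioo_lim_affine (h := fun z => cexp (pi%:C * 'i * z))) ioo_lim_nome; rewrite invr_gt0.
have e'0 : 0 < Num.min (1 / 2) (e / (K + K')) by rewrite lt_min !divr_gt0.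
have [Y H] := hq _ e'0; exists Y => v /H; rewrite subr0 lt_min => /andP[h1 h2].
have -> : kappa v = phi (cexp (pi%:C * 'i * (v / 4))) - phi (cexp (pi%:C * 'i * (v / 4)) ^+ 4).
  Transparent th. rewrite /kappa /th -nomeMn. Opaque th.
  by congr (_ - phi (cexp (_ * _))); field.
have q0 := cexp_neq0 (pi%:C * 'i * (v / 4)).
move: (cexp _) q0 h1 h2 => q q0 h1 h2; have q1 := ltW h1.
have p0 : 0 < normc q by rewrite normc_gt0.
have q41 : normc (q ^+ 4) <= normc q ^+ 2.
  by rewrite normcX ler_wiXn2l// ?normc_ge0//; lra.
have q4h : normc (q ^+ 4) <= 1 / 2.
  by rewrite (le_trans q41)// expr2 (le_trans _ q1)// ler_piMl ?normc_ge0//; lra.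
have -> : (phi q - phi (q ^+ 4)) / q - 2 = ((phi q - 1 - 2 * q) - (phi (q ^+ 4) - 1)) / q.
  by move: (phi q) (phi _) => A B; field.
rewrite normcM normcV ltr_pdivrMr// (le_lt_trans (ler_normcB _ _))//.
apply: (@le_lt_trans _ _ ((K + K') * normc q * normc q)).
  have -> : (K + K') * normc q * normc q = K * normc q ^+ 2 + K' * normc q ^+ 2 by ring.
  by apply: lerD (HK _ q1) (le_trans (HK' _ q4h) _); rewrite ler_pM2l.
by rewrite ltr_pM2r// mulrC -ltr_pdivlMr.
Qed.

Lemma sqrtc_Ni_hcls v k : 0 < complex.Im v -> ~~ hcls k -> k != 0 -> sqrtc (k * v) = sqrtc k * sqrtc v.
Proof.
move=> v0 hk k0; have hv : hcls v by rewrite /hcls v0.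
by rewrite (sqrtcM k0 (Im_neq0 v0)) (negPf hk) hv /sgsqrt /= mul1r.
Qed.

Lemma Ni_hcls (t : R) : 0 < t -> ~~ hcls (- 'i * t%:C).
Proof.
move=> t0; have -> : - 'i * t%:C = 0 -i* t by apply: complex_ext => /=; ring.
by rewrite /hcls /= oppr_gt0 oppr_eq0 (gt_eqF t0) /= orbF -leNgt ltW.
Qed.

Lemma Ni_neq0 (t : R) : 0 < t -> - 'i * t%:C != 0 :> C.
Proof. by move=> t0; rewrite -normc_gt0 normcM normcN' normci mul1r normcR normr_gt0 gt_eqF. Qed.

Lemma th_inv_scale (t : R) v : 0 < t -> 0 < complex.Im v ->
  th (- (t%:C * v)^-1) = sqrtc (- 'i * t%:C) * sqrtc v * th (t%:C * v).
Proof.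
move=> t0 v0; rewrite th_inv; last by rewrite cImRM mulr_gt0.
by rewrite mulrA sqrtc_Ni_hcls ?Ni_hcls ?Ni_neq0.
Qed.

(** With u = -1 / v, [phi_add_opp] gives th (u + 1) = 2 th (4 u) - th u; inverting both terms leaves
    th (v / 4) - th v, the 2 being cancelled by the root of 1 / 4. *)
Lemma th_inv_add1 v : 0 < complex.Im v -> th (1 - v^-1) = sqrtc (- 'i) * sqrtc v * kappa v.
Proof.
move=> v0; have v1 := Im_inv_gt0 v0.
have -> : th (1 - v^-1) = 2 * th (4 * - v^-1) - th (- v^-1).
  rewrite [1 - _]addrC th_add1.
  Transparent th. rewrite /th nomeMn -phi_add_opp; last exact: normc_nome.
  Opaque th. by rewrite addrAC subrr add0r.
have vn0 := Im_neq0 v0.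
have -> : 4 * - v^-1 = - ((4^-1)%:C * v)^-1.
  by rewrite fmorphV rmorph_nat; field; rewrite vn0.
have q0 : 0 < 4^-1 :> R by rewrite invr_gt0.
have H1 := th_inv_scale ltr01 v0; rewrite rmorph1 !mul1r mulr1 in H1.
rewrite (th_inv_scale q0 v0) H1.
have -> : sqrtc (- 'i * (4^-1)%:C) = sqrtc (- 'i) / 2 :> C.
  have : sqrtc (- 'i * (4^-1)%:C) ^+ 2 = (sqrtc (- 'i) / 2) ^+ 2 :> C.
    by rewrite expr_div_n !sqr_sqrtc fmorphV rmorph_nat -natrX.
  have := sqrtc_nhcls (Ni_neq0 q0) (Ni_hcls q0); have := sqrtc_nhcls (Ni_neq0 (@ltr01 R)) (Ni_hcls ltr01).
  rewrite rmorph1 mulr1; move: (sqrtc _) (sqrtc _) => A B [A1 _] [B1 _] /eqP.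
  rewrite eqf_sqr => /orP[/eqP//|/eqP e]; exfalso.
  have := congr1 (@complex.Re R) e; rewrite cReN mulrC -(rmorph_nat (real_complex R)) -fmorphV cReRM => e'.
  have : 0 < 2^-1 * complex.Re A by rewrite mulr_gt0// invr_gt0.
  by lra.
rewrite /kappa [_ * v]mulrC fmorphV rmorph_nat.
by move: (th _) (th _) (sqrtc _) (sqrtc _) => A B D E; field.
Qed.

End CuspLimits.

(** * The values of f1 and f2 at the cusps of Gamma_0(8) *)

Section Cusps.
Variable R : realType.
Notation C := R[i].
Implicit Types (z w u v k l q : C) (a b c d s : int) (x y t : R) (M N : 'M[int]_2) (f : uhp R -> C) (h : C -> C).
Opaque qprod phi Jth qpoch cexp qexp th.

Definition S2 := mk2 0 (-1) 1 0.
Definition L2 n := mk2 1 0 n 1.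

Lemma SL2Z_S2 : SL2Z S2. Proof. by apply: SL2Z_mk2. Qed.
Lemma SL2Z_L2 n : SL2Z (L2 n). Proof. by apply: SL2Z_mk2; ring. Qed.
Lemma SL2Z_1 : SL2Z (1%:M : 'M[int]_2). Proof. by rewrite /SL2Z /= det1. Qed.

Lemma jf_S2 w : jf S2 w = w.
Proof. by rewrite /jf !mk2s mul1r addr0. Qed.

Lemma moebius_S2 w : moebius S2 w = - w^-1.
Proof. by rewrite /moebius -/(jf S2 w) jf_S2 !mk2s mul0r add0r rmorphN1 mulN1r. Qed.

Lemma jf_L2 n w : jf (L2 n) w = n%:~R * w + 1.
Proof. by rewrite /jf !mk2s. Qed.

Lemma moebius_L2 n w : moebius (L2 n) w = w / (n%:~R * w + 1).
Proof. by rewrite /moebius !mk2s mul1r addr0. Qed.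

Lemma jf_L2_neq0 n w : 0 < complex.Im w -> n%:~R * w + 1 != 0 :> C.
Proof. by move=> w0; have := jf_neq0 (SL2Z_L2 n) w0; rewrite jf_L2. Qed.

Lemma slashC1_f1E M w : SL2Z M -> 0 < complex.Im w ->
  slashC 1 M (f1 R) w = (sqrtc (jf M w))^-1 * th (2 * moebius M w).
Proof. by move=> hM w0; rewrite slashC1E (extend_f1 (moebius_gt0 hM w0)). Qed.

Lemma slashC1_f2E M w : SL2Z M -> 0 < complex.Im w ->
  slashC 1 M (f2 R) w = (sqrtc (jf M w))^-1 * th (4 * moebius M w).
Proof. by move=> hM w0; rewrite slashC1E (extend_f2 (moebius_gt0 hM w0)). Qed.

Lemma sqrtc_cancel w k l : w != 0 -> (sqrtc w)^-1 * (k * sqrtc w * l) = k * l.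
Proof.
move=> w0; have s0 : sqrtc w != 0 by rewrite sqrtc_eq0.
by move: (sqrtc w) s0 => s s0; field.
Qed.

Lemma slash_S2_f1 w : 0 < complex.Im w ->
  slashC 1 S2 (f1 R) w = sqrtc (- 'i * (2^-1)%:C) * th ((2^-1)%:C * w).
Proof.
move=> w0; have wn0 := Im_neq0 w0; have t0 : 0 < 2^-1 :> R by rewrite invr_gt0.
rewrite (slashC1_f1E SL2Z_S2 w0) jf_S2 moebius_S2.
have -> : 2 * - w^-1 = - ((2^-1)%:C * w)^-1 by rewrite fmorphV rmorph_nat; field; rewrite wn0.
by rewrite (th_inv_scale t0 w0) (sqrtc_cancel _ _ wn0).
Qed.

Lemma slash_S2_f2 w : 0 < complex.Im w ->
  slashC 1 S2 (f2 R) w = sqrtc (- 'i * (4^-1)%:C) * th ((4^-1)%:C * w).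
Proof.
move=> w0; have wn0 := Im_neq0 w0; have t0 : 0 < 4^-1 :> R by rewrite invr_gt0.
rewrite (slashC1_f2E SL2Z_S2 w0) jf_S2 moebius_S2.
have -> : 4 * - w^-1 = - ((4^-1)%:C * w)^-1 by rewrite fmorphV rmorph_nat; field; rewrite wn0.
by rewrite (th_inv_scale t0 w0) (sqrtc_cancel _ _ wn0).
Qed.

Lemma Im_jf_L2 (n : int) w : 0 < n -> 0 < complex.Im w -> 0 < complex.Im (n%:~R * w + 1).
Proof.
move=> n0 w0; have -> : 1 = 1%:~R :> C by [].
by rewrite Im_add_int Im_intM mulr_gt0// ltr0z.
Qed.

Lemma slash_L4_f1 w : 0 < complex.Im w -> slashC 1 (L2 4) (f1 R) w = th (2 * w).
Proof.
move=> w0; rewrite (slashC1_f1E (SL2Z_L2 _) w0) jf_L2 moebius_L2.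
have := th_U 1 w0; rewrite mulr1 => ->.
have s0 : sqrtc (4%:~R * w + 1) != 0 :> C by rewrite sqrtc_eq0 (jf_L2_neq0 4 w0).
by rewrite mulrA (mulVf s0) mul1r.
Qed.

Lemma slash_L4_f2 w : 0 < complex.Im w ->
  slashC 1 (L2 4) (f2 R) w = sqrtc (- 'i) * kappa (4 * w + 1).
Proof.
move=> w0; rewrite (slashC1_f2E (SL2Z_L2 _) w0) jf_L2 moebius_L2.
have n0 := jf_L2_neq0 4 w0.
have -> : 4 * (w / (4%:~R * w + 1)) = 1 - (4%:~R * w + 1)^-1 by field; rewrite n0.
rewrite th_inv_add1; last exact: Im_jf_L2.
exact: sqrtc_cancel n0.
Qed.

Lemma slash_L2_f1 w : 0 < complex.Im w ->
  slashC 1 (L2 2) (f1 R) w = sqrtc (- 'i) * kappa (2 * w + 1).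
Proof.
move=> w0; rewrite (slashC1_f1E (SL2Z_L2 _) w0) jf_L2 moebius_L2.
have n0 := jf_L2_neq0 2 w0.
have -> : 2 * (w / (2%:~R * w + 1)) = 1 - (2%:~R * w + 1)^-1 by field; rewrite n0.
rewrite th_inv_add1; last exact: Im_jf_L2.
exact: sqrtc_cancel n0.
Qed.

Lemma slash_L2_f2 w : 0 < complex.Im w ->
  slashC 1 (L2 2) (f2 R) w = sqrtc (- 'i * (2^-1)%:C) * th ((2^-1)%:C * (2 * w + 1)).
Proof.
move=> w0; rewrite (slashC1_f2E (SL2Z_L2 _) w0) jf_L2 moebius_L2.
have n0 := jf_L2_neq0 2 w0.
have v0 : 0 < complex.Im (2%:~R * w + 1) by exact: Im_jf_L2.
have t0 : 0 < 2^-1 :> R by rewrite invr_gt0.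
have -> : 4 * (w / (2%:~R * w + 1)) = - ((2^-1)%:C * (2%:~R * w + 1))^-1 + 2 * 1%:~R.
  by rewrite fmorphV rmorph_nat; field; rewrite n0.
by rewrite th_add2z (th_inv_scale t0 v0) (sqrtc_cancel _ _ n0).
Qed.

(* The zero set of the polynomial of the cusp form g. *)
Definition six_lines (al be : C) :=
  al * be * (al ^+ 2 - be ^+ 2) * (al ^+ 2 - 2 * be ^+ 2) = 0.

Definition cusp_values M (al be : C) :=
  ioo_lim (slashC 1 M (f1 R)) al /\ ioo_lim (slashC 1 M (f2 R)) be.

Lemma ioo_lim_th_scale (t : R) k : 0 < t -> ioo_lim (fun w => th (t%:C * w + k)) 1.
Proof. by move=> t0; apply: ioo_lim_affine (@ioo_lim_th R). Qed.

Lemma sqrtc_Ni_neq0 (t : R) : 0 < t -> sqrtc (- 'i * t%:C) != 0 :> C.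
Proof. by move=> t0; rewrite sqrtc_eq0 Ni_neq0. Qed.

Lemma natC n : (n%:R : C) = (n%:R : R)%:C. Proof. by rewrite rmorph_nat. Qed.

Lemma cusp_values_1 : cusp_values 1%:M 1 1.
Proof.
split.
  apply: (@eq_ioo_lim _ (fun w => th ((2%:R : R)%:C * w + 0))) => [w w0|].
    by rewrite addr0 -natC slashC1E moebius1 (extend_f1 w0) /jf !mxE /= mul0r add0r sqrtc1 invr1 mul1r.
  exact: ioo_lim_th_scale.
apply: (@eq_ioo_lim _ (fun w => th ((4%:R : R)%:C * w + 0))) => [w w0|].
  by rewrite addr0 -natC slashC1E moebius1 (extend_f2 w0) /jf !mxE /= mul0r add0r sqrtc1 invr1 mul1r.
exact: ioo_lim_th_scale.
Qed.

Lemma cusp_values_S2 : cusp_values S2 (sqrtc (- 'i * (2^-1)%:C)) (sqrtc (- 'i * (4^-1)%:C)).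
Proof.
split.
  apply: (@eq_ioo_lim _ (fun w => sqrtc (- 'i * (2^-1)%:C) * th ((2^-1)%:C * w + 0))) => [w w0|].
    by rewrite addr0 slash_S2_f1.
  by rewrite -[X in ioo_lim _ X]mulr1; apply: ioo_limZ; apply: ioo_lim_th_scale; rewrite invr_gt0.
apply: (@eq_ioo_lim _ (fun w => sqrtc (- 'i * (4^-1)%:C) * th ((4^-1)%:C * w + 0))) => [w w0|].
  by rewrite addr0 slash_S2_f2.
by rewrite -[X in ioo_lim _ X]mulr1; apply: ioo_limZ; apply: ioo_lim_th_scale; rewrite invr_gt0.
Qed.

Lemma cusp_values_L4 : cusp_values (L2 4) 1 0.
Proof.
split.
  apply: (@eq_ioo_lim _ (fun w => th ((2%:R : R)%:C * w + 0))) => [w w0|].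
    by rewrite addr0 -natC slash_L4_f1.
  exact: ioo_lim_th_scale.
apply: (@eq_ioo_lim _ (fun w => sqrtc (- 'i) * kappa ((4%:R : R)%:C * w + 1))) => [w w0|].
  by rewrite -natC slash_L4_f2.
rewrite -[X in ioo_lim _ X](mulr0 (sqrtc (- 'i))); apply: ioo_limZ.
by apply: ioo_lim_affine; [|exact: ioo_lim_kappa0].
Qed.

Lemma cusp_values_L2 : cusp_values (L2 2) 0 (sqrtc (- 'i * (2^-1)%:C)).
Proof.
split.
  apply: (@eq_ioo_lim _ (fun w => sqrtc (- 'i) * kappa ((2%:R : R)%:C * w + 1))) => [w w0|].
    by rewrite -natC slash_L2_f1.
  rewrite -[X in ioo_lim _ X](mulr0 (sqrtc (- 'i))); apply: ioo_limZ.
  by apply: ioo_lim_affine; [|exact: ioo_lim_kappa0].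
apply: (@eq_ioo_lim _ (fun w => sqrtc (- 'i * (2^-1)%:C) * th (1%:C * w + (2^-1)%:C))) => [w w0|].
  rewrite (slash_L2_f2 w0); congr (_ * th _).
  by rewrite fmorphV rmorph_nat rmorph1; field.
by rewrite -[X in ioo_lim _ X]mulr1; apply: ioo_limZ; apply: ioo_lim_th_scale.
Qed.

(** A translation on the right is invisible in the limit. Gamma_0(8) on the left rescales the pair
    and may flip the relative sign through [chi8]; [six_lines] is invariant under both. *)
Lemma cusp_values_mul M N s al be : Gamma0 8 M -> SL2Z N -> cusp_values N al be ->
  cusp_values (M *m (N *m T2 s)) (vm R M * sgc R M (N *m T2 s) * al)
    ((chi8 (M 1 1))%:~R * vm R M * sgc R M (N *m T2 s) * be).
Proof.
move=> hM hN [h1 h2]; have hNT := SL2Z_mul hN (SL2Z_T2 s).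
have sh f l : ioo_lim (slashC 1 N f) l -> ioo_lim (slashC 1 (N *m T2 s) f) l.
  move=> h; apply: (@eq_ioo_lim _ (fun w => slashC 1 N f (1%:C * w + s%:~R))) => [w w0|].
    by rewrite mul1r slashC_T2.
  exact: ioo_lim_affine.
split.
  apply: eq_ioo_lim (ioo_limZ (vm R M * sgc R M (N *m T2 s)) (sh _ _ h1)) => w w0.
  by rewrite (slashC1_f1 hM hNT w0).
apply: eq_ioo_lim (ioo_limZ ((chi8 (M 1 1))%:~R * vm R M * sgc R M (N *m T2 s)) (sh _ _ h2)) => w w0.
by rewrite (slashC1_f2 hM hNT w0).
Qed.

Lemma mul_inv2_10 M N : (M *m inv2 N) 1 0 = M 1 0 * N 1 1 - M 1 1 * N 1 0.
Proof. by rewrite mulmx2 !mk2s; ring. Qed.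

Lemma mul_inv2_11 M N : (M *m inv2 N) 1 1 = M 1 1 * N 0 0 - M 1 0 * N 0 1.
Proof. by rewrite mulmx2 !mk2s; ring. Qed.

Lemma Gamma0_mul_inv2 M N : SL2Z M -> SL2Z N -> (8 %| M 1%R 0%R * N 1%R 1%R - M 1%R 1%R * N 1%R 0%R)%Z ->
  Gamma0 8 (M *m inv2 N) /\ M = (M *m inv2 N) *m N.
Proof.
move=> hM hN h8; split; last by rewrite -mulmxA inv2_mul// mulmx1.
by split; [exact: SL2Z_mul hM (SL2Z_inv2 hN)|rewrite mul_inv2_10].
Qed.

(** Representatives of the cusps oo, 0, 1/4 and 1/2. *)
Definition cusp_rep N := [\/ N = 1%:M, N = S2, N = L2 4 | N = L2 2].

(** The cusp is decided by the lower left entry c: odd, divisible by 8, equal to 4 modulo 8, or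
    equal to 2 modulo 4. The divisibility puts M (N T^s)^-1 into Gamma_0(8), see
    [Gamma0_mul_inv2]. *)
Lemma coset_reps M : SL2Z M -> exists N s, [/\ cusp_rep N, SL2Z N,
  (8 %| M 1%R 0%R * (N *m T2 s) 1%R 1%R - M 1%R 1%R * (N *m T2 s) 1%R 0%R)%Z &
  N = L2 2 -> (M 1%R 0%R %% 4)%Z = 2].
Proof.
move=> /SL2ZE hM; set c := M 1 0; set d := M 1 1.
have e N s : c * (N *m T2 s) 1 1 - d * (N *m T2 s) 1 0 = c * (N 1 0 * s + N 1 1) - d * N 1 0.
  by rewrite !mulmx2 !mk2s; ring.
have od : ~~ oddz c -> oddz d.
  rewrite /oddz => oc; have : (2 %| c)%Z by lia.
  by move/(oddz_det hM).
case: (boolP (oddz c)) => oc.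
  (* For odd c one has c ^ 2 = 1 modulo 8, so s = d c solves c s = d. *)
  exists S2, (d * c); split; [by constructor 2|exact: SL2Z_S2| |].
    rewrite e !mk2s; have -> : c * (1 * (d * c) + 0) - d * 1 = d * (c * c - 1) by ring.
    apply: dvdz_mull; have := modz8_odd oc; rewrite -eqz_mod_dvd -modzMm.
    by case=> ->.
  by move/(congr1 (fun A : 'M[int]_2 => A 1 0)); rewrite !mk2s.
have {}od := od oc; rewrite /oddz in oc od.
case: (boolP (8 %| c)%Z) => c8.
  exists 1%:M, 0; split; [by constructor 1|exact: SL2Z_1| |].
    by rewrite e !mxE /= mul0r mulr0 add0r mulr1 subr0.
  by move/(congr1 (fun A : 'M[int]_2 => A 1 0)); rewrite !mk2s mxE.
case: (boolP (4 %| c)%Z) => c4.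
  exists (L2 4), 0; split; [by constructor 3|exact: SL2Z_L2| |].
    by rewrite e !mk2s; lia.
  by move/(congr1 (fun A : 'M[int]_2 => A 1 0)); rewrite !mk2s.
(* Here c (2 s + 1) - 2 d must vanish modulo 8. It does modulo 4, and raising s by 1 adds 2 c, which
   is 4 modulo 8. *)
exists (L2 2), (if (8 %| c - 2 * d)%Z then 0 else 1); split; [by constructor 4|exact: SL2Z_L2| |].
  by rewrite e !mk2s; case: ifPn; lia.
by move=> _; lia.
Qed.

(** Checked at the four representatives and carried over by [cusp_values_mul]; the last clause
    confines the zeros of f1 to the cusps equivalent to 1/2. *)
Lemma cusp_limits M : SL2Z M -> exists al be, [/\ cusp_values M al be, six_lines al be &
  al <> 0 \/ (M 1%R 0%R %% 4)%Z = 2].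
Proof.
move=> hM; have [N [s [repN hN h8 h2]]] := coset_reps hM.
have hNT := SL2Z_mul hN (SL2Z_T2 s).
have [hG ME] := Gamma0_mul_inv2 hM hNT h8.
have v0 : vm R (M *m inv2 (N *m T2 s)) * sgc R (M *m inv2 (N *m T2 s)) (N *m T2 s) != 0.
  by rewrite mulf_neq0 ?vm_neq0 ?sgc_neq0.
suff [al [be [h1 h3 h4]]] : exists al be, [/\ cusp_values N al be, six_lines al be & al <> 0 \/ N = L2 2].
  have := cusp_values_mul s hG hN h1; rewrite -ME => H.
  do 2 eexists; split; first exact: H.
    move: h3; rewrite /six_lines.
    have : ((chi8 ((M *m inv2 (N *m T2 s)) 1 1))%:~R : C) ^+ 2 = 1.
      by rewrite -rmorphXn /= expr2 chi8_sqr.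
    move: (_%:~R : C) (vm R _) (sgc R _ _) => e v r e2 h3.
    have -> : v * r * al * (e * v * r * be) * ((v * r * al) ^+ 2 - (e * v * r * be) ^+ 2) *
        ((v * r * al) ^+ 2 - 2 * (e * v * r * be) ^+ 2)
     = e * (v * r) ^+ 6 * (al * be * (al ^+ 2 - e ^+ 2 * be ^+ 2) * (al ^+ 2 - 2 * (e ^+ 2 * be ^+ 2))) by ring.
    by rewrite e2 !mul1r h3 mulr0.
  case: h4 => [a0|/h2]; last by right.
  by left => /eqP; rewrite mulf_eq0 (negPf v0) /= => /eqP.
case: repN => ->.
- exists 1, 1; split; [exact: cusp_values_1|by rewrite /six_lines subrr mulr0 mul0r|left; exact/eqP/oner_neq0].
- do 2 eexists; split; first exact: cusp_values_S2.
    by rewrite /six_lines !sqr_sqrtc !fmorphV !rmorph_nat; field.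
  by left; apply/eqP; rewrite sqrtc_Ni_neq0// invr_gt0.
- exists 1, 0; split; [exact: cusp_values_L4|by rewrite /six_lines mulr0 !mul0r|left; exact/eqP/oner_neq0].
- do 2 eexists; split; [exact: cusp_values_L2|by rewrite /six_lines !mul0r|by right].
Qed.

End Cusps.

(** * Functions of given weight on Gamma_1(8) *)

Section Structure.
Variable R : realType.
Notation C := R[i].
Implicit Types (z w u v k l q : C) (s : int) (x y t : R) (M N G : 'M[int]_2) (f : uhp R -> C) (h F : C -> C).
Opaque qprod phi Jth qpoch cexp qexp th.

Definition Gamma1_8 M := Gamma0 8 M /\ (8 %| M 1%R 1%R - 1)%Z.

Lemma Gamma1_8_SL2Z M : Gamma1_8 M -> SL2Z M. Proof. by case=> /Gamma0_SL2Z. Qed.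

Lemma chi_Gamma1 (d : int) : (8 %| d - 1)%Z -> chi8 d = 1 /\ chi4 d = 1.
Proof.
move=> /dvdzP[k e]; have -> : d = k * 8 + 1 by rewrite -e; ring.
by rewrite /chi8 /chi4; split; rewrite ?modzMDl //; have -> : ((k * 8 + 1) %% 4)%Z = 1 by lia.
Qed.

Lemma vm_sqr M : Gamma1_8 M -> vm R M ^+ 2 = 1.
Proof.
move=> [hM /chi_Gamma1[_ h4]]; have [_ _ _ od] := Gamma0_8 hM.
rewrite /vm expr_div_n eps_sqr// h4 rmorph1 divr1 -rmorphXn /=.
by case: (kronecker_Gamma0 R hM) => ->.
Qed.

(** This is f2 / f1. A form of weight d / 2, divided by f1 ^ d, will turn out to be a polynomial in
    it ([weight_space_poly]). *)
Definition f_ratio z : C := th (4 * z) / th (2 * z).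
Definition f1_slash M w : C := slashC 1 M (f1 R) w.

Lemma th2_neq0 w : 0 < complex.Im w -> th (2 * w) != 0.
Proof. by move=> w0; apply: th_neq0; rewrite (Im_natM 2) mulr_gt0. Qed.

Lemma AE M w : SL2Z M -> 0 < complex.Im w -> f1_slash M w = (sqrtc (jf M w))^-1 * th (2 * moebius M w).
Proof. exact: slashC1_f1E. Qed.

Lemma A_neq0 M w : SL2Z M -> 0 < complex.Im w -> f1_slash M w != 0.
Proof.
by move=> hM w0; rewrite AE// mulf_neq0 ?invr_eq0 ?sqrtc_jf_neq0// th2_neq0// moebius_gt0.
Qed.

Lemma X_A M w : SL2Z M -> 0 < complex.Im w -> f_ratio (moebius M w) * f1_slash M w = slashC 1 M (f2 R) w.
Proof.
move=> hM w0; rewrite AE// slashC1_f2E//.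
have := th2_neq0 (moebius_gt0 hM w0); have := sqrtc_jf_neq0 hM w0; rewrite /f_ratio.
by move: (th _) (th _) (sqrtc _) => a b c c0 b0; field; rewrite c0 b0.
Qed.

Lemma X_Gamma0 M w : Gamma0 8 M -> 0 < complex.Im w -> f_ratio (moebius M w) = (chi8 (M 1 1))%:~R * f_ratio w.
Proof.
move=> hM w0; have hS := Gamma0_SL2Z hM; have m0 := moebius_gt0 hS w0.
have E1 := f1_Gamma0 hM w0; have E2 := f2_Gamma0 hM w0.
rewrite (extend_f1 m0) (extend_f1 w0) in E1; rewrite (extend_f2 m0) (extend_f2 w0) in E2.
apply: (etrans (congr2 (fun a b : C => a / b) E2 E1)); rewrite /f_ratio.
have := th2_neq0 w0; have := sqrtc_jf_neq0 hS w0; have := vm_neq0 R hM.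
move: (th _) (th _) (sqrtc _) (vm _ _) (_%:~R) => a b c d e d0 c0 b0.
by field; rewrite c0 b0 d0.
Qed.

Lemma X_Gamma1 M w : Gamma1_8 M -> 0 < complex.Im w -> f_ratio (moebius M w) = f_ratio w.
Proof. by move=> [hM /chi_Gamma1[h8 _]] w0; rewrite X_Gamma0// h8 mul1r. Qed.

Lemma cderiv_th_scale (n : nat) w : (0 < n)%N -> 0 < complex.Im w ->
  exists d, cderiv (fun w => th (n%:R * w)) w d.
Proof.
move=> n0 w0; have w'0 : 0 < complex.Im (n%:R * w) by rewrite Im_natM mulr_gt0// ltr0n.
have [d D] := cderiv_th w'0; eexists; exact: cderiv_comp (cderivZ n%:R (cderiv_id w)) D.
Qed.

Lemma X_hol : hol_above f_ratio 0.
Proof.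
move=> w w0; have [d D] := @cderiv_th_scale 4 w isT w0; have [d' D'] := @cderiv_th_scale 2 w isT w0.
by eexists; exact: (cderivM D (@cderivV R (fun w => th (2 * w)) w d' (th2_neq0 w0) D')).
Qed.

Lemma cderiv_jf M w : exists d, cderiv (jf M) w d.
Proof. by eexists; exact: cderiv_lin. Qed.

Lemma cderiv_moebius M w : SL2Z M -> 0 < complex.Im w -> exists d, cderiv (moebius M) w d.
Proof.
move=> hM w0; have [d D] := cderiv_jf M w.
by eexists; exact: cderivM (cderiv_lin _ _ w) (cderivV (jf_neq0 hM w0) D).
Qed.

Lemma hol_moebius F M : SL2Z M -> hol_above F 0 -> hol_above (fun w => F (moebius M w)) 0.
Proof.
move=> hM hF w w0; have [d D] := cderiv_moebius hM w0; have [d' D'] := hF _ (moebius_gt0 hM w0).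
by eexists; exact: cderiv_comp D D'.
Qed.

(* [F] stands for f / f1 ^ n with f a form of weight n / 2 on Gamma_1(8): the
   multiplier of the weight cancels in the quotient. *)
Definition weight_space (n : int) F := [/\ hol_above F 0,
  forall M, Gamma1_8 M -> forall w, 0 < complex.Im w -> F (moebius M w) = F w &
  forall M, SL2Z M -> exists l, ioo_lim (fun w => F (moebius M w) * f1_slash M w ^ n) l].

Lemma A_Gamma1_sqr M N w : Gamma1_8 M -> SL2Z N -> 0 < complex.Im w ->
  f1_slash (M *m N) w ^+ 2 = f1_slash N w ^+ 2.
Proof.
move=> hM hN w0; rewrite /f1_slash (slashC1_f1 hM.1 hN w0) [(_ * slashC _ _ _ _) ^+ 2]exprMn.
by rewrite [(vm R M * _) ^+ 2]exprMn (vm_sqr hM) sgc_sqr !mul1r.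
Qed.

Lemma moebius_mul_T2 N s w : SL2Z N -> 0 < complex.Im w ->
  moebius (N *m T2 s) w = moebius N (w + s%:~R).
Proof. by move=> hN w0; rewrite (moebius_mul hN (SL2Z_T2 s) w0) moebius_T2. Qed.

Lemma Gamma1_mul_inv2 M N : SL2Z M -> SL2Z N ->
  (8 %| M 1%R 0%R - N 1%R 0%R)%Z -> (8 %| M 1%R 1%R - N 1%R 1%R)%Z -> Gamma1_8 (M *m inv2 N).
Proof.
move=> hM hN /dvdzP[k e1] /dvdzP[l e2]; split.
  apply: (Gamma0_mul_inv2 hM hN _).1; apply/dvdzP; exists (k * N 1 1 - l * N 1 0).
  have -> : M 1 0 = k * 8 + N 1 0 by rewrite -e1; ring.
  have -> : M 1 1 = l * 8 + N 1 1 by rewrite -e2; ring.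
  by ring.
rewrite mul_inv2_11; apply/dvdzP; exists (l * N 0 0 - k * N 0 1).
have -> : M 1 0 = k * 8 + N 1 0 by rewrite -e1; ring.
have -> : M 1 1 = l * 8 + N 1 1 by rewrite -e2; ring.
rewrite -[X in _ - X](SL2ZE N).1//; ring.
Qed.

Lemma mul_inv2K M N : SL2Z N -> M = (M *m inv2 N) *m N.
Proof. by move=> hN; rewrite -mulmxA inv2_mul// mulmx1. Qed.

(** Reduction theory with 1 / 2 as height: if Im z < 1 / 2, a translation achieves |Re z| <= 1 / 2,
    hence |z| ^ 2 <= 1 / 2, and the inversion at least doubles the imaginary part. So n bounds the
    number of steps. *)
Lemma reduce_half (n : nat) z : 0 < complex.Im z -> 1 / 2 <= 2 ^+ n * complex.Im z ->
  exists2 M, SL2Z M & 1 / 2 <= complex.Im (moebius M z).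
Proof.
elim: n z => [|n IH] z z0.
  by rewrite expr0 [1 * complex.Im z]mul1r => h; exists 1%:M; [exact: SL2Z_1|rewrite moebius1].
move=> h; case: (leP (1 / 2) (complex.Im z)) => h2.
  by exists 1%:M; [exact: SL2Z_1|rewrite moebius1].
pose s := - Num.floor (complex.Re z + 1 / 2).
pose z1 := z + s%:~R.
have z10 : 0 < complex.Im z1 by rewrite Im_add_int.
have re : `|complex.Re z1| <= 1 / 2.
  rewrite cReD Re_int rmorphN /=.
  have := Num.Theory.floor_le (complex.Re z + 1 / 2); have := Num.Theory.lt_succ_floor (complex.Re z + 1 / 2).
  by rewrite intrD ler_norml => h3 h4; apply/andP; split; lra.
have n1 : normc z1 ^+ 2 <= 1 / 2.
  rewrite normc_sqr Im_add_int.
  have h3 : complex.Re z1 ^+ 2 <= (1 / 2) ^+ 2 by rewrite -real_normK ?num_real// lerXn2r// nnegrE.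
  have h4 : complex.Im z ^+ 2 <= (1 / 2) ^+ 2 by rewrite lerXn2r ?nnegrE ?(ltW z0) ?(ltW h2).
  by lra.
have np : 0 < normc z1 ^+ 2 by rewrite exprn_gt0// normc_gt0 Im_neq0.
have m0 := moebius_gt0 SL2Z_S2 z10.
have im : 2 * complex.Im z <= complex.Im (moebius S2 z1).
  by rewrite (Im_moebius z1 SL2Z_S2) jf_S2 ler_pdivlMr// Im_add_int; nra.
have [|M hM hM2] := IH _ m0.
  by rewrite (le_trans h)// exprS [2 * _]mulrC -mulrA ler_wpM2l// exprn_ge0.
exists (M *m (S2 *m T2 s)); first by apply: SL2Z_mul hM (SL2Z_mul SL2Z_S2 (SL2Z_T2 s)).
by rewrite (moebius_mul hM (SL2Z_mul SL2Z_S2 (SL2Z_T2 s)) z0) (moebius_mul_T2 s SL2Z_S2 z0).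
Qed.

Lemma cderiv_locally_bounded F z : (exists d, cderiv F z d) ->
  exists (r B : R), 0 < r /\ forall w, normc (w - z) < r -> normc (F w) <= B.
Proof.
move=> [d /cderiv_ccont/ccont_bound[r r0 H]]; exists r, (1 + normc (F z)); split => // w wz.
by have := H _ wz; rewrite addrC subrK => /ltW.
Qed.

(** Compactness by [bisect_rect]: unboundedness would concentrate at a point, where
    differentiability gives a local bound. *)
Lemma hol_rect_bounded F x1 x2 y1 y2 : hol_above F 0 -> x1 <= x2 -> 0 < y1 -> y1 <= y2 ->
  exists B, forall x y, x1 <= x <= x2 -> y1 <= y <= y2 -> normc (F (x +i* y)) <= B.
Proof.
move=> hF x12 y10 y12; apply: contrapT.
pose P (a b c d : R) := exists B, forall x y : R, a <= x <= b -> c <= y <= d -> normc (F (x +i* y)) <= B.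
move=> nP; have [] := @bisect_rect R P x1 x2 y1 y2 x12 y12 _ nP.
  move=> a b c d _ _ _ _ [B1 H1] [B2 H2] [B3 H3] [B4 H4].
  exists (Num.max (Num.max B1 B2) (Num.max B3 B4)) => x y /andP[ax xb] /andP[cy yd].
  rewrite !le_max; case: (leP x ((a + b) / 2)) => hx; case: (leP y ((c + d) / 2)) => hy.
  - by rewrite H1 ?ax ?cy.
  - by rewrite H3 ?orbT// ?ax ?yd ?hx ?(ltW hy).
  - by rewrite H2 ?orbT// ?cy ?xb ?hy ?(ltW hx).
  - by rewrite H4 ?orbT// ?yd ?xb ?(ltW hx) ?(ltW hy).
move=> x [y [xx yy H]].
have y0 : 0 < complex.Im (x +i* y) by rewrite /= (lt_le_trans y10)//; case/andP: yy.
have [r [B [r0 HB]]] := cderiv_locally_bounded (hF _ y0).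
have D0 : 0 <= (x2 - x1) + (y2 - y1) by rewrite addr_ge0// subr_ge0.
have [n Hn] := exists_pow2_gt (((x2 - x1) + (y2 - y1)) / r).
have p0 : 0 < 2 ^+ n :> R by rewrite exprn_gt0.
have [a [c [/andP[h1 h2] /andP[h3 h4] _ _ nPac]]] := H n.
apply: nPac; exists B => u v /andP[u1 u2] /andP[v1 v2]; apply: HB.
rewrite (le_lt_trans (ler_normc_ReIm _))//=.
have ux : `|u - x| <= (x2 - x1) / 2 ^+ n by rewrite ler_norml; apply/andP; split; lra.
have vy : `|v - y| <= (y2 - y1) / 2 ^+ n by rewrite ler_norml; apply/andP; split; lra.
rewrite (le_lt_trans (lerD ux vy))// -mulrDl ltr_pdivrMr//.
by move: Hn; rewrite ltr_pdivrMr// mulrC.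
Qed.

Lemma hol_cusp_bounded F l (n : nat) y1 : hol_above F 0 -> (0 < n)%N -> 0 < y1 ->
  (forall w, 0 < complex.Im w -> F (w + n%:R) = F w) -> ioo_lim F l ->
  exists B, forall w, y1 <= complex.Im w -> normc (F w) <= B.
Proof.
move=> hF n0 y10 pF /(_ 1 ltr01)[Y HY].
have y1Y : y1 <= Num.max y1 Y by rewrite le_max lexx.
have n0' : 0 <= n%:R :> R by [].
have [B HB] := hol_rect_bounded hF n0' y10 y1Y.
have pz (s : int) w : 0 < complex.Im w -> F (w + (n%:Z * s)%:~R) = F w.
  have pn (m : nat) v : 0 < complex.Im v -> F (v + (n%:Z * m%:Z)%:~R) = F v.
    elim: m => [|m IH] v0; first by rewrite mulr0 addr0.
    rewrite -[RHS]IH// -[RHS]pF ?Im_add_int//; congr F.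
    by rewrite intS mulrDr mulr1 rmorphD /=; ring.
  move=> w0; case: s => m; first exact: pn.
  rewrite -[LHS](pn m.+1) ?Im_add_int//; congr F.
  by rewrite NegzE -addrA -rmorphD /= -mulrDr addNr mulr0 addr0.
exists (Num.max B (1 + normc l)) => w w1.
have w0 := lt_le_trans y10 w1.
case: (leP (complex.Im w) (Num.max y1 Y)) => hY; last first.
  rewrite le_max; apply/orP; right.
  move: hY; rewrite gt_max => /andP[_ /HY h].
  have -> : F w = (F w - l) + l by ring.
  by rewrite (le_trans (ler_normcD _ _))// lerD2r ltW.
pose s := - Num.floor (complex.Re w / n%:R).
rewrite -(pz s)// le_max; apply/orP; left.
have np : 0 < n%:R :> R by rewrite ltr0n.
have -> : w + (n%:Z * s)%:~R = (complex.Re w + n%:R * s%:~R) +i* complex.Im w.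
  apply: complex_ext => /=; rewrite ?Im_add_int// cReD Re_int.
  by rewrite rmorphM.
apply: HB; last by rewrite w1.
have h1 := Num.Theory.floor_le (complex.Re w / n%:R).
have h2 := Num.Theory.lt_succ_floor (complex.Re w / n%:R).
rewrite /s rmorphN /= mulrN subr_ge0 lerBlDr.
rewrite ler_pdivlMr// in h1; rewrite ltr_pdivrMr// intrD mulrDl mul1r in h2.
by rewrite mulrC h1 /= addrC ltW.
Qed.

(* For F of weight -1/2, the square of the slash of the form by N (see [HnE]),
   written without square roots. *)
Definition Hn F N w : C := F (moebius N w) ^+ 2 * jf N w / th (2 * moebius N w) ^+ 2.

Lemma HnE F N w : SL2Z N -> 0 < complex.Im w -> Hn F N w = (F (moebius N w) / f1_slash N w) ^+ 2.
Proof.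
move=> hN w0; rewrite /Hn AE// -{1}[jf N w]sqr_sqrtc.
have := th2_neq0 (moebius_gt0 hN w0); have := sqrtc_jf_neq0 hN w0.
by move: (sqrtc _) (th _) (F _) => a b c a0 b0; field; rewrite a0 b0.
Qed.

Lemma Hn_hol F N : SL2Z N -> hol_above F 0 -> hol_above (Hn F N) 0.
Proof.
move=> hN hF w w0; have [d D] := hol_moebius hN hF w0.
have [d' D'] := cderivX 2 D; have [d2 D2] := cderiv_jf N w.
have [d3 D3] := @cderiv_th_scale 2 _ isT (moebius_gt0 hN w0).
have [d4 D4] := cderiv_moebius hN w0.
have [d5 D5] := cderivX 2 (cderiv_comp D4 D3).
have n0 : th (2%:R * moebius N w) ^+ 2 != 0 by rewrite expf_neq0// th2_neq0// moebius_gt0.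
by eexists; exact: (cderivM (cderivM D' D2) (@cderivV R (fun w => th (2 * moebius N w) ^+ 2) w d5 n0 D5)).
Qed.

Lemma Hn_Gamma1 F M N w : weight_space (-1) F -> Gamma1_8 M -> SL2Z N -> 0 < complex.Im w ->
  Hn F (M *m N) w = Hn F N w.
Proof.
move=> [_ iF _] hM hN w0; have hS := Gamma1_8_SL2Z hM.
rewrite (HnE _ (SL2Z_mul hS hN) w0) (HnE _ hN w0) (moebius_mul hS hN w0) (iF _ hM _ (moebius_gt0 hN w0)).
by rewrite !expr_div_n (A_Gamma1_sqr hM hN w0).
Qed.

Lemma Hn_T2 F N s w : SL2Z N -> 0 < complex.Im w -> Hn F (N *m T2 s) w = Hn F N (w + s%:~R).
Proof. by move=> hN w0; rewrite /Hn (moebius_mul_T2 s hN w0) jf_T2. Qed.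

(** T^8 is the identity modulo 8, and so are its conjugates. *)
Lemma Gamma1_conj_T8 N : SL2Z N -> Gamma1_8 (N *m T2 8 *m inv2 N).
Proof.
move=> hN; apply: Gamma1_mul_inv2; rewrite ?hN//; first exact: SL2Z_mul hN (SL2Z_T2 8).
  by rewrite mulmx2 !mk2s; apply/dvdzP; exists 0; ring.
by rewrite mulmx2 !mk2s; apply/dvdzP; exists (N 1 0); ring.
Qed.

Lemma Hn_per F N w : weight_space (-1) F -> SL2Z N -> 0 < complex.Im w -> Hn F N (w + 8%:R) = Hn F N w.
Proof.
move=> hF hN w0; rewrite -[8%:R]/(8%:~R) -(Hn_T2 _ 8 hN w0) (mul_inv2K (N *m T2 8) hN).
exact: Hn_Gamma1 hF (Gamma1_conj_T8 hN) hN w0.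
Qed.

Lemma Hn_bounded F N : weight_space (-1) F -> SL2Z N ->
  exists B, forall w, 1 / 2 <= complex.Im w -> normc (Hn F N w) <= B.
Proof.
move=> hF hN; have [holF _ /(_ N hN)[l hl]] := hF.
have h2 : 0 < 1 / 2 :> R by lra.
have hl2 : ioo_lim (Hn F N) (l ^+ 2).
  by apply: eq_ioo_lim (ioo_limX 2 hl) => w w0; apply: esym; exact: HnE.
have [B HB] := @hol_cusp_bounded (Hn F N) (l ^+ 2) 8 _ (Hn_hol hN holF) isT h2 (fun w => @Hn_per F N w hF hN) hl2.
by exists B => w hw; exact: HB.
Qed.

(** The bottom row modulo 8 determines the coset of Gamma_1(8); finiteness of the type of classes
    makes the bounds on [Hn] uniform in N. *)
Definition row_class N : 'I_8 * 'I_8 := (inord `|(N 1%R 0%R %% 8)%Z|, inord `|(N 1%R 1%R %% 8)%Z|).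

Lemma row_class_eq M N : row_class M = row_class N ->
  (8 %| M 1%R 0%R - N 1%R 0%R)%Z /\ (8 %| M 1%R 1%R - N 1%R 1%R)%Z.
Proof.
have m8 (x : int) : (`|(x %% 8)%Z| < 8)%N by lia.
by case=> /(congr1 val) /=; rewrite !inordK// => e1 /(congr1 val) /=; rewrite !inordK// => e2; split; lia.
Qed.

Lemma Hn_bounded_all F : weight_space (-1) F ->
  exists2 B : R, 0 <= B & forall N w, SL2Z N -> 1 / 2 <= complex.Im w -> normc (Hn F N w) <= B.
Proof.
move=> hF.
have H (t : 'I_8 * 'I_8) : exists B : R, 0 <= B /\
    forall N w, SL2Z N -> row_class N = t -> 1 / 2 <= complex.Im w -> normc (Hn F N w) <= B.
  have [[N0 [h0 e0]]|nN] := pselect (exists N0, SL2Z N0 /\ row_class N0 = t); last first.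
    by exists 0; split => // N w hN e; exfalso; apply: nN; exists N.
  have [B HB] := Hn_bounded hF h0.
  exists (Num.max B 0); split; first by rewrite le_max lexx orbT.
  move=> N w hN e w2; have w0 : 0 < complex.Im w by apply: lt_le_trans w2; lra.
  have [c8 d8] := row_class_eq (etrans e (esym e0)).
  rewrite (mul_inv2K N h0) (Hn_Gamma1 hF (Gamma1_mul_inv2 hN h0 c8 d8) h0 w0).
  by rewrite le_max HB.
have [B HB] := choice H.
exists (\sum_t B t); first by apply: sumr_ge0 => t _; case: (HB t).
move=> N w hN w2; rewrite (bigD1 (row_class N)) //=.
have [_ h] := HB (row_class N); rewrite (le_trans (h N w hN erefl w2))// lerDl.
by apply: sumr_ge0 => t _; case: (HB t).
Qed.

(* A form of weight -1/2 tends to 0 as Im w -> 0, so that all its Fourier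
   coefficients vanish. *)
Lemma weight_space_N1 F : weight_space (-1) F -> forall w, 0 < complex.Im w -> F w = 0.
Proof.
move=> hF; have [holF iF _] := hF; have [B B0 HB] := Hn_bounded_all hF.
pose h w : C := (F w / th (2 * w)) ^+ 2.
suff h0 w : 0 < complex.Im w -> h w = 0.
  move=> w w0; have /eqP := h0 w w0; rewrite /h expf_eq0 /= mulf_eq0 invr_eq0.
  by rewrite (negPf (th2_neq0 w0)) orbF => /eqP.
move: w; apply: decay_eq0.
- move=> w w0; have [d D] := holF w w0; have [d' D'] := @cderiv_th_scale 2 w isT w0.
  have := @cderivV R (fun w => th (2 * w)) w d' (th2_neq0 w0) D'.
  by move=> /(cderivM D)/(cderivX 2).
- move=> w w0; rewrite /h.
  have hT : Gamma1_8 (T2 1).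
    by split; [split; [exact: SL2Z_T2|rewrite mk2_10]|rewrite mk2_11].
  have := iF _ hT w w0; rewrite moebius_T2 => ->.
  have -> : 2 * (w + 1) = 2 * w + 2 * 1%:~R :> C by ring.
  by rewrite th_add2z.
move=> e e0.
(* With j the automorphy factor at w, |h z| <= B / |j| and Im z |j| ^ 2 = Im w >= 1 / 2. So Im z < r
   gives |j| > (B + 1) / e. *)
pose r := Num.min (1 / 2) ((e / (B + 1)) ^+ 2 / 2).
have B1 : 0 < B + 1 by rewrite ltr_wpDl.
exists r; first by rewrite lt_min divr_gt0// divr_gt0// exprn_gt0// divr_gt0.
move=> z /andP[z0]; rewrite lt_min => /andP[z2 zr].
have [n Hn2] := exists_pow2_gt (1 / 2 / complex.Im z).
have [|M hM Mz] := @reduce_half n z z0.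
  by move: Hn2; rewrite ltr_pdivrMr// => /ltW.
have m0 := moebius_gt0 hM z0.
have hI := SL2Z_inv2 hM.
have zE := moebiusK hM z0.
set w := moebius M z in Mz m0 zE.
have hE : h z = Hn F (inv2 M) w / jf (inv2 M) w.
  rewrite /Hn zE /h; have := jf_neq0 hI m0; have := th2_neq0 z0.
  by move: (jf _ _) (th _) (F z) => a b c b0 a0; field; rewrite a0 b0.
have jn : 0 < normc (jf (inv2 M) w) by rewrite normc_gt0 jf_neq0.
rewrite hE normcM normcV ler_pdivrMr// (le_trans (HB _ _ hI Mz))//.
have imE : complex.Im z * normc (jf (inv2 M) w) ^+ 2 = complex.Im w.
  by rewrite -[in LHS]zE Im_moebius// divfK// expf_neq0// gt_eqF.
have j2 : 1 / 2 <= complex.Im z * normc (jf (inv2 M) w) ^+ 2 by rewrite imE.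
move: (normc (jf _ _)) jn j2 => j j0 j2.
rewrite (@le_trans _ _ (B + 1))//; first by rewrite lerDl.
rewrite -ler_pdivrMl// mulrC -(ler_pXn2r (ltn0Sn 1)) ?nnegrE ?divr_ge0 ?(ltW B1) ?(ltW e0) ?(ltW j0)//.
have E1 : ((B + 1) / e) ^+ 2 * (e / (B + 1)) ^+ 2 = 1.
  by rewrite -exprMn mulrA divfK ?divff ?expr1n// gt_eqF.
have p0 : 0 < ((B + 1) / e) ^+ 2 by rewrite exprn_gt0// divr_gt0.
have j20 : 0 < j ^+ 2 by rewrite exprn_gt0.
move: zr j2 E1 p0 j20; move: (((B + 1) / e) ^+ 2) ((e / (B + 1)) ^+ 2) (j ^+ 2) (complex.Im z) z0.
move=> P Q J y y0 yQ yJ PQ P0 J0.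
have : y * J < Q / 2 * J by rewrite ltr_pM2r.
nra.
Qed.

End Structure.

(** * Division by f1 and expansion in the ratio f2 / f1 *)

Section Descent.
Variable R : realType.
Notation C := R[i].
Implicit Types (z w u v k l q : C) (s : int) (x y t : R) (M N G : 'M[int]_2) (f : uhp R -> C) (h F : C -> C).
Opaque qprod phi Jth qpoch cexp qexp th kappa.
Notation f1_slash := (@f1_slash R).
Notation f_ratio := (@f_ratio R).

Lemma SL2Z_opp M : SL2Z M -> SL2Z (- M).
Proof. by move=> /SL2ZE h; apply/SL2ZE; apply: etrans h; rewrite !mxE; ring. Qed.

Lemma moebius_opp M z : moebius (- M) z = moebius M z :> C.
Proof.
rewrite /moebius !mxE !rmorphN /= !mulNr -!opprD invrN mulrN mulNr opprK.
by [].
Qed.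

Lemma weight_space_pm n F G w : weight_space n F -> Gamma0 8 G ->
  (8 %| G 1%R 1%R - 1)%Z \/ (8 %| G 1%R 1%R + 1)%Z -> 0 < complex.Im w ->
  F (moebius G w) = F w.
Proof.
move=> [_ iF _] hG [h|h] w0; first by apply: iF.
rewrite -moebius_opp; apply: iF => //; split.
  split; first exact: SL2Z_opp hG.1.
  by rewrite mxE rpredN hG.2.
have -> : (- G) 1 1 - 1 = - (G 1 1 + 1) by rewrite mxE; ring.
by rewrite rpredN.
Qed.

Lemma cderiv_kappa v : 0 < complex.Im v -> exists d, cderiv (@kappa R) v d.
Proof.
move=> v0; have v40 : 0 < complex.Im ((4^-1)%:C * v) by rewrite cImRM mulr_gt0// invr_gt0.
have [d D] := cderiv_th v40; have [d' D'] := cderiv_th v0.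
have H := cderivB (cderiv_comp (cderivZ (4^-1)%:C (cderiv_id v)) D) D'.
eexists; apply: (cderiv_ext ltr01 _ H) => h _.
Transparent kappa. rewrite /kappa. Opaque kappa.
by rewrite mulrC fmorphV rmorph_nat.
Qed.

Lemma kappa_add8 v : kappa (v + 8) = kappa v :> C.
Proof.
Transparent kappa. rewrite /kappa. Opaque kappa.
have -> : (v + 8) / 4 = v / 4 + 2 * 1%:~R :> C by field.
have -> : v + 8 = v + 2 * 4%:~R :> C by ring.
by rewrite !th_add2z.
Qed.

(** An explicit formula for f1 slashed by [L2 2] (see [A_L2]), which shows its period 4 and its zero
    at the cusp. *)
Definition Ak u : C := sqrtc (- 'i) * kappa (2 * u + 1).

Lemma A_L2 u : 0 < complex.Im u -> f1_slash (L2 2) u = Ak u.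
Proof. exact: slash_L2_f1. Qed.

Lemma Ak_hol : hol_above Ak 0.
Proof.
move=> u u0; have v0 : 0 < complex.Im (2 * u + 1) by exact: (@Im_jf_L2 _ 2).
have [d D] := cderiv_kappa v0.
by eexists; exact: cderivZ (cderiv_comp (cderiv_lin 2 1 u) D).
Qed.

Lemma Ak_add4 u : Ak (u + 4) = Ak u.
Proof. by rewrite /Ak -(kappa_add8 (2 * u + 1)); congr (_ * kappa _); ring. Qed.

Lemma Gamma1_L2_T4 : Gamma1_8 (L2 2 *m T2 4 *m inv2 (L2 2)).
Proof.
apply: Gamma1_mul_inv2; [exact: SL2Z_mul (SL2Z_L2 2) (SL2Z_T2 4)|exact: SL2Z_L2|..].
  by rewrite mulmx2 !mk2s.
by rewrite mulmx2 !mk2s.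
Qed.

Lemma weight_space_L2_add4 n F u : weight_space n F -> 0 < complex.Im u ->
  F (moebius (L2 2) (u + 4)) = F (moebius (L2 2) u).
Proof.
move=> [_ iF _] u0; rewrite -[4]/(4%:~R) -(moebius_mul_T2 4 (SL2Z_L2 2) u0).
rewrite (mul_inv2K (L2 2 *m T2 4) (SL2Z_L2 2)) (moebius_mul (Gamma1_8_SL2Z Gamma1_L2_T4) (SL2Z_L2 2) u0).
by apply: iF; [exact: Gamma1_L2_T4|exact: moebius_gt0 (SL2Z_L2 2) u0].
Qed.

Lemma sqrtc_Ni1 : sqrtc (- 'i) != 0 :> C.
Proof. by rewrite sqrtc_eq0 oppr_eq0 -normc_gt0 normci. Qed.

(** After rescaling by the width 4, [qexp] is the local parameter at the cusp 1/2; the zero of f1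
    there is simple because [kappa] is asymptotic to 2 e ^ (pi i v / 4). *)
Lemma ioo_lim_Ak : exists2 k, k != 0 & ioo_lim (fun w => Ak (4 * w) / qexp w) k.
Proof.
pose k := cexp (pi%:C * 'i / 4) : C.
exists (sqrtc (- 'i) * 2 * k).
  apply: mulf_neq0 (cexp_neq0 _); apply: mulf_neq0 sqrtc_Ni1 _.
  by rewrite pnatr_eq0.
have H := ioo_lim_affine 1 (ltr0n R 8) (@ioo_lim_kappa R).
apply: eq_ioo_lim (ioo_limM (ioo_limZ (sqrtc (- 'i)) H) (ioo_lim_cst k)) => w w0.
have -> : cexp (pi%:C * 'i * (((8%:R : R)%:C * w + 1) / 4)) = qexp w * k.
  Transparent qexp. rewrite /qexp. Opaque qexp.
  by rewrite /k -cexpD -natC; congr cexp; field.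
rewrite /Ak -natC; have -> : 2 * (4 * w) + 1 = 8 * w + 1 by ring.
have := qexp_neq0 w; have : k != 0 by exact: cexp_neq0.
by move: (kappa _) (qexp _) (sqrtc _) k => a b c e e0 b0; field; rewrite e0 b0.
Qed.

(** Rescaling by 4 makes the expansion 1-periodic, so that [cusp_order] allows division by [qexp];
    by [ioo_lim_Ak] this amounts to division by f1. *)
Lemma L2_decay_quotient (m : nat) F : weight_space m%:Z F ->
  ioo_lim (fun w => F (moebius (L2 2) w) * f1_slash (L2 2) w ^ m%:Z) 0 ->
  exists l, ioo_lim (fun w => F (moebius (L2 2) w) * f1_slash (L2 2) w ^ (m%:Z - 1)) l.
Proof.
move=> hF h0; pose H w := F (moebius (L2 2) (4 * w)) * Ak (4 * w) ^+ m.
have holF := hol_moebius (SL2Z_L2 2) (let: And3 a _ _ := hF in a).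
have I4 w : 0 < complex.Im w -> 0 < complex.Im (4 * w) by move=> w0; rewrite (Im_natM 4) mulr_gt0.
have H1 : hol_above H 0.
  move=> w w0; have [d D] := holF _ (I4 w w0); have [d' D'] := Ak_hol (I4 w w0).
  have D4 := cderivZ 4 (cderiv_id w).
  have [d2 D2] := cderivX m (cderiv_comp D4 D').
  by eexists; exact: cderivM (cderiv_comp D4 D) D2.
have H2 : per_above H 0.
  move=> w w0; rewrite /H; have -> : 4 * (w + 1) = 4 * w + 4 by ring.
  by rewrite (weight_space_L2_add4 hF (I4 w w0)) Ak_add4.
have H3 : ioo_lim H 0.
  have := ioo_lim_affine 0 (ltr0n R 4) h0.
  apply: eq_ioo_lim => w w0; rewrite addr0 -natC /H.
  by rewrite (A_L2 (I4 w w0)).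
have [l hl] := cusp_order H1 H2 H3.
have [k k0 hk] := ioo_lim_Ak.
have h5 := ioo_limM hl (ioo_limV k0 hk).
exists (l / k).
have t4 : 0 < 4^-1 :> R by rewrite invr_gt0.
apply: eq_ioo_lim (ioo_lim_affine 0 t4 h5) => w w0.
rewrite addr0; set w' := (4^-1)%:C * w.
have e : 4 * w' = w by rewrite /w' fmorphV rmorph_nat; field.
rewrite /H e.
have a0 := A_neq0 (SL2Z_L2 2) w0; rewrite (A_L2 w0) in a0 *.
have := qexp_neq0 w'.
have -> : Ak w ^ (m%:Z - 1) = Ak w ^+ m / Ak w.
  by rewrite expfzDr// -exprnN expr1.
by move: (Ak w) (qexp w') (F _) (_ ^+ m) a0 => a b c x a0 b0; field; rewrite a0 b0.
Qed.

(** The lower left entry is 2 s modulo 8 with s = 1 or s = -1, and the lower right one is s (2 j +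
    1): modulo 8 the bottom row is s times that of [L2 2 *m T2 j]. The sign is harmless by
    [weight_space_pm]. *)
Lemma L2_reps M : SL2Z M -> (M 1%R 0%R %% 4)%Z = 2 -> exists j,
  let G := M *m inv2 (L2 2 *m T2 j) in
  Gamma0 8 G /\ ((8 %| G 1%R 1%R - 1)%Z \/ (8 %| G 1%R 1%R + 1)%Z).
Proof.
move=> hM c2; have od : oddz (M 1 1).
  have c2' : (2 %| M 1%R 0%R)%Z by lia.
  by apply: oddz_det ((SL2ZE M).1 hM) c2'.
rewrite /oddz in od.
pose s : int := if (M 1%R 0%R %% 8)%Z == 2 then 1 else -1.
pose j := ((s * M 1%R 1%R - 1)%R %/ 2)%Z; exists j.
have hP := SL2Z_mul (SL2Z_L2 2) (SL2Z_T2 j).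
have P10 : (L2 2 *m T2 j) 1 0 = 2 by rewrite mulmx2 !mk2s; ring.
have P11 : (L2 2 *m T2 j) 1 1 = 2 * j + 1 by rewrite mulmx2 !mk2s; ring.
have P00 : (L2 2 *m T2 j) 0 0 = 1 by rewrite mulmx2 !mk2s; ring.
have P01 : (L2 2 *m T2 j) 0 1 = j by rewrite mulmx2 !mk2s; ring.
have [k ck] : exists k : int, M 1 0 = 8 * k + 2 * s.
  exists ((M 1%R 0%R - 2 * s)%R %/ 8)%Z; rewrite /s; case: eqP; lia.
have dj : M 1 1 = s * (2 * j + 1) by rewrite /j /s; case: eqP; lia.
split.
  apply: (Gamma0_mul_inv2 hM hP _).1; rewrite P10 P11 ck dj.
  by apply/dvdzP; exists (k * (2 * j + 1)); ring.
have dE : (M *m inv2 (L2 2 *m T2 j)) 1 1 = s - 8 * (k * j).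
  by rewrite mul_inv2_11 P00 P01 ck dj; ring.
rewrite dE; have : s = 1 \/ s = -1 by rewrite /s; case: eqP; [left|right].
case=> ->; [left|right]; first by apply/dvdzP; exists (- (k * j)); ring.
by apply/dvdzP; exists (- (k * j)); ring.
Qed.

(* f1 has a simple zero at the cusp 1/2 and no other zero: a form vanishing
   there can be divided by it. *)
Lemma weight_space_descend (m : nat) F : weight_space m%:Z F ->
  ioo_lim (fun w => F (moebius (L2 2) w) * f1_slash (L2 2) w ^ m%:Z) 0 ->
  weight_space (m%:Z - 1) F.
Proof.
move=> hF h0; have [holF iF lF] := hF; split => // M hM.
have [al [be [[h1 _] _ [a0|c2]]]] := cusp_limits R hM.
  move/eqP: a0 => a0; have [l hl] := lF M hM; exists (l / al).
  apply: eq_ioo_lim (ioo_limM hl (ioo_limV a0 h1)) => w w0.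
  have an0 := A_neq0 hM w0; rewrite -mulrA; congr (_ * _).
  by rewrite -[slashC 1 M _ w]/(f1_slash M w) expfzDr// -exprnN expr1.
have [j [hG hG1]] := L2_reps hM c2; set G := M *m _ in hG hG1.
have hP := SL2Z_mul (SL2Z_L2 2) (SL2Z_T2 j).
have ME : M = G *m (L2 2 *m T2 j) by rewrite /G -mul_inv2K.
have [l hl] := L2_decay_quotient hF h0.
pose k := vm R G * sgc R G (L2 2 *m T2 j).
have hl' := ioo_lim_affine j%:~R ltr01 hl.
exists (k ^ (m%:Z - 1) * l).
apply: eq_ioo_lim (ioo_limZ (k ^ (m%:Z - 1)) hl') => w w0.
have wj0 : 0 < complex.Im (w + j%:~R) by rewrite Im_add_int.
rewrite rmorph1 mul1r [in RHS]ME (moebius_mul (Gamma0_SL2Z hG) hP w0).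
rewrite (weight_space_pm hF hG hG1 (moebius_gt0 hP w0)) (moebius_mul_T2 j (SL2Z_L2 2) w0).
have -> : f1_slash (G *m (L2 2 *m T2 j)) w = k * f1_slash (L2 2) (w + j%:~R).
  have := slashC1_f1 hG hP w0; rewrite -/k => H; apply: etrans H _.
  by rewrite (slashC_T2 1 _ j (SL2Z_L2 2) w0).
rewrite [(k * f1_slash _ _) ^ _]expfzMl; move: (F _) (k ^ _) (f1_slash _ _ ^ _) => a b c; ring.
Qed.

Lemma weight_space_lin n F h k : weight_space n F -> weight_space n h ->
  weight_space n (fun w => F w + k * h w).
Proof.
move=> [h1 h2 h3] [g1 g2 g3]; split.
- by move=> w w0; have [d D] := h1 w w0; have [d' D'] := g1 w w0; eexists; exact: cderivD D (cderivZ k D').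
- by move=> M hM w w0; rewrite h2// g2.
move=> M hM; have [l hl] := h3 M hM; have [l' hl'] := g3 M hM; exists (l + k * l').
by apply: eq_ioo_lim (ioo_limD hl (ioo_limZ k hl')) => w w0; rewrite mulrDl mulrA.
Qed.

Lemma X_A_X M (m : nat) w : SL2Z M -> 0 < complex.Im w ->
  f_ratio (moebius M w) ^+ m * f1_slash M w ^ m%:Z = slashC 1 M (f2 R) w ^+ m.
Proof. by move=> hM w0; rewrite -exprnP -exprMn X_A. Qed.

Lemma weight_space_X (m : nat) : weight_space m%:Z (fun w => f_ratio w ^+ m).
Proof.
split.
- by move=> w w0; have [d D] := X_hol w0; have [d' D'] := cderivX m D; exists d'.
- by move=> M hM w w0; rewrite X_Gamma1.
move=> M hM; have [al [be [[_ h2] _ _]]] := cusp_limits R hM; exists (be ^+ m).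
by apply: eq_ioo_lim (ioo_limX m h2) => w w0; rewrite X_A_X.
Qed.

Lemma weight_space_poly (m : nat) F : weight_space m%:Z F ->
  exists c : nat -> C, forall w, 0 < complex.Im w -> F w = \sum_(j < m.+1) c j * f_ratio w ^+ j.
Proof.
elim: m F => [|m IH] F hF.
all: have [_ _ /(_ _ (SL2Z_L2 2))[l hl]] := hF.
all: have [_ h2] := cusp_values_L2 R; set be := sqrtc _ in h2.
all: have b0 : be != 0 by apply: sqrtc_Ni_neq0; rewrite invr_gt0.
  have hG := weight_space_lin (- l) hF (weight_space_X 0).
  have h0 : ioo_lim (fun w => (F (moebius (L2 2) w) + - l * f_ratio (moebius (L2 2) w) ^+ 0) * f1_slash (L2 2) w ^ 0%:Z) 0.
    have := ioo_limD hl (ioo_lim_cst (- l)); rewrite subrr; apply: eq_ioo_lim => u u0.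
    by rewrite expr0 expr0z !mulr1.
  have H0 := weight_space_N1 (weight_space_descend hG h0).
  exists (fun=> l) => w w0; rewrite big_ord_recl big_ord0 addr0 /= expr0 mulr1.
  have := H0 w w0; rewrite expr0 mulr1 => H1.
  by rewrite -[LHS]addr0 -(subrr l) addrCA H1 addr0.
pose a := l / be ^+ m.+1.
have hG := weight_space_lin (- a) hF (weight_space_X m.+1).
have h0 : ioo_lim (fun w => (F (moebius (L2 2) w) + - a * f_ratio (moebius (L2 2) w) ^+ m.+1) * f1_slash (L2 2) w ^ m.+1%:Z) 0.
  have := ioo_limD hl (ioo_limZ (- a) (ioo_limX m.+1 h2)).
  rewrite mulNr divfK ?subrr ?expf_neq0//; apply: eq_ioo_lim => w w0.
  by rewrite -(X_A_X m.+1 (SL2Z_L2 2) w0) [RHS]mulrDl [- a * (_ * _)]mulrA.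
have := weight_space_descend hG h0; have -> : m.+1%:Z - 1 = m%:Z by lia.
move=> /IH[c Hc]; exists (fun j => if (j == m.+1)%N then a else c j) => w w0.
rewrite big_ord_recr /= eqxx; have := Hc w w0.
have -> : \sum_(i < m.+1) (if (i == m.+1 :> nat)%N then a else c i) * f_ratio w ^+ i = \sum_(j < m.+1) c j * f_ratio w ^+ j.
  by apply: eq_bigr => i _; rewrite ltn_eqF// ltnW.
by move=> <-; rewrite mulNr subrK.
Qed.

End Descent.

(** * Modular forms as homogeneous polynomials *)

Section ModularForms.
Variable R : realType.
Notation C := R[i].
Implicit Types (z w u v k l : C) (M N G : 'M[int]_2) (f g F H : uhp R -> C).
Opaque qprod phi Jth qpoch cexp qexp th kappa f1 f2 extend.

Lemma holomorphicP f : holomorphic f <-> hol_above (extend f) 0.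
Proof.
split=> [hf w w0|hf z].
  by have H := hf (exist _ w w0); have := (cderivableP (extend f) w).1 H.
by have := (cderivableP (extend f) (val z)).2 (hf (val z) (valP z)).
Qed.

Lemma slash_ratio_aux (kk : nat) (m v s t x y : C) : v != 0 -> s != 0 -> t != 0 ->
  m * v ^+ kk = 1 -> m * (s ^ (- kk%:Z) * x) = y -> x / (v * s * t) ^+ kk = y / t ^+ kk.
Proof.
move=> /(expf_neq0 kk) + /(expf_neq0 kk) + /(expf_neq0 kk); rewrite -exprnN !exprMn.
move: (v ^+ kk) (s ^+ kk) (t ^+ kk) => V S T V0 S0 T0 mV <-.
have -> : m = V^-1 by rewrite -[LHS]mulr1 -(divff V0) mulrA mV div1r.
by field; rewrite V0 S0 T0.
Qed.

Lemma slash_fmon_aux (a b : nat) (s x y : C) :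
  s ^ (- (a + b)%N%:Z) * (x ^+ a * y ^+ b) = (s ^ (- 1) * x) ^+ a * (s ^ (- 1) * y) ^+ b.
Proof. by rewrite -exprnN exprD -[s ^ (- 1)]/(s^-1) !exprMn !exprVn invfM; ring. Qed.

Lemma fmon_modular_aux (a b : nat) (m v x y c k : C) : m * v ^+ (a + b) = k ->
  m * ((v * x) ^+ a * (c * v * y) ^+ b) = k * c ^+ b * (x ^+ a * y ^+ b).
Proof. by move=> <-; rewrite exprD !exprMn; ring. Qed.

Lemma eps_expz d (kk : nat) : oddz d -> ~~ odd kk -> eps R d ^+ kk = (chi4 d)%:~R ^+ kk./2.
Proof. by move=> od ek; rewrite -eps_sqr// -exprM mul2n even_halfK. Qed.

(** For odd kk the two factors are inverse to each other by definition; for even kk it is [vm_sqr],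
    where [chi4] being 1 on Gamma_1(8) enters. *)
Lemma multiplier_Gamma1 M (kk : nat) : Gamma1_8 M ->
  multiplier R kk (M 1 0) (M 1 1) * vm R M ^+ kk = 1.
Proof.
move=> hM; have v0 := vm_neq0 R hM.1; rewrite /multiplier absz_nat.
case: ifPn => ok; last first.
  by rewrite mul1r -(even_halfK ok) -mul2n exprM vm_sqr// expr1n.
have K0 : ((kronecker (M 1 0) (M 1 1))%:~R : C) != 0.
  by move: v0; rewrite /vm mulf_eq0 negb_or => /andP[].
rewrite /vm expr_div_n -exprnN -exprnP.
have e0 : eps R (M 1 1) ^+ kk != 0 by rewrite expf_neq0// eps_neq0.
have k0 : ((kronecker (M 1 0) (M 1 1))%:~R : C) ^+ kk != 0 by rewrite expf_neq0.
by move: (_ ^+ kk) (_ ^+ kk) e0 k0 => a b a0 b0; field; rewrite a0 b0.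
Qed.

Lemma slashC_mul_A (kk : nat) M f w : SL2Z M -> 0 < complex.Im w ->
  extend f (moebius M w) / th (2 * moebius M w) ^+ kk * f1_slash M w ^ kk%:Z = slashC kk M f w.
Proof.
move=> hM w0; rewrite (AE hM w0) /slashC -exprnP exprMn exprVn -exprnN.
have := sqrtc_jf_neq0 hM w0; have := th2_neq0 (moebius_gt0 hM w0).
move=> /(expf_neq0 kk) + /(expf_neq0 kk).
by move: (th _ ^+ kk) (sqrtc _ ^+ kk) (extend f _) => a b c a0 b0; field; rewrite a0 b0.
Qed.

Lemma uhp_limP f h l : (forall z : uhp R, f z = h (val z)) ->
  (f z @[z --> i_infty] --> l) <-> ioo_lim h l.
Proof.
move=> fh; split=> [/(@cvgrPdist_lt R[i]) H e e0|H].
  have e0' : 0 < e%:C by rewrite ltcR.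
  have [Y _ HY] := H _ e0'; exists (Num.max Y 0) => w; rewrite gt_max => /andP[Yw w0].
  have := HY (exist _ w w0) Yw; rewrite /= fh /= normC_normc ltcR.
  by rewrite normcB.
apply/(@cvgrPdist_lt R[i]) => e e0.
have er : e = (complex.Re e)%:C by apply: complex_ext => //=; move: e0; case: e => a b; rewrite ltcE /= => /andP[/eqP->].
have er0 : 0 < complex.Re e by move: e0; rewrite er ltcR.
have [Y HY] := H _ er0; exists Y => // z /= Yz.
by rewrite fh normC_normc er ltcR normcB HY.
Qed.

Lemma modular_limit (kk : int) M f : 
  (exists l : C, slash kk M f z @[z --> i_infty] --> l) -> exists l, ioo_lim (slashC kk M f) l.
Proof.
by move=> [l hl]; exists l; apply/(uhp_limP (f := slash kk M f)).
Qed.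

Lemma modular_weight_space (kk : nat) chi f : chi 1 = 1 -> (forall a, chi (a + 8) = chi a) ->
  modular_forms kk%:Z 8 chi f -> weight_space kk%:Z (fun w => extend f w / th (2 * w) ^+ kk).
Proof.
move=> chi1 chi8 [/holomorphicP hf wf lf]; split.
- move=> w w0; have [d D] := hf w w0; have [d' D'] := @cderiv_th_scale R 2 w isT w0.
  have [d2 D2] := cderivX kk D'.
  by eexists; exact: (cderivM D (@cderivV R (fun w => th (2 * w) ^+ kk) w d2 (expf_neq0 kk (th2_neq0 w0)) D2)).
- move=> M hM w w0; have hS := Gamma1_8_SL2Z hM; have m0 := moebius_gt0 hS w0.
  have := wf M hM.1 (exist _ w w0).
  have -> : chi (M 1 1) = 1.
    have /dvdzP[k kE] := hM.2.
    have -> : M 1 1 = 1 + k * 8 by rewrite -kE; ring.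
    have pn (n : nat) x : chi (x + n%:Z * 8) = chi x.
      elim: n => [|n IH]; first by rewrite mul0r addr0.
      by rewrite -IH -[RHS]chi8; congr chi; rewrite intS; ring.
    case: k {kE} => n; first by rewrite pn.
    by rewrite -[LHS](pn n.+1) -{}chi1; congr chi; rewrite NegzE; ring.
  rewrite mul1r slashCE /slashC /= -(extend_in f w0) => E.
  have := f1_Gamma0 hM.1 w0; rewrite (extend_f1 m0) (extend_f1 w0) => ->.
  exact: slash_ratio_aux (vm_neq0 R hM.1) (sqrtc_jf_neq0 hS w0) (th2_neq0 w0) (multiplier_Gamma1 kk hM) E.
move=> M hM; have [l hl] := modular_limit (lf M hM); exists l.
by apply: eq_ioo_lim hl => w w0; rewrite slashC_mul_A.
Qed.

Lemma ratio_exp_aux (kk j : nat) (x y t : C) : t != 0 -> (j < kk.+1)%N -> x = t ->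
  (y / t) ^+ j * t ^+ kk = x ^+ (kk - j) * y ^+ j.
Proof.
move=> t0 jk ->; have -> : t ^+ kk = t ^+ (kk - j) * t ^+ j by rewrite -exprD subnK.
by rewrite expr_div_n; field; rewrite expf_neq0.
Qed.

Lemma modular_form_expansion (kk : nat) chi f : chi 1 = 1 -> (forall a, chi (a + 8) = chi a) ->
  modular_forms kk%:Z 8 chi f ->
  exists c : nat -> C, forall z : uhp R, f z = \sum_(j < kk.+1) c j * (f1 R z ^+ (kk - j) * f2 R z ^+ j).
Proof.
move=> c1 c8 /(modular_weight_space c1 c8)/weight_space_poly[c Hc]; exists c => z.
have z0 := Im_val_gt0 z; have := Hc _ z0; rewrite extend_val.
have t0 := th2_neq0 z0; move=> /(canRL (divfK (expf_neq0 kk t0))) ->.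
rewrite mulr_suml; apply: eq_bigr => j _; rewrite -mulrA; congr (_ * _).
by rewrite (f2E z); exact: ratio_exp_aux t0 (ltn_ord j) (f1E z).
Qed.

(* The four quadratic characters modulo 8. *)
Definition qchar (e1 e2 : nat) (a : int) : C :=
  if oddz a then (chi4 a ^+ e1 * chi8 a ^+ e2)%:~R else 0.

Lemma coprimez8 a : coprimez a 8 = oddz a.
Proof.
rewrite /coprimez /gcdz eqz_nat.
by rewrite -[_ == _]/(coprime `|a|%N (2 ^ 3)) coprime_pexpr// coprimen2.
Qed.

Lemma sign_exp_cases (x : int) n : x = 1 \/ x = -1 -> x ^+ n = 1 \/ x ^+ n = -1.
Proof. by case=> ->; [left; rewrite expr1n|rewrite -signr_odd; case: odd; [right|left]]. Qed.

Lemma chi4_cases a : chi4 a = 1 \/ chi4 a = -1.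
Proof. by rewrite /chi4; case: ifP; [left|right]. Qed.

Lemma chi8_cases a : chi8 a = 1 \/ chi8 a = -1.
Proof. by rewrite /chi8; case: ifP; [left|right]. Qed.

Lemma qchar_cases e1 e2 a : oddz a -> qchar e1 e2 a = 1 \/ qchar e1 e2 a = -1.
Proof.
rewrite /qchar => ->.
case: (sign_exp_cases e1 (chi4_cases a)) => ->; case: (sign_exp_cases e2 (chi8_cases a)) => ->.
- by left. - by right; rewrite rmorphM rmorphN /= mul1r. - by right; rewrite rmorphM rmorphN /= mulr1.
- by left.
Qed.

Lemma oddzM a b : oddz (a * b) = oddz a && oddz b.
Proof. by rewrite /oddz abszM oddM. Qed.

Lemma qchar_quadratic e1 e2 : quadratic_characters R 8 (qchar e1 e2).
Proof.
split; last by move=> a; rewrite coprimez8; exact: qchar_cases.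
split=> [|a b|a|a].
- by rewrite /qchar /= !expr1n.
- rewrite /qchar oddzM; case: (boolP (oddz a)) => oa; last by rewrite mul0r.
  case: (boolP (oddz b)) => ob; last by rewrite mulr0.
  by rewrite chi4M// chi8M// !exprMn -rmorphM /=; congr (_%:~R); ring.
- rewrite /qchar; have -> : oddz (a + 8) = oddz a by rewrite /oddz; lia.
  rewrite (@chi4_mod (a + 8) a) ?(@chi8_mod (a + 8) a)//; first by lia.
  by lia.
rewrite coprimez8; case: (boolP (oddz a)) => oa; last by rewrite /qchar (negPf oa) eqxx.
by case: (qchar_cases e1 e2 oa) => ->; rewrite ?oppr_eq0 oner_eq0.
Qed.

Definition fmon (F H : uhp R -> C) (a b : nat) (z : uhp R) : C := F z ^+ a * H z ^+ b.

Lemma extend_fmon F H a b w : 0 < complex.Im w -> extend (fmon F H a b) w = extend F w ^+ a * extend H w ^+ b.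
Proof. by move=> w0; rewrite !(extend_in _ w0). Qed.

Lemma slashC_fmon F H a b M w : SL2Z M -> 0 < complex.Im w ->
  slashC (a + b)%N%:Z M (fmon F H a b) w = slashC 1 M F w ^+ a * slashC 1 M H w ^+ b.
Proof.
by move=> hM w0; rewrite {1}/slashC (extend_fmon F H a b (moebius_gt0 hM w0)) slash_fmon_aux.
Qed.

Lemma holomorphic_fmon F H a b : holomorphic F -> holomorphic H -> holomorphic (fmon F H a b).
Proof.
move=> /holomorphicP hF /holomorphicP hG; apply/holomorphicP => w w0.
have [d D] := hF w w0; have [d' D'] := hG w w0.
have [d2 D2] := cderivX a D; have [d3 D3] := cderivX b D'.
exists (d2 * extend H w ^+ b + extend F w ^+ a * d3).
apply: (cderiv_ext w0 _ (cderivM D2 D3)) => h hw.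
have wh0 : 0 < complex.Im (w + h).
  rewrite cImD -ltrBlDr sub0r; have := ler_Im_normc h.
  by rewrite ler_norml => /andP[h1 _]; rewrite ltrNl; apply: lt_le_trans h1; rewrite ltrN2.
by rewrite extend_fmon.
Qed.

Lemma holomorphic_scale (n : nat) F : (0 < n)%N -> (forall z : uhp R, F z = th (n%:R * val z)) -> holomorphic F.
Proof.
move=> n0 hF; apply/holomorphicP => w w0; have [d D] := @cderiv_th_scale R n w n0 w0.
exists d; apply: (cderiv_ext w0 _ D) => h hw.
have wh0 : 0 < complex.Im (w + h).
  rewrite cImD -ltrBlDr sub0r; have := ler_Im_normc h.
  by rewrite ler_norml => /andP[h1 _]; rewrite ltrNl; apply: lt_le_trans h1; rewrite ltrN2.
by rewrite (extend_in _ wh0) hF.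
Qed.

Lemma holomorphic_f1 : holomorphic (f1 R).
Proof. exact: (@holomorphic_scale 2 _ isT (@f1E R)). Qed.

Lemma holomorphic_f2 : holomorphic (f2 R).
Proof. exact: (@holomorphic_scale 4 _ isT (@f2E R)). Qed.

(** Each factor f2 contributes [chi8]. In integral weight the slash operator carries no theta
    multiplier, so the power a + b of that multiplier, which is [chi4] to the power (a + b) / 2,
    moves into the character. *)
Lemma fmon_modular a b : modular_forms (a + b)%N%:Z 8
  (qchar (if odd (a + b) then 0 else (a + b)./2) b) (fmon (f1 R) (f2 R) a b).
Proof.
split; first exact: holomorphic_fmon holomorphic_f1 holomorphic_f2.
  move=> M hM z; have [_ _ _ od] := Gamma0_8 hM; have hS := Gamma0_SL2Z hM.
  have z0 := Im_val_gt0 z.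
  have s0 := sqrtc_jf_neq0 hS z0; have v0 := vm_neq0 R hM.
  have E1 : slashC 1 M (f1 R) (val z) = vm R M * f1 R z.
    rewrite slashC1E (f1_Gamma0 hM z0) (extend_val (f1 R)).
    by move: (sqrtc _) s0 => s s0; field.
  have E2 : slashC 1 M (f2 R) (val z) = (chi8 (M 1 1))%:~R * vm R M * f2 R z.
    rewrite slashC1E (f2_Gamma0 hM z0) (extend_val (f2 R)).
    by move: (sqrtc _) s0 => s s0; field.
  have E : slash (a + b)%N%:Z M (fmon (f1 R) (f2 R) a b) z = (vm R M * f1 R z) ^+ a * ((chi8 (M 1 1))%:~R * vm R M * f2 R z) ^+ b.
    exact: etrans (slashC_fmon (f1 R) (f2 R) a b hS z0) (congr2 (fun x y : C => x ^+ a * y ^+ b) E1 E2).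
  rewrite E /qchar od rmorphM !rmorphXn /=; apply: fmon_modular_aux.
  have K0 : ((kronecker (M 1 0) (M 1 1))%:~R : C) != 0.
    by move: v0; rewrite /vm mulf_eq0 negb_or => /andP[].
  have e0 : eps R (M 1 1) ^+ (a + b) != 0 by rewrite expf_neq0// eps_neq0.
  rewrite /multiplier absz_nat; case: ifPn => ok.
    rewrite /vm expr_div_n -exprnN -exprnP expr0.
    have k0 : ((kronecker (M 1 0) (M 1 1))%:~R : C) ^+ (a + b) != 0 by rewrite expf_neq0.
    by move: (_ ^+ (a + b)) (_ ^+ (a + b)) e0 k0 => x y x0 y0; field; rewrite x0 y0.
  rewrite mul1r /vm expr_div_n eps_expz//.
  have -> : ((kronecker (M 1 0) (M 1 1))%:~R : C) ^+ (a + b) = 1.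
    rewrite -(even_halfK ok) -mul2n exprM.
    by case: (kronecker_Gamma0 R hM) => ->; rewrite ?sqrrN !expr1n.
  rewrite div1r -exprVn; congr (_ ^+ _).
  by case: (chi4_cases (M 1 1)) => ->; rewrite ?rmorphN1 ?rmorph1 ?invrN invr1.
move=> M hM; have [al [be [[h1 h2] _ _]]] := cusp_limits R hM.
exists (al ^+ a * be ^+ b); apply/(@uhp_limP _ (slashC (a + b)%N%:Z M (fmon (f1 R) (f2 R) a b))) => //.
by apply: eq_ioo_lim (ioo_limM (ioo_limX a h1) (ioo_limX b h2)) => w w0; apply: esym; exact: slashC_fmon.
Qed.

End ModularForms.

(** * Sums of spaces of functions *)

Section SpaceSum.
Variables (R : realType) (I : choiceType) (D : set I).
Notation C := R[i].
Implicit Types (V : I -> set (uhp R -> C)) (P : set (uhp R -> C)).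

Lemma fsum_seq (F : I -> uhp R -> C) : fin_supp D F ->
  exists s : seq I, [/\ uniq s, forall i, i \in s -> D i,
    forall i, D i -> F i <> 0 -> i \in s & \sum_(i \in D) F i = \sum_(i <- s) F i].
Proof.
move=> fD; have fD' : finite_set (D `&` F @^-1` [set~ 0]) := fD.
exists (finite_support 0 D F); split.
- exact: finite_support_uniq.
- by move=> i; rewrite in_finite_support// inE => -[].
- by move=> i Di Fi; rewrite in_finite_support// inE.
by [].
Qed.

Lemma space_sum_min V P : P 0 -> (forall f h, P f -> P h -> P (f + h)) ->
  (forall i, D i -> V i `<=` P) -> space_sum D V `<=` P.
Proof.
move=> P0 PD VP f [F [fF VF ->]]; have [s [_ sD _ ->]] := fsum_seq fF.
elim: s sD => [|i s IH] sD; first by rewrite big_nil.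
rewrite big_cons; apply: PD.
  by apply: (VP i); [apply: sD; rewrite mem_head|apply: VF; apply: sD; rewrite mem_head].
by apply: IH => j js; apply: sD; rewrite inE js orbT.
Qed.

Lemma space_sum_single V i f : D i -> (forall j, D j -> V j 0) -> V i f -> space_sum D V f.
Proof.
move=> Di V0 Vf; exists (fun j => if j == i then f else 0); split.
- apply: (@sub_finite_set _ _ [set i]); last exact: finite_set1.
  by move=> j [_] /=; case: eqVneq.
- by move=> j Dj; case: eqVneq => [->//|_]; exact: V0.
rewrite -(@fsbig_widen _ _ _ _ [set i] D).
- by rewrite fsbig_set1 eqxx.
- by move=> j ->.
by move=> j [_ /= /eqP/negPf ->].
Qed.

Lemma space_sumD V f h : (forall i f h, D i -> V i f -> V i h -> V i (f + h)) ->
  space_sum D V f -> space_sum D V h -> space_sum D V (f + h).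
Proof.
move=> VD [F [fF VF ->]] [H [fH VH ->]].
have fU : finite_set ((D `&` [set i | F i <> 0]) `|` (D `&` [set i | H i <> 0])) by rewrite finite_setU.
have sub1 : D `&` [set i | F i <> 0] `<=` (D `&` [set i | F i <> 0]) `|` (D `&` [set i | H i <> 0]) by left.
have sub2 : D `&` [set i | H i <> 0] `<=` (D `&` [set i | F i <> 0]) `|` (D `&` [set i | H i <> 0]) by right.
have sub3 : (D `&` [set i | F i <> 0]) `|` (D `&` [set i | H i <> 0]) `<=` D by move=> i [[]|[]].
have dec (K : I -> uhp R -> C) (A : set I) : D `&` [set i | K i <> 0] `<=` A -> A `<=` D ->
    \sum_(i \in D) K i = \sum_(i \in A) K i.
  move=> KA AD; apply: esym; apply: fsbig_widen => // i [Di /= nA].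
  by apply: contrapT => K0; apply: nA; apply: KA; split.
have F0 i : F i + H i <> 0 -> F i <> 0 \/ H i <> 0.
  move=> FH; have [F0|] := eqVneq (F i) 0; last by move=> /eqP; left.
  by right => H0; apply: FH; rewrite F0 H0 addr0.
exists (fun i => F i + H i); split.
- apply: sub_finite_set fU => i [Di /= /F0[]]; first by left.
  by right.
- by move=> i Di; apply: VD; [|exact: VF|exact: VH].
rewrite (dec F _ sub1 sub3) (dec H _ sub2 sub3) (dec (fun i => F i + H i) _ _ sub3).
  by rewrite fsbig_split.
by move=> i [Di /= /F0[]]; [left|right].
Qed.

Lemma independent_seq V : (forall s F, uniq s -> (forall i, i \in s -> D i) ->
    (forall i, i \in s -> V i (F i)) -> \sum_(i <- s) F i = 0 -> forall i, i \in s -> F i = 0) ->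
  independent D V.
Proof.
move=> H F fF VF; have [s [us sD Fs ->]] := fsum_seq fF => F0 i Di.
apply: contrapT => Fi; apply: (Fi); apply: (H s F us sD _ F0) => [j js|]; first exact: VF (sD _ js).
exact: Fs.
Qed.

End SpaceSum.

(** * Linear structure of the form spaces and independence of the characters *)

Section FormSpaces.
Variable R : realType.
Notation C := R[i].
Implicit Types (f h F : uhp R -> C) (M : 'M[int]_2) (chi : int -> C).

Lemma extend_lin (c : C) f h (w : C) : extend (c *: f + h) w = c * extend f w + extend h w.
Proof. by rewrite /extend; case: insub => [z|]//=; rewrite mulr0 addr0. Qed.

Lemma slash_lin (kk : int) M c f h (z : uhp R) :
  slash kk M (c *: f + h) z = c * slash kk M f z + slash kk M h z.
Proof. by rewrite /slash extend_lin mulrDr mulrCA. Qed.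

Lemma holomorphic_lin c f h : holomorphic f -> holomorphic h -> holomorphic (c *: f + h).
Proof.
move=> /holomorphicP hf /holomorphicP hh; apply/holomorphicP => w w0.
have [d D] := hf w w0; have [d' D'] := hh w w0; exists (c * d + d').
have -> : extend (c *: f + h) = (fun w => c * extend f w + extend h w).
  by apply/funext => x; exact: extend_lin.
exact: cderivD (cderivZ c D) D'.
Qed.

Lemma weakly_modular_lin (kk : int) N chi c f h : weakly_modular kk N chi f ->
  weakly_modular kk N chi h -> weakly_modular kk N chi (c *: f + h).
Proof.
move=> mf mh M hM z; rewrite slash_lin.
have -> : (c *: f + h) z = c * f z + h z by [].
by rewrite mulrDr mulrCA (mf M hM z) (mh M hM z) mulrCA -mulrDr.
Qed.

Lemma slash_cvg_lin (kk : int) M c f h (l l' : C) :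
  slash kk M f z @[z --> i_infty] --> l -> slash kk M h z @[z --> i_infty] --> l' ->
  slash kk M (c *: f + h) z @[z --> i_infty] --> c * l + l'.
Proof.
have H F k := uhp_limP k (fun z => slashCE kk M F z).
move=> /H h1 /H h2; apply/H; apply: eq_ioo_lim (ioo_limD (ioo_limZ c h1) h2) => w w0.
by rewrite /slashC extend_lin mulrDr mulrCA.
Qed.

Lemma modular_forms_lin (kk : int) N chi c f h : modular_forms kk N chi f ->
  modular_forms kk N chi h -> modular_forms kk N chi (c *: f + h).
Proof.
move=> [h1 h2 h3] [h1' h2' h3']; split; [exact: holomorphic_lin|exact: weakly_modular_lin|].
move=> M hM; have [l hl] := h3 M hM; have [l' hl'] := h3' M hM.
by exists (c * l + l'); exact: slash_cvg_lin.
Qed.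

Lemma cusp_forms_lin (kk : int) N chi c f h : cusp_forms kk N chi f ->
  cusp_forms kk N chi h -> cusp_forms kk N chi (c *: f + h).
Proof.
move=> [h1 h2 h3] [h1' h2' h3']; split; [exact: holomorphic_lin|exact: weakly_modular_lin|].
move=> M hM; have -> : 0 = c * 0 + 0 :> C by rewrite mulr0 addr0.
by apply: slash_cvg_lin; [exact: h3|exact: h3'].
Qed.

Lemma extend0 (w : C) : extend (0 : uhp R -> C) w = 0.
Proof. by rewrite /extend; case: insub. Qed.

Lemma cusp_forms0 (kk : int) N chi : cusp_forms kk N chi (0 : uhp R -> C).
Proof.
split.
- apply/holomorphicP => w w0; exists 0.
  have -> : extend (0 : uhp R -> C) = fun=> 0 by apply/funext => x; exact: extend0.
  exact: cderiv_cst.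
- by move=> M hM z; rewrite /slash extend0 !mulr0.
move=> M hM; apply/(uhp_limP _ (fun z => slashCE kk M _ z)).
by apply: eq_ioo_lim (ioo_lim_cst 0) => w w0; rewrite /slashC extend0 mulr0.
Qed.

Lemma cusp_modular (kk : int) N chi : cusp_forms kk N chi `<=` modular_forms kk N chi.
Proof. by move=> f [h1 h2 h3]; split=> // M hM; exists 0; exact: h3. Qed.

Lemma modular_forms0 (kk : int) N chi : modular_forms kk N chi (0 : uhp R -> C).
Proof. exact/cusp_modular/cusp_forms0. Qed.

Lemma lin_add (P : set (uhp R -> C)) : (forall c f h, P f -> P h -> P (c *: f + h)) ->
  forall f h, P f -> P h -> P (f + h).
Proof. by move=> Pl f h Pf Ph; rewrite -[f]scale1r; exact: Pl. Qed.

Lemma space_sum_lin (I : choiceType) (D : set I) (V : I -> set (uhp R -> C)) :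
  (forall i, D i -> V i 0) ->
  (forall i c f h, D i -> V i f -> V i h -> V i (c *: f + h)) ->
  forall c f h, space_sum D V f -> space_sum D V h -> space_sum D V (c *: f + h).
Proof.
move=> V0 Vl c f h hf hh; apply: space_sumD => //.
  by move=> i f' h' Di; apply: lin_add => c' f'' h''; exact: Vl.
move: f hf; apply: space_sum_min.
- rewrite scaler0; have [[i Di]|nD] := pselect (exists i, D i).
    exact: space_sum_single Di V0 (V0 i Di).
  exists (fun=> 0); split=> //; last by rewrite fsbig1.
  by apply: (@sub_finite_set _ _ set0) => // i [].
- move=> f f' hf hf'; rewrite scalerDr; apply: space_sumD => //.
  by move=> i f'' h' Di; apply: lin_add => c' k k'; exact: Vl.
move=> i Di f Vf; apply: (space_sum_single Di V0).
by rewrite -[c *: f]addr0; apply: Vl => //; exact: V0.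
Qed.

(** Since a ^ 2 = 1 modulo 8, the matrix [a, k; 8, a] with a ^ 2 - 8 k = 1 will do. *)
Lemma Gamma0_8_odd a : oddz a -> exists2 M : 'M[int]_2, Gamma0 8 M & M 1 1 = a.
Proof.
move=> oa; have /dvdzP[k kE] : (8 %| a * a - 1)%Z.
  have := modz8_odd oa; have -> : a = (a %/ 8)%Z * 8 + (a %% 8)%Z by exact: divz_eq.
  rewrite modzMDl modz_mod.
  case=> -> ; apply/dvdzP; set q := (_ %/ _)%Z.
  - by exists (8 * q * q + 2 * q); ring.
  - by exists (8 * q * q + 6 * q + 1); ring.
  - by exists (8 * q * q + 10 * q + 3); ring.
  - by exists (8 * q * q + 14 * q + 6); ring.
exists (mk2 a k 8 a); last by have [_ _ _ ->] := mk2E a k 8 a.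
have [h1 h2 h3 h4] := mk2E a k 8 a; split; last by rewrite h3.
by apply/SL2ZE; rewrite h1 h2 h3 h4 -kE; ring.
Qed.

(** Dedekind's argument: for an a at which psi and chi differ, transforming a relation by a matrix
    with lower right entry a and subtracting chi a times the relation removes chi and keeps psi. *)
Lemma modular_forms_independent (kk : int) :
  independent (quadratic_characters R 8) (modular_forms kk 8).
Proof.
apply: independent_seq => s; elim: s => [|chi s IH] F //= /andP[chis us] sQ sM F0.
have Qchi : quadratic_characters R 8 chi by apply: sQ; rewrite mem_head.
have sF0 psi : psi \in s -> F psi = 0.
  move=> psis; have Qpsi : quadratic_characters R 8 psi by apply: sQ; rewrite inE psis orbT.
  have [a oa na] : exists2 a, oddz a & psi a != chi a.
    apply: contrapT => H; move: chis; suff -> : chi = psi by rewrite psis.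
    apply/funext => a; have [oa|ea] := boolP (oddz a).
      by apply/eqP; rewrite eq_sym; apply: contrapT => /negP na; apply: H; exists a.
    have [[_ _ _ c0] _] := Qchi; have [[_ _ _ p0] _] := Qpsi.
    move: (c0 a) (p0 a); rewrite coprimez8 (negPf ea) => /negbFE/eqP -> /negbFE/eqP ->//.
  have [M hM Ma] := Gamma0_8_odd oa.
  have := IH (fun xi => (xi a - chi a) *: F xi) us _ _ _ psi psis.
  have K : forall i, i \in s -> quadratic_characters R 8 i by move=> i si; apply: sQ; rewrite inE si orbT.
  move=> /(_ K); have K2 : forall i, i \in s -> modular_forms kk 8 i ((i a - chi a) *: F i).
    move=> i si; rewrite -[_ *: _]addr0; apply: modular_forms_lin; last exact: modular_forms0.
    by apply: sM; rewrite inE si orbT.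
  move=> /(_ K2); have -> : \sum_(i <- s) (i a - chi a) *: F i = 0.
    apply/funext => z.
    have E (t : seq (int -> C)) (k : (int -> C) -> C) :
        (\sum_(i <- t) k i *: F i) z = \sum_(i <- t) k i * F i z.
      by elim: t => [|x t IHt]; rewrite ?big_nil// !big_cons -IHt.
    have Ez (z' : uhp R) : F chi z' + \sum_(i <- s) F i z' = 0.
      have := congr1 (fun f : uhp R -> C => f z') F0; rewrite big_cons.
      have -> : (F chi + \sum_(i <- s) F i) z' = F chi z' + \sum_(i <- s) F i z'.
        congr (_ + _); elim: (s) => [|x t IHt]; rewrite ?big_nil// !big_cons -IHt//.
      by [].
    rewrite E; have hS := Gamma0_SL2Z hM; have m0 := moebius_gt0 hS (Im_val_gt0 z).
    pose m := multiplier R kk (M 1 0) (M 1 1) * sqrtc (jf M (val z)) ^ (- kk).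
    (* The automorphy factor [m] is common to all characters, so the transformation law turns the
       relation at the image of z into one weighted by the character values. *)
    have T i : i \in chi :: s -> i a * F i z = m * F i (exist _ (moebius M (val z)) m0).
      move=> si; have [_ wm _] := sM i si; rewrite -Ma -(wm M hM z) slashCE /slashC (extend_in _ m0).
      by rewrite mulrA.
    have := Ez (exist _ (moebius M (val z)) m0) => /(congr1 (fun x => m * x)).
    rewrite mulr0 mulrDr mulr_sumr -T ?mem_head// => S1.
    have -> : \sum_(i <- s) (i a - chi a) * F i z =
       \sum_(i <- s) m * F i (exist _ (moebius M (val z)) m0) - chi a * \sum_(i <- s) F i z.
      rewrite mulr_sumr -sumrB big_seq [RHS]big_seq; apply: eq_bigr => i si.
      by rewrite -T ?inE ?si ?orbT// mulrBl.
    move: S1 (Ez z) => /eqP; rewrite addrC addr_eq0 => /eqP -> /eqP; rewrite addrC addr_eq0 => /eqP ->.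
    by have -> : (0 : uhp R -> C) z = 0 by []; ring.
  move=> /(_ erefl) /eqP; rewrite scaler_eq0 subr_eq0 (negPf na) /= => /eqP//.
move=> psi; rewrite inE => /orP[/eqP->|/sF0//].
by move: F0; rewrite big_cons big_seq big1 ?addr0// => i /sF0.
Qed.

End FormSpaces.

(** * Evaluation of polynomials at two functions *)

Section Evaluation.
Variable R : realType.
Notation C := R[i].
Implicit Types (F H : uhp R -> C) (p q : mpoly 2 C).

Definition evf F H p (z : uhp R) : C := meval (fun i : 'I_2 => if i == 0 then F z else H z) p.

Section Morphism.
Variables F H : uhp R -> C.

Lemma evf_is_zmod_morphism : {morph evf F H : p q / p - q}.
Proof. by move=> p q; apply/funext => z; exact: mevalB. Qed.

Lemma evf_is_monoid_morphism : evf F H 1 = 1 /\ {morph evf F H : p q / p * q}.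
Proof.
by split=> [|p q]; apply/funext => z; [exact: meval1|exact: mevalM].
Qed.

Lemma evf_is_scalable : scalable_for *:%R (evf F H).
Proof. by move=> c p; apply/funext => z; exact: mevalZ. Qed.

HB.instance Definition _ :=
  GRing.isZmodMorphism.Build (mpoly 2 C) (uhp R -> C) (evf F H) evf_is_zmod_morphism.
HB.instance Definition _ :=
  GRing.isMonoidMorphism.Build (mpoly 2 C) (uhp R -> C) (evf F H) evf_is_monoid_morphism.
HB.instance Definition _ :=
  GRing.isScalable.Build C (mpoly 2 C) (uhp R -> C) *:%R (evf F H) evf_is_scalable.

End Morphism.

Lemma evf_x1 F H : evf F H (x1 R) = F.
Proof. by apply/funext => z; rewrite /evf /x1 mevalXU eqxx. Qed.

Lemma evf_x2 F H : evf F H (x2 R) = H.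
Proof. by apply/funext => z; rewrite /evf /x2 mevalXU. Qed.

Lemma lift01 : lift ord0 ord0 = 1 :> 'I_2. Proof. exact: val_inj. Qed.

Lemma fct_exprE F n z : (F ^+ n) z = F z ^+ n.
Proof. by elim: n => [|n IH]; rewrite ?expr0// !exprS -IH. Qed.

Lemma fmonE F H a b : fmon F H a b = F ^+ a * H ^+ b.
Proof. by apply/funext => z; rewrite /fmon -!fct_exprE. Qed.

Lemma evfE F H p : evf F H p = \sum_(m <- msupp p) mcoeff m p *: fmon F H (m 0) (m 1).
Proof.
apply/funext => z; rewrite fct_sumE /evf mevalE; apply: eq_bigr => m _.
by rewrite big_ord_recl big_ord1 lift01.
Qed.

Lemma mdeg2 (m : multinom 2) : mdeg m = (m 0%R + m 1%R)%N.
Proof. by rewrite mdegE big_ord_recl big_ord1 lift01. Qed.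

Lemma mnm2_eq (m m' : multinom 2) : mdeg m = mdeg m' -> m 1 = m' 1 -> m = m'.
Proof.
rewrite !mdeg2 => h e1; have e0 : m 0 = m' 0 by move: h; rewrite e1 => /addIn.
apply/mnmP => i; case: (unliftP 0 i) => [j ->|->//]; rewrite ord1.
by have -> : lift 0 0 = 1 :> 'I_2 by exact: val_inj.
Qed.

Lemma homogeneous_evf F H d (c : nat -> C) : exists2 p, homogeneous R d p &
  evf F H p = \sum_(j < d.+1) c j *: fmon F H (d - j) j.
Proof.
exists (\sum_(j < d.+1) c j *: (x1 R ^+ (d - j) * x2 R ^+ j)).
  rewrite /homogeneous /=; apply: rpred_sum => j _; apply: dhomogZ.
  have x1h : x1 R \is ishomog1 1 mdeg by rewrite dhomogX; apply/eqP; exact: mdeg1.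
  have x2h : x2 R \is ishomog1 1 mdeg by rewrite dhomogX; apply/eqP; exact: mdeg1.
  have := dhomogM (dhomogMn (d - j) x1h) (dhomogMn j x2h).
  by rewrite !mul1n subnK// -ltnS.
rewrite raddf_sum; apply: eq_bigr => j _.
apply: etrans (evf_is_scalable F H _ _) _; congr (_ *: _).
by rewrite -[LHS]/(evf F H _) rmorphM !rmorphXn /= evf_x1 evf_x2 fmonE.
Qed.

Lemma inf_roots_eq0 (U : {poly C}) (s : nat -> C) : injective s -> (forall n, U.[s n] = 0) -> U = 0.
Proof.
move=> sI Us; apply: (@roots_geq_poly_eq0 _ U [seq s i | i <- iota 0 (size U)]).
- by apply/allP => x /mapP[n _ ->]; apply/rootP.
- by rewrite map_inj_uniq ?iota_uniq.
by rewrite size_map size_iota.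
Qed.

(** At a fixed z the relation along the orbit is a polynomial in the scaling factor with infinitely
    many roots, so its homogeneous parts vanish separately. Dividing the part of degree d by F ^ d
    leaves a polynomial in H / F, to which the last hypothesis applies. *)
Lemma evf_eq0 F H (s : nat -> uhp R -> C) (act : nat -> uhp R -> uhp R) :
  (forall z, injective (s^~ z)) -> (forall n z, F (act n z) = s n z * F z) ->
  (forall n z, H (act n z) = s n z * H z) -> (forall z, F z != 0) ->
  (forall V : {poly C}, (forall z, V.[H z / F z] = 0) -> V = 0) ->
  forall p, evf F H p = 0 -> p = 0.
Proof.
move=> sI Fa Ha F0 VX p p0.
have U0 d z : \sum_(m <- msupp p | mdeg m == d) mcoeff m p * fmon F H (m 0) (m 1) z = 0.
  pose U : {poly C} := \sum_(m <- msupp p) (mcoeff m p * fmon F H (m 0) (m 1) z) *: 'X^(mdeg m).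
  have : U = 0.
    apply: (inf_roots_eq0 (sI z)) => n; rewrite /U horner_sum.
    have := congr1 (fun f : uhp R -> C => f (act n z)) p0; rewrite evfE fct_sumE => E.
    apply: etrans E; apply: eq_bigr => m _.
    rewrite hornerZ hornerXn -[RHS]/(mcoeff m p * fmon F H (m 0) (m 1) (act n z)) /fmon Fa Ha mdeg2.
    by rewrite exprD !exprMn; ring.
  move=> /(congr1 (fun U : {poly C} => U`_d)); rewrite /U coef_sum coef0 => E.
  apply: etrans E; rewrite big_mkcond; apply: eq_bigr => m _.
  by rewrite coefZ coefXn eq_sym; case: eqP; rewrite ?mulr1 ?mulr0.
have V0 d : \sum_(m <- msupp p | mdeg m == d) mcoeff m p *: 'X^(m 1) = 0 :> {poly C}.
  apply: VX => z; rewrite horner_sum.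
  apply: (mulIf (expf_neq0 d (F0 z))); rewrite mul0r mulr_suml -[RHS](U0 d z).
  apply: eq_bigr => m /eqP <-; rewrite hornerZ hornerXn /fmon mdeg2 expr_div_n exprD.
  by field; rewrite expf_neq0.
apply/eqP; rewrite -msupp_eq0; apply/eqP; apply: contrapT => /eqP.
case E : (msupp p) => [//|m0 s0] _.
have m0p : m0 \in msupp p by rewrite E mem_head.
move: m0p (m0p); rewrite {1}mcoeff_msupp => /negP + m0p; apply.
have := congr1 (fun U : {poly C} => U`_(m0 1)) (V0 (mdeg m0)).
rewrite coef_sum coef0 big_mkcond (bigD1_seq m0)//= ?msupp_uniq// eqxx coefZ coefXn eqxx mulr1.
rewrite big1_seq ?addr0 => [->//|m /andP[mn _]]; case: eqP => // md.
rewrite coefZ coefXn; case: eqP => [e1|_]; last by rewrite mulr0.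
by move: mn; rewrite (mnm2_eq md (esym e1)) eqxx.
Qed.

Lemma range_evf F H : range (evf F H) = generated_subalgebra [set F; H].
Proof.
apply/seteqP; split=> [_ [p _ <-]|].
  move=> A [/= [A1 Al Am] FHA].
  have FA : F \in A by rewrite inE; apply: FHA; left.
  have HA : H \in A by rewrite inE; apply: FHA; right.
  have AX f n : f \in A -> f ^+ n \in A.
    by move=> fA; elim: n => [|n IH]; [exact: A1|rewrite exprS; exact: Am].
  have A0 : (0 : uhp R -> C) \in A.
    by have := Al (-1) _ _ A1 A1; rewrite scaleN1r addNr.
  suff : evf F H p \in A by rewrite inE.
  rewrite evfE; elim: (msupp p) => [|m t IH]; first by rewrite big_nil.
  rewrite big_cons; apply: Al => //.
  by rewrite fmonE; apply: Am; apply: AX.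
apply: smallest_sub => [|f [->|->]]; last 2 first.
- by exists (x1 R) => //; rewrite evf_x1.
- by exists (x2 R) => //; rewrite evf_x2.
split=> /=.
- by rewrite inE; exists 1 => //; rewrite rmorph1.
- move=> c f h; rewrite !inE => -[p _ <-] [q _ <-]; exists (c *: p + q) => //.
  by rewrite linearP.
move=> f h; rewrite !inE => -[p _ <-] [q _ <-]; exists (p * q) => //.
by rewrite rmorphM.
Qed.

End Evaluation.

(** * Algebraic independence of f1 and f2 *)

Section Injectivity.
Variable R : realType.
Notation C := R[i].
Opaque qprod phi Jth qpoch cexp qexp th kappa f1 f2 extend.

Lemma ioo_lim_horner (h : C -> C) (l : C) (q : {poly C}) : ioo_lim h l -> ioo_lim (fun w => q.[h w]) q.[l].
Proof.
move=> hl; elim/poly_ind: q => [|q c IH].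
  by rewrite horner0; apply: eq_ioo_lim (ioo_lim_cst 0) => w _; rewrite horner0.
rewrite hornerMXaddC; apply: eq_ioo_lim (ioo_limD (ioo_limM IH hl) (ioo_lim_cst c)) => w _.
by rewrite hornerMXaddC.
Qed.

Lemma ioo_lim_th_nat (n : nat) : (0 < n)%N -> ioo_lim (fun w : C => th (n%:R * w)) 1.
Proof.
move=> n0; have nR : 0 < n%:R :> R by rewrite ltr0n.
by apply: eq_ioo_lim (ioo_lim_th_scale 0 nR) => w _; rewrite addr0 -natC.
Qed.

Lemma ioo_lim_X : ioo_lim (@f_ratio R) 1.
Proof.
have -> : 1 = 1 * 1^-1 :> C by rewrite invr1 mulr1.
apply: ioo_limM (@ioo_lim_th_nat 4 isT) _.
exact: ioo_limV (oner_neq0 _) (@ioo_lim_th_nat 2 isT).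
Qed.

Lemma sqr_sub_eq (a b c : C) : (a - b) ^+ 2 = c ^+ 2 - b ^+ 2 -> b = c -> a = b.
Proof. by move=> h e; move: h; rewrite e subrr => /eqP; rewrite expf_eq0 /= subr_eq0 => /eqP. Qed.

Lemma kappa4_eq0 (w : C) : 0 < complex.Im w -> th (4 * w) = th (2 * w) -> kappa (4 * w) = 0.
Proof.
move=> w0 e; have e' := sqr_sub_eq (th_diff_sqr w0) e.
have w4 : 4 * w / 4 = w by field.
Transparent kappa. rewrite /kappa w4. Opaque kappa.
by apply/eqP; rewrite subr_eq0; apply/eqP.
Qed.

(** If th (4 w) = th (2 w), then [th_diff_sqr] forces [kappa (4 * w)] to vanish, which its
    asymptotics exclude high up. *)
Lemma X_neq1 : exists Y : R, forall w : C, 0 < complex.Im w -> Y < complex.Im w -> f_ratio w != 1.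
Proof.
have [Y HY] := @ioo_lim_kappa R 1 ltr01.
exists Y => w w0 Yw; apply/eqP => X1.
have t0 := th2_neq0 w0.
have e : th (4 * w) = th (2 * w) by rewrite -[LHS](divfK t0) -[_ / _]/(f_ratio w) X1 mul1r.
have k0 := kappa4_eq0 w0 e.
have Im4 : complex.Im (4 * w) = 4 * complex.Im w by exact: (Im_natM 4 w).
have /HY : Y < complex.Im (4 * w) by rewrite Im4; move: (complex.Im w) w0 Yw => y y0 Yy; lra.
rewrite k0 mul0r sub0r normcN' natC normcR normr_nat.
by move=> h; lra.
Qed.

(** Split off all factors X - 1 from V. High up the ratio is not 1 but tends to 1, so the cofactor
    vanishes at its values and hence at 1, a contradiction. *)
Lemma poly_X_eq0 (V : {poly C}) : (forall w : C, 0 < complex.Im w -> V.[f_ratio w] = 0) -> V = 0.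
Proof.
move=> VX; apply/eqP; apply: contrapT => /negP V0.
have [m [q]] := multiplicity_XsubC V 1; rewrite V0 /= => /negP q1 Vq; apply: q1; apply/rootP.
have [Y HY] := X_neq1.
apply: (ioo_lim_unique (ioo_lim_horner q ioo_lim_X)) => e e0.
exists (Num.max Y 0) => w; rewrite gt_max => /andP[Yw w0].
have := VX w w0; rewrite Vq hornerM horner_exp hornerXsubC => /eqP.
rewrite mulf_eq0 expf_eq0 subr_eq0 (negPf (HY w w0 Yw)) andbF orbF => /eqP ->.
by rewrite subrr normc0.
Qed.

(* The matrices [1, 0; 8 n, 1] of Gamma_1(8) have trivial multiplier; they
   scale a form of weight d / 2 by the d-th power of [sn n z], which takes
   infinitely many values. *)
Definition act (n : nat) (z : uhp R) : uhp R :=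
  exist _ (moebius (L2 (8 * n%:Z)) (val z)) (moebius_gt0 (SL2Z_L2 (8 * n%:Z)) (Im_val_gt0 z)).

Definition sn (n : nat) (z : uhp R) : C := sqrtc (jf (L2 (8 * n%:Z)) (val z)).

Lemma Gamma0_L2 n : Gamma0 8 (L2 (8 * n%:Z)).
Proof.
have [_ _ e _] := mk2E 1 0 (8 * n%:Z) 1.
by split; [exact: SL2Z_L2|rewrite e dvdz_mulr].
Qed.

Lemma act_f1 n z : f1 R (act n z) = sn n z * f1 R z.
Proof.
have := f1_Gamma0 (Gamma0_L2 n) (Im_val_gt0 z).
rewrite (extend_in (f1 R) (moebius_gt0 (SL2Z_L2 (8 * n%:Z)) (Im_val_gt0 z))) extend_val.
have [_ _ e1 e2] := mk2E 1 0 (8 * n%:Z) 1.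
have -> : vm R (L2 (8 * n%:Z)) = 1.
  by rewrite /vm e1 e2 /kronecker /eps /= big_nil mulr1 divr1.
by rewrite mul1r.
Qed.

Lemma act_f2 n z : f2 R (act n z) = sn n z * f2 R z.
Proof.
have := f2_Gamma0 (Gamma0_L2 n) (Im_val_gt0 z).
rewrite (extend_in (f2 R) (moebius_gt0 (SL2Z_L2 (8 * n%:Z)) (Im_val_gt0 z))) extend_val.
have [_ _ e1 e2] := mk2E 1 0 (8 * n%:Z) 1.
have -> : vm R (L2 (8 * n%:Z)) = 1.
  by rewrite /vm e1 e2 /kronecker /eps /= big_nil mulr1 divr1.
by rewrite e2 !mul1r.
Qed.

Lemma sn_inj z : injective (sn^~ z).
Proof.
move=> n n' /(congr1 (fun x : C => x ^+ 2)); rewrite /sn !sqr_sqrtc /jf.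
have [_ _ -> ->] := mk2E 1 0 (8 * n%:Z) 1; have [_ _ -> ->] := mk2E 1 0 (8 * n'%:Z) 1.
move=> /addIr /(congr1 (@complex.Im R)); rewrite !Im_intM.
move=> /(mulIf (lt0r_neq0 (Im_val_gt0 z))) /eqP; rewrite eqr_int => /eqP; lia.
Qed.

End Injectivity.

(** * Cusp forms *)

Section CuspPolynomial.
Variable R : realType.
Notation C := R[i].
Implicit Types (F H f h : uhp R -> C) (M N : 'M[int]_2).

Lemma ioo_lim_sum (I : Type) (s : seq I) (h : I -> C -> C) (l : I -> C) :
  (forall i, ioo_lim (h i) (l i)) -> ioo_lim (fun w => \sum_(i <- s) h i w) (\sum_(i <- s) l i).
Proof.
move=> hl; elim: s => [|i s IH].
  by rewrite big_nil; apply: eq_ioo_lim (ioo_lim_cst 0) => w _; rewrite big_nil.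
by rewrite big_cons; apply: eq_ioo_lim (ioo_limD (hl i) IH) => w _; rewrite big_cons.
Qed.

Lemma slashC_sum (kk : int) M (I : Type) (s : seq I) (c : I -> C) (G : I -> uhp R -> C) w :
  slashC kk M (\sum_(i <- s) c i *: G i) w = \sum_(i <- s) c i * slashC kk M (G i) w.
Proof.
elim: s => [|i s IH]; first by rewrite !big_nil /slashC extend0 mulr0.
by rewrite !big_cons -IH /slashC extend_lin mulrDr mulrCA.
Qed.

Lemma slashC_form_lim F H (d : nat) (c : nat -> C) M al be : SL2Z M ->
  ioo_lim (slashC 1 M F) al -> ioo_lim (slashC 1 M H) be ->
  ioo_lim (slashC d%:Z M (\sum_(j < d.+1) c j *: fmon F H (d - j) j))
    (\sum_(j < d.+1) c j * (al ^+ (d - j) * be ^+ j)).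
Proof.
move=> hM hF hH.
have L (j : 'I_d.+1) : ioo_lim (fun w => c j * (slashC 1 M F w ^+ (d - j) * slashC 1 M H w ^+ j))
    (c j * (al ^+ (d - j) * be ^+ j)).
  by apply: ioo_limZ; apply: ioo_limM; apply: ioo_limX.
apply: eq_ioo_lim (ioo_lim_sum (index_enum _) L) => w w0.
rewrite slashC_sum; apply: eq_bigr => j _; congr (_ * _).
by rewrite -slashC_fmon// subnK// -ltnS.
Qed.

Lemma form_horner (d : nat) (c : nat -> C) (x y : C) : x != 0 ->
  \sum_(j < d.+1) c j * (x ^+ (d - j) * y ^+ j) = x ^+ d * (\poly_(j < d.+1) c j).[y / x].
Proof.
move=> x0; rewrite horner_poly mulr_sumr; apply: eq_bigr => j _.
have -> : x ^+ d = x ^+ (d - j) * x ^+ j by rewrite -exprD subnK// -ltnS.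
by rewrite expr_div_n; field; rewrite expf_neq0.
Qed.

Lemma form_horner_wide (n : nat) (q : {poly C}) (x y : C) : x != 0 -> (size q <= n.+1)%N ->
  x ^+ n * q.[y / x] = \sum_(j < n.+1) q`_j * (x ^+ (n - j) * y ^+ j).
Proof.
move=> x0 sq; rewrite (horner_coef_wide _ sq) mulr_sumr; apply: eq_bigr => j _.
have -> : x ^+ n = x ^+ (n - j) * x ^+ j by rewrite -exprD subnK// -ltnS.
by rewrite expr_div_n; field; rewrite expf_neq0.
Qed.

Lemma horner_prod5 (a b c d e x : C) : (\prod_(z <- [:: a; b; c; d; e]) ('X - z%:P)).[x] =
  (x - a) * (x - b) * (x - c) * (x - d) * (x - e).
Proof. by rewrite horner_prod !big_cons big_nil mulr1 !hornerXsubC !mulrA. Qed.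

(** The five roots are the values of f2 / f1 at the cusps where f1 does not vanish. The sixth, at
    infinity, is the condition [size P <= d]: P comes from a form of degree d and would otherwise
    have size d + 1. *)
Lemma cusp_poly_factor (d : nat) (P : {poly C}) (r : C) : r ^+ 2 = 2^-1 -> (size P <= d)%N ->
  root P 0 -> root P 1 -> root P (-1) -> root P r -> root P (- r) -> P != 0 ->
  exists q : {poly C}, [/\ q != 0, (size q + 5 <= d)%N &
    forall x, P.[x] = q.[x] * (x * (x - 1) * (x + 1) * (x - r) * (x + r))].
Proof.
move=> r2 sP P0 P1 PN1 Pr PNr Pn0; pose rs : seq C := [:: 0; 1; -1; r; - r].
have n2 : 2 != 0 :> C by rewrite pnatr_eq0.
have r0 : r != 0 by apply: contra_eq_neq r2 => ->; rewrite expr0n eq_sym invr_eq0.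
have two (x : C) : x != 0 -> x != - x.
  by move=> x0; rewrite -subr_eq0 opprK -mulr2n -mulr_natl mulf_neq0.
have r1 (e : C) : e ^+ 2 = 1 -> r != e.
  move=> e2; apply: contra_eq_neq r2 => ->; rewrite e2 -subr_eq0.
  have -> : 1 - 2^-1 = 2^-1 :> C by field.
  by rewrite invr_eq0.
have rs_uniq : uniq_roots rs.
  rewrite uniq_rootsE /= !inE !negb_or [0 == 1]eq_sym oner_eq0 [0 == -1]eq_sym oppr_eq0 oner_eq0.
  rewrite [0 == r]eq_sym r0 [0 == - r]eq_sym oppr_eq0 r0 two ?oner_eq0// [1 == r]eq_sym r1 ?expr1n//=.
  rewrite -[1 == - r]eqr_opp opprK [-1 == r]eq_sym r1 ?sqrrN ?expr1n//=.
  by rewrite eqr_opp [1 == r]eq_sym r1 ?expr1n// two.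
have rs_root : all (root P) rs by rewrite /= P0 P1 PN1 Pr PNr.
have [q Pq] := uniq_roots_prod_XsubC rs_root rs_uniq.
have q0 : q != 0 by apply: contra_neq Pn0 => q0; rewrite Pq q0 mul0r.
exists q; split=> //.
  apply: leq_trans sP; rewrite Pq size_Mmonic ?size_prod_XsubC ?monic_prod_XsubC//=.
  by rewrite [(size q + 6)%N]addnS.
by move=> x; rewrite Pq hornerM horner_prod5 subr0 !opprK.
Qed.

(** The factor -2 compares the monic polynomial in y / x with the normalisation of g: (y ^ 2 - x ^
    2) (y ^ 2 - x ^ 2 / 2) is - 2 times (2 y ^ 2 - x ^ 2) (x ^ 2 - y ^ 2) / 4. *)
Lemma cusp_factor_aux (n : nat) (x y q r : C) : x != 0 -> r ^+ 2 = 2^-1 ->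
  x ^+ n.+4.+2 * (q * ((y / x) * (y / x - 1) * (y / x + 1) * (y / x - r) * (y / x + r))) =
  x * y * (2 * y ^+ 2 - x ^+ 2) * (x ^+ 2 - y ^+ 2) / 4 * (- 2 * (x ^+ n * q)).
Proof.
move=> x0 r2.
have -> : (y / x) * (y / x - 1) * (y / x + 1) * (y / x - r) * (y / x + r) =
  (y / x) * (y / x - 1) * (y / x + 1) * ((y / x) ^+ 2 - r ^+ 2) by ring.
by rewrite r2 !exprS; field.
Qed.

Lemma fct_scalerAr (c : C) F H : F * (c *: H) = c *: (F * H).
Proof. by apply/funext => z; exact: mulrCA. Qed.

Lemma fmon00 F H : fmon F H 0 0 = 1.
Proof. by rewrite fmonE !expr0 mulr1. Qed.

Lemma evf_g_polyE F H : evf F H (g_poly R) = - (2^-1) *: fmon F H 1 5 +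
  (3 / 4 *: fmon F H 3 3 + (- (4^-1) *: fmon F H 5 1 + 0)).
Proof.
apply/funext => z.
have -> : evf F H (g_poly R) z = 4^-1 * (- 2 * F z * H z ^+ 5 + 3 * F z ^+ 3 * H z ^+ 3 - F z ^+ 5 * H z).
  have -> : evf F H (g_poly R) = 4^-1 *: (- 2 * F * H ^+ 5 + 3 * F ^+ 3 * H ^+ 3 - F ^+ 5 * H).
    apply: etrans (evf_is_scalable F H _ _) _; congr (_ *: _).
    rewrite !exprS !expr0 !mulr1 -[LHS]/(evf F H _) rmorphB rmorphD !rmorphM rmorphN /=.
    by rewrite !rmorph_nat evf_x1 evf_x2.
  by rewrite -!fct_exprE.
rewrite -[RHS]/(- (2^-1) * (F z ^+ 1 * H z ^+ 5) + (3 / 4 * (F z ^+ 3 * H z ^+ 3) +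
  (- (4^-1) * (F z ^+ 5 * H z ^+ 1) + 0))).
by field.
Qed.

End CuspPolynomial.

(** * The graded algebra of modular forms *)

Section QuadraticForms.
Variable R : realType.
Notation C := R[i].
Opaque qprod phi Jth qpoch cexp qexp th kappa f1 f2 g extend.

Lemma f1_neq0 (z : uhp R) : f1 R z != 0.
Proof. by rewrite f1E th2_neq0// Im_val_gt0. Qed.

Lemma evf_inj p : evf (f1 R) (f2 R) p = 0 -> p = 0.
Proof.
apply: (evf_eq0 (@sn_inj R) (@act_f1 R) (@act_f2 R) f1_neq0) => V VX.
apply: poly_X_eq0 => w w0; have := VX (exist _ w w0).
by rewrite (f1E (exist _ w w0)) (f2E (exist _ w w0)).
Qed.

Lemma quadratic_char1 chi : quadratic_characters R 8 chi -> chi 1 = 1.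
Proof. by case=> -[]. Qed.

Lemma quadratic_char8 chi : quadratic_characters R 8 chi -> forall a, chi (a + 8) = chi a.
Proof. by case=> -[]. Qed.

Lemma form_expansion (d : nat) chi f : quadratic_characters R 8 chi -> modular_forms d%:Z 8 chi f ->
  exists c : nat -> C, f = \sum_(j < d.+1) c j *: fmon (f1 R) (f2 R) (d - j) j.
Proof.
move=> Q mf; have [c Hc] := modular_form_expansion (quadratic_char1 Q) (quadratic_char8 Q) mf.
by exists c; apply/funext => z; rewrite fct_sumE; apply: etrans (Hc z) _.
Qed.

Lemma quad_lin (d : int) (c : C) f h : modular_forms_quad R d 8 f -> modular_forms_quad R d 8 h ->
  modular_forms_quad R d 8 (c *: f + h).
Proof.
apply: space_sum_lin => [chi _|chi k k' h' _]; first exact: modular_forms0.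
exact: modular_forms_lin.
Qed.

Lemma quad0 (d : int) : modular_forms_quad R d 8 0.
Proof.
by apply: (space_sum_single (qchar_quadratic R 0 0)) => [chi _|]; exact: modular_forms0.
Qed.

Lemma quad_fmon a b : modular_forms_quad R (a + b)%N%:Z 8 (fmon (f1 R) (f2 R) a b).
Proof.
apply: (space_sum_single (qchar_quadratic R _ _)) (fmon_modular R a b) => chi _.
exact: modular_forms0.
Qed.

Lemma evf_homogeneous d : evf (f1 R) (f2 R) @` homogeneous R d = modular_forms_quad R d%:Z 8.
Proof.
apply/seteqP; split=> [_ [p /dhomogP hp <-]|].
  rewrite evfE big_seq; elim/big_rec: _ => [|m f mp hf]; first exact: quad0.
  apply: quad_lin => //; have <- : (m 0%R + m 1%R)%N = d.
    by apply: etrans (hp m mp); apply: esym; exact: mdeg2.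
  exact: quad_fmon.
apply: space_sum_min => [|_ _ [p hp <-] [q hq <-]|chi Q f mf].
- by exists 0; [exact: dhomog0|rewrite raddf0].
- by exists (p + q); [exact: dhomogD|rewrite raddfD].
by have [c ->] := form_expansion Q mf; have [p hp e] := homogeneous_evf (f1 R) (f2 R) d c; exists p.
Qed.

Lemma evf_scale F H (s : nat -> uhp R -> C) (act : nat -> uhp R -> uhp R) d p n z :
  (forall n z, F (act n z) = s n z * F z) -> (forall n z, H (act n z) = s n z * H z) ->
  homogeneous R d p -> evf F H p (act n z) = s n z ^+ d * evf F H p z.
Proof.
move=> Fa Ha /dhomogP hp; rewrite evfE !fct_sumE mulr_sumr big_seq [RHS]big_seq.
apply: eq_bigr => m mp; rewrite -[LHS]/(mcoeff m p * fmon F H (m 0) (m 1) (act n z)).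
rewrite -[X in _ = _ * X]/(mcoeff m p * fmon F H (m 0) (m 1) z) /fmon Fa Ha.
by rewrite -(hp m mp) [mf_ in s n z ^+ mf_]mdeg2 exprD !exprMn; ring.
Qed.

Lemma quad_scale d f n z : modular_forms_quad R d%:Z 8 f -> f (act n z) = sn n z ^+ d * f z.
Proof.
rewrite -evf_homogeneous => -[p hp <-].
exact: evf_scale (@act_f1 R) (@act_f2 R) hp.
Qed.

(** By [quad_scale] a relation at the points [act n z] is a polynomial in [sn n z] whose
    coefficients are the values of the forms at z; it has infinitely many roots. *)
Lemma weights_independent : independent [set: nat] (fun d => modular_forms_quad R d%:Z 8).
Proof.
apply: independent_seq => s F us _ sF F0 d ds; apply/funext => z.
pose U : {poly C} := \sum_(d <- s) F d z *: 'X^d.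
have U0 : U = 0.
  apply: (inf_roots_eq0 (@sn_inj R z)) => n; rewrite /U horner_sum.
  have := congr1 (fun f : uhp R -> C => f (act n z)) F0; rewrite fct_sumE => E.
  apply: etrans E; rewrite big_seq [RHS]big_seq; apply: eq_bigr => e es.
  by rewrite hornerZ hornerXn (quad_scale n z (sF e es)) mulrC.
have := congr1 (fun U : {poly C} => U`_d) U0; rewrite /U coef_sum coef0 (bigD1_seq d)//=.
rewrite coefZ coefXn eqxx mulr1 big1_seq ?addr0// => e /andP[ed _].
by rewrite coefZ coefXn eq_sym (negPf ed) mulr0.
Qed.

Lemma all_quad_evf : all_modular_forms_quad R 8 = range (evf (f1 R) (f2 R)).
Proof.
apply/seteqP; split.
  apply: space_sum_min => [|_ _ [p _ <-] [q _ <-]|d _ f].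
  - by exists 0 => //; rewrite raddf0.
  - by exists (p + q) => //; rewrite raddfD.
  by rewrite -evf_homogeneous => -[p _ <-]; exists p.
move=> _ [p _ <-]; rewrite evfE.
have V0 (d : nat) : [set: nat] d -> modular_forms_quad R d%:Z 8 0 by move=> _; exact: quad0.
have hl := space_sum_lin V0 (fun d c f h _ => @quad_lin d%:Z c f h).
elim: (msupp p) => [|m s IH].
  by rewrite big_nil; apply: (@space_sum_single _ _ _ _ 0%N) => //; exact: quad0.
rewrite big_cons; apply: hl => //.
by apply: (@space_sum_single _ _ _ _ (m 0%R + m 1%R)%N) => //; exact: quad_fmon.
Qed.

End QuadraticForms.

(** * Cusp forms as multiples of g *)

Section CuspForms.
Variable R : realType.
Notation C := R[i].
Opaque qprod phi Jth qpoch cexp qexp th kappa f1 f2 g extend.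

(** Multiply by a matrix of Gamma_0(8) with lower right entry 3, where [chi8] is -1. This is how one
    cusp of Gamma_0(8) accounts for two opposite roots. *)
Lemma cusp_values_opp N (al be : C) : SL2Z N -> cusp_values N al be -> al != 0 ->
  exists M, exists al' be' : C, [/\ SL2Z M, cusp_values M al' be', al' != 0 & be' / al' = - (be / al)].
Proof.
move=> hN hv al0; have [M hM M3] := @Gamma0_8_odd 3 isT.
have v0 := vm_neq0 R hM; have s0 := sgc_neq0 R M (N *m T2 0).
have := cusp_values_mul 0 hM hN hv; rewrite M3 -[(chi8 3)%:~R]/(-1) => H.
eexists; eexists; eexists; split; [|exact: H| |].
- by apply: SL2Z_mul (Gamma0_SL2Z hM) (SL2Z_mul hN (SL2Z_T2 0)).
- exact: mulf_neq0 (mulf_neq0 v0 s0) al0.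
by move: (vm R M) (sgc R M _) v0 s0 => a b a0 b0; field; rewrite al0 a0 b0.
Qed.

Lemma cusp_form_vanish (d : nat) chi (c : nat -> C) M (al be : C) :
  cusp_forms d%:Z 8 chi (\sum_(j < d.+1) c j *: fmon (f1 R) (f2 R) (d - j) j) ->
  SL2Z M -> cusp_values M al be -> \sum_(j < d.+1) c j * (al ^+ (d - j) * be ^+ j) = 0.
Proof.
move=> [_ _ hc] hM [h1 h2]; have l1 := @slashC_form_lim R _ _ d c M al be hM h1 h2.
have l2 := (uhp_limP 0 (fun z => slashCE d%:Z M _ z)).1 (hc M hM).
exact: ioo_lim_unique l1 l2.
Qed.

Lemma cusp_form_factor (d : nat) chi f : quadratic_characters R 8 chi -> cusp_forms d%:Z 8 chi f ->
  exists p, f = g R * evf (f1 R) (f2 R) p.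
Proof.
move=> Q cf; have [c fE] := form_expansion Q (cusp_modular cf).
move: cf; rewrite fE => cf {fE f}.
pose P : {poly C} := \poly_(j < d.+1) c j.
have PV M (al be : C) : SL2Z M -> cusp_values M al be -> al != 0 -> root P (be / al).
  move=> hM hv al0; have := cusp_form_vanish cf hM hv; rewrite form_horner// => /eqP.
  by rewrite mulf_eq0 expf_eq0 (negPf al0) andbF.
have PNV M (al be : C) : SL2Z M -> cusp_values M al be -> al != 0 -> root P (- (be / al)).
  move=> hM hv al0; have [M' [al' [be' [hM' hv' al'0 <-]]]] := cusp_values_opp hM hv al0.
  exact: PV hM' hv' al'0.
have S1 : SL2Z 1%:M by rewrite /SL2Z /= det1.
have P1 := PV _ _ _ S1 (@cusp_values_1 R) (oner_neq0 _).
have PN1 := PNV _ _ _ S1 (@cusp_values_1 R) (oner_neq0 _).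
have P0 := PV _ _ _ (SL2Z_L2 4) (@cusp_values_L4 R) (oner_neq0 _).
have i20 : 0 < 2^-1 :> R by rewrite invr_gt0.
have i40 : 0 < 4^-1 :> R by rewrite invr_gt0.
have Pr := PV _ _ _ SL2Z_S2 (@cusp_values_S2 R) (sqrtc_Ni_neq0 i20).
have PNr := PNV _ _ _ SL2Z_S2 (@cusp_values_S2 R) (sqrtc_Ni_neq0 i20).
(* At the cusp 1/2 the limit of f1 is 0 and that of f2 is not, so only the coefficient of f2 ^ d
   survives there. *)
have cd : c d = 0.
  have := cusp_form_vanish cf (SL2Z_L2 2) (@cusp_values_L2 R); rewrite big_ord_recr /= subnn.
  rewrite big1 ?add0r ?expr0 ?mul1r => [/eqP|j _].
    by rewrite mulf_eq0 expf_eq0 (negPf (sqrtc_Ni_neq0 i20)) andbF orbF => /eqP.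
  by rewrite expr0n subn_eq0 leqNgt ltn_ord mul0r mulr0.
rewrite divr1 in P1 PN1; rewrite mul0r in P0.
move: Pr PNr; set r := _ / _ => Pr PNr.
(* Only the square of the ratio at the cusp 0 matters: both signs of r are roots. *)
have r2 : r ^+ 2 = 2^-1.
  rewrite /r expr_div_n !sqr_sqrtc !rmorphV ?unitfE ?pnatr_eq0//=.
  rewrite !rmorph_nat; have i0 : ('i : C) != 0 by rewrite neq0Ci.
  by field.
have sP : (size P <= d)%N.
  apply/leq_sizeP => j dj; rewrite coef_poly; case: ltnP => // jd.
  by have -> : j = d by apply/eqP; rewrite eqn_leq dj -ltnS jd.
have [P00|Pn0] := eqVneq P 0.
  exists 0; rewrite raddf0 mulr0; apply/funext => z; rewrite fct_sumE.
  apply: etrans (form_horner d c (f2 R z) (f1_neq0 z)) _.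
  by rewrite -/P P00 horner0 mulr0.
have [q [q0 sq Pq]] := cusp_poly_factor r2 sP P0 P1 PN1 Pr PNr Pn0.
(* A nonzero cofactor has positive size, which forces d >= 6. *)
have [n dn] : exists n, d = n.+4.+2.
  by exists (d - 6)%N; move: q0; rewrite -size_poly_gt0; move: sq; clear; lia.
have sq' : (size q <= n.+1)%N by move: sq; rewrite dn; clear; lia.
have [p _ pE] := homogeneous_evf (f1 R) (f2 R) n (fun j => - 2 * q`_j).
exists p; rewrite pE; apply/funext => z; rewrite fct_sumE.
apply: etrans (form_horner d c (f2 R z) (f1_neq0 z)) _.
rewrite -/P Pq dn; apply: etrans (cusp_factor_aux n (f2 R z) q.[_] (f1_neq0 z) r2) _.
rewrite -gE; apply: (congr1 (fun x : C => g R z * x)).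
rewrite (form_horner_wide _ (f1_neq0 z) sq') fct_sumE mulr_sumr.
by apply: eq_bigr => j _; rewrite mulrA.
Qed.

Lemma qcharE (e1 e2 : nat) : qchar R e1 e2 = qchar R e1 (odd e2).
Proof.
apply/funext => a; rewrite /qchar; case: ifP => // oa; congr (_%:~R); congr (_ * _).
by case: (chi8_cases a) => ->; rewrite ?expr1n// signr_odd.
Qed.

Lemma fmon_modular_parity n e a b : (a + b)%N = n -> odd b = e ->
  modular_forms n%:Z 8 (qchar R (if odd n then 0 else n./2) e) (fmon (f1 R) (f2 R) a b).
Proof. by move=> <- <-; rewrite -qcharE; exact: fmon_modular. Qed.

Lemma g_fmon_aux (x y : C) a b :
  x * y * (2 * y ^+ 2 - x ^+ 2) * (x ^+ 2 - y ^+ 2) / 4 * (x ^+ a * y ^+ b) =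
  - (2^-1) * (x ^+ a.+1 * y ^+ b.+4.+1) + (3 / 4 * (x ^+ a.+3 * y ^+ b.+3) +
    (- (4^-1) * (x ^+ a.+4.+1 * y ^+ b.+1) + 0)).
Proof. by rewrite !exprS; field. Qed.

Lemma g_fmon a b : g R * fmon (f1 R) (f2 R) a b =
  - (2^-1) *: fmon (f1 R) (f2 R) a.+1 b.+4.+1 + (3 / 4 *: fmon (f1 R) (f2 R) a.+3 b.+3 +
    (- (4^-1) *: fmon (f1 R) (f2 R) a.+4.+1 b.+1 + 0)).
Proof.
apply/funext => z; apply: etrans (g_fmon_aux (f1 R z) (f2 R z) a b).
exact: (congr1 (fun x : C => x * (f1 R z ^+ a * f2 R z ^+ b)) (gE z)).
Qed.

Lemma slashC_fmon_lim M n a b (al be : C) : SL2Z M -> (a + b)%N = n -> cusp_values M al be ->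
  slash n%:Z M (fmon (f1 R) (f2 R) a b) z @[z --> i_infty] --> (al ^+ a * be ^+ b : C).
Proof.
move=> hM <- [h1 h2]; apply: (uhp_limP _ (fun z => slashCE (a + b)%N%:Z M _ z)).2.
apply: eq_ioo_lim (ioo_limM (ioo_limX a h1) (ioo_limX b h2)) => w w0; apply: esym.
exact: slashC_fmon.
Qed.

(** The three monomials of g contain f2 to the odd powers 5, 3 and 1, so after multiplication by a
    monomial they share one character, which depends on the exponent of f2 only through its parity.
    The limits at the cusps vanish by [six_lines]. *)
Lemma g_fmon_cusp a b :
  exists2 chi, quadratic_characters R 8 chi & cusp_forms (a + b + 6)%N%:Z 8 chi (g R * fmon (f1 R) (f2 R) a b).
Proof.
set n := (a + b + 6)%N.
have e1 : (a.+1 + b.+4.+1)%N = n by rewrite /n; lia.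
have e2 : (a.+3 + b.+3)%N = n by rewrite /n; lia.
have e3 : (a.+4.+1 + b.+1)%N = n by rewrite /n; lia.
have o1 : odd b.+4.+1 = ~~ odd b by rewrite /= !negbK.
have o2 : odd b.+3 = ~~ odd b by rewrite /= !negbK.
have [h1 h2 _] : modular_forms n%:Z 8 (qchar R (if odd n then 0 else n./2) (~~ odd b)) (g R * fmon (f1 R) (f2 R) a b).
  rewrite g_fmon; apply: modular_forms_lin (fmon_modular_parity e1 o1) _.
  apply: modular_forms_lin (fmon_modular_parity e2 o2) _.
  apply: modular_forms_lin (fmon_modular_parity e3 erefl) _.
  exact: modular_forms0.
exists (qchar R (if odd n then 0 else n./2) (~~ odd b)); first exact: qchar_quadratic.
split=> // M hM; have [al [be [hv h6 _]]] := cusp_limits R hM.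
have -> : (0 : C) = - (2^-1) * (al ^+ a.+1 * be ^+ b.+4.+1) + (3 / 4 * (al ^+ a.+3 * be ^+ b.+3) +
    (- (4^-1) * (al ^+ a.+4.+1 * be ^+ b.+1) + 0)).
  rewrite -g_fmon_aux; move: h6; rewrite /six_lines => h6.
  have -> : al * be * (2 * be ^+ 2 - al ^+ 2) * (al ^+ 2 - be ^+ 2) =
    - (al * be * (al ^+ 2 - be ^+ 2) * (al ^+ 2 - 2 * be ^+ 2)) by ring.
  by rewrite h6 oppr0 !mul0r.
rewrite g_fmon; apply: slash_cvg_lin (slashC_fmon_lim hM e1 hv) _.
apply: slash_cvg_lin (slashC_fmon_lim hM e2 hv) _.
apply: slash_cvg_lin (slashC_fmon_lim hM e3 hv) _.
by have [_ _ h] := cusp_forms0 n%:Z 8 (fun=> 0 : C); exact: h.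
Qed.

Lemma cusp_quad_lin (d : int) (c : C) f h : cusp_forms_quad R d 8 f -> cusp_forms_quad R d 8 h ->
  cusp_forms_quad R d 8 (c *: f + h).
Proof.
apply: space_sum_lin => [chi _|chi k k' h' _]; first exact: cusp_forms0.
exact: cusp_forms_lin.
Qed.

Lemma cusp_quad0 (d : int) : cusp_forms_quad R d 8 0.
Proof.
by apply: (space_sum_single (qchar_quadratic R 0 0)) => [chi _|]; exact: cusp_forms0.
Qed.

Lemma all_cusp_evf : all_cusp_forms_quad R 8 = [set g R * h | h in range (evf (f1 R) (f2 R))].
Proof.
apply/seteqP; split.
  have P0 : [set g R * h | h in range (evf (f1 R) (f2 R))] 0.
    by exists 0; [exists 0 => //; rewrite raddf0|rewrite mulr0].
  have PD f h : [set g R * h | h in range (evf (f1 R) (f2 R))] f ->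
      [set g R * h | h in range (evf (f1 R) (f2 R))] h -> [set g R * h | h in range (evf (f1 R) (f2 R))] (f + h).
    move=> [_ [p _ <-] <-] [_ [q _ <-] <-]; exists (evf (f1 R) (f2 R) (p + q)); first by exists (p + q).
    by rewrite raddfD mulrDr.
  apply: space_sum_min => // d _; apply: space_sum_min => // chi Q f.
  by move=> /(cusp_form_factor Q)[p ->]; exists (evf (f1 R) (f2 R) p) => //; exists p.
move=> _ [_ [p _ <-] <-]; rewrite evfE mulr_sumr.
have V0 (d : nat) : [set: nat] d -> cusp_forms_quad R d%:Z 8 0 by move=> _; exact: cusp_quad0.
have hl := space_sum_lin V0 (fun d c f h _ => @cusp_quad_lin d%:Z c f h).
elim: (msupp p) => [|m s IH].
  by rewrite big_nil; apply: (@space_sum_single _ _ _ _ 0%N) => //; exact: cusp_quad0.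
rewrite big_cons fct_scalerAr; apply: hl => //.
apply: (@space_sum_single _ _ _ _ (m 0%R + m 1%R + 6)%N) => //.
have [chi Q hc] := g_fmon_cusp (m 0) (m 1).
by apply: (space_sum_single Q) hc => psi _; exact: cusp_forms0.
Qed.

Lemma evf_g_poly : evf (f1 R) (f2 R) (g_poly R) = g R.
Proof.
apply: etrans (evf_g_polyE _ _) _; apply: etrans (esym (g_fmon 0 0)) _.
by rewrite fmon00 mulr1.
Qed.

End CuspForms.

Theorem theorem1p1 (R : realType) :
  let Cf : set (uhp R -> R[i]) := generated_subalgebra [set f1 R; f2 R] in
  [/\ forall d : nat,
        independent (quadratic_characters R 8) (modular_forms d%:Z 8),
      independent [set: nat] (fun d => modular_forms_quad R d%:Z 8),
      all_modular_forms_quad R 8 = Cf,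
      all_cusp_forms_quad R 8 = [set g R * h | h in Cf] &
      exists psi : {lrmorphism mpoly 2 R[i] -> (uhp R -> R[i])},
        [/\ psi (x1 R) = f1 R,
            psi (x2 R) = f2 R,
            set_bij [set: mpoly 2 R[i]] Cf psi,
            forall d : nat,
              psi @` homogeneous R d = modular_forms_quad R d%:Z 8 &
            psi (g_poly R) = g R]].
Proof.
move=> Cf; have CfE : Cf = range (evf (f1 R) (f2 R)) by rewrite range_evf.
split; first by move=> d; exact: modular_forms_independent.
- exact: weights_independent.
- by rewrite CfE; exact: all_quad_evf.
- by rewrite CfE; exact: all_cusp_evf.
exists (evf (f1 R) (f2 R)); split; [exact: evf_x1|exact: evf_x2| |exact: evf_homogeneous|exact: evf_g_poly].
rewrite CfE; split=> [p _|p q _ _ e|f [p _ <-]].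
- by exists p.
- by apply/eqP; rewrite -subr_eq0; apply/eqP; apply: evf_inj;
    apply: etrans (evf_is_zmod_morphism _ _ p q) _; rewrite e subrr.
- by exists p.
Qed.
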